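(* Let $\sigma,\kappa,\lambda,\ell>0$, let $\bar u_\varepsilon=-1+\lambda\varepsilon^{2/3}$, and let $E_\varepsilon$, $\mathcal A$ and $\lambda_c$ be as in the context. There exists $\varepsilon_0=\varepsilon_0(\sigma,\kappa,\lambda,\ell)>0$ such that: (i) if $\lambda<\lambda_c$ and $0<\varepsilon<\varepsilon_0$, then $u=-1$ is the unique minimizer of $E_\varepsilon$ in $\mathcal A$; (ii) if $\lambda>\lambda_c$ and $0<\varepsilon<\varepsilon_0$, then $u=-1$ is not a minimizer of $E_\varepsilon$ in $\mathcal A$.
   Context: $\mathbb T_\ell$ is the flat three-dimensional torus of sidelength $\ell$. Screened sharp interface energy: for $u\in\mathcal A:=BV(\mathbb T_\ell;\{-1,1\})$ (functions identified if equal a.e.), $$E_\varepsilon(u)=\frac{\varepsilon\sigma}{2}\int_{\mathbb T_\ell}|\nabla u|\,dx+\frac12\int_{\mathbb T_\ell}(u-\bar u_\varepsilon)(-\Delta+\kappa^2)^{-1}(u-\bar u_\varepsilon)\,dx,$$ with $\int|\nabla u|$ the total variation (no volume constraint on $u$). $\lambda_c=2^{-1/3}\sigma^{2/3}\kappa^2f^*$, where $$f^*=\inf_\chi\frac{\int_{\mathbb R^3}|\nabla\chi|\,dx+\frac1{8\pi}\int_{\mathbb R^3}\int_{\mathbb R^3}\frac{\chi(x)\chi(y)}{|x-y|}\,dx\,dy}{\int_{\mathbb R^3}\chi\,dx}$$ over all $\chi\in BV(\mathbb R^3;\{0,1\})$ with $\int\chi>0$. *)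

(* Defs.v *)
From HB Require Import structures.
From mathcomp Require Import all_boot all_order all_algebra.
From mathcomp Require Import all_classical all_reals all_analysis.
Import Order.TTheory GRing.Theory Num.Theory.
Import numFieldNormedType.Exports.

Set Implicit Arguments.
Unset Strict Implicit.
Unset Printing Implicit Defensive.

Local Open Scope classical_set_scope.
Local Open Scope ring_scope.

(* R^3 is an iterated product: this type carries both the Borel (product)
   sigma-algebra and a normed module structure.  The library norm on it is the
   maximum norm, hence the separate Euclidean norm [enorm]. *)
Notation R3 R :=
  (measurableTypeR R * measurableTypeR R * measurableTypeR R)%type.

Section Space.
Context {R : realType}.
Implicit Types (f : R3 R -> R) (phi : R3 R -> R3 R).

Definition vol3 : set (R3 R) -> \bar R :=
  (@lebesgue_measure R \x @lebesgue_measure R \x @lebesgue_measure R)%E.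

HB.instance Definition _ := Measure.on vol3.

(* The library does not infer this for an iterated product. *)
Let vol3_sigma_finite : sigma_finite setT vol3.
Proof.
pose I (n : nat) := `[(- n%:R : R), n%:R]%classic.
have cover (x : R) n : ((Num.Def.truncn `|x|).+1 <= n)%N -> I n x.
  move=> xn; rewrite /I/= in_itv/= -ler_norml.
  by apply: le_trans (ltW (truncnS_gt _)) _; rewrite ler_nat.
exists (fun n => I n `*` I n `*` I n).
  apply/esym; rewrite -subTset => -[[x y] z] _.
  pose N := maxn (Num.Def.truncn `|x : R|).+1
    (maxn (Num.Def.truncn `|y : R|).+1 (Num.Def.truncn `|z : R|).+1).
  exists N => //; split; first split; apply: cover.
  - exact: leq_maxl.
  - exact: leq_trans (leq_maxl _ _) (leq_maxr _ _).
  - exact: leq_trans (leq_maxr _ _) (leq_maxr _ _).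
move=> n; have mI : measurable (I n : set (measurableTypeR R)).
  exact: measurable_itv.
split; first by apply: measurableX => //; exact: measurableX.
rewrite /vol3 product_measure1E//=; last exact: measurableX.
rewrite product_measure1E//= /I lebesgue_measure_itv/= lte_fin.
by case: ifP => _; rewrite ?mule0 ?mul0e -?EFinB -?EFinM ltry.
Qed.

HB.instance Definition _ :=
  Measure_isSigmaFinite.Build _ _ _ vol3 vol3_sigma_finite.

Definition coord (x : R3 R) (i : 'I_3) : R :=
  tnth [tuple (x.1.1 : R); (x.1.2 : R); (x.2 : R)] i.

Definition unit_vec (i : 'I_3) : R3 R :=
  ((i == 0 :> nat)%:R, (i == 1 :> nat)%:R, (i == 2 :> nat)%:R).

Definition enorm (x : R3 R) : R := Num.sqrt (\sum_(i < 3) coord x i ^+ 2).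

Definition partial (i : 'I_3) f (x : R3 R) : R := 'D_(unit_vec i) f x.

Fixpoint Ck (k : nat) f : Prop :=
  if k is k'.+1 then
    continuous f /\
    forall i, (forall x, derivable f x (unit_vec i)) /\ Ck k' (partial i f)
  else continuous f.

Definition smooth f : Prop := forall k, Ck k f.

Definition laplacian f (x : R3 R) : R := \sum_(i < 3) partial i (partial i f) x.

Definition component phi (i : 'I_3) (x : R3 R) : R := coord (phi x) i.

Definition divergence phi (x : R3 R) : R :=
  \sum_(i < 3) partial i (component phi i) x.

Definition C1_field phi : Prop := forall i, Ck 1 (component phi i).

(* The total variation of u on D, by duality against the test fields of the
   class [adm] with Euclidean norm at most 1. *)
Definition total_variation (D : set (R3 R)) (adm : set (R3 R -> R3 R))
    (u : R3 R -> R) : \bar R :=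
  ereal_sup [set (\int[vol3]_(x in D) (u x * divergence phi x)%:E)%E
            | phi in [set phi | [/\ adm phi, C1_field phi
                                  & forall x, enorm (phi x) <= 1]]].

Definition compactly_supported phi : Prop :=
  compact (closure [set x | phi x != 0]).

Definition TV_space (u : R3 R -> R) : \bar R :=
  total_variation setT compactly_supported u.

(* Functions on the flat torus (R / l Z)^3 are functions on R^3 that are
   l-periodic in each coordinate, integrated over the cell [0, l)^3. *)
Definition periodic (T : Type) (l : R) (g : R3 R -> T) : Prop :=
  forall i x, g (x + l *: unit_vec i) = g x.

Definition cell (l : R) : set (R3 R) :=
  `[0, l[%classic `*` `[0, l[%classic `*` `[0, l[%classic.

Definition TV_torus (l : R) (u : R3 R -> R) : \bar R :=
  total_variation (cell l) (periodic l) u.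

Definition BV_space (u : R3 R -> R) : Prop :=
  vol3.-integrable setT (EFin \o u) /\ (TV_space u < +oo)%E.

Definition BV_torus (l : R) (u : R3 R -> R) : Prop :=
  [/\ measurable_fun setT u, periodic l u,
      vol3.-integrable (cell l) (EFin \o u) & (TV_torus l u < +oo)%E].

Definition admissible (l : R) : set (R3 R -> R) :=
  [set u | BV_torus l u /\ forall x, u x = -1 \/ u x = 1].

Definition L2_torus (l : R) (v : R3 R -> R) : Prop :=
  [/\ measurable_fun setT v, periodic l v
    & (\int[vol3]_(x in cell l) (v x ^+ 2)%:E < +oo)%E].

(* v in L^2 of the torus with - Delta v + kappa^2 v = f in the sense of
   distributions on the torus. *)
Definition screened_poisson (kappa l : R) (f v : R3 R -> R) : Prop :=
  L2_torus l v /\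
  forall phi : R3 R -> R, smooth phi -> periodic l phi ->
    (\int[vol3]_(x in cell l)
       (v x * (- laplacian phi x + kappa ^+ 2 * phi x))%:E =
     \int[vol3]_(x in cell l) (f x * phi x)%:E)%E.

(* (- Delta + kappa^2)^-1 f: for f in L^2 and kappa != 0 the solution exists
   and is unique up to a.e. equality; [get] picks a representative. *)
Definition resolvent (kappa l : R) (f : R3 R -> R) : R3 R -> R :=
  get [set v | screened_poisson kappa l f v].

Definition energy (sigma kappa l ubar eps : R) (u : R3 R -> R) : \bar R :=
  ((eps * sigma / 2)%:E * TV_torus l u +
   (1 / 2)%:E * \int[vol3]_(x in cell l)
     ((u x - ubar) * resolvent kappa l (fun y => u y - ubar) x)%:E)%E.

Definition coulomb (chi : R3 R -> R) : \bar R :=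
  (\int[vol3]_x \int[vol3]_y (chi x * chi y / enorm (x - y))%:E)%E.

Definition mass (chi : R3 R -> R) : \bar R := (\int[vol3]_x (chi x)%:E)%E.

Definition f_star : \bar R :=
  ereal_inf
    [set ((TV_space chi + (1 / (8 * pi))%:E * coulomb chi) / mass chi)%E
    | chi in [set chi | [/\ BV_space chi, forall x, chi x = 0 \/ chi x = 1
                          & (0 < mass chi)%E]]].

Definition lambda_c (sigma kappa : R) : \bar R :=
  ((2 `^ (- (1 / 3)) * sigma `^ (2 / 3) * kappa ^+ 2)%:E * f_star)%E.

Definition minimizer (A : set (R3 R -> R)) (E : (R3 R -> R) -> \bar R)
    (u : R3 R -> R) : Prop :=
  A u /\ forall v, A v -> (E u <= E v)%E.

Definition unique_minimizer (A : set (R3 R -> R)) (E : (R3 R -> R) -> \bar R)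
    (u : R3 R -> R) : Prop :=
  minimizer A E u /\
  forall v, minimizer A E v -> {ae vol3, forall x, v x = u x}.

End Space.

(* Main.v *)
From HB Require Import structures.
From mathcomp Require Import all_boot all_order all_algebra.
From mathcomp Require Import all_classical all_reals all_analysis.
From mathcomp Require Import measurable_realfun ring lra.
Import Order.TTheory GRing.Theory Num.Theory.
Import numFieldNormedType.Exports.
Require Import Defs.

(** The resolvent (-Δ + κ²)⁻¹ on the torus is convolution with the periodized
    Yukawa kernel, and the Yukawa kernel e^{-κ|z|}/(4π|z|) is a mixture of heat
    kernels; a solution of the equation is identified with that convolution by
    testing against trigonometric polynomials, whose level sets exhaust boxes.
    Writing u = -1 + 2·1_S, the difference E(u) - E(-1) equals
    (εσ/2)·TV(u) + 2·⟨1_S, (-Δ + κ²)⁻¹ 1_S⟩ - 2λε^{2/3}κ⁻²|S|, and dilating by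
    r = (εσ/4)^{1/3} turns it into a multiple of
    perimeter + Yukawa self-energy - c·volume with screening rκ, where
    λ < λ_c is exactly c < f^*.

    Below the threshold, cut the torus into cubes of a fixed small side whose
    faces, by averaging over translations, cut little of S: the self-energy only
    decreases when interactions between distinct cubes are dropped, inside a
    cube the Yukawa kernel is almost 1/(4π|z|), and near-optimal dual fields of
    the pieces are glued by C¹ cutoffs, so each piece pays at least almost
    f^* times its volume.  Above the threshold, truncate a near-optimal set to
    a bounded one, dilate it by r and periodize: the interactions with its
    other copies are O(r⁶), hence negligible against r³. *)

Set Implicit Arguments.
Unset Strict Implicit.
Unset Printing Implicit Defensive.

Local Open Scope classical_set_scope.
Local Open Scope ring_scope.

(** Two definitions shape the argument. The resolvent is picked by [get], so all that is known of it
    is the distributional equation, and the energy formula requires both existence of a solution and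
    a.e. uniqueness among periodic L^2 solutions. The total variation is a supremum over C1 fields,
    and no structure theory of sets of finite perimeter is used: it is bounded below by exhibiting
    one field and above by bounding every field. Cutting a set along faces thus means multiplying
    fields by cutoffs that vanish near the faces, and the area of a cut appears as the integral over
    the set of the gradient of the cutoff.

    The order of choices matters. The cell side d is fixed first, from kappa, l and the gap between
    c and f^*; only then is r made small. After dilation by 1/r the cells have side d/r, so the cuts
    cost O(r/d) per unit volume, while inside a cell the loss in the kernel is a fixed factor close
    to 1. Kernels and potentials stay nonnegative and extended-valued as long as possible, so that
    Tonelli applies; signed data are first shifted by constants. *)

Lemma scaled_pushforward d1 d2 (T1 : measurableType d1) (T2 : measurableType d2)
    (R : realType) (r : R) (m : {measure set T1 -> \bar R}) (f : T1 -> T2) :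
  0 <= r -> measurable_fun setT f ->
  exists m' : {measure set T2 -> \bar R},
    forall A, m' A = (r%:E * m (f @^-1` A)%classic)%E.
Proof.
move=> r0 mf.
pose m' := mscale (NngNum r0) (pushforward m f) : {measure set T2 -> \bar R}.
by exists (m' mf).
Qed.

(** * Affine changes of variables for Lebesgue measure on R^3 *)

Section Affine.
Context {R : realType}.
Local Notation leb := (@lebesgue_measure R).
Local Notation vol3 := (@vol3 R).

Definition vol2 : set (measurableTypeR R * measurableTypeR R) -> \bar R :=
  (leb \x leb)%E.

HB.instance Definition _ := Measure.on vol2.

Let vol2_sigma_finite : sigma_finite setT vol2.
Proof.
have /sigma_finiteP[F [TF ndF Foo]] := sigma_finiteT leb.
exists (fun n => F n `*` F n).
  rewrite -setXTT TF predeqE => -[x y]; split.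
    move=> [/= [n _ Fnx] [k _ Gky]]; exists (maxn n k) => //; split.
    - by move: x Fnx; exact/subsetPset/ndF/leq_maxl.
    - by move: y Gky; exact/subsetPset/ndF/leq_maxr.
  by move=> [n _ []/= ? ?]; split; exists n.
move=> k; have [? ?] := Foo k; split; first exact: measurableX.
by rewrite /vol2 product_measure1E// lte_mul_pinfty// ge0_fin_numE.
Qed.

HB.instance Definition _ :=
  Measure_isSigmaFinite.Build _ _ _ vol2 vol2_sigma_finite.

Lemma vol2_setX A B : measurable A -> measurable B ->
  vol2 (A `*` B) = (leb A * leb B)%E.
Proof. exact: product_measure1E. Qed.

Lemma vol3_setX A B : measurable A -> measurable B ->
  vol3 (A `*` B) = (vol2 A * leb B)%E.
Proof. exact: (@product_measure1E _ _ _ _ R vol2 leb). Qed.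

Definition affine3 (a : R3 R) (s : R) (x : R3 R) : R3 R :=
  (a.1.1 + s * x.1.1, a.1.2 + s * x.1.2, a.2 + s * x.2).

Lemma affine3E a s x : affine3 a s x = a + s *: x.
Proof. by case: a => -[a1 a2] a3; case: x => -[x1 x2] x3. Qed.

Lemma measurable_affine1 (a s : R) :
  measurable_fun setT (fun x : measurableTypeR R => a + s * x : measurableTypeR R).
Proof. by apply: measurable_funD => //; apply: measurable_funM. Qed.

Lemma measurable_affine3 a s : measurable_fun setT (affine3 a s).
Proof.
apply: measurable_fun_pair; first apply: measurable_fun_pair.
- by apply: (measurableT_comp (measurable_affine1 _ _)); apply: (measurableT_comp measurable_fst measurable_fst).
- by apply: (measurableT_comp (measurable_affine1 _ _)); apply: (measurableT_comp measurable_snd measurable_fst).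
- by apply: (measurableT_comp (measurable_affine1 _ _)); apply: measurable_snd.
Qed.

(** Uniqueness of Lebesgue measure: the pushforward under the affine map, rescaled by |s|, gives
    half-open intervals their length. For s < 0 the preimage is closed on the other side, which
    leaves its length unchanged. *)
Lemma lebesgue_measure_affine (a s : R) (s0 : s != 0) (A : set (measurableTypeR R)) :
  measurable A ->
  leb ((fun x => a + s * x) @^-1` A) = ((`|s|^-1)%:E * leb A)%E.
Proof.
move=> mA.
have s_ge0 : 0 <= `|s| by [].
pose f (x : measurableTypeR R) : measurableTypeR R := a + s * x.
have mf : measurable_fun setT f by exact: measurable_affine1.
have [m' m'E] := scaled_pushforward leb s_ge0 mf.
have -> : leb A = m' A.
  apply: lebesgue_measure_unique => // _ [[c d] _ <-].
  rewrite m'E.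
  have [sp|sn] := ltP 0 s.
    have -> : f @^-1` `]c, d] = `](c - a) / s, (d - a) / s]%classic.
      apply/seteqP; split => x /=; rewrite !in_itv/= /f ltr_pdivrMr// ler_pdivlMr//.
        by move=> /andP[h1 h2]; apply/andP; split; lra.
      by move=> /andP[h1 h2]; apply/andP; split; lra.
    rewrite lebesgue_measure_itv [X in (_ * X)%E]lebesgue_measure_itv/= !lte_fin ltr_pM2r ?invr_gt0// ltrD2r gtr0_norm//.
    case: ifPn => _; last by rewrite mule0.
    by rewrite -!EFinB -EFinM; congr EFin; field.
  have {}sn : s < 0 by rewrite lt_neqAle s0.
  have -> : f @^-1` `]c, d] = `[(d - a) / s, (c - a) / s[%classic.
    apply/seteqP; split => x /=; rewrite !in_itv/= /f ler_ndivrMr// ltr_ndivlMr//.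
      by move=> /andP[h1 h2]; apply/andP; split; lra.
    by move=> /andP[h1 h2]; apply/andP; split; lra.
  rewrite lebesgue_measure_itv [X in (_ * X)%E]lebesgue_measure_itv/= !lte_fin ltr_nM2r ?invr_lt0// ltrD2r ltr0_norm//.
  case: ifPn => _; last by rewrite mule0.
  by rewrite -!EFinB -EFinM; congr EFin; field.
rewrite m'E muleA -EFinM mulVf ?mul1e//.
by rewrite normr_eq0.
Qed.

(** As [vol3] is an iterated product, uniqueness of product measures is applied twice, in the plane
    and then in space, and each time only rectangles have to be checked. *)
Lemma vol3_affine a s (s0 : s != 0) A : measurable A ->
  vol3 (affine3 a s @^-1` A) = ((`|s|^-1 ^+ 3)%:E * vol3 A)%E.
Proof.
move=> mA; have s_ge0 : 0 <= `|s| by [].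
pose f2 (x : measurableTypeR R * measurableTypeR R)
  : (measurableTypeR R * measurableTypeR R)%type := (a.1.1 + s * x.1, a.1.2 + s * x.2).
have mf2 : measurable_fun setT f2.
  apply: measurable_fun_pair.
  - by apply: (measurableT_comp (measurable_affine1 _ _)); apply: measurable_fst.
  - by apply: (measurableT_comp (measurable_affine1 _ _)); apply: measurable_snd.
have [m2 m2E] := scaled_pushforward vol2 (exprn_ge0 2 s_ge0) mf2.
have E2 B : measurable B -> vol2 B = m2 B.
  rewrite /vol2; apply: product_measure_unique => A1 A2 mA1 mA2.
  rewrite m2E /=.
  have -> : f2 @^-1` (A1 `*` A2) = ((fun x => a.1.1 + s * x) @^-1` A1) `*`
     ((fun x => a.1.2 + s * x) @^-1` A2) by [].
  rewrite vol2_setX//; [|by rewrite -[X in measurable X]setTI; apply: measurable_affine1..].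
  rewrite /= (lebesgue_measure_affine a.1.1 s0 mA1) (lebesgue_measure_affine a.1.2 s0 mA2).
  have s1 : (`|s| ^+ 2)%:E = ((`|s|%:E) * `|s|%:E)%E by rewrite -EFinM -expr2.
  have s2 : (`|s|%:E * `|s|^-1%:E = 1)%E by rewrite -EFinM mulfV ?normr_eq0.
  by rewrite s1 [X in (_ * X)%E = _]muleACA [LHS]muleA [X in (X * _)%E = _]muleACA s2 !mul1e.
pose f (x : R3 R) : R3 R := affine3 a s x.
have mf : measurable_fun setT f by exact: measurable_affine3.
have [m3 m3E] := scaled_pushforward vol3 (exprn_ge0 3 s_ge0) mf.
have E3 B : measurable B -> vol3 B = m3 B.
  move=> mB.
  apply: (@product_measure_unique _ _ _ _ R vol2 leb m3 _ B mB).
  move=> A1 A2 mA1 mA2.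
  rewrite m3E.
  have -> : f @^-1` (A1 `*` A2) = (f2 @^-1` A1) `*`
     ((fun x => a.2 + s * x) @^-1` A2) by [].
  have mf2A : measurable (f2 @^-1` A1) by rewrite -[X in measurable X]setTI; apply: mf2.
  rewrite /= vol3_setX//; last by rewrite -[X in measurable X]setTI; apply: measurable_affine1.
  rewrite /= (lebesgue_measure_affine a.2 s0 mA2).
  rewrite (E2 A1)// m2E /=.
  have s1 : (`|s| ^+ 3)%:E = ((`|s| ^+ 2)%:E * `|s|%:E)%E by rewrite -EFinM -exprSr.
  have s2 : (`|s|%:E * `|s|^-1%:E = 1)%E by rewrite -EFinM mulfV ?normr_eq0.
  rewrite s1 -muleA [X in (_ * X)%E = _]muleCA [X in (_ * (_ * X))%E = _]muleA s2 mul1e.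
  by rewrite muleA.
by rewrite (E3 A mA) m3E muleA -EFinM -exprMn mulVf ?expr1n ?mul1e ?normr_eq0.
Qed.

Lemma ge0_integral_affine a s (s0 : s != 0) D (f : R3 R -> \bar R) :
  measurable D -> measurable_fun D f -> (forall x, D x -> 0 <= f x)%E ->
  (\int[vol3]_(x in (affine3 a s @^-1` D)%classic) f (affine3 a s x) =
   (`|s|^-1 ^+ 3)%:E * \int[vol3]_(x in D) f x)%E.
Proof.
move=> mD mf f0.
have k0 : 0 <= `|s|^-1 ^+ 3 by rewrite exprn_ge0// invr_ge0.
have f0' : {in D, forall y, (0 <= f y)%E} by move=> x; rewrite inE; exact: f0.
have /= <- := @ge0_integral_pushforward _ _ _ _ R _ (measurable_affine3 a s) vol3 D f
  mD mf f0'.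
rewrite -(@ge0_integral_mscale _ _ _ vol3 D mD (NngNum k0) f mf)//.
by apply: eq_measure_integral => [|mf3 B mB _]; [exact: measurable_affine3|exact: vol3_affine].
Qed.

End Affine.

(** * Coordinates of R^3 and the fundamental cell *)

Section Coordinates.
Context {R : realType}.
Implicit Types (x y : R3 R) (i j : 'I_3).

(** Fixes one spelling for each of the three indices; [coordE] and [sum_ord3] use the same
    spelling. *)
Lemma ord3_ind (P : 'I_3 -> Prop) :
  P ord0 -> P (lift ord0 ord0) -> P ord_max -> forall i, P i.
Proof.
move=> P0 P1 P2 [[|[|[|//]]] Hi].
- by rewrite (_ : Ordinal _ = ord0)//; exact: val_inj.
- by rewrite (_ : Ordinal _ = lift ord0 ord0)//; exact: val_inj.
- by rewrite (_ : Ordinal _ = ord_max)//; exact: val_inj.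
Qed.

Lemma coord0 x : coord x ord0 = x.1.1. Proof. by []. Qed.
Lemma coord1 x : coord x (lift ord0 ord0) = x.1.2. Proof. by []. Qed.
Lemma coord2 x : coord x ord_max = x.2. Proof. by []. Qed.

Definition coordE := (coord0, coord1, coord2).

Lemma coordD x y i : coord (x + y) i = coord x i + coord y i.
Proof. by case: x y => -[? ?] ? [[? ?] ?]; elim/ord3_ind: i. Qed.

Lemma coordN x i : coord (- x) i = - coord x i.
Proof. by case: x => -[? ?] ?; elim/ord3_ind: i. Qed.

Lemma coordZ (s : R) x i : coord (s *: x) i = s * coord x i.
Proof. by case: x => -[? ?] ?; elim/ord3_ind: i. Qed.

Lemma coord_unit_vec i j : coord (@unit_vec R i) j = (j == i)%:R.
Proof. by elim/ord3_ind: i; elim/ord3_ind: j. Qed.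

Lemma coordP x y : (forall i, coord x i = coord y i) -> x = y.
Proof.
case: x y => -[x1 x2] x3 [[y1 y2] y3] H.
by have := (H ord0, H (lift ord0 ord0), H ord_max); rewrite !coordE/= => -[[-> ->] ->].
Qed.

Lemma measurable_coord i : measurable_fun setT (fun x : R3 R => coord x i : R).
Proof.
elim/ord3_ind: i.
- exact: (measurableT_comp measurable_fst measurable_fst).
- exact: (measurableT_comp measurable_snd measurable_fst).
- exact: measurable_snd.
Qed.

Lemma continuous_coord i : continuous (fun x : R3 R => coord x i : R).
Proof.
elim/ord3_ind: i => x.
- by apply: (@continuous_comp _ _ _ fst fst); apply: cvg_fst.
- by apply: (@continuous_comp _ _ _ fst snd); [apply: cvg_fst|apply: cvg_snd].
- exact: cvg_snd.
Qed.

Lemma sum_unit_vec x : x = \sum_(i < 3) coord x i *: unit_vec i.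
Proof.
apply: coordP => i; rewrite !big_ord_recl big_ord0 !coordD !coordZ !coord_unit_vec.
have -> : coord (0 : R3 R) i = 0 by elim/ord3_ind: i.
by elim/ord3_ind: i => /=; rewrite ?(mulr1, mulr0, addr0, add0r).
Qed.

Lemma cellP (l : R) x : cell l x <-> forall i, 0 <= coord x i < l.
Proof.
case: x => -[x1 x2] x3; rewrite /cell/=; split.
  by move=> [[/= h1 h2] h3] i; elim/ord3_ind: i; rewrite coordE/=;
    move: h1 h2 h3; rewrite !in_itv/=.
by move=> H; move: (H ord0) (H (lift ord0 ord0)) (H ord_max); rewrite !coordE/=;
  rewrite !in_itv.
Qed.

Lemma measurable_cell (l : R) : measurable (cell l : set (R3 R)).
Proof. by apply: measurableX; [apply: measurableX|]; exact: measurable_itv. Qed.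

Lemma vol3_cell (l : R) : 0 <= l -> vol3 (cell l : set (R3 R)) = (l ^+ 3)%:E.
Proof.
move=> l0; rewrite /cell vol3_setX; [|by apply: measurableX; exact: measurable_itv|exact: measurable_itv].
rewrite vol2_setX; [|exact: measurable_itv..].
have -> : lebesgue_measure (`[0, l[%classic : set (measurableTypeR R)) = l%:E.
  rewrite lebesgue_measure_itv/= lte_fin.
  case: ltP => l0'; first by rewrite -EFinB subr0.
  by congr EFin; apply/eqP; rewrite eq_le l0.
by rewrite -!EFinM; congr EFin; ring.
Qed.

End Coordinates.

(** * Borel measurability of continuous functions *)

Section MeasurableContinuous.
Context {R : realType}.

(** The sigma-algebra on R^3 is a product, so open sets are not measurable by definition. Balls of
    the maximum norm are boxes, hence measurable, and an open set is the union of the countably many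
    balls of rational centre and radius 1/(n+1) that it contains. *)
Lemma open_measurable3 (U : set (R3 R)) : open U -> measurable U.
Proof.
move=> oU.
pose pt (q : rat * rat * rat) : R3 R := (ratr q.1.1, ratr q.1.2, ratr q.2).
pose F (q : rat * rat * rat * nat) := if `[< ball (pt q.1) q.2.+1%:R^-1 `<=` U >]
  then ball (pt q.1) (q.2.+1%:R^-1 : R) else set0.
have -> : U = \bigcup_q F q.
  apply/seteqP; split => [x Ux|x [q _]]; last first.
    by rewrite /F; case: asboolP => [|//]; apply.
  have /nbhs_ballP[e /= e0 eU] := open_nbhs_nbhs (conj oU Ux).
  pose n := Num.Def.truncn (2 / e).
  (* The chosen ball only contains x, it is not centred there, so its diameter has to stay below
     e. *)
  have ne : n.+1%:R^-1 < e / 2.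
    rewrite invf_plt ?posrE ?divr_gt0// invf_div.
    exact: truncnS_gt.
  have n0 : 0 < n.+1%:R^-1 :> R by rewrite invr_gt0.
  have app0 (t d : R) : 0 < d -> exists q : rat, ball (ratr q : R) d t.
    move=> d0.
    have /rat_in_itvoo[q] : t - d < t + d by lra.
    rewrite in_itv/= => /andP[h1 h2]; exists q.
    by rewrite -ball_normE/= ltr_norml; apply/andP; split; lra.
  have app (t : R) : exists q : rat, ball (ratr q : R) (n.+1%:R^-1 : R) t.
    exact: app0.
  have [q1 h1] := app x.1.1; have [q2 h2] := app x.1.2; have [q3 h3] := app x.2.
  have Bx : ball (pt (q1, q2, q3)) (n.+1%:R^-1 : R) x by split; [split|].
  exists (q1, q2, q3, n) => //; rewrite /F/=; case: asboolP => // /(_ _) nU.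
  exfalso; apply: nU => y By; apply: eU.
  have -> : e = e / 2 + e / 2 by lra.
  apply: (@ball_triangle _ _ (pt (q1, q2, q3))).
    by apply: ball_sym; apply: le_ball Bx; exact: ltW.
  by apply: le_ball By; exact: ltW.
apply: countable_bigcupT_measurable; first exact: countableP.
move=> q; rewrite /F; case: asboolP => _; last exact: measurable0.
have -> : ball (pt q.1) (q.2.+1%:R^-1 : R) =
   ball ((pt q.1).1.1) (q.2.+1%:R^-1 : R) `*` ball ((pt q.1).1.2) (q.2.+1%:R^-1 : R) `*`
   ball ((pt q.1).2) (q.2.+1%:R^-1 : R) by [].
by apply: measurableX; [apply: measurableX|]; exact: measurable_ball.
Qed.

Lemma continuous_measurable3 (f : R3 R -> R) : continuous f -> measurable_fun setT f.
Proof.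
move=> /continuousP cf; apply: (measurability _ (RGenOpens.measurableE R)) => //.
move=> _ [_ [a [b ->] <-]]; rewrite setTI; apply: open_measurable3.
by apply: cf; exact: interval_open.
Qed.

End MeasurableContinuous.

(** * Translation invariance *)

Section Shift.
Context {R : realType}.
Local Notation vol3 := (@vol3 R).
Implicit Types (x y c : R3 R) (i : 'I_3).

Lemma measurable_shift3 c : measurable_fun setT (fun x : R3 R => c + x).
Proof.
by have := measurable_affine3 c (1 : R); apply: eq_measurable_fun => x _;
  rewrite affine3E scale1r.
Qed.

Lemma ge0_integral_shift3 c D (f : R3 R -> \bar R) :
  measurable D -> measurable_fun D f -> (forall x, D x -> 0 <= f x)%E ->
  (\int[vol3]_(x in ((fun x => (c + x)%R) @^-1` D)%classic) f (c + x)%R =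
   \int[vol3]_(x in D) f x)%E.
Proof.
move=> mD mf f0.
have := ge0_integral_affine c (oner_neq0 R) mD mf f0.
rewrite normr1 invr1 expr1n mul1e => <-.
have E : affine3 c 1 = (fun x => c + x).
  by apply/funext => x; rewrite affine3E scale1r.
by rewrite E.
Qed.

Lemma integral_shift3 c D (f : R3 R -> \bar R) :
  measurable D -> measurable_fun D f ->
  (\int[vol3]_(x in ((fun x => (c + x)%R) @^-1` D)%classic) f (c + x)%R =
   \int[vol3]_(x in D) f x)%E.
Proof.
move=> mD mf; rewrite integralE [RHS]integralE.
rewrite -(@ge0_integral_shift3 c D (f^\+)%E)//; last exact: measurable_funepos.
rewrite -(@ge0_integral_shift3 c D (f^\-)%E)//; last exact: measurable_funeneg.
by congr (_ - _)%E; apply: eq_integral => x _; rewrite ?funeposE ?funenegE.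
Qed.

End Shift.

(** * Integrals of periodic functions over a cell *)

Section Periodic.
Context {R : realType}.
Local Notation vol3 := (@vol3 R).
Implicit Types (x y c : R3 R) (i : 'I_3).

Lemma periodic_int T l (f : R3 R -> T) i (z : int) x :
  periodic l f -> f (x + (l * z%:~R) *: unit_vec i) = f x.
Proof.
move=> pf.
have nat_case (n : nat) y : f (y + (l * n%:R) *: unit_vec i) = f y.
  elim: n y => [|n IH] y; first by rewrite mulr0 scale0r addr0.
  by rewrite -addn1 natrD mulrDr mulr1 scalerDl addrA pf IH.
case: z => n; first exact: nat_case.
rewrite NegzE mulrNz mulrN scaleNr.
by rewrite -[in RHS](subrK ((l * n.+1%:R) *: unit_vec i) x) nat_case.
Qed.

Lemma periodic_shift T l (f : R3 R -> T) c : periodic l f ->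
  periodic l (fun x => f (c + x)).
Proof. by move=> pf i x; rewrite addrA pf. Qed.

(** Translating the cell by t along an axis pushes a slab across one face, and periodicity brings it
    back by l. In the proof [A] is the part that stays inside and [B] the slab that crosses. *)
Lemma ge0_integral_cell_axis l (f : R3 R -> \bar R) i t : 0 <= t <= l ->
  measurable_fun setT f -> (forall x, 0 <= f x)%E -> periodic l f ->
  (\int[vol3]_(x in cell l) f (t *: unit_vec i + x)%R = \int[vol3]_(x in cell l) f x)%E.
Proof.
move=> /andP[t0 tl] mf f0 pf.
pose H : set (R3 R) := [set x | (coord x i < t)%R].
have mH : measurable H.
  rewrite (_ : H = (fun x => coord x i) @^-1` `]-oo, t[%classic).
    by rewrite -[X in measurable X]setTI; apply: measurable_coord.
  by apply/seteqP; split=> x; rewrite /H/= in_itv.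
have mc := @measurable_cell R l.
have ms c D : measurable D -> measurable ((fun x : R3 R => c + x) @^-1` D).
  by move=> mD; rewrite -[X in measurable X]setTI; apply: measurable_shift3.
pose A := (fun x => t *: unit_vec i + x) @^-1` (cell l `\` H).
pose B := (fun x => (t - l) *: unit_vec i + x) @^-1` (cell l `&` H).
have mA : measurable A by apply: ms; apply: measurableD.
have mB : measurable B by apply: ms; apply: measurableI.
have cAB : cell l = A `|` B.
  apply/seteqP; split => x.
    move=> /cellP cx.
    have [h|h] := ltP (coord x i) (l - t).
      left; split; last first.
        by rewrite /H/= coordD coordZ coord_unit_vec eqxx mulr1; move: (cx i) => /andP[]; lra.
      apply/cellP => j; rewrite coordD coordZ coord_unit_vec.
      have [->|ij] := eqVneq j i; rewrite ?mulr1 ?mulr0 ?add0r ?cx//.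
      by move: (cx i) => /andP[]; lra.
    right; split; last first.
      by rewrite /H/= coordD coordZ coord_unit_vec eqxx mulr1; move: (cx i) => /andP[]; lra.
    apply/cellP => j; rewrite coordD coordZ coord_unit_vec.
    have [->|ij] := eqVneq j i; rewrite ?mulr1 ?mulr0 ?add0r ?cx//.
    by move: (cx i) => /andP[]; lra.
  move=> [[/cellP cx /negP Hx]|[/cellP cx Hx]]; apply/cellP => j; move: (cx j) Hx;
    rewrite /H/= !coordD !coordZ !coord_unit_vec eqxx mulr1;
    have [->|ij] := eqVneq j i; rewrite ?mulr1 ?mulr0 ?add0r//; lra.
have dAB : [disjoint A & B].
  apply/disj_setPS => x [[/cellP/(_ i) h1 _] [/cellP/(_ i) h2 _]].
  move: h1 h2; rewrite !coordD !coordZ !coord_unit_vec eqxx !mulr1 => /andP[h1 h2] /andP[h3 h4].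
  by exfalso; lra.
rewrite [in LHS]cAB ge0_integral_setU//=.
- rewrite ge0_integral_shift3//; [|by apply: measurableD|exact: measurable_funTS].
  have -> : (\int[vol3]_(x in B) f (t *: unit_vec i + x)%R)%E =
      (\int[vol3]_(x in B) f (((t - l) *: unit_vec i) + x)%R)%E.
    apply: eq_integral => x _.
    by rewrite -[in LHS](subrK l t) scalerDl -addrA (addrC (l *: _)) addrA pf.
  rewrite ge0_integral_shift3//; [|by apply: measurableI|exact: measurable_funTS].
  rewrite -ge0_integral_setU//.
  + by rewrite setUC setUIDK.
  + exact: measurableD.
  + exact: measurableI.
  + exact: measurable_funTS.
  + by apply/disj_setPS => x [[_ ?] [_ ?]].
- by apply: measurable_funTS; apply: measurableT_comp; [exact: mf|exact: measurable_shift3].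
Qed.

End Periodic.

Section PeriodicShift.
Context {R : realType}.
Local Notation vol3 := (@vol3 R).
Implicit Types (x y c : R3 R) (i : 'I_3).

Lemma ge0_integral_cell_axisT l (f : R3 R -> \bar R) i t : 0 < l ->
  measurable_fun setT f -> (forall x, 0 <= f x)%E -> periodic l f ->
  (\int[vol3]_(x in cell l) f (t *: unit_vec i + x)%R = \int[vol3]_(x in cell l) f x)%E.
Proof.
move=> l0 mf f0 pf.
pose k := Num.floor (t / l).
have tE : t = l * k%:~R + (t - l * k%:~R) by rewrite addrC subrK.
rewrite -[RHS](@ge0_integral_cell_axis R l f i (t - l * k%:~R))//.
  apply: eq_integral => x _; rewrite {1}tE scalerDl -addrA (addrC (_ *: _)).
  by rewrite periodic_int.
have := floor_itv (t / l).
rewrite -/k ler_pdivlMr// ltr_pdivrMr// intrD => /andP[h1 h2].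
by apply/andP; split; nra.
Qed.

Lemma ge0_integral_cell_shift l (f : R3 R -> \bar R) c : 0 < l ->
  measurable_fun setT f -> (forall x, 0 <= f x)%E -> periodic l f ->
  (\int[vol3]_(x in cell l) f (c + x)%R = \int[vol3]_(x in cell l) f x)%E.
Proof.
move=> l0 mf f0 pf.
have ms (a : R3 R) (g : R3 R -> \bar R) : measurable_fun setT g -> measurable_fun setT (fun x : R3 R => g (a + x)).
  by move=> mg; apply: measurableT_comp; [exact: mg|exact: measurable_shift3].
rewrite [in LHS](sum_unit_vec c) !big_ord_recl big_ord0 addr0.
under eq_integral do rewrite -!addrA.
pose f1 x := f (coord c ord0 *: unit_vec ord0 + x).
pose f2 x := f1 (coord c (lift ord0 ord0) *: unit_vec (lift ord0 ord0) + x).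
have mf1 : measurable_fun setT f1 := ms _ _ mf.
have mf2 : measurable_fun setT f2 := ms _ _ mf1.
rewrite (@ge0_integral_cell_axisT l f2)//; last 2 first.
- by move=> x; exact: f0.
- by do 2 apply: periodic_shift.
rewrite /f2 (@ge0_integral_cell_axisT l f1)//; last 2 first.
- by move=> x; exact: f0.
- exact: periodic_shift.
by rewrite /f1 (@ge0_integral_cell_axisT l f).
Qed.

Lemma integral_cell_shift l (f : R3 R -> \bar R) c : 0 < l ->
  measurable_fun setT f -> periodic l f ->
  (\int[vol3]_(x in cell l) f (c + x)%R = \int[vol3]_(x in cell l) f x)%E.
Proof.
move=> l0 mf pf; rewrite integralE [RHS]integralE.
rewrite -(@ge0_integral_cell_shift l (f^\+)%E c)//; last 2 first.
- exact: measurable_funepos.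
- by move=> i x; rewrite !funeposE pf.
rewrite -(@ge0_integral_cell_shift l (f^\-)%E c)//; last 2 first.
- exact: measurable_funeneg.
- by move=> i x; rewrite !funenegE pf.
by congr (_ - _)%E; apply: eq_integral => x _; rewrite ?funeposE ?funenegE.
Qed.

End PeriodicShift.

(** * Subdivision of a cell *)

Section Subcells.
Context {R : realType}.
Local Notation vol3 := (@vol3 R).
Implicit Types (x y c : R3 R) (i : 'I_3).

Definition node (d : R) (k : int * int * int) : R3 R :=
  (d * k.1.1%:~R, d * k.1.2%:~R, d * k.2%:~R).

Definition nat_node (N : nat) (k : 'I_N * 'I_N * 'I_N) : int * int * int :=
  (k.1.1 : int, k.1.2 : int, k.2 : int).

Definition subcell (N : nat) (d : R) (k : 'I_N * 'I_N * 'I_N) : set (R3 R) :=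
  (fun x => - node d (nat_node k) + x) @^-1` (cell d).

Lemma measurable_subcell N d k : measurable (@subcell N d k).
Proof.
by rewrite -[X in measurable X]setTI; apply: measurable_shift3 => //; exact: measurable_cell.
Qed.

Lemma subcell_floor N d (k : 'I_N * 'I_N * 'I_N) x : 0 < d -> subcell d k x ->
  nat_node k = (Num.floor (x.1.1 / d), Num.floor (x.1.2 / d), Num.floor (x.2 / d)).
Proof.
move=> d0 /cellP H.
have fl (m : nat) (t : R) : 0 <= - (d * m%:~R) + t < d -> (m : int) = Num.floor (t / d).
  move=> /andP[h1 h2]; apply/esym/floor_def.
  rewrite ler_pdivlMr// ltr_pdivrMr// intrD.
  by apply/andP; split; nra.
have := (H ord0, H (lift ord0 ord0), H ord_max); rewrite !coordE/= => -[[h1 h2] h3].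
by rewrite /nat_node; congr (_, _, _); exact: fl.
Qed.

(** Half-open cells tile exactly: the subcell of a point is read off the integer parts of its
    coordinates divided by d, so no null set of faces has to be discarded. *)
Lemma cell_subcells N d : 0 < d ->
  cell (N%:R * d) = \big[setU/set0]_(k <- index_enum ('I_N * 'I_N * 'I_N)%type) subcell d k.
Proof.
move=> d0; rewrite -bigcup_seq; apply/seteqP; split => x; last first.
  move=> [k _ /cellP H]; apply/cellP => i.
  have b (m : 'I_N) (t : R) : 0 <= - (d * (m : nat)%:~R) + t < d -> 0 <= t < N%:R * d.
    move=> /andP[h1 h2].
    have : ((m : nat).+1%:R : R) <= N%:R by rewrite ler_nat.
    have : 0 <= ((m : nat)%:~R : R) by rewrite ler0n.
    rewrite -natr1 => h3 h4; apply/andP; split; nra.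
  move: (H i); elim/ord3_ind: i => /=; rewrite !coordE/=; exact: b.
move=> /cellP H.
have b (t : R) : 0 <= t < N%:R * d -> exists m : 'I_N, 0 <= - (d * (m : nat)%:~R) + t < d.
  move=> /andP[t0 tN].
  pose m := Num.Def.truncn (t / d).
  have /andP[h1 h2] := truncn_itv (divr_ge0 t0 (ltW d0)).
  have mN : (m < N)%N.
    rewrite -(ltr_nat R); apply: (le_lt_trans h1).
    by rewrite ltr_pdivrMr.
  exists (Ordinal mN) => /=; rewrite -/m in h1 h2.
  move: h1 h2; rewrite ler_pdivlMr// ltr_pdivrMr// -natr1.
  by move=> h1 h2; apply/andP; split; rewrite -[m%:~R]/(m%:R); nra.
have [k1 h1] := b _ (H ord0); have [k2 h2] := b _ (H (lift ord0 ord0)).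
have [k3 h3] := b _ (H ord_max).
exists (k1, k2, k3); first by rewrite /= mem_index_enum.
by apply/cellP; elim/ord3_ind.
Qed.

Lemma trivIset_subcell N d D : 0 < d -> trivIset D (@subcell N d).
Proof.
move=> d0; apply/trivIsetP => k k' _ _ kk'; apply/seteqP; split => // x [h h'].
move: kk'; have := subcell_floor d0 h; rewrite -(subcell_floor d0 h').
move=> [e1 e2 e3]; case: k k' h h' e1 e2 e3 => -[k1 k2] k3 [[k1' k2'] k3'] _ _ /= e1 e2 e3.
by rewrite (ord_inj e1) (ord_inj e2) (ord_inj e3) eqxx.
Qed.

Lemma ge0_integral_subcells N d (f : R3 R -> \bar R) : 0 < d ->
  measurable_fun setT f -> (forall x, 0 <= f x)%E ->
  (\int[vol3]_(x in cell (N%:R * d)) f x =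
   \sum_(k : 'I_N * 'I_N * 'I_N) \int[vol3]_(x in cell d) f (node d (nat_node k) + x)%R)%E.
Proof.
move=> d0 mf f0.
rewrite cell_subcells// ge0_integral_bigsetU//=; last 4 first.
- by move=> k; exact: measurable_subcell.
- exact: index_enum_uniq.
- exact: trivIset_subcell.
- exact: measurable_funTS.
apply: eq_bigr => k _; rewrite /subcell.
rewrite -(@ge0_integral_shift3 R (- node d (nat_node k)) _
  (fun x => f (node d (nat_node k) + x)))//; last 2 first.
- exact: measurable_cell.
- by apply: measurable_funTS; apply: measurableT_comp; [exact: mf|exact: measurable_shift3].
by apply: eq_integral => x _; rewrite addrA subrr add0r.
Qed.

Lemma integral_subcells N d (f : R3 R -> R) : 0 < d ->
  measurable_fun setT f ->
  (\int[vol3]_(x in cell (N%:R * d)) (f x)%:E =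
   \sum_(k : 'I_N * 'I_N * 'I_N) \int[vol3]_(x in cell d) (f (node d (nat_node k) + x)%R)%:E)%E.
Proof.
move=> d0 mf.
rewrite cell_subcells// integral_bigsetU_EFin//=; last 4 first.
- by move=> k; exact: measurable_subcell.
- exact: index_enum_uniq.
- exact: trivIset_subcell.
- by apply: measurable_funTS; exact/measurable_EFinP.
apply: eq_bigr => k _; rewrite /subcell.
rewrite -(@integral_shift3 R (- node d (nat_node k)) _
  (fun x => (f (node d (nat_node k) + x))%:E))//; last 2 first.
- exact: measurable_cell.
- by apply: measurable_funTS; apply/measurable_EFinP; apply: measurableT_comp; [exact: mf|exact: measurable_shift3].
by apply: eq_integral => x _; rewrite addrA subrr add0r.
Qed.

End Subcells.

(** * Directional derivatives and differentiation under the integral *)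

Section LineDerivative.
Context {R : realType}.
Local Notation vol3 := (@vol3 R).
Implicit Types (x y c : R3 R) (i : 'I_3) (F G : R3 R -> R).

(** The directional and the one-variable difference quotients are the same function, so one-variable
    derivative rules transfer to [partial] without any total differentiability. *)
Lemma line_quotient F x i (h : R) :
  (fun k : R => k^-1 *: (((fun t : R => F (x + t *: unit_vec i)) \o shift h) (k *: (1 : R))
    - F (x + h *: unit_vec i))) =
  (fun k : R => k^-1 *: ((F \o shift (x + h *: unit_vec i)) (k *: unit_vec i)
    - F (x + h *: unit_vec i))).
Proof.
apply/funext => k /=; congr (_ *: (F _ - _)).
by rewrite [k *: (1 : R)]mulr1 scalerDl addrCA addrA.
Qed.

Lemma derivable_lineP F x i (h : R) :
  derivable (fun t : R => F (x + t *: unit_vec i)) h 1 <->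
  derivable F (x + h *: unit_vec i) (unit_vec i).
Proof. by rewrite /derivable /= line_quotient. Qed.

Lemma derive_line F x i (h : R) :
  'D_1 (fun t : R => F (x + t *: unit_vec i)) h = partial i F (x + h *: unit_vec i).
Proof. by rewrite /partial /derive line_quotient. Qed.

Lemma is_derive_line F x i (h df : R) :
  derivable F (x + h *: unit_vec i) (unit_vec i) ->
  partial i F (x + h *: unit_vec i) = df ->
  is_derive h 1 (fun t : R => F (x + t *: unit_vec i)) df.
Proof.
move=> dF E; apply: DeriveDef; first exact/derivable_lineP.
by rewrite derive_line.
Qed.

Lemma is_derive_line0 F x i (df : R) :
  is_derive (0 : R) 1 (fun t : R => F (x + t *: unit_vec i)) df ->
  is_derive x (unit_vec i) F df.
Proof.
move=> [dF E]; apply: DeriveDef.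
  by have /derivable_lineP := dF; rewrite scale0r addr0.
have := derive_line F x i 0; rewrite E scale0r addr0 => ->.
by [].
Qed.

(* A translation-invariant integral has zero derivative; differentiating under
   the integral sign turns this into [\int partial i F = 0]. *)
Lemma Rintegral_partial_eq0 D F G i : measurable D ->
  (forall x, derivable F x (unit_vec i)) ->
  (forall h : R, vol3.-integrable D (fun x => (F (x + h *: unit_vec i))%:E)) ->
  (forall h : R, \int[vol3]_(x in D) F (x + h *: unit_vec i) = \int[vol3]_(x in D) F x) ->
  (forall x, 0 <= G x) -> vol3.-integrable D (EFin \o G) ->
  (forall x (h : R), `|h| < 1 -> D x -> `|partial i F (x + h *: unit_vec i)| <= G x) ->
  \int[vol3]_(x in D) partial i F x = 0.
Proof.
move=> mD dF intF invF G0 intG FG.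
pose f (h : R) (x : R3 R) := F (x + h *: unit_vec i).
have d1E h x : partial1of2 f h x = partial i F (x + h *: unit_vec i).
  by rewrite partial1of2E derive_line.
have I0 : (`](-1), 1[%classic : set R) 0 by rewrite /= in_itv/= ltrN10 ltr01.
have FG' (h : R) x : `](-1), 1[%classic h -> D x -> `|partial1of2 f h x| <= G x.
  move=> /=; rewrite in_itv/= => /andP[h1 h2] Dx.
  by rewrite d1E FG// ltr_norml h1 h2.
have H := @differentiation_under_integral R _ _ vol3 f D mD 0 (-1) 1 I0
  (fun h _ => intF h) (fun h x _ _ => (derivable_lineP F x i h).2 (dF _)) G G0 intG FG'.
have E : (fun x' : R => \int[vol3]_(y in D) f x' y) = cst (\int[vol3]_(x in D) F x).
  by apply/funext => h; exact: invF.
move: H; rewrite E derive1E derive_cst => ->.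
by apply: eq_Rintegral => x _; rewrite d1E scale0r addr0.
Qed.

End LineDerivative.

(** * Gaussian integrals on R^3 *)

Section Gaussian.
Context {R : realType}.
Local Notation vol3 := (@vol3 R).
Local Notation leb := (@lebesgue_measure R).
Implicit Types (x y z : R3 R) (i : 'I_3) (F G : R3 R -> R).

(** The squared Euclidean norm is polynomial, which keeps square roots, and their singularity at 0,
    out of the Gaussian calculus. *)
Definition sqn x : R := \sum_(i < 3) coord x i ^+ 2.

Lemma sqnE x : sqn x = x.1.1 ^+ 2 + x.1.2 ^+ 2 + x.2 ^+ 2.
Proof. by rewrite /sqn !big_ord_recl big_ord0 /= addr0 addrA. Qed.

Lemma sqn_ge0 x : 0 <= sqn x.
Proof. by rewrite sqnE !addr_ge0// sqr_ge0. Qed.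

Lemma sqr_coord_le_sqn x i : coord x i ^+ 2 <= sqn x.
Proof.
rewrite sqnE; elim/ord3_ind: i; rewrite coordE;
have := sqr_ge0 x.1.1; have := sqr_ge0 x.1.2; have := sqr_ge0 x.2; lra.
Qed.

Lemma sqnZ (s : R) x : sqn (s *: x) = s ^+ 2 * sqn x.
Proof. by rewrite !sqnE/= /GRing.scale/=; ring. Qed.

Lemma sqnN x : sqn (- x) = sqn x.
Proof. by rewrite -scaleN1r sqnZ sqrrN expr1n mul1r. Qed.

Lemma sqnD_le x y : sqn (x + y) <= 2 * sqn x + 2 * sqn y.
Proof.
rewrite !sqnE/=.
have := sqr_ge0 (x.1.1 - y.1.1); have := sqr_ge0 (x.1.2 - y.1.2).
have := sqr_ge0 (x.2 - y.2); nra.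
Qed.

Lemma sqn_unit_vec i : sqn (@unit_vec R i) = 1.
Proof. by elim/ord3_ind: i; rewrite sqnE/= ?expr0n/= expr1n ?addr0 ?add0r. Qed.

Lemma sqn_line x i (t : R) :
  sqn (x + t *: unit_vec i) = sqn x + (2 * coord x i) * t + t ^+ 2.
Proof.
rewrite !sqnE; elim/ord3_ind: i; rewrite coordE/= /GRing.scale/=; ring.
Qed.

Lemma continuous_sqn : continuous sqn.
Proof.
have cX i : continuous (fun x : R3 R => coord x i ^+ 2).
  move=> x; apply: (@continuous_comp _ _ _ (fun x : R3 R => coord x i) (fun t => t ^+ 2)).
    exact: continuous_coord.
  exact: exprn_continuous.
move=> x; rewrite (_ : sqn = (fun x => coord x ord0 ^+ 2 + coord x (lift ord0 ord0) ^+ 2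
  + coord x ord_max ^+ 2)); last by apply/funext => y; rewrite sqnE.
by apply: cvgD; [apply: cvgD|]; apply: cX.
Qed.

Lemma measurable_sqn : measurable_fun setT sqn.
Proof. exact: continuous_measurable3 continuous_sqn. Qed.

Lemma measurable_gauss3 (b : R) : measurable_fun setT (fun z => expR (- (b * sqn z))).
Proof.
apply: measurableT_comp; first exact: measurable_expR.
by apply: measurable_funN; apply: measurable_funM => //; exact: measurable_sqn.
Qed.

Lemma integral_gauss3_1 :
  (\int[vol3]_z (expR (- sqn z))%:E = (Num.sqrt pi ^+ 3)%:E)%E.
Proof.
have G1 (c : R) : (\int[leb]_t (c%:E * (expR (- t ^+ 2))%:E) = (c * Num.sqrt pi)%:E)%E.
  have /integrableP[mg _] := @integrableT_gauss R.
  by rewrite integralZl//= ?integralT_gauss//; exact: integrableT_gauss.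
have mf : measurable_fun setT (fun z : R3 R => (expR (- sqn z))%:E).
  by apply/measurable_EFinP; have := measurable_gauss3 1; under eq_fun do rewrite mul1r.
have f0 z : (0 <= (expR (- sqn z))%:E)%E by rewrite lee_fin expR_ge0.
have -> : (\int[vol3]_z (expR (- sqn z))%:E =
   \int[@vol2 R]_x \int[leb]_t (expR (- sqn (x, t)))%:E)%E.
  exact: (@fubini_tonelli1 _ _ _ _ R (@vol2 R) leb (fun z => (expR (- sqn z))%:E) mf f0).
under eq_integral => x _.
  under eq_integral => t _ do rewrite sqnE/= opprD expRD EFinM.
  rewrite G1.
  over.
have mf2 : measurable_fun setT
   (fun x : measurableTypeR R * measurableTypeR R => (expR (- (x.1 ^+ 2 + x.2 ^+ 2)) * Num.sqrt pi)%:E).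
  apply/measurable_EFinP; apply: measurable_funM => //.
  apply: measurableT_comp; first exact: measurable_expR.
  apply: measurable_funN.
  by apply: measurable_funD; apply: measurable_funX; [exact: measurable_fst|exact: measurable_snd].
have -> : (\int[@vol2 R]_x (expR (- (x.1 ^+ 2 + x.2 ^+ 2)) * Num.sqrt pi)%:E =
   \int[leb]_s \int[leb]_t (expR (- (s ^+ 2 + t ^+ 2)) * Num.sqrt pi)%:E)%E.
  apply: (@fubini_tonelli1 _ _ _ _ R leb leb _ mf2) => x.
  by rewrite lee_fin mulr_ge0 ?expR_ge0.
under eq_integral => x _.
  under eq_integral => t _ do rewrite opprD expRD mulrAC EFinM.
  rewrite G1 -mulrA mulrC EFinM.
  over.
by rewrite G1; congr EFin; ring.
Qed.

Lemma integral_gauss3 (b : R) : 0 < b ->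
  (\int[vol3]_z (expR (- (b * sqn z)))%:E = (Num.sqrt (pi / b) ^+ 3)%:E)%E.
Proof.
move=> b0; have sb0 : Num.sqrt b != 0 by rewrite sqrtr_eq0 -ltNge.
have mf : measurable_fun setT (fun z : R3 R => (expR (- sqn z))%:E).
  by apply/measurable_EFinP; have := measurable_gauss3 1; under eq_fun do rewrite mul1r.
have f0 z : setT z -> (0 <= (expR (- sqn z))%:E)%E by move=> _; rewrite lee_fin expR_ge0.
have := ge0_integral_affine 0 sb0 measurableT mf f0.
rewrite preimage_setT integral_gauss3_1.
under eq_integral do rewrite affine3E add0r sqnZ sqr_sqrtr ?ltW//.
move=> ->; rewrite -EFinM; congr EFin.
by rewrite -exprMn sqrtrM ?pi_ge0// sqrtrV ?ltW// ger0_norm ?sqrtr_ge0// mulrC.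
Qed.

Lemma integrable_gauss3 (b : R) : 0 < b ->
  vol3.-integrable setT (fun z => (expR (- (b * sqn z)))%:E).
Proof.
move=> b0; apply/integrableP; split; first by apply/measurable_EFinP; exact: measurable_gauss3.
under eq_integral do rewrite gee0_abs ?lee_fin ?expR_ge0//.
by rewrite integral_gauss3// ltry.
Qed.

Lemma integrable_gauss_bound (C b : R) F : 0 < b -> measurable_fun setT F ->
  (forall z, `|F z| <= C * expR (- (b * sqn z))) ->
  vol3.-integrable setT (EFin \o F).
Proof.
move=> b0 mF FC; apply: (@le_integrable _ _ _ _ _ _ _ (fun z => (C%:E * (expR (- (b * sqn z)))%:E)%E)) => //.
- exact/measurable_EFinP.
- by move=> z _; rewrite /= lee_fin (le_trans (FC z))// ler_norm.
- exact/integrableZl/integrable_gauss3.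
Qed.

(** A Gaussian moved by less than one unit is dominated by a wider centred Gaussian: this is the
    majorant, uniform in h, that differentiation under the integral asks for. *)
Lemma gauss_line_le (b : R) z i (h : R) : 0 <= b -> `|h| < 1 ->
  expR (- (b * sqn (z + h *: unit_vec i))) <= expR b * expR (- (b / 2 * sqn z)).
Proof.
move=> b0 h1; rewrite -expRD ler_expR.
have : sqn z <= 2 * sqn (z + h *: unit_vec i) + 2.
  have -> : sqn z = sqn (z + h *: unit_vec i + (- h) *: unit_vec i).
    by rewrite scaleNr addrK.
  apply: (le_trans (sqnD_le _ _)); rewrite lerD2l (sqnZ (- h)) sqn_unit_vec mulr1 sqrrN.
  by rewrite -[leRHS]mulr1 ler_pM2l// -real_normK ?num_real// expr_le1// ltW.
nra.
Qed.

Lemma Rintegral_shiftT (c : R3 R) F : measurable_fun setT F ->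
  \int[vol3]_x F (x + c) = \int[vol3]_x F x.
Proof.
move=> mF; rewrite /Rintegral.
have := integral_shift3 c measurableT (measurableT_comp (@EFin_measurable R setT) mF).
rewrite preimage_setT /= => <-.
by under eq_integral do rewrite addrC.
Qed.

Lemma Rintegral_partial_gauss (C b : R) F i : 0 < b -> measurable_fun setT F ->
  (forall x, derivable F x (unit_vec i)) ->
  (forall z, `|F z| <= C * expR (- (b * sqn z))) ->
  (forall z, `|partial i F z| <= C * expR (- (b * sqn z))) ->
  \int[vol3]_x partial i F x = 0.
Proof.
move=> b0 mF dF FC pFC.
have C0 : 0 <= C by rewrite -(pmulr_lge0 _ (expR_gt0 (- (b * sqn 0)))) (le_trans _ (FC 0)).
apply: (@Rintegral_partial_eq0 R setT F (fun z => C * expR b * expR (- (b / 2 * sqn z)))) => //.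
- move=> h; apply: (@integrable_gauss_bound (C * (expR (b * h ^+ 2))) (b / 2)).
  + by rewrite divr_gt0.
  + apply: measurableT_comp => //.
    by have := measurable_shift3 (h *: unit_vec i); under eq_fun do rewrite addrC.
  + move=> z; apply: (le_trans (FC _)); rewrite -mulrA ler_wpM2l//.
    rewrite -expRD ler_expR.
    have : sqn z <= 2 * sqn (z + h *: unit_vec i) + 2 * h ^+ 2.
      have {1}-> : z = z + h *: unit_vec i + (- h) *: unit_vec i by rewrite scaleNr addrK.
      by apply: (le_trans (sqnD_le _ _)); rewrite lerD2l (sqnZ (- h)) sqn_unit_vec mulr1 sqrrN.
    nra.
- by move=> h; exact: Rintegral_shiftT.
- by move=> z; rewrite !mulr_ge0 ?expR_ge0.
- apply: (@integrable_gauss_bound (C * expR b) (b / 2)).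
  + by rewrite divr_gt0.
  + by apply: measurable_funM => //; exact: measurable_gauss3.
  + by move=> z; rewrite ger0_norm ?mulr_ge0 ?expR_ge0.
- move=> z h h1 _; apply: (le_trans (pFC _)); rewrite -mulrA ler_wpM2l//.
  by apply: gauss_line_le => //; exact: ltW.
Qed.

End Gaussian.

(** * The heat kernel and its derivatives *)

Section HeatKernel.
Context {R : realType}.
Local Notation vol3 := (@vol3 R).
Local Notation leb := (@lebesgue_measure R).
Implicit Types (x y z : R3 R) (i : 'I_3) (F G : R3 R -> R).

(** This is (2 pi)^(-3/2), the normalization of the standard Gaussian, so that [heat_kernel v] is
    the centred Gaussian density of variance v^-2 in each coordinate. *)
Definition gnorm : R := (Num.sqrt (2 * pi))^-1 ^+ 3.

(* The heat kernel at time [1 / (2 * v ^+ 2)]. *)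
Definition heat_kernel (v : R) z : R := gnorm * v ^+ 3 * expR (- (v ^+ 2 / 2 * sqn z)).

Lemma gnorm_gt0 : 0 < gnorm.
Proof. by rewrite exprn_gt0// invr_gt0 sqrtr_gt0 mulr_gt0// pi_gt0. Qed.

Lemma heat_kernel_ge0 v z : 0 <= v -> 0 <= heat_kernel v z.
Proof.
by move=> v0; rewrite mulr_ge0 ?expR_ge0// mulr_ge0 ?exprn_ge0// ltW// gnorm_gt0.
Qed.

Lemma measurable_heat_kernel v : measurable_fun setT (heat_kernel v).
Proof. by apply: measurable_funM => //; exact: measurable_gauss3. Qed.

Lemma integral_heat_kernel v : 0 < v -> (\int[vol3]_z (heat_kernel v z)%:E = 1)%E.
Proof.
move=> v0; have b0 : 0 < v ^+ 2 / 2 by rewrite divr_gt0// exprn_gt0.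
under eq_integral do rewrite EFinM.
rewrite ge0_integralZl//; last 2 first.
- by apply/measurable_EFinP; exact: measurable_gauss3.
- by rewrite lee_fin; apply: mulr_ge0; [exact: ltW gnorm_gt0|apply: exprn_ge0; exact: ltW].
rewrite integral_gauss3// -EFinM; congr EFin.
rewrite /gnorm -!exprMn -[RHS](expr1n _ 3); congr (_ ^+ 3).
have -> : pi / (v ^+ 2 / 2) = (2 * pi) / v ^+ 2 :> R.
  by field; rewrite gt_eqF.
rewrite [Num.sqrt (_ / _)]sqrtrM; last by rewrite mulr_ge0// pi_ge0.
rewrite sqrtrV ?sqr_ge0// sqrtr_sqr gtr0_norm//.
rewrite mulrACA mulVf ?mul1r ?mulfV ?gt_eqF// ?mulr1//.
by rewrite sqrtr_gt0 mulr_gt0// pi_gt0.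
Qed.

(** Half of the exponent absorbs the linear factor, by exp t >= 1 + t. *)
Lemma poly_gauss_le (a c b s : R) : 0 <= a -> 0 <= c -> 0 < b -> 0 <= s ->
  (a + c * s) * expR (- (2 * b * s)) <= (a + c / b) * expR (- (b * s)).
Proof.
move=> a0 c0 b0 s0.
have -> : - (2 * b * s) = - (b * s) - (b * s) by ring.
rewrite expRD mulrA ler_wpM2r ?expR_ge0//.
rewrite expRN ler_pdivrMr ?expR_gt0//.
have h := expR_ge1Dx (b * s).
have h1 : 0 <= b * s by rewrite mulr_ge0// ltW.
have h2 : s <= expR (b * s) / b by rewrite ler_pdivlMr//; nra.
have h3 : 1 <= expR (b * s) by lra.
rewrite mulrDl lerD//; first by nra.
by rewrite -mulrA (mulrC b^-1) ler_wpM2l.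
Qed.

Lemma normr_coord_le_sqn z i : `|coord z i| <= 1 + sqn z.
Proof.
have := sqr_coord_le_sqn z i; have := sqr_ge0 (`|coord z i| - 1).
rewrite -[coord z i ^+ 2]real_normK ?num_real//; nra.
Qed.

Lemma is_derive_gauss_line (a : R) z i (h : R) :
  is_derive h 1 (fun t => expR (- (a * sqn (z + t *: unit_vec i))))
    (- (2 * a * (coord z i + h)) * expR (- (a * sqn (z + h *: unit_vec i)))).
Proof.
have E : (fun t => expR (- (a * sqn (z + t *: unit_vec i)))) =
   (fun t => expR (- (a * (sqn z + (2 * coord z i) * t + t ^+ 2)))).
  by apply/funext => t; rewrite sqn_line.
rewrite E sqn_line.
apply: is_derive_eq => /=.
rewrite /GRing.scale/=. ring.
Qed.

Lemma is_derive_heat_kernel v z i :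
  is_derive z (unit_vec i) (heat_kernel v) (- (v ^+ 2 * coord z i) * heat_kernel v z).
Proof.
apply: is_derive_line0; rewrite /heat_kernel.
have H := is_derive_gauss_line (v ^+ 2 / 2) z i 0.
apply: is_derive_eq.
rewrite scale0r addr0 /GRing.scale/= addr0.
by field.
Qed.

Lemma is_derive_heat_kernel2 v z i :
  is_derive z (unit_vec i) (fun y => - (v ^+ 2 * coord y i) * heat_kernel v y)
    ((v ^+ 4 * coord z i ^+ 2 - v ^+ 2) * heat_kernel v z).
Proof.
apply: is_derive_line0; rewrite /heat_kernel.
have H := is_derive_gauss_line (v ^+ 2 / 2) z i 0.
have E : (fun t : R => - (v ^+ 2 * coord (z + t *: unit_vec i) i)) =
  (fun t : R => - (v ^+ 2 * (coord z i + t))).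
  by apply/funext => t; rewrite coordD coordZ coord_unit_vec eqxx mulr1.
have H2 : is_derive (0 : R) 1 (fun t : R => - (v ^+ 2 * coord (z + t *: unit_vec i) i)) (- v ^+ 2).
  by rewrite E; apply: is_derive_eq; rewrite /GRing.scale/= add0r mulr1.
apply: is_derive_eq.
rewrite scale0r addr0 /GRing.scale/= addr0.
by field.
Qed.

Lemma is_derive_heat_kernel_time z (v : R) : v != 0 ->
  is_derive v 1 (fun v => heat_kernel v z) ((3 / v - v * sqn z) * heat_kernel v z).
Proof.
move=> v0; rewrite /heat_kernel.
apply: is_derive_eq.
rewrite /GRing.scale/= !mulr1.
by field.
Qed.

End HeatKernel.

(** * Heat flow of a bounded function *)

Section HeatFlow.
Context {R : realType}.
Local Notation vol3 := (@vol3 R).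
Local Notation leb := (@lebesgue_measure R).
Implicit Types (x y z : R3 R) (i : 'I_3) (F G g phi : R3 R -> R).

Definition heat_flow (v : R) g : R := \int[vol3]_z (heat_kernel v z * g z).

Lemma heat_kernel_gauss_le v z : 0 <= v ->
  heat_kernel v z <= gnorm * v ^+ 3 * expR (- (v ^+ 2 / 4 * sqn z)).
Proof.
move=> v0; rewrite /heat_kernel ler_wpM2l//.
  by apply: mulr_ge0; [exact: ltW gnorm_gt0|exact: exprn_ge0].
by rewrite ler_expR; have := sqn_ge0 z; have := sqr_ge0 v; nra.
Qed.

Lemma weighted_heat_kernel_le (a c v : R) z : 0 <= a -> 0 <= c -> 0 < v ->
  (a + c * sqn z) * heat_kernel v z <=
  (a + c * (4 / v ^+ 2)) * (gnorm * v ^+ 3) * expR (- (v ^+ 2 / 4 * sqn z)).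
Proof.
move=> a0 c0 v0.
have b0 : 0 < v ^+ 2 / 4 by rewrite divr_gt0// exprn_gt0.
have := poly_gauss_le a0 c0 b0 (sqn_ge0 z).
have -> : 2 * (v ^+ 2 / 4) * sqn z = v ^+ 2 / 2 * sqn z by field.
rewrite invf_div => H.
rewrite /heat_kernel mulrCA [leRHS]mulrAC [leRHS]mulrC ler_wpM2l//.
by apply: mulr_ge0; [exact: ltW gnorm_gt0|apply: exprn_ge0; exact: ltW].
Qed.

Lemma integrable_heat_kernel v g M : 0 < v -> measurable_fun setT g ->
  (forall z, `|g z| <= M) ->
  vol3.-integrable setT (fun z => (heat_kernel v z * g z)%:E).
Proof.
move=> v0 mg gM.
apply: (@integrable_gauss_bound R (gnorm * v ^+ 3 * M) (v ^+ 2 / 4)).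
- by rewrite divr_gt0// exprn_gt0.
- by apply: measurable_funM => //; exact: measurable_heat_kernel.
- move=> z; rewrite normrM (ger0_norm (heat_kernel_ge0 _ (ltW v0))).
  rewrite [leRHS]mulrAC; apply: ler_pM => //; first exact: heat_kernel_ge0 (ltW v0).
  by rewrite heat_kernel_gauss_le// ltW.
Qed.

Lemma is_derive_heat_flow g M (v0 : R) : 0 < v0 -> measurable_fun setT g ->
  (forall z, `|g z| <= M) ->
  is_derive v0 1 (heat_flow^~ g)
    (\int[vol3]_z ((3 / v0 - v0 * sqn z) * heat_kernel v0 z * g z)).
Proof.
move=> v00 mg gM.
have M0 : 0 <= M by rewrite (le_trans _ (gM 0)).
pose f v z := heat_kernel v z * g z.
have I0 : (`](v0 / 2), (2 * v0)[%classic : set R) v0 by rewrite /= in_itv/=; apply/andP; split; lra.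
have pos (v : R) : `](v0 / 2), (2 * v0)[%classic v -> 0 < v.
  by rewrite /= in_itv/= => /andP[h _]; lra.
have d1 (v : R) z : v != 0 -> is_derive v 1 (f^~ z) ((3 / v - v * sqn z) * heat_kernel v z * g z).
  move=> vn0; have H := is_derive_heat_kernel_time z vn0.
  rewrite /f; apply: is_derive_eq; rewrite scaler0 add0r /GRing.scale/=; ring.
have intf (v : R) : `](v0 / 2), (2 * v0)[%classic v -> vol3.-integrable setT (EFin \o f v).
  by move=> /pos vp; exact: (integrable_heat_kernel vp mg gM).
have derf (v : R) y : `](v0 / 2), (2 * v0)[%classic v -> setT y -> derivable (f^~ y) v 1.
  by move=> /pos vp _; have [] := d1 v y (lt0r_neq0 vp).
(* For v between v0/2 and 2 v0 one has v^2 <= 4 v0^2 and v^4 <= 16 v0^4, which bounds the derivative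
   by (12 v0^2 + 16 v0^4 s) exp(- v0^2 s / 8) with s = |z|^2. Giving up half of the exponent through
   [poly_gauss_le] turns 16 v0^4 into 256 v0^2 and leaves the rate v0^2 / 16. *)
pose C := gnorm * (12 * v0 ^+ 2 + 256 * v0 ^+ 2) * M.
have C0 : 0 <= C.
  have q0 : 0 <= 12 * v0 ^+ 2 + 256 * v0 ^+ 2 by have := sqr_ge0 v0; lra.
  exact: mulr_ge0 (mulr_ge0 (ltW gnorm_gt0) q0) M0.
pose G z := C * expR (- (v0 ^+ 2 / 16 * sqn z)).
have G0 z : 0 <= G z by rewrite mulr_ge0// expR_ge0.
have v016 : 0 < v0 ^+ 2 / 16 by rewrite divr_gt0// exprn_gt0.
have intG : vol3.-integrable setT (EFin \o G).
  apply: (@integrable_gauss_bound R C (v0 ^+ 2 / 16)) => //.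
    by apply: measurable_funM => //; exact: measurable_gauss3.
  by move=> z; rewrite ger0_norm ?G0.
have Gub (v : R) y : `](v0 / 2), (2 * v0)[%classic v -> setT y -> `|partial1of2 f v y| <= G y.
  move=> Iv _; have vp := pos _ Iv; rewrite partial1of2E.
  have [_ ->] := d1 v y (lt0r_neq0 vp).
  move: Iv; rewrite /= in_itv/= => /andP[vl vu].
  have s0 := sqn_ge0 y.
  have -> : (3 / v - v * sqn y) * heat_kernel v y =
      gnorm * ((3 * v ^+ 2 - v ^+ 4 * sqn y) * expR (- (v ^+ 2 / 2 * sqn y))).
    by rewrite /heat_kernel; field; rewrite gt_eqF.
  rewrite (normrM _ (g y)) (normrM gnorm) (normrM _ (expR _)).
  rewrite (ger0_norm (ltW gnorm_gt0)) (ger0_norm (expR_ge0 _)).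
  rewrite /G /C (mulrAC _ M) ler_pM//; first by rewrite !mulr_ge0 ?expR_ge0// ltW// gnorm_gt0.
  rewrite -[leRHS]mulrA ler_pM2l ?gnorm_gt0//.
  have v2 : 0 <= v ^+ 2 <= 4 * v0 ^+ 2 by rewrite sqr_ge0/=; nra.
  have v2l : v0 ^+ 2 / 4 <= v ^+ 2 by nra.
  have v4 : v ^+ 4 <= 16 * v0 ^+ 4.
    have -> : v ^+ 4 = v ^+ 2 * v ^+ 2 by ring.
    have -> : v0 ^+ 4 = v0 ^+ 2 * v0 ^+ 2 by ring.
    by move: v2 => /andP[]; nra.
  apply: (@le_trans _ _ ((12 * v0 ^+ 2 + 16 * v0 ^+ 4 * sqn y) * expR (- (2 * (v0 ^+ 2 / 16) * sqn y)))).
    apply: ler_pM; [exact: normr_ge0|exact: expR_ge0| |].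
    - rewrite ler_norml; apply/andP; split.
        rewrite lerNl opprB; have : v ^+ 4 * sqn y <= 16 * v0 ^+ 4 * sqn y by rewrite ler_wpM2r.
        by move: v2 => /andP[]; nra.
      have : 0 <= v ^+ 4 * sqn y by rewrite mulr_ge0// exprn_ge0// ltW.
      have : 0 <= 16 * v0 ^+ 4 * sqn y.
        by apply: mulr_ge0 => //; apply: mulr_ge0 => //; apply: exprn_ge0; exact: ltW.
      by move: v2 => /andP[]; lra.
    - rewrite ler_expR; nra.
  have := @poly_gauss_le R (12 * v0 ^+ 2) (16 * v0 ^+ 4) (v0 ^+ 2 / 16) (sqn y) _ _ v016 s0.
  rewrite (_ : 16 * v0 ^+ 4 / (v0 ^+ 2 / 16) = 256 * v0 ^+ 2); last by field; rewrite gt_eqF.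
  by apply; rewrite mulr_ge0// exprn_ge0// ltW.
have H := @differentiation_under_integral R _ _ vol3 f setT measurableT v0 _ _ I0 intf derf G G0 intG Gub.
apply: DeriveDef.
  exact: (@derivable_under_integral R _ _ vol3 f setT measurableT v0 _ _ I0 intf derf G G0 intG Gub).
rewrite -derive1E H; apply: eq_Rintegral => z _.
by rewrite partial1of2E; have [_ ->] := d1 v0 z (lt0r_neq0 v00).
Qed.

(* Green's identity against the heat kernel: the flux
   [partial i p * phi - p * partial i phi] integrates to zero. *)
Lemma heat_flow_partial2 phi M v i : 0 < v ->
  (forall x, derivable phi x (unit_vec i)) ->
  (forall x, derivable (partial i phi) x (unit_vec i)) ->
  measurable_fun setT phi -> measurable_fun setT (partial i phi) ->
  measurable_fun setT (partial i (partial i phi)) ->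
  (forall x, `|phi x| <= M) -> (forall x, `|partial i phi x| <= M) ->
  (forall x, `|partial i (partial i phi) x| <= M) ->
  \int[vol3]_z ((v ^+ 4 * coord z i ^+ 2 - v ^+ 2) * heat_kernel v z * phi z) =
  heat_flow v (partial i (partial i phi)).
Proof.
move=> v0 d1 d2 m0 m1 m2 b0 b1 b2.
have M0 : 0 <= M by rewrite (le_trans _ (b0 0)).
pose F z := - (v ^+ 2 * coord z i) * heat_kernel v z * phi z - heat_kernel v z * partial i phi z.
pose F' z := (v ^+ 4 * coord z i ^+ 2 - v ^+ 2) * heat_kernel v z * phi z -
  heat_kernel v z * partial i (partial i phi) z.
have dF z : is_derive z (unit_vec i) F (F' z).
  have h1 := is_derive_heat_kernel v z i.
  have h2 := is_derive_heat_kernel2 v z i.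
  have h3 : is_derive z (unit_vec i) phi (partial i phi z) by apply: DeriveDef.
  have h4 : is_derive z (unit_vec i) (partial i phi) (partial i (partial i phi) z) by apply: DeriveDef.
  rewrite /F /F'; apply: is_derive_eq; rewrite /GRing.scale/=; ring.
have F'E : partial i F = F' by apply/funext => z; rewrite /partial; have [_ ->] := dF z.
have mc : measurable_fun setT (fun x : R3 R => coord x i : R) := @measurable_coord R i.
have mh := @measurable_heat_kernel R v.
have vv : 0 < v ^+ 2 / 4 by rewrite divr_gt0// exprn_gt0.
have v2 : 0 <= v ^+ 2 := sqr_ge0 v.
have v4 : 0 <= v ^+ 4 by rewrite exprn_ge0// ltW.
have g3 : 0 <= gnorm * v ^+ 3 :> R.
  by apply: mulr_ge0; [exact: ltW gnorm_gt0|apply: exprn_ge0; exact: ltW].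
have bound (f : R3 R -> R) (a c : R) : 0 <= a -> 0 <= c ->
    (forall z, `|f z| <= (a + c * sqn z) * heat_kernel v z * M) ->
    forall z, `|f z| <= (a + c * (4 / v ^+ 2)) * (gnorm * v ^+ 3) * M * expR (- (v ^+ 2 / 4 * sqn z)).
  move=> a0 c0 fb z; apply: (le_trans (fb z)); rewrite [leRHS]mulrAC ler_wpM2r//.
  exact: weighted_heat_kernel_le.
have bP (z : R3 R) : `|- (v ^+ 2 * coord z i) * heat_kernel v z * phi z| <= (v ^+ 2 + v ^+ 2 * sqn z) * heat_kernel v z * M.
  rewrite normrM ler_pM// normrM (ger0_norm (heat_kernel_ge0 _ (ltW v0))).
  rewrite ler_wpM2r ?(heat_kernel_ge0 _ (ltW v0))//.
  by rewrite normrN normrM (ger0_norm v2); have := normr_coord_le_sqn z i; nra.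
have bh (f : R3 R -> R) (z : R3 R) : (forall x, `|f x| <= M) -> `|heat_kernel v z * f z| <= (1 + 0 * sqn z) * heat_kernel v z * M.
  move=> fM; rewrite normrM mul0r addr0 mul1r (ger0_norm (heat_kernel_ge0 _ (ltW v0))).
  by rewrite ler_wpM2l ?(heat_kernel_ge0 _ (ltW v0)).
have bQ (z : R3 R) : `|(v ^+ 4 * coord z i ^+ 2 - v ^+ 2) * heat_kernel v z * phi z| <= (v ^+ 2 + v ^+ 4 * sqn z) * heat_kernel v z * M.
  rewrite normrM ler_pM// normrM (ger0_norm (heat_kernel_ge0 _ (ltW v0))).
  rewrite ler_wpM2r ?(heat_kernel_ge0 _ (ltW v0))//.
  have := sqr_coord_le_sqn z i; have := sqr_ge0 (coord z i) => h1 h2.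
  by rewrite ler_norml; apply/andP; split; nra.
have sum_bound (f1 f2 : R3 R -> R) (a c : R) z :
    `|f1 z| <= (a + c * sqn z) * heat_kernel v z * M ->
    `|f2 z| <= (1 + 0 * sqn z) * heat_kernel v z * M ->
    `|f1 z - f2 z| <= ((a + 1) + c * sqn z) * heat_kernel v z * M.
  move=> h1 h2; apply: (le_trans (ler_normB _ _)); apply: (le_trans (lerD h1 h2)).
  by rewrite -!mulrDl; rewrite le_eqVlt; apply/orP; left; apply/eqP; ring.
have int1 : vol3.-integrable setT (EFin \o (fun z => (v ^+ 4 * coord z i ^+ 2 - v ^+ 2) * heat_kernel v z * phi z)).
  apply: (integrable_gauss_bound vv); last exact: (bound _ _ _ v2 v4 bQ).
  apply: measurable_funM => //; apply: measurable_funM => //; apply: measurable_funB => //.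
  by apply: measurable_funM => //; exact: measurable_funX.
have int2 := integrable_heat_kernel v0 m2 b2.
have mF : measurable_fun setT F.
  apply: measurable_funB; last exact: measurable_funM.
  apply: measurable_funM => //; apply: measurable_funM => //; apply: measurable_funN.
  exact: measurable_funM.
have v21 : 0 <= v ^+ 2 + 1 by rewrite addr_ge0.
have FB := bound F _ _ v21 v2 (fun z => sum_bound
  (fun z => - (v ^+ 2 * coord z i) * heat_kernel v z * phi z)
  (fun z => heat_kernel v z * partial i phi z) _ _ z (bP z) (bh _ z b1)).
have FB' := bound F' _ _ v21 v4 (fun z => sum_bound
  (fun z => (v ^+ 4 * coord z i ^+ 2 - v ^+ 2) * heat_kernel v z * phi z)
  (fun z => heat_kernel v z * partial i (partial i phi) z) _ _ z (bQ z) (bh _ z b2)).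
pose C1 := (v ^+ 2 + 1 + v ^+ 2 * (4 / v ^+ 2)) * (gnorm * v ^+ 3) * M.
pose C2 := (v ^+ 2 + 1 + v ^+ 4 * (4 / v ^+ 2)) * (gnorm * v ^+ 3) * M.
have := @Rintegral_partial_gauss R (Num.max C1 C2) _ F i vv mF.
rewrite F'E => H.
apply/eqP; rewrite -subr_eq0 /heat_flow -RintegralB//.
apply/eqP; apply: H.
- by move=> x; have [] := dF x.
- move=> z; apply: (le_trans (FB z)).
  by rewrite ler_wpM2r ?expR_ge0// le_max lexx.
- move=> z; apply: (le_trans (FB' z)).
  by rewrite ler_wpM2r ?expR_ge0// le_max lexx orbT.
Qed.

End HeatFlow.

Lemma measurable_inv (R : realType) : measurable_fun [set: R] (@GRing.inv R).
Proof.
have m0 : measurable [set (0 : R)] by [].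
rewrite (_ : [set: R] = [set 0] `|` ~` [set 0]); last by rewrite setUv.
apply/measurable_funU => //; first exact: measurableC.
split; first exact: measurable_fun_set1.
apply: open_continuous_measurable_fun.
  by apply: closed_openC; exact: closed_eq.
by move=> x; rewrite inE/= => /eqP x0; exact: inv_continuous.
Qed.

(** * The Yukawa kernel *)

Section Yukawa.
Context {R : realType}.
Local Notation vol3 := (@vol3 R).
Local Notation leb := (@lebesgue_measure R).
Implicit Types (x y z : R3 R) (i : 'I_3) (F G g phi : R3 R -> R).
Variable kappa : R.

(** At the heat time t = 1 / (2 v^2) this is the factor exp(- kappa^2 t) by which the screening
    damps the heat semigroup. *)
Definition damping (v : R) : R := expR (- (kappa ^+ 2 / (2 * v ^+ 2))).

(** The substitution t = 1 / (2 v^2) in the time integral of exp(- kappa^2 t) times the heat kernel: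
    the Jacobian v^-3 cancels the factor v^3 of [heat_kernel] and leaves an integrand bounded in
    v. *)
Definition yukawa_density (z : R3 R) (v : R) : R :=
  \1_(`]0, +oo[%classic : set R) v * (gnorm * damping v * expR (- (v ^+ 2 / 2 * sqn z))).

(* The Yukawa potential [exp (- kappa |z|) / (4 pi |z|)] as a mixture of heat
   kernels. *)
Definition yukawa (z : R3 R) : \bar R := (\int[leb]_v (yukawa_density z v)%:E)%E.

Lemma yukawa_density_ge0 z v : 0 <= yukawa_density z v.
Proof.
apply: mulr_ge0 => //; apply: mulr_ge0; last exact: expR_ge0.
by apply: mulr_ge0; [exact: ltW gnorm_gt0|exact: expR_ge0].
Qed.

Lemma measurable_damping : measurable_fun setT damping.
Proof.
apply: measurableT_comp; first exact: measurable_expR.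
apply: measurable_funN; apply: measurable_funM => //.
apply: measurableT_comp; first exact: measurable_inv.
by apply: measurable_funM => //; exact: measurable_funX.
Qed.

Lemma measurable_yukawa_density :
  measurable_fun setT (fun zv : R3 R * measurableTypeR R => yukawa_density zv.1 zv.2).
Proof.
apply: measurable_funM.
  apply: measurableT_comp; last exact: measurable_snd.
  by apply: measurable_indic; exact: measurable_itv.
apply: measurable_funM.
  apply: measurable_funM => //.
  by apply: measurableT_comp; [exact: measurable_damping|exact: measurable_snd].
apply: measurableT_comp; first exact: measurable_expR.
apply: measurable_funN; apply: measurable_funM.
  apply: measurable_funM => //; apply: measurable_funX; exact: measurable_snd.
by apply: measurableT_comp; [exact: measurable_sqn|exact: measurable_fst].
Qed.

Lemma measurable_yukawa_density1 z : measurable_fun setT (yukawa_density z).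
Proof.
apply: (@measurableT_comp _ _ _ _ _ _ (fun zv => yukawa_density zv.1 zv.2) _ (fun v => (z, v))).
  exact: measurable_yukawa_density.
exact: measurable_fun_pair.
Qed.

Lemma measurable_yukawa : measurable_fun setT yukawa.
Proof.
have mf : measurable_fun setT
    (fun zv : R3 R * measurableTypeR R => (yukawa_density zv.1 zv.2)%:E).
  by apply/measurable_EFinP; exact: measurable_yukawa_density.
have f0 zv : (0 <= (yukawa_density zv.1 zv.2)%:E)%E.
  by rewrite lee_fin yukawa_density_ge0.
have := @measurable_fun_fubini_tonelli_F _ _ _ _ R leb _ mf f0.
exact.
Qed.

Lemma yukawa_ge0 z : (0 <= yukawa z)%E.
Proof. by apply: integral_ge0 => v _; rewrite lee_fin yukawa_density_ge0. Qed.

(** Every Gaussian of the mixture decreases with |z|. *)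
Lemma le_yukawa z z' : sqn z <= sqn z' -> (yukawa z' <= yukawa z)%E.
Proof.
move=> zz; apply: ge0_le_integral => //.
- by move=> v _; rewrite lee_fin yukawa_density_ge0.
- by apply/measurable_EFinP; exact: measurable_yukawa_density1.
- by apply/measurable_EFinP; exact: measurable_yukawa_density1.
- move=> v _; rewrite lee_fin ler_wpM2l// ler_wpM2l//.
    by apply: mulr_ge0; [exact: ltW gnorm_gt0|exact: expR_ge0].
  by rewrite ler_expR lerN2 ler_wpM2l// divr_ge0// sqr_ge0.
Qed.

Lemma yukawaN z : yukawa (- z) = yukawa z.
Proof. by rewrite /yukawa /yukawa_density sqnN. Qed.

Lemma yukawa_density_heat z v : 0 < v ->
  yukawa_density z v = damping v / v ^+ 3 * heat_kernel v z.
Proof.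
move=> v0; rewrite /yukawa_density indicE mem_set/=; last by rewrite in_itv/= v0.
by rewrite mul1r /heat_kernel; field; rewrite gt_eqF.
Qed.

(** Tonelli in z and v. Its sign condition is the reason why test functions are shifted by a
    constant before they meet the kernel. *)
Lemma integral_yukawa g M : measurable_fun setT g -> (forall z, 0 <= g z <= M) ->
  (\int[vol3]_z (yukawa z * (g z)%:E) =
   \int[leb]_(v in `]0%R, +oo[) (damping v / v ^+ 3 * heat_flow v g)%:E)%E.
Proof.
move=> mg g0M.
have g0 z : 0 <= g z by have /andP[] := g0M z.
have gM z : `|g z| <= M by rewrite ger0_norm//; have /andP[] := g0M z.
transitivity (\int[vol3]_z \int[leb]_v (yukawa_density z v * g z)%:E)%E.
  apply: eq_integral => z _; rewrite /yukawa -ge0_integralZr//.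
  - by apply/measurable_EFinP; exact: measurable_yukawa_density1.
  - by move=> v _; rewrite lee_fin yukawa_density_ge0.
  - by rewrite lee_fin.
rewrite (@fubini_tonelli _ _ _ _ R vol3 leb
  (fun zv => (yukawa_density zv.1 zv.2 * g zv.1)%:E))/=; last 2 first.
- apply/measurable_EFinP; apply: measurable_funM; first exact: measurable_yukawa_density.
  by apply: measurableT_comp; [exact: mg|exact: measurable_fst].
- by move=> zv; rewrite lee_fin mulr_ge0// yukawa_density_ge0.
rewrite [RHS]integral_mkcond; apply: eq_integral => v _.
rewrite patchE; case: ifPn => [|v0]; last first.
  rewrite integral0_eq// => z _.
  by rewrite /yukawa_density indicE (negbTE v0) !mul0r.
rewrite inE/= in_itv/= andbT => v0.
have intg := integrable_heat_kernel v0 mg gM.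
rewrite EFinM /heat_flow /Rintegral fineK; last exact: integrable_fin_num.
rewrite -integralZl//.
apply: eq_integral => z _; rewrite yukawa_density_heat// -EFinM; congr EFin.
by rewrite -(mulrA _ (heat_kernel v z)).
Qed.

End Yukawa.

(** * The heat flow at small times *)

Section HeatLimit.
Context {R : realType}.
Local Notation vol3 := (@vol3 R).
Implicit Types (x y z : R3 R) (i : 'I_3) (f g : R3 R -> R).

Lemma Rintegral_affine a (s : R) f : s != 0 -> vol3.-integrable setT (EFin \o f) ->
  \int[vol3]_x f (affine3 a s x) = `|s|^-1 ^+ 3 * \int[vol3]_x f x.
Proof.
move=> s0 intf; have mf := measurable_int vol3 intf.
rewrite /Rintegral integralE [in RHS]integralE.
have mp := measurable_funepos mf; have mn := measurable_funeneg mf.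
have := ge0_integral_affine a s0 measurableT mp (fun x _ => funepos_ge0 _ x).
have := ge0_integral_affine a s0 measurableT mn (fun x _ => funeneg_ge0 _ x).
rewrite !preimage_setT => En Ep.
transitivity (fine (\int[vol3]_x ((EFin \o f)^\+)%E (affine3 a s x) -
   \int[vol3]_x ((EFin \o f)^\-)%E (affine3 a s x))%E).
  by congr (fine (_ - _)%E); apply: eq_integral => x _; rewrite ?funeposE ?funenegE.
rewrite En Ep.
have /fineK <- := integrable_pos_fin_num measurableT intf.
have /fineK <- := integrable_neg_fin_num measurableT intf.
by rewrite -!EFinM -!EFinB /= mulrBr.
Qed.

Lemma heat_flow_rescale v g M : 0 < v -> measurable_fun setT g ->
  (forall z, `|g z| <= M) ->
  heat_flow v g = \int[vol3]_w (heat_kernel 1 w * g (v^-1 *: w)).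
Proof.
move=> v0 mg gM; have v0' : v != 0 by rewrite gt_eqF.
have ms : measurable_fun setT (fun w : R3 R => g (v^-1 *: w)).
  apply: measurableT_comp => //.
  by have := measurable_affine3 (0 : R3 R) v^-1; apply: eq_measurable_fun => w _;
    rewrite affine3E add0r.
have intf := integrable_heat_kernel ltr01 ms (fun z => gM _).
have := Rintegral_affine 0 v0' intf.
rewrite gtr0_norm// => H.
apply: (@mulfI _ (v^-1 ^+ 3)); first by rewrite expf_neq0// invr_neq0.
rewrite -H /heat_flow -RintegralZl//; last exact: integrable_heat_kernel.
apply: eq_Rintegral => z _.
rewrite affine3E add0r scalerA mulVf// scale1r /heat_kernel sqnZ.
have -> : 1 ^+ 2 / 2 * (v ^+ 2 * sqn z) = v ^+ 2 / 2 * sqn z by field.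
by field.
Qed.

(** Large v means small time, so the kernel is an approximate identity: after rescaling, the weight
    is a fixed Gaussian and dominated convergence applies. The sequence n + 2 is the one that
    exhausts the half-line in [fundamental_solution]. *)
Lemma cvg_heat_flow g M : continuous g -> (forall z, `|g z| <= M) ->
  heat_flow n.+2%:R g @[n --> \oo] --> g 0.
Proof.
move=> cg gM; have mg := continuous_measurable3 cg.
have h01 z := heat_kernel_ge0 z (@ler01 R).
have int1 : vol3.-integrable setT (EFin \o (fun z => heat_kernel 1 z * M)).
  apply: (@integrable_heat_kernel R 1 (cst M) M) => // z.
  by rewrite ger0_norm// (le_trans _ (gM 0)).
have ms (v : R) : measurable_fun setT (fun w : R3 R => g (v^-1 *: w)).
  apply: measurableT_comp => //.
  by have := measurable_affine3 (0 : R3 R) v^-1; apply: eq_measurable_fun => w _;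
    rewrite affine3E add0r.
have := @dominated_convergence _ _ R vol3 setT measurableT
  (fun n w => (heat_kernel 1 w * g (n.+2%:R^-1 *: w))%:E)
  (fun w => (heat_kernel 1 w * g 0)%:E) (EFin \o (fun z => heat_kernel 1 z * M)).
case.
- move=> n; apply/measurable_EFinP; apply: measurable_funM => //.
  exact: measurable_heat_kernel.
- apply/measurable_EFinP; apply: measurable_funM => //; exact: measurable_heat_kernel.
- apply/aeW => w _; apply: cvg_EFin; first by apply: nearW.
  apply: cvgMr.
  apply: (@cvg_comp _ _ _ (fun n : nat => (n.+2%:R^-1 : R) *: w) g _ (nbhs (0 : R3 R))); last exact: cg.
  rewrite -(scale0r w); apply: cvgZr_tmp.
  have := @cvg_harmonic R.
  by rewrite -(cvg_shiftn 1); apply: cvg_trans; apply: near_eq_cvg; apply: nearW => n; rewrite /= addn1.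
- exact: int1.
- apply/aeW => w n _; rewrite /= lee_fin normrM ger0_norm// ler_wpM2l//.
move=> _ _ H.
have {H} : \int[vol3]_w (heat_kernel 1 w * g (n.+2%:R^-1 *: w)) @[n --> \oo] -->
    \int[vol3]_w (heat_kernel 1 w * g 0).
  apply: fine_cvg; rewrite fineK//.
  apply: integrable_fin_num => //.
  by apply: (@integrable_heat_kernel R 1 (cst (g 0)) M) => // z; exact: gM.
have -> : \int[vol3]_w (heat_kernel 1 w * g 0) = g 0.
  rewrite RintegralZr//.
    by rewrite /Rintegral integral_heat_kernel//= mul1r.
  have := @integrable_heat_kernel R 1 (cst 1) 1 ltr01 (@measurable_cst _ _ _ _ _ _).
  under eq_fun do rewrite mulr1; apply => z; by rewrite normr1.
apply: cvg_trans; apply: near_eq_cvg; apply: nearW => n.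
by rewrite /= -(@heat_flow_rescale n.+2%:R g M).
Qed.

End HeatLimit.

Lemma sum_ord3 (V : nmodType) (F : 'I_3 -> V) :
  \sum_(i < 3) F i = F ord0 + F (lift ord0 ord0) + F ord_max.
Proof.
rewrite !big_ord_recl big_ord0 addr0.
have -> : lift ord0 (lift ord0 ord0) = ord_max :> 'I_3 by exact: val_inj.
by rewrite addrA.
Qed.

Lemma normr_sum3_le (R : realDomainType) (a b c M : R) :
  `|a| <= M -> `|b| <= M -> `|c| <= M -> `|a + b + c| <= 3 * M.
Proof.
move=> aM bM cM; apply: (le_trans (ler_normD _ _)).
by have := ler_normD a b; lra.
Qed.

Lemma integrable_addr d (T : measurableType d) (R : realType)
    (mu : {measure set T -> \bar R}) (D : set T) (f g : T -> R) :
  measurable D -> mu.-integrable D (EFin \o f) -> mu.-integrable D (EFin \o g) ->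
  mu.-integrable D (EFin \o (fun x => f x + g x)).
Proof.
move=> mD intf intg.
have := integrableD mD intf intg.
by congr (integrable _ _ _); apply/funext => x /=; rewrite EFinD.
Qed.

(** * The heat equation for bounded functions with bounded derivatives *)

Section Tame.
Context {R : realType}.
Local Notation vol3 := (@vol3 R).
Implicit Types (x y z : R3 R) (i : 'I_3) (f g phi : R3 R -> R).

(** A translation-invariant class that contains the smooth periodic functions and asks just for what
    integrating the Laplacian by parts against a Gaussian uses: only pure second derivatives
    occur. *)
Definition tame (M : R) phi := [/\ continuous phi, (forall x, `|phi x| <= M) &
  forall i, [/\ (forall x, derivable phi x (unit_vec i)),
    (forall x, derivable (partial i phi) x (unit_vec i)),
    continuous (partial i phi), continuous (partial i (partial i phi)) &
    forall x, `|partial i phi x| <= M /\ `|partial i (partial i phi) x| <= M]].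

Lemma shift_quotient phi a x i :
  (fun k : R => k^-1 *: (((fun z => phi (a + z)) \o shift x) (k *: unit_vec i) - phi (a + x))) =
  (fun k : R => k^-1 *: ((phi \o shift (a + x)) (k *: unit_vec i) - phi (a + x))).
Proof. by apply/funext => k /=; rewrite addrCA. Qed.

Lemma derivable_shift phi a x i : derivable phi (a + x) (unit_vec i) ->
  derivable (fun z => phi (a + z)) x (unit_vec i).
Proof. by rewrite /derivable shift_quotient. Qed.

Lemma partial_shift phi a i :
  partial i (fun z => phi (a + z)) = (fun z => partial i phi (a + z)).
Proof. by apply/funext => x; rewrite /partial /derive shift_quotient. Qed.

Lemma continuous_shift3 phi a : continuous phi -> continuous (fun z => phi (a + z)).
Proof.
move=> cphi x; apply: (@continuous_comp _ _ _ (fun z => a + z) phi); last exact: cphi.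
by apply: cvgD; [exact: cvg_cst|exact: cvg_id].
Qed.

Lemma tame_shift M phi a : tame M phi -> tame M (fun z => phi (a + z)).
Proof.
move=> [c0 b0 H]; split; [exact: continuous_shift3|by []|] => i.
have [d1 d2 c1 c2 b] := H i.
rewrite (partial_shift phi) (partial_shift (partial i phi)); split.
- by move=> x; apply: derivable_shift.
- by move=> x; apply: derivable_shift.
- exact: continuous_shift3.
- exact: continuous_shift3.
- by move=> x; exact: b.
Qed.

Lemma laplacianE phi x : laplacian phi x = partial ord0 (partial ord0 phi) x +
  partial (lift ord0 ord0) (partial (lift ord0 ord0) phi) x +
  partial ord_max (partial ord_max phi) x.
Proof. exact: (@sum_ord3 R (fun i => partial i (partial i phi) x)). Qed.

Lemma continuous_laplacian M phi : tame M phi -> continuous (laplacian phi).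
Proof.
move=> [_ _ H] x.
rewrite (_ : laplacian phi = (fun x => partial ord0 (partial ord0 phi) x +
  partial (lift ord0 ord0) (partial (lift ord0 ord0) phi) x +
  partial ord_max (partial ord_max phi) x)); last by apply/funext => y; exact: laplacianE.
by apply: cvgD; [apply: cvgD|]; [have [_ _ _ + _] := H ord0|
  have [_ _ _ + _] := H (lift ord0 ord0)|have [_ _ _ + _] := H ord_max]; apply.
Qed.

Lemma laplacian_shift phi a : laplacian (fun z => phi (a + z)) = (fun z => laplacian phi (a + z)).
Proof. apply/funext => x; rewrite !laplacianE.
have E i : partial i (partial i (fun z => phi (a + z))) = (fun z => partial i (partial i phi) (a + z)).
  by rewrite (partial_shift phi) (partial_shift (partial i phi)).
by rewrite !E. Qed.

Lemma laplacian_le M phi x : tame M phi -> `|laplacian phi x| <= 3 * M.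
Proof.
move=> [_ _ H]; rewrite laplacianE.
have [_ _ _ _ /(_ x)[_ h0]] := H ord0.
have [_ _ _ _ /(_ x)[_ h1]] := H (lift ord0 ord0).
have [_ _ _ _ /(_ x)[_ h2]] := H ord_max.
exact: (normr_sum3_le h0 h1 h2).
Qed.

Opaque partial.

Lemma integrable_quad_heat_kernel v phi M i : 0 < v -> measurable_fun setT phi ->
  (forall x, `|phi x| <= M) ->
  vol3.-integrable setT
    (fun z => ((v ^+ 4 * coord z i ^+ 2 - v ^+ 2) * heat_kernel v z * phi z)%:E).
Proof.
move=> v0 m0 b0; have M0 : 0 <= M by rewrite (le_trans _ (b0 0)).
have vv : 0 < v ^+ 2 / 4 by rewrite divr_gt0// exprn_gt0.
have v2 : 0 <= v ^+ 2 := sqr_ge0 v.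
have v4 : 0 <= v ^+ 4 by rewrite exprn_ge0// ltW.
have mc : measurable_fun setT (fun x : R3 R => coord x i : R) := @measurable_coord R i.
apply: (@integrable_gauss_bound R
  ((v ^+ 2 + v ^+ 4 * (4 / v ^+ 2)) * (gnorm * v ^+ 3) * M) _ _ vv).
  apply: measurable_funM => //; apply: measurable_funM; last exact: measurable_heat_kernel.
  apply: measurable_funB => //.
  by apply: measurable_funM => //; exact: measurable_funX.
move=> z.
have := weighted_heat_kernel_le z v2 v4 v0 => H.
rewrite [leRHS]mulrAC; apply: (le_trans _ (ler_wpM2r M0 H)).
rewrite normrM ler_pM// normrM (ger0_norm (heat_kernel_ge0 _ (ltW v0))).
rewrite ler_wpM2r ?(heat_kernel_ge0 _ (ltW v0))//.
have := sqr_coord_le_sqn z i; have := sqr_ge0 (coord z i) => h1 h2.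
by rewrite ler_norml; apply/andP; split; nra.
Qed.

(** The heat equation in the variable v, where dt/dv = - v^-3. The Laplacian of the kernel is moved
    to [phi] one coordinate at a time by [heat_flow_partial2]. *)
Lemma is_derive_heat_flow_laplacian M phi (v : R) : 0 < v -> tame M phi ->
  is_derive v 1 (heat_flow^~ phi) (- (v ^+ 3)^-1 * heat_flow v (laplacian phi)).
Proof.
move=> v0 tphi; have [c0 b0 H] := tphi.
have m0 := continuous_measurable3 c0.
have H1 := is_derive_heat_flow v0 m0 b0.
apply: is_derive_eq.
have I i := integrable_quad_heat_kernel i v0 m0 b0.
have ibp i : \int[vol3]_z ((v ^+ 4 * coord z i ^+ 2 - v ^+ 2) * heat_kernel v z * phi z) =
    heat_flow v (partial i (partial i phi)).
  have [d1 d2 c1 c2 b] := H i.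
  apply: (@heat_flow_partial2 R phi M) => //.
  - exact: continuous_measurable3.
  - exact: continuous_measurable3.
  - by move=> x; have [] := b x.
  - by move=> x; have [] := b x.
have J i : vol3.-integrable setT (fun z => (heat_kernel v z * partial i (partial i phi) z)%:E).
  have [d1 d2 c1 c2 b] := H i.
  apply: (@integrable_heat_kernel R v _ M) => //; first exact: continuous_measurable3.
  by move=> x; have [] := b x.
pose o1 : 'I_3 := lift ord0 ord0.
pose q i z := (v ^+ 4 * coord z i ^+ 2 - v ^+ 2) * heat_kernel v z * phi z.
have -> : heat_flow v (laplacian phi) =
    \int[vol3]_z q ord0 z + \int[vol3]_z q o1 z + \int[vol3]_z q ord_max z.
  transitivity (heat_flow v (partial ord0 (partial ord0 phi)) +
      heat_flow v (partial o1 (partial o1 phi)) +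
      heat_flow v (partial ord_max (partial ord_max phi))).
    rewrite /heat_flow -(RintegralD measurableT (J ord0) (J o1)).
    rewrite -(RintegralD measurableT (integrable_addr measurableT (J ord0) (J o1)) (J ord_max)).
    by apply: eq_Rintegral => z _; rewrite laplacianE !mulrDr.
  exact: (f_equal2 +%R (f_equal2 +%R (esym (ibp ord0)) (esym (ibp o1)))
    (esym (ibp ord_max))).
rewrite -(RintegralD measurableT (I ord0) (I o1)).
rewrite -(RintegralD measurableT (integrable_addr measurableT (I ord0) (I o1)) (I ord_max)).
rewrite -(RintegralZl _ measurableT (integrable_addr measurableT
  (integrable_addr measurableT (I ord0) (I o1)) (I ord_max))).
apply: eq_Rintegral => z _; rewrite sqnE /q !coordE.
by field; rewrite gt_eqF.
Qed.

End Tame.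

(** * The Yukawa kernel as a fundamental solution *)

Section Fundamental.
Context {R : realType}.
Local Notation vol3 := (@vol3 R).
Local Notation leb := (@lebesgue_measure R).
Implicit Types (x y z : R3 R) (i : 'I_3) (f g phi : R3 R -> R).
Variable kappa : R.
Hypothesis kappa_gt0 : 0 < kappa.

Definition screened (phi : R3 R -> R) (x : R3 R) : R := - laplacian phi x + kappa ^+ 2 * phi x.

Lemma damping_gt0 (v : R) : 0 < damping kappa v.
Proof. exact: expR_gt0. Qed.

Lemma damping_le (v : R) : 0 < v -> damping kappa v <= 2 * v ^+ 2 / kappa ^+ 2.
Proof.
move=> v0; rewrite /damping expRN invf_ple ?posrE ?expR_gt0//; last first.
  by rewrite divr_gt0// ?exprn_gt0// mulr_gt0// exprn_gt0.
rewrite invf_div (le_trans _ (expR_ge1Dx _))// lerDr//.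
Qed.

Lemma is_derive_damping (v : R) : 0 < v ->
  is_derive v 1 (damping kappa) (kappa ^+ 2 / v ^+ 3 * damping kappa v).
Proof.
move=> v0; rewrite /damping.
have vn0 : 2 * v ^+ 2 != 0 by rewrite mulf_neq0// expf_neq0// gt_eqF.
apply: is_derive_eq.
rewrite /GRing.scale/=.
by field; rewrite gt_eqF.
Qed.

Lemma is_derive_cont (f : R -> R) (v df : R) : is_derive v 1 f df -> {for v, continuous f}.
Proof. by move=> [dv _]; apply/differentiable_continuous/derivable1_diffP. Qed.

(** After Tonelli the v-integrand is an exact derivative, by the heat equation and the differential
    equation of [damping], so the integral is a boundary term: at v = 0 the damping kills it, at
    infinity the heat flow returns phi 0. The constant c makes the integrand nonnegative, as Tonelli
    and monotone exhaustion require, and contributes c / kappa^2. *)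
Lemma fundamental_solution M c phi : tame M phi ->
  (forall x, `|screened phi x| <= c) ->
  (\int[vol3]_z (yukawa kappa z * (screened phi z + c)%:E) = (phi 0 + c / kappa ^+ 2)%:E)%E.
Proof.
move=> tphi sc.
have [cphi bphi Hphi] := tphi.
have clap := continuous_laplacian tphi.
have mphi := continuous_measurable3 cphi; have mlap := continuous_measurable3 clap.
have c0 : 0 <= c by rewrite (le_trans _ (sc 0)).
pose g z := screened phi z + c.
have cg : continuous g.
  move=> z; apply: cvgD; last exact: cvg_cst.
  by apply: cvgD; [apply: cvgN; exact: clap|apply: cvgMr; exact: cphi].
have mg := continuous_measurable3 cg.
have g0 z : 0 <= g z <= 2 * c.
  by have := sc z; rewrite ler_norml /g => /andP[h1 h2]; apply/andP; split; lra.
have gM z : `|g z| <= 2 * c by have /andP[h1 h2] := g0 z; rewrite ger0_norm.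
rewrite (integral_yukawa kappa mg g0).
pose fv (v : R) := damping kappa v / v ^+ 3 * heat_flow v g.
(* The primitive: differentiating [damping] produces kappa^2 / v^3, which supplies the zeroth-order
   term of [screened] and turns c / kappa^2 into c / v^3. *)
pose Fv (v : R) := damping kappa v * (heat_flow v phi + c / kappa ^+ 2).
have hg (v : R) : 0 < v -> heat_flow v g = - heat_flow v (laplacian phi) + kappa ^+ 2 * heat_flow v phi + c.
  move=> v0.
  have I1 := integrable_heat_kernel v0 mlap (fun z => laplacian_le z tphi).
  have I2 := integrable_heat_kernel v0 mphi bphi.
  have I3 : vol3.-integrable setT (EFin \o (fun z => heat_kernel v z * c)).
    by apply: (@integrable_heat_kernel R v (cst c) c) => // z; rewrite ger0_norm.
  have I1' : vol3.-integrable setT (EFin \o (fun z => - 1 * (heat_kernel v z * laplacian phi z))).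
    by have := integrableZl measurableT (-1) I1; congr (integrable _ _ _); apply/funext => z /=; rewrite -EFinM.
  have I2' : vol3.-integrable setT (EFin \o (fun z => kappa ^+ 2 * (heat_kernel v z * phi z))).
    by have := integrableZl measurableT (kappa ^+ 2) I2; congr (integrable _ _ _); apply/funext => z /=; rewrite -EFinM.
  have -> : c = \int[vol3]_z (heat_kernel v z * c).
    rewrite RintegralZr//; first by rewrite /Rintegral integral_heat_kernel//= mul1r.
    have := @integrable_heat_kernel R v (cst 1) 1 v0 (@measurable_cst _ _ _ _ _ _).
    by under eq_fun do rewrite mulr1; apply => z; rewrite normr1.
  rewrite -mulN1r -(RintegralZl _ measurableT I1) -(RintegralZl _ measurableT I2).
  rewrite -(RintegralD measurableT I1' I2') -(RintegralD measurableT (integrable_addr measurableT I1' I2') I3).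
  by apply: eq_Rintegral => z _; rewrite /g /screened; ring.
have dF (v : R) : 0 < v -> is_derive v 1 Fv (fv v).
  move=> v0; have h1 := is_derive_damping v0.
  have h2 := is_derive_heat_flow_laplacian v0 tphi.
  rewrite /Fv; apply: is_derive_eq.
  rewrite /fv (hg _ v0) /GRing.scale/=.
  by field; rewrite !gt_eqF.
have cf (v : R) : 0 < v -> {for v, continuous fv}.
  move=> v0.
  have h1 := is_derive_damping v0.
  have h2 := is_derive_heat_flow v0 mg gM.
  have v30 : v ^+ 3 != 0 by rewrite expf_neq0// gt_eqF.
  apply: cvgM; last exact: is_derive_cont h2.
  apply: cvgM; first exact: is_derive_cont h1.
  by apply: cvgV => //; apply: exprn_continuous.
have fv0 (v : R) : 0 < v -> 0 <= fv v.
  move=> v0; apply: mulr_ge0.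
    by apply: mulr_ge0; [exact: ltW (damping_gt0 v)|rewrite invr_ge0 exprn_ge0// ltW].
  apply: Rintegral_ge0 => z _; apply: mulr_ge0; last by have /andP[] := g0 z.
  exact: heat_kernel_ge0 (ltW v0).
(* Starting the sequence at 2 makes the inverse strictly smaller than the integer for every n, so
   that the intervals are nondegenerate. *)
pose a_ n : R := n.+2%:R^-1; pose b_ n : R := n.+2%:R.
pose J n : set R := `[a_ n, b_ n]%classic.
have a0 n : 0 < a_ n by rewrite invr_gt0.
have ab n : a_ n < b_ n.
  have h : 1 < b_ n by rewrite /b_ ltr1n.
  by apply: lt_trans h; rewrite /a_ invf_lt1// ltr1n.
have ftc n : (\int[leb]_(v in J n) (fv v)%:E = (Fv (b_ n) - Fv (a_ n))%:E)%E.
  have pos (v : R) : `[a_ n, b_ n]%classic v -> 0 < v.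
    by rewrite /= in_itv/= => /andP[h _]; exact: lt_le_trans (a0 n) h.
  rewrite /J (@continuous_FTC2 R fv Fv)//.
  - apply: continuous_in_subspaceT => v; rewrite inE => /pos v0; exact: cf.
  - split.
    + move=> v; rewrite in_itv/= => /andP[h _].
      by have [] := dF v (lt_trans (a0 n) h).
    + apply: cvg_at_right_filter; exact: is_derive_cont (dF _ (a0 n)).
    + apply: cvg_at_left_filter; exact: is_derive_cont (dF _ (lt_trans (a0 n) (ab n))).
  - move=> v; rewrite in_itv/= => /andP[h _]; rewrite derive1E.
    by have [_ ->] := dF v (lt_trans (a0 n) h).
have UJ : \bigcup_n J n = `]0, +oo[%classic.
  apply/seteqP; split => v /=.
    move=> [n _]; rewrite /J/= !in_itv/= andbT => /andP[h _].
    exact: lt_le_trans (a0 n) h.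
  rewrite in_itv/= andbT => v0.
  exists (maxn (Num.Def.truncn v) (Num.Def.truncn v^-1)) => //.
  rewrite /J/= in_itv/=; apply/andP; split; last first.
    rewrite (le_trans (ltW (truncnS_gt v)))// /b_ ler_nat ltnW// !ltnS leq_maxl//.
  rewrite /a_ -[leRHS]invrK lef_pV2 ?posrE ?invr_gt0//.
  by rewrite (le_trans (ltW (truncnS_gt v^-1)))// ler_nat ltnW// !ltnS leq_maxr.
have ndJ : nondecreasing_seq J.
  move=> m n mn; apply/subsetPset => v; rewrite /J/= !in_itv/= => /andP[h1 h2].
  apply/andP; split; last by rewrite (le_trans h2)// ler_nat !ltnS.
  by rewrite (le_trans _ h1)// lef_pV2 ?posrE// ler_nat !ltnS.
have mJ n : measurable (J n : set (measurableTypeR R)) by exact: measurable_itv.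
have mfv : measurable_fun (`]0, +oo[%classic : set (measurableTypeR R)) (EFin \o fv).
  apply/measurable_EFinP; apply: open_continuous_measurable_fun; first exact: interval_open.
  by move=> v; rewrite inE/= in_itv/= andbT => v0; exact: cf.
have := @ge0_nondecreasing_set_cvg_integral _ (measurableTypeR R) R J (EFin \o fv) leb ndJ mJ.
rewrite UJ => H.
have {}H : (Fv (b_ n) - Fv (a_ n))%:E @[n --> \oo] --> (\int[leb]_(v in `]0%R, +oo[) (fv v)%:E)%E.
  have -> : (fun n => (Fv (b_ n) - Fv (a_ n))%:E) = (fun n => \int[leb]_(v in J n) (fv v)%:E)%E.
    by apply/funext => n; rewrite ftc.
  apply: H => //.
  - by move=> n; apply: measurable_funS mfv => //; rewrite -UJ; exact: bigcup_sup.
  - move=> n v; rewrite /J/= in_itv/= => /andP[h _]; rewrite lee_fin; apply: fv0; exact: lt_le_trans (a0 n) h.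
have ca : a_ n @[n --> \oo] --> 0.
  have := @cvg_harmonic R.
  by rewrite -(cvg_shiftn 1); apply: cvg_trans; apply: near_eq_cvg; apply: nearW => n; rewrite /= addn1.
(* Near v = 0 the damping is O(v^2), while the heat flow stays bounded by the bound M of phi. *)
have cFa : Fv (a_ n) @[n --> \oo] --> 0.
  apply: norm_cvg0.
  apply: (@squeeze_cvgr _ _ _ _ (cst 0) (fun n => (2 / kappa ^+ 2 * (M + c / kappa ^+ 2)) * (a_ n * a_ n))).
  - apply: nearW => n; rewrite normr_ge0/= /Fv normrM (gtr0_norm (damping_gt0 _)).
    have h1 := damping_le (a0 n).
    have h2 : `|heat_flow (a_ n) phi + c / kappa ^+ 2| <= M + c / kappa ^+ 2.
      apply: (le_trans (ler_normD _ _)); apply: lerD; last first.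
        by rewrite ger0_norm// divr_ge0// sqr_ge0.
      have I2 := integrable_heat_kernel (a0 n) mphi bphi.
      rewrite /heat_flow (le_trans (le_normr_Rintegral measurableT I2))//.
      have IM : vol3.-integrable setT (EFin \o (fun z => heat_kernel (a_ n) z * M)).
        apply: (@integrable_heat_kernel R _ (cst M) M) => // z.
        by rewrite ger0_norm// (le_trans _ (bphi 0)).
      have <- : \int[vol3]_z (heat_kernel (a_ n) z * M) = M.
        rewrite RintegralZr//; first by rewrite /Rintegral integral_heat_kernel//= mul1r.
        have := @integrable_heat_kernel R (a_ n) (cst 1) 1 (a0 n) (@measurable_cst _ _ _ _ _ _).
        by under eq_fun do rewrite mulr1; apply => z; rewrite normr1.
      apply: le_Rintegral => //.
        exact: (integrable_norm I2).
      move=> z _; rewrite normrM ger0_norm ?ler_wpM2l//; exact: heat_kernel_ge0 (ltW (a0 n)).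
    apply: (le_trans (ler_pM (ltW (damping_gt0 _)) (normr_ge0 _) h1 h2)).
    by rewrite le_eqVlt; apply/orP; left; apply/eqP; ring.
  - exact: cvg_cst.
  - by rewrite -[X in _ --> X](mulr0 (2 / kappa ^+ 2 * (M + c / kappa ^+ 2))); apply: cvgMr;
      rewrite -[X in _ --> X](mulr0 0); apply: cvgM.
have cda : damping kappa (b_ n) @[n --> \oo] --> (1 : R).
  have E n : - (kappa ^+ 2 / (2 * b_ n ^+ 2)) = - (kappa ^+ 2 / 2) * (a_ n * a_ n).
    by rewrite /a_ -/(b_ n); field; rewrite gt_eqF// /b_.
  have cE : - (kappa ^+ 2 / (2 * b_ n ^+ 2)) @[n --> \oo] --> (0 : R).
    have -> : (fun n => - (kappa ^+ 2 / (2 * b_ n ^+ 2))) =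
      (fun n => - (kappa ^+ 2 / 2) * (a_ n * a_ n)) by apply/funext.
    by rewrite -[X in _ --> X](mulr0 (- (kappa ^+ 2 / 2))); apply: cvgMr;
      rewrite -[X in _ --> X](mulr0 0); apply: cvgM.
  rewrite -expR0; apply: (@cvg_comp _ _ _ (fun n => - (kappa ^+ 2 / (2 * b_ n ^+ 2))) (@expR R) _ (nbhs (0 : R))) => //.
  exact: continuous_expR.
have cFb : Fv (b_ n) @[n --> \oo] --> phi 0 + c / kappa ^+ 2.
  rewrite -[X in _ --> X]mul1r; apply: cvgM => //.
  by apply: cvgD; [exact: cvg_heat_flow cphi bphi|exact: cvg_cst].
have cF : (Fv (b_ n) - Fv (a_ n))%:E @[n --> \oo] --> (phi 0 + c / kappa ^+ 2)%:E.
  apply: cvg_EFin; first by apply: nearW.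
  by rewrite -[X in _ --> X]subr0; apply: cvgB.
exact: (cvg_unique _ H cF).
Qed.

End Fundamental.

(** * Convolution with the Yukawa kernel *)

Section Resolvent.
Context {R : realType}.
Local Notation vol3 := (@vol3 R).
Implicit Types (x y z : R3 R) (i : 'I_3) (f h psi phi : R3 R -> R).
Variables (kappa l : R).
Hypotheses (kappa_gt0 : 0 < kappa) (l_gt0 : 0 < l).

Lemma tame_cst0 : tame 1 (cst 0 : R3 R -> R).
Proof.
have p0 i : partial i (cst 0 : R3 R -> R) = cst 0.
  by apply/funext => x; apply: derive_cst.
split; [exact: cst_continuous|by move=> x; rewrite normr0|] => i.
rewrite !p0; split; try exact: cst_continuous.
- by move=> x; exact: derivable_cst.
- by move=> x; exact: derivable_cst.
- by move=> x; rewrite normr0.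
Qed.

(** The total mass is read off the fundamental solution identity with phi = 0 and c = 1. *)
Lemma integral_yukawa1 : (\int[vol3]_z yukawa kappa z = (kappa ^- 2)%:E)%E.
Proof.
have s0 : screened kappa (cst 0 : R3 R -> R) = cst 0.
  apply/funext => x; rewrite /screened laplacianE.
  have p0 i : partial i (cst 0 : R3 R -> R) = cst 0.
    by apply/funext => y; apply: derive_cst.
  by rewrite !p0 /= !addr0 oppr0 mulr0 addr0.
have sc (x : R3 R) : `|screened kappa (cst 0) x| <= 1 by rewrite s0 normr0.
transitivity (\int[vol3]_z (yukawa kappa z * (screened kappa (cst 0) z + 1)%:E))%E.
  by apply: eq_integral => z _; rewrite s0/= add0r mule1.
rewrite (fundamental_solution kappa_gt0 tame_cst0 sc); congr EFin.
by rewrite /= add0r mul1r.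
Qed.

(** Integrating the unperiodized kernel over all of R^3 against a periodic h is the convolution with
    the periodized kernel on the torus, so no lattice sum has to be written. *)
Definition resolve (h : R3 R -> R) (x : R3 R) : \bar R :=
  (\int[vol3]_z (yukawa kappa z * (h (x + z))%:E))%E.

Lemma measurable_add3 : measurable_fun setT (fun xz : R3 R * R3 R => xz.1 + xz.2 : R3 R).
Proof.
have m1 : measurable_fun setT (fun xz : R3 R * R3 R => xz.1) := measurable_fst.
have m2 : measurable_fun setT (fun xz : R3 R * R3 R => xz.2) := measurable_snd.
have mc1 i : measurable_fun setT (fun xz : R3 R * R3 R => coord xz.1 i : R).
  exact: (measurableT_comp (measurable_coord i) m1).
have mc2 i : measurable_fun setT (fun xz : R3 R * R3 R => coord xz.2 i : R).
  exact: (measurableT_comp (measurable_coord i) m2).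
have E : (fun xz : R3 R * R3 R => xz.1 + xz.2 : R3 R) = (fun xz =>
   ((coord xz.1 ord0 + coord xz.2 ord0,
     coord xz.1 (lift ord0 ord0) + coord xz.2 (lift ord0 ord0)),
     coord xz.1 ord_max + coord xz.2 ord_max)) by [].
rewrite E.
by do 2 (apply: measurable_fun_pair; last by apply: measurable_funD); apply: measurable_funD.
Qed.

(** The weight g is 1 for the measurability of [resolve] and a function cut off to the cell for the
    symmetry argument. *)
Definition resolve_integrand h (g : R3 R -> \bar R) (xz : R3 R * R3 R) : \bar R :=
  (g xz.1 * (yukawa kappa xz.2 * (h (xz.1 + xz.2))%:E))%E.

Lemma measurable_resolve_integrand h (g : R3 R -> \bar R) : measurable_fun setT h -> measurable_fun setT g ->
  measurable_fun setT (resolve_integrand h g).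
Proof.
move=> mh mg; apply: emeasurable_funM.
  by apply: measurableT_comp; [exact: mg|exact: measurable_fst].
apply: emeasurable_funM.
  by apply: measurableT_comp; [exact: measurable_yukawa|exact: measurable_snd].
apply/measurable_EFinP.
by apply: measurableT_comp; [exact: mh|exact: measurable_add3].
Qed.

Lemma resolve_ge0 h x : (forall x, 0 <= h x) -> (0 <= resolve h x)%E.
Proof.
move=> h0; apply: integral_ge0 => z _; apply: mule_ge0; first exact: yukawa_ge0.
by rewrite lee_fin.
Qed.

Lemma measurable_resolve h : measurable_fun setT h -> (forall x, 0 <= h x) ->
  measurable_fun setT (resolve h).
Proof.
move=> mh h0.
have mf := measurable_resolve_integrand mh (@measurable_cst _ _ _ _ setT 1%E).
have f0 xz : (0 <= resolve_integrand h (cst 1%E) xz)%E.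
  by rewrite /resolve_integrand mul1e mule_ge0 ?yukawa_ge0 ?lee_fin.
have := @measurable_fun_fubini_tonelli_F _ _ _ _ R vol3 _ mf f0.
apply: eq_measurable_fun => x _; rewrite /fubini_F /resolve.
by apply: eq_integral => z _; rewrite /resolve_integrand mul1e.
Qed.

Lemma measurable_shiftr h x : measurable_fun setT h -> measurable_fun setT (fun z : R3 R => h (x + z)).
Proof. by move=> mh; apply: measurableT_comp; [exact: mh|exact: measurable_shift3]. Qed.

Lemma measurable_shiftl h x : measurable_fun setT h -> measurable_fun setT (fun z : R3 R => h (z + x)).
Proof.
move=> mh; apply: (eq_measurable_fun (fun z => h (x + z))) (measurable_shiftr x mh) => z _.
by rewrite addrC.
Qed.

Lemma resolve_le h M x : measurable_fun setT h -> (forall x, 0 <= h x <= M) ->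
  (resolve h x <= (M * kappa ^- 2)%:E)%E.
Proof.
move=> mh hM; have M0 : 0 <= M by have /andP[a b] := hM 0; exact: le_trans b.
rewrite EFinM -integral_yukawa1 muleC.
rewrite -ge0_integralZr//; last 2 first.
- exact: measurable_yukawa.
- by move=> z _; exact: yukawa_ge0.
apply: ge0_le_integral => //.
- by move=> z _; rewrite mule_ge0 ?yukawa_ge0// lee_fin; have /andP[] := hM (x + z).
- apply: emeasurable_funM; first exact: measurable_yukawa.
  by apply/measurable_EFinP; exact: measurable_shiftr.
- by apply: emeasurable_funM => //; exact: measurable_yukawa.
- by move=> z _; rewrite lee_wpmul2l ?yukawa_ge0// lee_fin; have /andP[] := hM (x + z).
Qed.

Lemma resolve_fin h M x : measurable_fun setT h -> (forall x, 0 <= h x <= M) ->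
  resolve h x \is a fin_num.
Proof.
move=> mh hM; rewrite ge0_fin_numE; last by apply: resolve_ge0 => y; have /andP[] := hM y.
by rewrite (le_lt_trans (resolve_le x mh hM))// ltry.
Qed.

Lemma periodic_resolve h : periodic l h -> periodic l (resolve h).
Proof.
move=> ph i x; apply: eq_integral => z _.
by rewrite addrAC ph.
Qed.

(* Tonelli, a lattice translation in the outer variable, and the reflection
   [z |-> - z] of the even kernel. *)
Lemma resolve_sym h psi : measurable_fun setT h -> measurable_fun setT psi ->
  (forall x, 0 <= h x) -> (forall x, 0 <= psi x) -> periodic l h -> periodic l psi ->
  (\int[vol3]_(x in cell l) ((psi x)%:E * resolve h x) =
   \int[vol3]_(x in cell l) ((h x)%:E * resolve psi x))%E.
Proof.
move=> mh mpsi h0 psi0 ph ppsi.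
have mc := @measurable_cell R l.
have key (a b : R3 R -> R) : measurable_fun setT a -> measurable_fun setT b ->
    (forall x, 0 <= a x) -> (forall x, 0 <= b x) ->
    (\int[vol3]_(x in cell l) ((b x)%:E * resolve a x) =
     \int[vol3]_z (yukawa kappa z * \int[vol3]_(x in cell l) (b x * a (x + z))%:E))%E.
  move=> ma mb a0 b0.
  pose g x : \bar R := ((b x)%:E * (\1_(cell l : set (R3 R)) x)%:E)%E.
  have mg : measurable_fun setT g.
    apply: emeasurable_funM; first exact/measurable_EFinP.
    by apply/measurable_EFinP; exact: measurable_indic.
  have g0 x : (0 <= g x)%E by rewrite mule_ge0// lee_fin.
  have mf := measurable_resolve_integrand ma mg.
  have f0 xz : (0 <= resolve_integrand a g xz)%E.
    by rewrite /resolve_integrand mule_ge0// mule_ge0 ?yukawa_ge0 ?lee_fin.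
  have H := @fubini_tonelli _ _ _ _ R vol3 vol3 _ mf f0.
  have mz x : measurable_fun setT (fun z => yukawa kappa z * (a (x + z))%:E)%E.
    apply: emeasurable_funM; first exact: measurable_yukawa.
    by apply/measurable_EFinP; exact: measurable_shiftr.
  have z0 x z : (0 <= yukawa kappa z * (a (x + z))%:E)%E.
    by rewrite mule_ge0 ?yukawa_ge0 ?lee_fin.
  have Z x : (\int[vol3]_z (g x * (yukawa kappa z * (a (x + z))%:E)) = g x * resolve a x)%E.
    exact: (ge0_integralZl vol3 measurableT (mz x) (fun z _ => z0 x z) (g0 x)).
  transitivity (\int[vol3]_x \int[vol3]_z resolve_integrand a g (x, z))%E.
    rewrite integral_mkcond; apply: eq_integral => x _.
    transitivity (g x * resolve a x)%E; last by rewrite -Z.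
    rewrite /g patchE indicE; case: ifPn => xc; first by rewrite mule1.
    by rewrite mule0 mul0e.
  rewrite H; apply: eq_integral => z _; rewrite /resolve_integrand/=.
  have mab : measurable_fun setT (fun x : R3 R => b x * a (x + z)).
    exact: measurable_funM mb (measurable_shiftl z ma).
  have mabc : measurable_fun (cell l : set (R3 R)) (fun x : R3 R => (b x * a (x + z))%:E).
    by apply: measurable_funTS; exact/measurable_EFinP.
  have ab0 x : (cell l : set (R3 R)) x -> (0 <= (b x * a (x + z))%:E)%E.
    by move=> _; rewrite lee_fin mulr_ge0.
  rewrite -(ge0_integralZl vol3 mc mabc ab0 (yukawa_ge0 kappa z)).
  rewrite [RHS]integral_mkcond; apply: eq_integral => x _.
  rewrite /g patchE; case: ifPn => xc.
    by rewrite indicE xc mule1 muleCA EFinM.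
  by rewrite indicE (negbTE xc) mule0 mul0e.
rewrite (key h psi mh mpsi h0 psi0) (key psi h mpsi mh psi0 h0).
transitivity (\int[vol3]_z (yukawa kappa (- z)%R *
    \int[vol3]_(x in cell l) (h x * psi (x + - z)%R)%:E))%E.
  apply: eq_integral => z _; rewrite yukawaN; congr (_ * _)%E.
  pose F (x : R3 R) : \bar R := (h x * psi (x - (z : R3 R)))%:E.
  have mF : measurable_fun setT F.
    by apply/measurable_EFinP; exact: measurable_funM mh (measurable_shiftl (- (z : R3 R)) mpsi).
  have F0 x : (0 <= F x)%E by rewrite lee_fin mulr_ge0.
  have pF : periodic l F by move=> i x; rewrite /F ph addrAC ppsi.
  rewrite -[RHS](ge0_integral_cell_shift (z : R3 R) l_gt0 mF F0 pF).
  by apply: eq_integral => x _; rewrite /F (addrC z x) addrK mulrC.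
pose G z := (yukawa kappa z * \int[vol3]_(x in cell l) (h x * psi (x + z))%:E)%E.
have mG : measurable_fun setT G.
  apply: emeasurable_funM; first exact: measurable_yukawa.
  pose f (zx : R3 R * R3 R) := ((h zx.2 * psi (zx.2 + zx.1)) * \1_(cell l : set (R3 R)) zx.2)%:E.
  have mf : measurable_fun setT f.
    apply/measurable_EFinP; apply: measurable_funM; last first.
      by apply: measurableT_comp; [exact: measurable_indic|exact: measurable_snd].
    apply: measurable_funM; first by apply: measurableT_comp; [exact: mh|exact: measurable_snd].
    apply: measurableT_comp; first exact: mpsi.
    by apply: eq_measurable_fun measurable_add3 => zx _; rewrite addrC.
  have f0 zx : (0 <= f zx)%E by rewrite lee_fin !mulr_ge0.
  have := @measurable_fun_fubini_tonelli_F _ _ _ _ R vol3 _ mf f0.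
  apply: eq_measurable_fun => z _; rewrite /fubini_F /f/= [RHS]integral_mkcond.
  apply: eq_integral => x _; rewrite patchE indicE.
  by case: ifPn => _; rewrite ?mulr1 ?mulr0.
have G0 z : (0 <= G z)%E.
  apply: mule_ge0; first exact: yukawa_ge0.
  by apply: integral_ge0 => x _; rewrite lee_fin mulr_ge0.
have n1 : (-1 : R) != 0 by rewrite oppr_eq0 oner_neq0.
have := @ge0_integral_affine R 0 (-1) n1 setT G measurableT mG (fun x _ => G0 x).
rewrite preimage_setT normrN1 invr1 expr1n mul1e => <-.
by apply: eq_integral => z _; rewrite affine3E add0r scaleN1r.
Qed.

End Resolvent.

(** * Weak solutions of the screened Poisson equation *)

Section WeakSolution.
Context {R : realType}.
Local Notation vol3 := (@vol3 R).
Implicit Types (x y z : R3 R) (i : 'I_3) (f g h psi phi : R3 R -> R).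
Variables (kappa l : R).
Hypotheses (kappa_gt0 : 0 < kappa) (l_gt0 : 0 < l).

Local Notation "\cell f" := (\int[vol3]_(x in cell l) f x) (at level 36, f at level 36).

Definition lattice_floor (d : R) x : int * int * int :=
  (Num.floor (x.1.1 / d), Num.floor (x.1.2 / d), Num.floor (x.2 / d)).

Definition wrap (d : R) x : R3 R := x - node d (lattice_floor d x).

Lemma cell_wrap (d : R) x : 0 < d -> cell d (wrap d x).
Proof.
move=> d0.
have fl (t : R) : 0 <= t - d * (Num.floor (t / d))%:~R < d.
  have := floor_itv (t / d); rewrite ler_pdivlMr// ltr_pdivrMr// intrD => /andP[h1 h2].
  by apply/andP; split; nra.
by apply/cellP; elim/ord3_ind; rewrite coordE; exact: fl.
Qed.

Lemma periodic_node T (f : R3 R -> T) x (k : int * int * int) : periodic l f ->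
  f (x + node l k) = f x.
Proof.
move=> pf; rewrite (sum_unit_vec (node l k)) sum_ord3 !addrA.
by rewrite !periodic_int.
Qed.

Lemma periodic_wrap T (f : R3 R -> T) x : periodic l f -> f (wrap l x) = f x.
Proof.
by move=> pf; rewrite -(periodic_node (wrap l x) (lattice_floor l x) pf) subrK.
Qed.

Lemma periodic_bounded f : continuous f -> periodic l f -> exists M, forall x, `|f x| <= M.
Proof.
move=> cf pf.
pose K : set (R3 R) := `[0, l]%classic `*` `[0, l]%classic `*` `[0, l]%classic.
have cK : compact K.
  by apply: compact_setX; [apply: compact_setX|]; exact: segment_compact.
have : compact (f @` K).
  by apply: continuous_compact cK; exact: continuous_subspaceT.
move=> /compact_bounded[M [_ HM]].
exists (M + 1) => x; rewrite -(periodic_wrap x pf).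
apply: (HM (M + 1)); first by rewrite ltrDl.
exists (wrap l x) => //; have /cellP H := cell_wrap x l_gt0.
move: (H ord0) (H (lift ord0 ord0)) (H ord_max); rewrite !coordE => /andP[a1 a2] /andP[b1 b2] /andP[c1 c2].
by split; [split|] => /=; rewrite in_itv/= ?a1 ?b1 ?c1/= ltW.
Qed.

Lemma periodic_partial phi i : periodic l phi -> periodic l (partial i phi).
Proof.
move=> pphi j x.
have E : (fun z => phi (l *: unit_vec j + z)) = phi by apply/funext => z; rewrite addrC pphi.
have := f_equal (fun F => F x) (partial_shift phi (l *: unit_vec j) i).
by rewrite E => /= ->; rewrite addrC.
Qed.

Lemma smooth_tame phi : smooth phi -> periodic l phi -> exists M, tame M phi.
Proof.
move=> sphi pphi.
have [c0 H2] := sphi 2.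
have c1 i : continuous (partial i phi) by have [_ []] := H2 i.
have d1 i x : derivable phi x (unit_vec i) by have [+ _] := H2 i; apply.
have d2 i x : derivable (partial i phi) x (unit_vec i).
  by have [_ [_ /(_ i)[+ _]]] := H2 i; apply.
have c2 i : continuous (partial i (partial i phi)) by have [_ [_ /(_ i)[_ +]]] := H2 i.
have [M0 b0] := periodic_bounded c0 pphi.
have /choice[B1 b1] : forall i, exists M, forall x, `|partial i phi x| <= M.
  by move=> i; exact: (periodic_bounded (c1 i) (periodic_partial i pphi)).
have /choice[B2 b2] : forall i, exists M, forall x, `|partial i (partial i phi) x| <= M.
  by move=> i; exact: (periodic_bounded (c2 i) (periodic_partial i (periodic_partial i pphi))).
pose S (B : 'I_3 -> R) := B ord0 + B (lift ord0 ord0) + B ord_max.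
have le_S (B : 'I_3 -> R) i : (forall i, 0 <= B i) -> B i <= S B.
  move=> B0; have := B0 ord0; have := B0 (lift ord0 ord0); have := B0 ord_max.
  by rewrite /S; elim/ord3_ind: i; lra.
have B10 i : 0 <= B1 i := le_trans (normr_ge0 _) (b1 i 0).
have B20 i : 0 <= B2 i := le_trans (normr_ge0 _) (b2 i 0).
have M00 : 0 <= M0 := le_trans (normr_ge0 _) (b0 0).
have S10 : 0 <= S B1 by rewrite /S !addr_ge0.
have S20 : 0 <= S B2 by rewrite /S !addr_ge0.
exists (M0 + S B1 + S B2); split.
- exact: c0.
- by move=> x; rewrite (le_trans (b0 x))// -addrA lerDl addr_ge0.
- move=> i; split; [exact: d1|exact: d2|exact: c1|exact: c2|move=> x; split].
    apply: (le_trans (b1 i x)); apply: (le_trans (le_S _ i B10)).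
    by move: M00 S20; lra.
  apply: (le_trans (b2 i x)); apply: (le_trans (le_S _ i B20)).
  by move: M00 S10; lra.
Qed.

Lemma vol3_cell_lty : (vol3 (cell l) < +oo)%E.
Proof. by rewrite vol3_cell ?ltW// ltry. Qed.

Lemma integrable_cell f M : measurable_fun setT f -> (forall x, `|f x| <= M) ->
  vol3.-integrable (cell l) (EFin \o f).
Proof.
move=> mf fM; apply: measurable_bounded_integrable.
- exact: measurable_cell.
- exact: vol3_cell_lty.
- exact: measurable_funTS.
- exists M; split; first exact: num_real.
  by move=> r Mr x _; rewrite /= (le_trans (fM x))// ltW.
Qed.

(** For bounded nonnegative measurable h the extended value is finite ([resolve_fin]), so [fine]
    loses nothing there. *)
Definition rresolve h x : R := fine (resolve kappa h x).

Lemma rresolve_bound h M x : measurable_fun setT h -> (forall x, 0 <= h x <= M) ->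
  0 <= rresolve h x <= M * kappa ^- 2.
Proof.
move=> mh hM; have h0 y : 0 <= h y by have /andP[] := hM y.
rewrite -!lee_fin fineK; last exact: (resolve_fin kappa_gt0 x mh hM).
by rewrite resolve_ge0// resolve_le.
Qed.

Lemma measurable_rresolve h : measurable_fun setT h -> (forall x, 0 <= h x) ->
  measurable_fun setT (rresolve h).
Proof.
move=> mh h0; apply: measurableT_comp; first exact: fine_measurable.
exact: measurable_resolve.
Qed.

Opaque resolve rresolve.

Lemma periodic_rresolve h : periodic l h -> periodic l (rresolve h).
Proof. by move=> ph i x; exact: (congr1 fine (periodic_resolve kappa ph i x)). Qed.

Lemma rresolve_sym h psi A B : measurable_fun setT h -> measurable_fun setT psi ->
  (forall x, 0 <= h x <= A) -> (forall x, 0 <= psi x <= B) -> periodic l h -> periodic l psi ->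
  \cell (fun x => rresolve h x * psi x) = \cell (fun x => h x * rresolve psi x).
Proof.
move=> mh mpsi hA psiB ph ppsi.
have h0 y : 0 <= h y by have /andP[] := hA y.
have psi0 y : 0 <= psi y by have /andP[] := psiB y.
have H := resolve_sym kappa l_gt0 mh mpsi h0 psi0 ph ppsi.
Transparent rresolve.
rewrite /Rintegral; congr fine.
Opaque rresolve.
transitivity (\int[vol3]_(x in cell l) ((psi x)%:E * resolve kappa h x))%E.
  by apply: eq_integral => x _; rewrite mulrC EFinM (fineK (resolve_fin kappa_gt0 x mh hA)).
by rewrite H; apply: eq_integral => x _; rewrite EFinM (fineK (resolve_fin kappa_gt0 x mpsi psiB)).
Qed.

Lemma rresolve_cst c x : 0 <= c -> rresolve (cst c) x = c * kappa ^- 2.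
Proof.
move=> c0.
have k0 : (0 <= c%:E)%E by rewrite lee_fin.
have := ge0_integralZr vol3 measurableT (measurable_yukawa kappa)
  (fun z _ => yukawa_ge0 kappa z) k0.
rewrite (integral_yukawa1 kappa_gt0) -EFinM mulrC => H.
exact: (congr1 fine H).
Qed.

Lemma rresolve_screened phi M c x : tame M phi -> (forall x, `|screened kappa phi x| <= c) ->
  rresolve (fun y => screened kappa phi y + c) x = phi x + c * kappa ^- 2.
Proof.
move=> tphi sc.
have E : screened kappa (fun z => phi (x + z)) = (fun z => screened kappa phi (x + z)).
  by apply/funext => z; rewrite /screened laplacian_shift.
have := @fundamental_solution R kappa kappa_gt0 M c _ (tame_shift x tphi).
rewrite E => /(_ (fun z => sc (x + z))); rewrite addr0 => H.
exact: (congr1 fine H).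
Qed.

Lemma screened_bound phi M : 0 <= M -> tame M phi ->
  forall x, `|screened kappa phi x| <= 3 * M + kappa ^+ 2 * M.
Proof.
move=> M0 tphi x; have [_ b0 _] := tphi.
rewrite (le_trans (ler_normD _ _))// normrN lerD//; first exact: laplacian_le.
by rewrite normrM ger0_norm ?sqr_ge0// ler_wpM2l// sqr_ge0.
Qed.

Lemma periodic_laplacian phi : periodic l phi -> periodic l (laplacian phi).
Proof.
move=> pphi i x; rewrite !laplacianE.
have E j : partial j (partial j phi) (x + l *: unit_vec i) = partial j (partial j phi) x.
  by apply: periodic_partial; exact: periodic_partial.
by rewrite (E ord0) (E (lift ord0 ord0)) (E ord_max).
Qed.

(** By symmetry the convolution passes from h to screened phi + c, where the fundamental solution
    identity evaluates it as phi + c / kappa^2. The contributions of c on the two sides agree and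
    cancel. *)
Lemma weak_rresolve h A phi M : measurable_fun setT h -> (forall x, 0 <= h x <= A) ->
  periodic l h -> tame M phi -> periodic l phi ->
  \cell (fun x => rresolve h x * screened kappa phi x) = \cell (fun x => h x * phi x).
Proof.
move=> mh hA ph tphi pphi.
have [cphi bphi _] := tphi.
have h0 y : 0 <= h y by have /andP[] := hA y.
have hn y : `|h y| <= A by rewrite ger0_norm//; have /andP[] := hA y.
have M0 : 0 <= M := le_trans (normr_ge0 _) (bphi 0).
have mphi := continuous_measurable3 cphi.
have clap := continuous_laplacian tphi.
pose psi := screened kappa phi.
have mpsi : measurable_fun setT psi.
  apply: measurable_funD; last exact: measurable_funM.
  apply: measurable_funN; exact: continuous_measurable3 clap.
have sc := screened_bound M0 tphi.
set c := 3 * M + kappa ^+ 2 * M in sc.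
have c0 : 0 <= c := le_trans (normr_ge0 _) (sc 0).
have ppsi : periodic l psi by move=> i x; rewrite /psi /screened periodic_laplacian// pphi.
have pc : periodic l (fun x => psi x + c) by move=> i x; rewrite ppsi.
have mpc : measurable_fun setT (fun x => psi x + c) by apply: measurable_funD.
have bpc x : 0 <= psi x + c <= 2 * c.
  by have := sc x; rewrite ler_norml /psi => /andP[]; lra.
have mr := measurable_rresolve mh h0.
have br x : `|rresolve h x| <= A * kappa ^- 2.
  by have /andP[r0 r1] := rresolve_bound x mh hA; rewrite ger0_norm.
have mc := @measurable_cell R l.
have H1 := rresolve_sym mh mpc hA bpc ph pc.
have c01 x : 0 <= cst c x <= c by rewrite /= c0 lexx.
have H2 := rresolve_sym mh (@measurable_cst _ _ _ _ setT c) hA c01 ph (fun i x => erefl).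
have I1 : vol3.-integrable (cell l) (EFin \o (fun x => rresolve h x * psi x)).
  apply: (@integrable_cell _ (A * kappa ^- 2 * c)); first exact: measurable_funM.
  by move=> x; rewrite normrM ler_pM.
have I2 : vol3.-integrable (cell l) (EFin \o (fun x => rresolve h x * cst c x)).
  apply: (@integrable_cell _ (A * kappa ^- 2 * c)); first exact: measurable_funM.
  by move=> x; rewrite normrM ler_pM//= ger0_norm.
have I3 : vol3.-integrable (cell l) (EFin \o (fun x => h x * phi x)).
  apply: (@integrable_cell _ (A * M)); first exact: measurable_funM.
  by move=> x; rewrite normrM ler_pM.
have I4 : vol3.-integrable (cell l) (EFin \o (fun x => h x * (c * kappa ^- 2))).
  apply: (@integrable_cell _ (A * (c * kappa ^- 2))); first exact: measurable_funM.
  by move=> x; rewrite normrM ler_pM//= ger0_norm// mulr_ge0// invr_ge0 sqr_ge0.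
have E1 : \cell (fun x => rresolve h x * (psi x + c)) =
   \cell (fun x => rresolve h x * psi x) + \cell (fun x => rresolve h x * cst c x).
  by rewrite -(RintegralD mc I1 I2); apply: eq_Rintegral => x _; rewrite mulrDr.
have E2 : \cell (fun x => h x * rresolve (fun x => psi x + c) x) =
   \cell (fun x => h x * phi x) + \cell (fun x => h x * (c * kappa ^- 2)).
  rewrite -(RintegralD mc I3 I4); apply: eq_Rintegral => x _.
  by rewrite (rresolve_screened x tphi sc) mulrDr.
have E3 : \cell (fun x => h x * rresolve (cst c) x) = \cell (fun x => h x * (c * kappa ^- 2)).
  by apply: eq_Rintegral => x _; rewrite rresolve_cst.
by move: H1; rewrite E1 E2 H2 E3; exact: addIr.
Qed.

(** The form a h + b covers u - ubar = 2 chi - m, which changes sign, whereas [resolve] is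
    controlled for nonnegative h. *)
Lemma screened_poisson_rresolve h A (a b : R) : measurable_fun setT h ->
  (forall x, 0 <= h x <= A) -> periodic l h ->
  screened_poisson kappa l (fun x => a * h x + b) (fun x => a * rresolve h x + b * kappa ^- 2).
Proof.
move=> mh hA ph.
have h0 y : 0 <= h y by have /andP[] := hA y.
have hn y : `|h y| <= A by rewrite ger0_norm//; have /andP[] := hA y.
have mr := measurable_rresolve mh h0.
have br x : `|rresolve h x| <= A * kappa ^- 2.
  by have /andP[r0 r1] := rresolve_bound x mh hA; rewrite ger0_norm.
have mc := @measurable_cell R l.
have mv : measurable_fun setT (fun x => a * rresolve h x + b * kappa ^- 2).
  by apply: measurable_funD => //; exact: measurable_funM.
have bv x : `|a * rresolve h x + b * kappa ^- 2| <= `|a| * (A * kappa ^- 2) + `|b * kappa ^- 2|.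
  by rewrite (le_trans (ler_normD _ _))// lerD// normrM ler_wpM2l.
split.
  split => //.
    by move=> i x; rewrite periodic_rresolve.
  set B := `|a| * _ + _ in bv.
  apply: integrable_lty => //; apply: (@integrable_cell (fun x => _ ^+ 2) (B ^+ 2)).
    exact: measurable_funX.
  by move=> x; rewrite normrX; apply: lerXn2r; rewrite ?nnegrE// (le_trans _ (bv x)).
move=> phi sphi pphi.
have [M tphi] := smooth_tame sphi pphi.
have [cphi bphi _] := tphi.
have M0 : 0 <= M := le_trans (normr_ge0 _) (bphi 0).
have mphi := continuous_measurable3 cphi.
have clap := continuous_laplacian tphi.
pose psi := screened kappa phi.
have mpsi : measurable_fun setT psi.
  apply: measurable_funD; last exact: measurable_funM.
  apply: measurable_funN; exact: continuous_measurable3 clap.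
have sc := screened_bound M0 tphi.
set c := 3 * M + kappa ^+ 2 * M in sc.
have I1 : vol3.-integrable (cell l) (EFin \o (fun x => rresolve h x * psi x)).
  apply: (@integrable_cell _ (A * kappa ^- 2 * c)); first exact: measurable_funM.
  by move=> x; rewrite normrM ler_pM.
have I2 : vol3.-integrable (cell l) (EFin \o psi) by exact: integrable_cell mpsi sc.
have I3 : vol3.-integrable (cell l) (EFin \o (fun x => h x * phi x)).
  apply: (@integrable_cell _ (A * M)); first exact: measurable_funM.
  by move=> x; rewrite normrM ler_pM.
have I4 : vol3.-integrable (cell l) (EFin \o phi) by exact: integrable_cell mphi bphi.
have W1 := weak_rresolve mh hA ph tphi pphi.
(* The weak identity for the constant function 1 says that Laplacians of periodic functions have
   zero mean; this handles the summand b. *)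
have W2 : \cell psi = kappa ^+ 2 * \cell phi.
  have m1 := @measurable_cst _ _ (R3 R) R setT 1.
  have b1 x : 0 <= (cst 1 : R3 R -> R) x <= 1 by rewrite /= ler01 lexx.
  have := weak_rresolve m1 b1 (fun i x => erefl) tphi pphi.
  have -> : \cell (fun x => rresolve (cst 1) x * psi x) = kappa ^- 2 * \cell psi.
    rewrite -(RintegralZl _ mc I2); apply: eq_Rintegral => x _.
    by rewrite (rresolve_cst x ler01) mul1r.
  have -> : \cell (fun x => cst 1 x * phi x) = \cell phi.
    by apply: eq_Rintegral => x _; rewrite mul1r.
  by move=> <-; rewrite mulrA mulfV ?mul1r// expf_neq0// gt_eqF.
have Zi (r : R) f : vol3.-integrable (cell l) (EFin \o f) ->
    vol3.-integrable (cell l) (EFin \o (fun x => r * f x)).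
  by move=> If; have := integrableZl mc r If; congr (integrable _ _ _); apply/funext => x /=; rewrite -EFinM.
have L : \cell (fun x => (a * rresolve h x + b * kappa ^- 2) * psi x) =
  a * \cell (fun x => h x * phi x) + b * \cell phi.
  transitivity (\cell (fun x => a * (rresolve h x * psi x) + (b * kappa ^- 2) * psi x)).
    by apply: eq_Rintegral => x _; ring.
  rewrite (RintegralD mc (Zi _ _ I1) (Zi _ _ I2)) (RintegralZl _ mc I1) (RintegralZl _ mc I2).
  rewrite W1 W2; congr (_ + _); rewrite mulrA -(mulrA b) mulVf ?mulr1// expf_neq0// gt_eqF//.
have L2 : \cell (fun x => (a * h x + b) * phi x) = a * \cell (fun x => h x * phi x) + b * \cell phi.
  transitivity (\cell (fun x => a * (h x * phi x) + b * phi x)).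
    by apply: eq_Rintegral => x _; ring.
  by rewrite (RintegralD mc (Zi _ _ I3) (Zi _ _ I4)) (RintegralZl _ mc I3) (RintegralZl _ mc I4).
have J1 : vol3.-integrable (cell l) (EFin \o (fun x => (a * rresolve h x + b * kappa ^- 2) * psi x)).
  apply: (@integrable_cell _ ((`|a| * (A * kappa ^- 2) + `|b * kappa ^- 2|) * c)); first exact: measurable_funM.
  by move=> x; rewrite normrM ler_pM.
have J2 : vol3.-integrable (cell l) (EFin \o (fun x => (a * h x + b) * phi x)).
  apply: (@integrable_cell _ ((`|a| * A + `|b|) * M)).
    by apply: measurable_funM => //; apply: measurable_funD => //; exact: measurable_funM.
  by move=> x; rewrite normrM ler_pM// (le_trans (ler_normD _ _))// lerD// normrM ler_wpM2l.
have := congr1 EFin (etrans L (esym L2)).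
by rewrite /Rintegral !fineK//; exact: integrable_fin_num.
Qed.

End WeakSolution.

(** Bundles the measure of density f, so that uniqueness of measures can be applied to the positive
    and negative parts of a function. *)
Lemma exists_density d (T : measurableType d) (R : realType)
    (mu : {measure set T -> \bar R}) (f : T -> \bar R) :
  measurable_fun setT f -> (forall x, 0 <= f x)%E ->
  exists m : {measure set T -> \bar R}, forall A, m A = (\int[mu]_(x in A) f x)%E.
Proof.
move=> mf f0.
pose nu A := (\int[mu]_(x in A) f x)%E.
have nu0 : nu set0 = 0%E by rewrite /nu integral_set0.
have nu_ge0 A : (0 <= nu A)%E by exact: integral_ge0.
have sa : semi_sigma_additive nu := semi_sigma_additive_nng_induced mf f0.
pose m : {measure set T -> \bar R} := HB.pack nu (isMeasure.Build _ _ _ nu nu0 nu_ge0 sa).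
by exists m.
Qed.

(** * Octants as a generating pi-system *)

Section Octants.
Context {R : realType}.

(** Products of three open rays. They are stable under intersection, generate the sigma-algebra, and
    their indicators factor into one-variable functions that trigonometric polynomials can
    approximate on the cell. *)
Definition octant (a : R3 R) : set (R3 R) := [set x | forall i, coord a i < coord x i].

Definition octants : set (set (R3 R)) := [set B | exists a, B = octant a].

Lemma measurable_octant a : measurable (octant a).
Proof.
have -> : octant a = `]a.1.1, +oo[%classic `*` `]a.1.2, +oo[%classic `*` `]a.2, +oo[%classic.
  apply/seteqP; split => x.
    by move=> H; move: (H ord0) (H (lift ord0 ord0)) (H ord_max); rewrite !coordE/= !in_itv/= !andbT.
  by move=> [[/= h1 h2] h3] i; move: h1 h2 h3; rewrite !in_itv/= !andbT; elim/ord3_ind: i.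
by apply: measurableX; [apply: measurableX|]; exact: measurable_itv.
Qed.

Lemma measurable_octantsE : (@measurable _ (R3 R)) = <<s octants>>.
Proof.
apply/seteqP; split; last first.
  apply: smallest_sub; first exact: sigma_algebra_measurable.
  by move=> _ [a ->]; exact: measurable_octant.
pose T' := g_sigma_algebraType octants.
have mo (a : R3 R) : measurable (octant a : set T').
  by apply: sub_sigma_algebra; exists a.
have mc (i : 'I_3) : measurable_fun setT (fun x : T' => coord (x : R3 R) i : measurableTypeR R).
  apply: (measurability _ (RGenOInfty.measurableE R)) => //.
  move=> _ [_ [a ->] <-]; rewrite setTI.
  (* The corner has i-th coordinate a and all others - n, so the octants increase to the half-space
     where the i-th coordinate exceeds a. *)
  pose v n : R3 R := - (n%:R : R) *: (1, 1, 1) + (a + n%:R) *: unit_vec i.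
  have vi n : coord (v n) i = a.
    rewrite coordD coordZ coordZ coord_unit_vec eqxx mulr1.
    by rewrite (_ : coord (1, 1, 1) i = 1) ?mulr1 ?addrA ?(addrC _ a) ?addrNK ?addrK//; elim/ord3_ind: (i).
  have vj n j : j != i -> coord (v n) j = - n%:R.
    move=> /negPf ji; rewrite coordD coordZ coordZ coord_unit_vec ji mulr0 addr0.
    by rewrite (_ : coord (1, 1, 1) j = 1) ?mulr1//; elim/ord3_ind: (j).
  rewrite (_ : _ @^-1` _ = \bigcup_n octant (v n)).
    by apply: bigcupT_measurable => n; exact: mo.
  apply/seteqP; split => x /=.
    rewrite in_itv/= andbT => ax.
    pose N := maxn (Num.Def.truncn `|x.1.1|).+1 (maxn (Num.Def.truncn `|x.1.2|).+1 (Num.Def.truncn `|x.2|).+1).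
    have NE j : `|coord x j| < N%:R.
      have h (t : R) : ((Num.Def.truncn `|t|).+1 <= N)%N -> `|t| < N%:R.
        by move=> tN; apply: (lt_le_trans (truncnS_gt _)); rewrite ler_nat.
      elim/ord3_ind: j; rewrite coordE; apply: h; rewrite /N.
      - exact: leq_maxl.
      - exact: leq_trans (leq_maxl _ _) (leq_maxr _ _).
      - exact: leq_trans (leq_maxr _ _) (leq_maxr _ _).
    exists N => // j; have [->|ji] := eqVneq j i; first by rewrite vi.
    by rewrite vj//; have := NE j; rewrite ltr_norml => /andP[].
  by move=> [n _ /(_ i)]; rewrite vi in_itv/= andbT.
have mid : measurable_fun setT (fun x : T' => (x : R3 R)).
  have -> : (fun x : T' => (x : R3 R)) =
      (fun x : T' => (coord (x : R3 R) ord0, coord (x : R3 R) (lift ord0 ord0), coord (x : R3 R) ord_max)).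
    by apply/funext => -[[]].
  by apply: measurable_fun_pair; [apply: measurable_fun_pair|]; exact: mc.
move=> B mB; have := mid measurableT B mB; rewrite setTI preimage_id.
by [].
Qed.

Lemma octants_setI : setI_closed octants.
Proof.
move=> _ _ [a ->] [b ->].
exists (Num.max a.1.1 b.1.1, Num.max a.1.2 b.1.2, Num.max a.2 b.2).
apply/seteqP; split => x.
  move=> [ha hb]; move: (ha ord0) (ha (lift ord0 ord0)) (ha ord_max) (hb ord0) (hb (lift ord0 ord0)) (hb ord_max).
  by rewrite !coordE => *; elim/ord3_ind; rewrite !coordE/= gt_max; apply/andP; split.
move=> H; move: (H ord0) (H (lift ord0 ord0)) (H ord_max); rewrite !coordE/= !gt_max.
by move=> /andP[? ?] /andP[? ?] /andP[? ?]; split; elim/ord3_ind; rewrite !coordE.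
Qed.

Lemma octants_measure_unique (m1 m2 : {measure set (R3 R) -> \bar R}) :
  (forall a, m1 (octant a) = m2 (octant a)) -> (m1 setT < +oo)%E ->
  forall A, measurable A -> m1 A = m2 A.
Proof.
move=> H mT A mA.
pose g n : set (R3 R) := octant (- (n%:R : R) *: (1, 1, 1)).
apply: (measure_unique octants g) => //.
- exact: measurable_octantsE.
- exact: octants_setI.
- by move=> i; exists (- (i%:R : R) *: (1, 1, 1)).
- rewrite -subTset => x _.
  pose N := maxn (Num.Def.truncn `|x.1.1|).+1 (maxn (Num.Def.truncn `|x.1.2|).+1 (Num.Def.truncn `|x.2|).+1).
  exists N => // j; rewrite coordZ.
  have h (t : R) : ((Num.Def.truncn `|t|).+1 <= N)%N -> - N%:R < t.
    move=> tN; have : `|t| < N%:R by apply: (lt_le_trans (truncnS_gt _)); rewrite ler_nat.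
    by rewrite ltr_norml => /andP[].
  rewrite (_ : coord (1, 1, 1) j = 1) ?mulr1; last by elim/ord3_ind: (j).
  elim/ord3_ind: j; rewrite coordE; apply: h; rewrite /N.
  - exact: leq_maxl.
  - exact: leq_trans (leq_maxl _ _) (leq_maxr _ _).
  - exact: leq_trans (leq_maxr _ _) (leq_maxr _ _).
- by move=> _ [a ->].
- move=> k; apply: le_lt_trans mT; apply: le_measure; rewrite ?inE//.
  exact: measurable_octant.
Qed.

End Octants.

(** * Polynomials approximating a jump *)

Section Threshold.
Context {R : realType}.

Lemma bernoulli_ge (x : R) N : 0 <= x <= 1 -> 1 - N%:R * x <= (1 - x) ^+ N.
Proof.
move=> /andP[x0 x1]; elim: N => [|N IH]; first by rewrite mul0r subr0 expr0.
rewrite exprS -natr1.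
apply: (@le_trans _ _ ((1 - x) * (1 - N%:R * x))); last by rewrite ler_wpM2l// subr_ge0.
have : 0 <= N%:R * x * x by rewrite !mulr_ge0.
nra.
Qed.

Lemma bernoulli_le (x : R) N : 0 <= x <= 1 -> (1 - x) ^+ N * (1 + N%:R * x) <= 1.
Proof.
move=> /andP[x0 x1].
have h : 1 + N%:R * x <= (1 + x) ^+ N.
  elim: N => [|N IH]; first by rewrite mul0r addr0 expr0.
  rewrite exprS -natr1.
  apply: (@le_trans _ _ ((1 + x) * (1 + N%:R * x))); last by rewrite ler_wpM2l// addr_ge0.
  have : 0 <= N%:R * x * x by rewrite !mulr_ge0.
  nra.
apply: (@le_trans _ _ ((1 - x) ^+ N * (1 + x) ^+ N)).
  by rewrite ler_wpM2l// exprn_ge0// subr_ge0.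
rewrite -exprMn exprn_ile1//; first by rewrite mulr_ge0; lra.
nra.
Qed.

(** With r = s^2, Bernoulli's inequality bounds n s^n, and the remaining factor s^n tends to 0. *)
Lemma cvg_mulnX (r : R) : 0 <= r < 1 -> n%:R * r ^+ n @[n --> \oo] --> 0.
Proof.
move=> /andP[r0 r1].
have [->|rn0] := eqVneq r 0.
  rewrite (_ : (fun n => _) = cst 0); first exact: cvg_cst.
  by apply/funext => -[|n]; rewrite ?mul0r// expr0n mulr0.
pose s := Num.sqrt r.
have rp : 0 < r by rewrite lt_neqAle eq_sym rn0.
have sp : 0 < s by rewrite sqrtr_gt0.
have s1 : s < 1 by rewrite -sqrtr1 ltr_sqrt.
have rE : r = s * s by rewrite -expr2 sqr_sqrtr.
pose C := (s^-1 - 1)^-1.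
have d0 : 0 < s^-1 - 1 by rewrite subr_gt0 invf_gt1.
have bound n : n%:R * s ^+ n <= C.
  rewrite /C -[leRHS]mul1r ler_pdivlMr//.
  have : 1 + n%:R * (s^-1 - 1) <= s^-1 ^+ n.
    elim: n => [|n IH]; first by rewrite mul0r addr0 expr0.
    rewrite exprS -natr1.
    have {2}-> : s^-1 = 1 + (s^-1 - 1) by ring.
    apply: (@le_trans _ _ ((1 + (s^-1 - 1)) * (1 + n%:R * (s^-1 - 1)))).
      have : 0 <= n%:R * (s^-1 - 1) * (s^-1 - 1) by rewrite !mulr_ge0// ltW.
      nra.
    by rewrite ler_wpM2l//; lra.
  rewrite exprVn => h.
  have sn0 : 0 < s ^+ n by rewrite exprn_gt0.
  have : n%:R * (s^-1 - 1) <= (s ^+ n)^-1 by lra.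
  by rewrite -[(s ^+ n)^-1]mul1r ler_pdivlMr// => ?; rewrite mulrAC.
have cs : s ^+ n @[n --> \oo] --> 0 by apply: cvg_expr; rewrite gtr0_norm.
apply: (@squeeze_cvgr _ _ _ _ (cst 0) (fun n => C * s ^+ n)).
- apply: nearW => n; rewrite mulr_ge0 ?exprn_ge0//=.
  by rewrite {1}rE exprMn mulrA ler_wpM2r// exprn_ge0// ltW.
- exact: cvg_cst.
- by rewrite -[X in _ --> X](mulr0 C); apply: cvgMr.
Qed.

(** The polynomials of the Brosowski-Deutsch proof of the Stone-Weierstrass theorem. Bernoulli
    bounds them below by 1 - n (2t)^n and above by 1 / (1 + n (2t)^n): the power 2^n puts the jump
    at 1/2, and the extra factor n forces the limit 0 at t = 1/2 itself. *)
Definition threshold (n : nat) (t : R) : R := (1 - t ^+ n) ^+ (n * 2 ^ n).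

Lemma threshold01 n (t : R) : 0 <= t <= 1 -> 0 <= threshold n t <= 1.
Proof.
move=> /andP[t0 t1]; have tn0 : 0 <= t ^+ n by rewrite exprn_ge0.
have tn1 : t ^+ n <= 1 by rewrite exprn_ile1.
by rewrite /threshold exprn_ge0 ?exprn_ile1//; lra.
Qed.

Lemma cvg_threshold_lt (t : R) : 0 <= t < 1 / 2 -> threshold n t @[n --> \oo] --> (1 : R).
Proof.
move=> /andP[t0 t1].
have t01 n : 0 <= t ^+ n <= 1 by rewrite exprn_ge0// exprn_ile1//; lra.
apply: (@squeeze_cvgr _ _ _ _ (fun n => 1 - n%:R * (2 * t) ^+ n) (cst 1)).
- apply: nearW => n; apply/andP; split.
    have := bernoulli_ge (n * 2 ^ n) (t01 n).
    by rewrite natrM natrX -mulrA -exprMn.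
  by have /andP[] : 0 <= threshold n t <= 1 by apply: threshold01; lra.
- rewrite -[X in _ --> X](subr0 1); apply: cvgB; first exact: cvg_cst.
  by apply: cvg_mulnX; lra.
- exact: cvg_cst.
Qed.

Lemma cvg_threshold_ge (t : R) : 1 / 2 <= t <= 1 -> threshold n t @[n --> \oo] --> (0 : R).
Proof.
move=> /andP[t0 t1].
have t01 n : 0 <= t ^+ n <= 1 by rewrite exprn_ge0 ?exprn_ile1//; lra.
apply: (@squeeze_cvgr _ _ _ _ (cst 0) (@harmonic R)).
- apply: nearW => n; apply/andP; split.
    by have /andP[] : 0 <= threshold n t <= 1 by apply: threshold01; lra.
  rewrite /harmonic/= -[leRHS]mul1r ler_pdivlMr//.
  have := bernoulli_le (n * 2 ^ n) (t01 n); rewrite -/(threshold n t).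
  apply: le_trans; rewrite ler_wpM2l//.
    by have /andP[] : 0 <= threshold n t <= 1 by apply: threshold01; lra.
  rewrite -natr1 addrC lerD2l natrM natrX -mulrA -exprMn ler_peMr//.
  by rewrite exprn_ege1//; lra.
- exact: cvg_cst.
- exact: cvg_harmonic.
Qed.

End Threshold.

(** * Products of cosines *)

Section Waves.
Context {R : realType}.
Implicit Types (x y z : R3 R) (i j : 'I_3).

(** Arbitrary phases make the family stable under partial derivatives: differentiating a cosine
    advances its phase by a quarter turn, so sines never appear and smoothness is an immediate
    induction. *)
Definition wave (c : R) (om th : 'I_3 -> R) x : R :=
  c * (cos (om ord0 * x.1.1 + th ord0) *
       cos (om (lift ord0 ord0) * x.1.2 + th (lift ord0 ord0)) *
       cos (om ord_max * x.2 + th ord_max)).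

Definition quarter_turn (th : 'I_3 -> R) i j : R := if j == i then th j + pi / 2 else th j.

Lemma is_derive_cos_affine (a b t : R) :
  is_derive t 1 (fun t => cos (a * t + b)) (a * cos (a * t + (b + pi / 2))).
Proof.
apply: is_derive_eq; rewrite /GRing.scale/= addrA cosDpihalf.
ring.
Qed.

Lemma is_derive_wave c om th x i :
  is_derive x (unit_vec i) (wave c om th) (wave (c * om i) om (quarter_turn th i) x).
Proof.
apply: is_derive_line0.
pose F (a b t : R) := cos (a * t + b).
have D (a b t0 d : R) : d != 0 -> is_derive (0 : R) 1 (fun t : R => cos (a * (t0 + t * d) + b))
    (a * d * cos (a * t0 + (b + pi / 2))).
  move=> d0; have -> : (fun t : R => cos (a * (t0 + t * d) + b)) = (fun t => cos (a * d * t + (a * t0 + b))).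
    by apply/funext => t; congr cos; ring.
  have := is_derive_cos_affine (a * d) (a * t0 + b) 0.
  by rewrite mulr0 add0r addrA.
rewrite /wave.
have D1 k t0 : is_derive (0 : R) 1 (fun t : R => cos (om k * (t0 + t * 1) + th k))
    (om k * cos (om k * t0 + (th k + pi / 2))).
  by have := D (om k) (th k) t0 1 (oner_neq0 _); rewrite mulr1.
elim/ord3_ind: i => /=; rewrite /quarter_turn/=.
- have H := D1 ord0 x.1.1; rewrite /GRing.scale/=.
  have -> : (fun t : R => c * (cos (om ord0 * (x.1.1 + t * 1) + th ord0) *
       cos (om (lift ord0 ord0) * (x.1.2 + t * 0) + th (lift ord0 ord0)) *
       cos (om ord_max * (x.2 + t * 0) + th ord_max))) =
    (fun t : R => cos (om ord0 * (x.1.1 + t * 1) + th ord0) * (c *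
       (cos (om (lift ord0 ord0) * x.1.2 + th (lift ord0 ord0)) *
       cos (om ord_max * x.2 + th ord_max)))).
    by apply/funext => t; rewrite !mulr0 !addr0; ring.
  by apply: is_derive_eq; rewrite /GRing.scale/= ?mulr0 ?add0r ?addr0; ring.
- have H := D1 (lift ord0 ord0) x.1.2; rewrite /GRing.scale/=.
  have -> : (fun t : R => c * (cos (om ord0 * (x.1.1 + t * 0) + th ord0) *
       cos (om (lift ord0 ord0) * (x.1.2 + t * 1) + th (lift ord0 ord0)) *
       cos (om ord_max * (x.2 + t * 0) + th ord_max))) =
    (fun t : R => cos (om (lift ord0 ord0) * (x.1.2 + t * 1) + th (lift ord0 ord0)) * (c *
       (cos (om ord0 * x.1.1 + th ord0) *
       cos (om ord_max * x.2 + th ord_max)))).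
    by apply/funext => t; rewrite !mulr0 !addr0; ring.
  by apply: is_derive_eq; rewrite /GRing.scale/= ?mulr0 ?add0r ?addr0; ring.
- have H := D1 ord_max x.2; rewrite /GRing.scale/=.
  have -> : (fun t : R => c * (cos (om ord0 * (x.1.1 + t * 0) + th ord0) *
       cos (om (lift ord0 ord0) * (x.1.2 + t * 0) + th (lift ord0 ord0)) *
       cos (om ord_max * (x.2 + t * 1) + th ord_max))) =
    (fun t : R => cos (om ord_max * (x.2 + t * 1) + th ord_max) * (c *
       (cos (om ord0 * x.1.1 + th ord0) *
       cos (om (lift ord0 ord0) * x.1.2 + th (lift ord0 ord0))))).
    by apply/funext => t; rewrite !mulr0 !addr0; ring.
  by apply: is_derive_eq; rewrite /GRing.scale/= ?mulr0 ?add0r ?addr0; ring.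
Qed.

Transparent partial.
Lemma partial_wave c om th i :
  partial i (wave c om th) = wave (c * om i) om (quarter_turn th i).
Proof. by apply/funext => x; rewrite /partial; have [_ ->] := is_derive_wave c om th x i. Qed.
Opaque partial.

Lemma continuous_cos_coord (a b : R) i : continuous (fun x : R3 R => cos (a * coord x i + b)).
Proof.
move=> x; apply: (@continuous_comp _ _ _ (fun x : R3 R => a * coord x i + b) (@cos R)).
  by apply: cvgD; [apply: cvgMr; exact: continuous_coord|exact: cvg_cst].
exact: continuous_cos.
Qed.

Lemma continuous_wave c om th : continuous (wave c om th).
Proof.
move=> x; apply: cvgMr; apply: cvgM; first apply: cvgM.
- exact: (@continuous_cos_coord _ _ ord0).
- exact: (@continuous_cos_coord _ _ (lift ord0 ord0)).
- exact: (@continuous_cos_coord _ _ ord_max).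
Qed.

Lemma smooth_wave c om th : smooth (wave c om th).
Proof.
move=> k; elim: k c th => [|k IH] c th; first exact: continuous_wave.
split; first exact: continuous_wave.
move=> i; split; first by move=> x; have [] := is_derive_wave c om th x i.
by rewrite partial_wave; exact: IH.
Qed.

Lemma laplacian_wave c om th x :
  laplacian (wave c om th) x = - (\sum_(i < 3) om i ^+ 2) * wave c om th x.
Proof.
rewrite laplacianE sum_ord3 !partial_wave.
rewrite /wave /quarter_turn /= !addrA !cosDpihalf !sinDpihalf.
ring.
Qed.

Lemma periodic_wave (l c : R) om th (k : 'I_3 -> int) : l != 0 ->
  (forall i, om i = 2 * pi * (k i)%:~R / l) -> periodic l (wave c om th).
Proof.
move=> l0 omE i x.
have P (n : int) (t : R) : cos (t + 2 * pi * n%:~R) = cos t.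
  have N (m : nat) (s : R) : cos (s + 2 * pi * m%:R) = cos s.
    elim: m s => [|m IH] s; first by rewrite mulr0 addr0.
    rewrite -(natr1 m) mulrDr mulr1 addrA (_ : 2 * pi = pi *+ 2); last by rewrite mulr_natl.
    by rewrite cosD2pi -(mulr_natl pi 2) IH.
  case: n => n; first exact: N.
  by rewrite NegzE -[in RHS](subrK (2 * pi * n.+1%:R) t) N mulrNz mulrN.
have Q j (t d b : R) : d = 0 \/ d = 1 -> cos (om j * (t + l * d) + b) = cos (om j * t + b).
  move=> [->|->]; first by rewrite mulr0 addr0.
  rewrite -[RHS](P (k j)); congr cos; rewrite omE; field.
  exact: l0.
rewrite /wave; elim/ord3_ind: i => /=; rewrite /GRing.scale/= !Q//; by [left|right].
Qed.

End Waves.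

(** * Trigonometric polynomials on the circle *)

Section TrigPolynomials.
Context {R : realType}.
Variables (l : R).
Hypothesis l_gt0 : 0 < l.

(** Sums of single waves, given inductively: linear statements about them are inductions that reduce
    to one wave, and stability under products is the product-to-sum formula. *)
Inductive trigpoly : (R -> R) -> Prop :=
| trig_wave (c : R) (k : int) (th : R) :
    trigpoly (fun t => c * cos (2 * pi * k%:~R / l * t + th))
| trig_add f g : trigpoly f -> trigpoly g -> trigpoly (fun t => f t + g t).

Lemma trig_cst c : trigpoly (fun _ => c).
Proof.
have := trig_wave c 0 0; congr trigpoly; apply/funext => t.
by rewrite mulr0 mul0r mul0r addr0 cos0 mulr1.
Qed.

Lemma trig_mul f g : trigpoly f -> trigpoly g -> trigpoly (fun t => f t * g t).
Proof.
elim => [c k th|f1 f2 _ IH1 _ IH2] tg; last first.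
  have := trig_add (IH1 tg) (IH2 tg); congr trigpoly; apply/funext => t.
  ring.
elim: tg => [c' k' th'|g1 g2 _ IH1 _ IH2]; last first.
  have := trig_add IH1 IH2; congr trigpoly; apply/funext => t.
  ring.
have := trig_add (trig_wave (c * c' / 2) (k + k') (th + th'))
  (trig_wave (c * c' / 2) (k - k') (th - th')).
congr trigpoly; apply/funext => t.
set a := 2 * pi * k%:~R / l * t + th; set b := 2 * pi * k'%:~R / l * t + th'.
have -> : 2 * pi * (k + k')%:~R / l * t + (th + th') = a + b.
  by rewrite /a /b intrD; ring.
have -> : 2 * pi * (k - k')%:~R / l * t + (th - th') = a - b.
  by rewrite /a /b intrB; ring.
by rewrite cosD cosB; field.
Qed.

Lemma trig_exp f n : trigpoly f -> trigpoly (fun t => f t ^+ n).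
Proof.
move=> tf; elim: n => [|n IH].
  have := trig_cst 1; congr trigpoly; apply/funext => t; by rewrite expr0.
have := trig_mul tf IH; congr trigpoly; apply/funext => t; by rewrite exprS.
Qed.

Lemma trigpoly_continuous f : trigpoly f -> continuous f.
Proof.
elim => [c k th|f1 f2 _ IH1 _ IH2] t; last first.
  by apply: cvgD; [exact: IH1|exact: IH2].
apply: cvgMr; apply: (@continuous_comp _ _ _ (fun t => 2 * pi * k%:~R / l * t + th) (@cos R)).
  by apply: cvgD; [apply: cvgMr; exact: cvg_id|exact: cvg_cst].
exact: continuous_cos.
Qed.

Lemma trigpoly_bounded f : trigpoly f -> exists2 M, 0 <= M & forall t, `|f t| <= M.
Proof.
elim => [c k th|f1 f2 _ [M1 M10 h1] _ [M2 M20 h2]].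
  exists `|c| => // t; rewrite normrM -[leRHS]mulr1 ler_wpM2l//; exact: cos_max.
by exists (M1 + M2) => [|t]; [rewrite addr_ge0|rewrite (le_trans (ler_normD _ _))// lerD].
Qed.

(* The ray [(a, l)] is an arc of the circle [R / l Z], that is a superlevel set
   of a cosine. *)
Lemma cos_arc (a t : R) : 0 <= a < l -> 0 <= t < l ->
  (cos (pi * (l - a) / l) < cos (2 * pi / l * (t - (a + l) / 2))) = (a < t).
Proof.
move=> /andP[a0 al] /andP[t0 tl].
have p0 := pi_gt0 R.
(* Half the angular length of the arc from a to l, whose midpoint is (a + l) / 2. *)
pose al' := pi * (l - a) / l.
have al0 : 0 < al' by rewrite /al' divr_gt0// mulr_gt0// subr_gt0.
have alpi : al' <= pi.
  by rewrite /al' ler_pdivrMr// ler_pM2l// lerBlDr lerDl.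
have sE : 2 * pi / l * (t - (a + l) / 2) = 2 * pi / l * (t - a) - al'.
  by rewrite /al'; field; rewrite gt_eqF.
have al'E : al' = pi - pi / l * a by rewrite /al'; field; rewrite gt_eqF.
have pl0 : 0 < pi / l by rewrite divr_gt0.
have al'M : al' = pi / l * (l - a) by rewrite /al' mulrAC.
have inpi (u : R) : 0 <= u <= pi -> u \in `[0, pi] by rewrite in_itv.
rewrite -/al'; have [at_|ta] := ltP a t.
  have i1 : al' \in `[0, pi] by apply: inpi; rewrite alpi ltW.
  have i2 : `|2 * pi / l * (t - (a + l) / 2)| \in `[0, pi].
    apply: inpi; rewrite normr_ge0/= (le_trans _ alpi)// ler_norml sE.
    have h1 : 0 < pi / l * (t - a) by rewrite mulr_gt0// subr_gt0.
    have h2 : 2 * (pi / l * (t - a)) <= 2 * al'.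
      by rewrite al'M ler_pM2l// ler_pM2l// lerB// ltW.
    have -> : 2 * pi / l * (t - a) = 2 * (pi / l * (t - a)) by ring.
    by apply/andP; split; lra.
  rewrite -[cos (2 * pi / l * _)]cos_norm (ltr_cos i2 i1).
  rewrite ltr_norml sE.
  have h1 : 0 < pi / l * (t - a) by rewrite mulr_gt0// subr_gt0.
  have h2 : pi / l * (t - a) < al'.
    by rewrite al'M ltr_pM2l// ltrD2r.
  have -> : 2 * pi / l * (t - a) = 2 * (pi / l * (t - a)) by ring.
  by apply/andP; split; lra.
apply/negbTE; rewrite -leNgt.
have h1 : pi / l * (t - a) <= 0 by rewrite pmulr_rle0// subr_le0.
have h2 : - (pi / l * a) <= pi / l * (t - a) by rewrite mulrBr lerDr mulr_ge0// ltW.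
set s := 2 * pi / l * _.
have sE' : s = 2 * (pi / l * (t - a)) - al' by rewrite /s sE; ring.
(* Off the arc the angle - s lies between al' and 2 pi - al', where the cosine is at most cos al';
   past pi it is reflected to 2 pi + s. *)
have sl : al' <= - s by rewrite sE'; lra.
have su : - s <= 2 * pi - al' by rewrite sE'; lra.
rewrite -cosN.
have lec (x y : R) : 0 <= x -> x <= y -> y <= pi -> cos y <= cos x.
  move=> x0; rewrite le_eqVlt => /predU1P[->//|xy] ypi; apply: ltW.
  have ix : x \in `[0, pi] by apply: inpi; rewrite x0 (le_trans (ltW xy)).
  have iy : y \in `[0, pi] by apply: inpi; rewrite ypi (le_trans x0)// ltW.
  by rewrite (ltr_cos ix iy).
have [h|h] := leP (- s) pi; first exact: lec (ltW al0) sl h.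
have -> : cos (- s) = cos (2 * pi + s).
  by rewrite cosN (addrC _ s) (mulr_natl pi 2) cosD2pi.
by apply: lec; [exact: ltW|lra|lra].
Qed.

Lemma ray_approx (a : R) : exists u : nat -> R -> R,
  [/\ forall n, trigpoly (u n), forall n t, 0 <= u n t <= 1 &
      forall t, 0 <= t < l -> u n t @[n --> \oo] --> ((a < t)%R%:R : R)].
Proof.
have [a0|a0] := ltP a 0.
  exists (fun n _ => 1); split.
  - by move=> n; exact: trig_cst.
  - by move=> n t; rewrite ler01 lexx.
  - by move=> t /andP[t0 _]; rewrite (lt_le_trans a0 t0); exact: cvg_cst.
have [al|la] := ltP a l; last first.
  exists (fun n _ => 0); split.
  - by move=> n; exact: trig_cst.
  - by move=> n t; rewrite ler01 lexx.
  - move=> t /andP[_ tl]; rewrite ltNge (le_trans (ltW tl) la); exact: cvg_cst.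
pose s0 := cos (pi * (l - a) / l).
pose C t := cos (2 * pi / l * (t - (a + l) / 2)).
(* The factor 1/4 keeps T in [0, 1], since s0 and C t differ by at most 2, and T t < 1/2 holds
   exactly when s0 < C t: the jump of [threshold] falls on the end of the arc. *)
pose T t := 1 / 2 + (s0 - C t) / 4.
have C1 t : -1 <= C t <= 1 by rewrite cos_geN1 cos_le1.
have s1 : -1 <= s0 <= 1 by rewrite cos_geN1 cos_le1.
have T01 t : 0 <= T t <= 1.
  by move: (C1 t) s1; rewrite /T => /andP[? ?] /andP[? ?]; apply/andP; split; lra.
have trigT : trigpoly T.
  have := trig_add (trig_cst (1 / 2 + s0 / 4)) (trig_wave (- 1 / 4) 1 (- (2 * pi / l * ((a + l) / 2)))).
  congr trigpoly; apply/funext => t; rewrite /T /C mulr1.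
  by rewrite (mulrBr (2 * pi / l)); ring.
exists (fun n t => threshold n (T t)); split.
- move=> n; rewrite /threshold.
  apply: (@trig_exp (fun t => 1 - T t ^+ n)).
  have := trig_add (trig_cst 1) (trig_mul (trig_cst (-1)) (trig_exp n trigT)).
  by congr trigpoly; apply/funext => t; rewrite mulN1r.
- by move=> n t; exact: threshold01.
- move=> t tl; have a0l : 0 <= a < l by rewrite a0.
  have := cos_arc a0l tl; rewrite -/s0 -/(C t) => <-.
  have [h|h] := ltP s0 (C t).
    by apply: cvg_threshold_lt; move: (T01 t); rewrite /T => /andP[? ?]; apply/andP; split; lra.
  by apply: cvg_threshold_ge; move: (T01 t); rewrite /T => /andP[? ?]; apply/andP; split; lra.
Qed.

End TrigPolynomials.

(** * Uniqueness of the weak solution *)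

Section Uniqueness.
Context {R : realType}.
Local Notation vol3 := (@vol3 R).
Implicit Types (x y z : R3 R) (i : 'I_3).
Variables (kappa l : R).
Hypotheses (kappa_gt0 : 0 < kappa) (l_gt0 : 0 < l).
Variable w : R3 R -> R.
Hypothesis mw : measurable_fun setT w.
Hypothesis intw : vol3.-integrable (cell l) (EFin \o w).
Hypothesis w_weak : forall phi, smooth phi -> periodic l phi ->
  \int[vol3]_(x in cell l) (w x * screened kappa phi x) = 0.

Local Notation "\cell f" := (\int[vol3]_(x in cell l) f x) (at level 36, f at level 36).

Definition tensor3 (f1 f2 f3 : R -> R) x : R := f1 x.1.1 * f2 x.1.2 * f3 x.2.

Lemma integrable_wM (b : R3 R -> R) M : measurable_fun setT b -> (forall x, `|b x| <= M) ->
  vol3.-integrable (cell l) (EFin \o (fun x => w x * b x)).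
Proof.
move=> mb bM; apply: (@le_integrable _ _ _ _ _ _ _ (fun x => (M%:E * (w x)%:E)%E)).
- exact: measurable_cell.
- by apply/measurable_EFinP; apply: measurable_funTS; exact: measurable_funM.
- move=> x _; rewrite /= lee_fin !normrM mulrC ler_wpM2r//.
  by rewrite (le_trans (bM x))// ler_norm.
- by apply: integrableZl => //; exact: measurable_cell.
Qed.

Lemma measurable_tensor3 f1 f2 f3 : continuous f1 -> continuous f2 -> continuous f3 ->
  measurable_fun setT (tensor3 f1 f2 f3).
Proof.
move=> c1 c2 c3; apply: continuous_measurable3 => x.
apply: cvgM; first apply: cvgM.
- by apply: (@continuous_comp _ _ _ (fun x : R3 R => coord x ord0) f1); [exact: continuous_coord|exact: c1].
- by apply: (@continuous_comp _ _ _ (fun x : R3 R => coord x (lift ord0 ord0)) f2); [exact: continuous_coord|exact: c2].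
- by apply: (@continuous_comp _ _ _ (fun x : R3 R => coord x ord_max) f3); [exact: continuous_coord|exact: c3].
Qed.

Lemma integrable_w_tensor3 f1 f2 f3 : trigpoly l f1 -> trigpoly l f2 -> trigpoly l f3 ->
  vol3.-integrable (cell l) (EFin \o (fun x => w x * tensor3 f1 f2 f3 x)).
Proof.
move=> t1 t2 t3; have [M1 M10 b1] := trigpoly_bounded t1.
have [M2 M20 b2] := trigpoly_bounded t2; have [M3 M30 b3] := trigpoly_bounded t3.
apply: (@integrable_wM _ (M1 * M2 * M3)).
  by apply: measurable_tensor3; exact: (@trigpoly_continuous _ l).
by move=> x; rewrite /tensor3 !normrM ler_pM// ler_pM.
Qed.

(** Waves are eigenfunctions of the screened operator, and the screening makes the eigenvalue
    positive also at frequency zero, so the weak equation forces orthogonality. *)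
Lemma w_wave c th (k : 'I_3 -> int) :
  \cell (fun x => w x * wave c (fun i => 2 * pi * (k i)%:~R / l) th x) = 0.
Proof.
set om := (fun i => _).
pose L := \sum_(i < 3) om i ^+ 2 + kappa ^+ 2.
have L0 : 0 < L by rewrite ltr_wpDl ?exprn_gt0// sumr_ge0// => i _; rewrite sqr_ge0.
have ln0 : l != 0 by rewrite gt_eqF.
have pw := periodic_wave c th ln0 (fun i => erefl (om i)).
have [M tw] := smooth_tame l_gt0 (smooth_wave c om th) pw.
have [cw bw _] := tw.
have iw := integrable_wM (continuous_measurable3 cw) bw.
have := w_weak (smooth_wave c om th) pw.
have -> : \cell (fun x => w x * screened kappa (wave c om th) x) =
    L * \cell (fun x => w x * wave c om th x).
  rewrite -(RintegralZl _ (@measurable_cell R l) iw).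
  by apply: eq_Rintegral => x _; rewrite /screened laplacian_wave /L; ring.
by move=> /eqP; rewrite mulf_eq0 gt_eqF//= => /eqP.
Qed.

Lemma w_tensor3 f1 f2 f3 : trigpoly l f1 -> trigpoly l f2 -> trigpoly l f3 ->
  \cell (fun x => w x * tensor3 f1 f2 f3 x) = 0.
Proof.
have mc := @measurable_cell R l.
move=> t1 t2 t3.
elim: t1 => [c1 k1 th1|f g tf IHf tg IHg]; last first.
  rewrite -[RHS](addr0 0) -{1}IHf -IHg.
  rewrite -(RintegralD mc (integrable_w_tensor3 tf t2 t3) (integrable_w_tensor3 tg t2 t3)).
  by apply: eq_Rintegral => x _; rewrite /tensor3; ring.
have t1 := trig_wave l c1 k1 th1.
elim: t2 => [c2 k2 th2|f g tf IHf tg IHg]; last first.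
  rewrite -[RHS](addr0 0) -{1}IHf -IHg.
  rewrite -(RintegralD mc (integrable_w_tensor3 t1 tf t3) (integrable_w_tensor3 t1 tg t3)).
  by apply: eq_Rintegral => x _; rewrite /tensor3; ring.
have t2 := trig_wave l c2 k2 th2.
elim: t3 => [c3 k3 th3|f g tf IHf tg IHg]; last first.
  rewrite -[RHS](addr0 0) -{1}IHf -IHg.
  rewrite -(RintegralD mc (integrable_w_tensor3 t1 t2 tf) (integrable_w_tensor3 t1 t2 tg)).
  by apply: eq_Rintegral => x _; rewrite /tensor3; ring.
pose k (i : 'I_3) : int := if i == 0 :> nat then k1 else if i == 1%N :> nat then k2 else k3.
pose th (i : 'I_3) : R := if i == 0 :> nat then th1 else if i == 1%N :> nat then th2 else th3.
rewrite -[RHS](w_wave (c1 * c2 * c3) th k).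
by apply: eq_Rintegral => x _; rewrite /tensor3 /wave /k /th /=; ring.
Qed.

Lemma w_octant a : \cell (fun x => w x * \1_(octant a) x) = 0.
Proof.
have mc := @measurable_cell R l.
have [u1 [t1 b1 c1]] := ray_approx l_gt0 a.1.1.
have [u2 [t2 b2 c2]] := ray_approx l_gt0 a.1.2.
have [u3 [t3 b3 c3]] := ray_approx l_gt0 a.2.
have mo : measurable_fun setT (\1_(octant a) : R3 R -> R).
  by apply: measurable_indic; exact: measurable_octant.
have := @dominated_convergence _ _ R vol3 (cell l) mc
  (fun n x => (w x * tensor3 (u1 n) (u2 n) (u3 n) x)%:E)
  (fun x => (w x * \1_(octant a) x)%:E) (fun x => `|(w x)%:E|%E).
case.
- move=> n; have := integrable_w_tensor3 (t1 n) (t2 n) (t3 n).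
  exact: measurable_int.
- by apply/measurable_EFinP; apply: measurable_funTS; exact: measurable_funM.
- apply/aeW => x /cellP cx; apply: cvg_EFin; first by apply: nearW.
  apply: cvgMr.
  have -> : \1_(octant a) x = (a.1.1 < x.1.1)%R%:R * (a.1.2 < x.1.2)%R%:R * (a.2 < x.2)%R%:R :> R.
    rewrite -!natrM !mulnb indicE; congr (nat_of_bool _)%:R.
    apply/idP/idP.
      rewrite inE => H; move: (H ord0) (H (lift ord0 ord0)) (H ord_max); rewrite !coordE.
      by move=> -> -> ->.
    move=> /andP[/andP[h1 h2] h3]; rewrite inE.
    by apply: ord3_ind; rewrite !coordE.
  apply: cvgM; first apply: cvgM.
  - by apply: c1; have := cx ord0.
  - by apply: c2; have := cx (lift ord0 ord0).
  - by apply: c3; have := cx ord_max.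
- by have := integrable_norm intw.
- apply/aeW => x n _; rewrite /= lee_fin normrM ler_piMr// /tensor3 ger0_norm.
    have /andP[p1 q1] := b1 n x.1.1; have /andP[p2 q2] := b2 n x.1.2.
    have /andP[p3 q3] := b3 n x.2.
    by rewrite mulr_ile1 ?mulr_ge0// mulr_ile1.
  have /andP[p1 _] := b1 n x.1.1; have /andP[p2 _] := b2 n x.1.2.
  by have /andP[p3 _] := b3 n x.2; rewrite !mulr_ge0.
move=> iL _ H.
have : (\int[vol3]_(x in cell l) (w x * tensor3 (u1 n) (u2 n) (u3 n) x))
    @[n --> \oo] --> \cell (fun x => w x * \1_(octant a) x).
  apply: fine_cvg; rewrite /Rintegral fineK; first exact: H.
  exact: integrable_fin_num iL.
rewrite (_ : (fun n => _) = cst 0); last by apply/funext => n; exact: w_tensor3.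
move=> H0; have := cvg_unique (@norm_hausdorff _ _) H0 (cvg_cst 0).
by move=> ->.
Qed.

(** On the cell the positive and negative parts of w are densities of finite measures that agree on
    octants, hence on all measurable sets. *)
Lemma w_ae0 : ae_eq vol3 (cell l) (EFin \o w) (cst 0%E).
Proof.
have mc := @measurable_cell R l.
pose wc x := (w x * \1_(cell l : set (R3 R)) x)%:E.
have mwc : measurable_fun setT wc.
  by apply/measurable_EFinP; apply: measurable_funM => //; exact: measurable_indic.
have iwc : vol3.-integrable setT wc.
  have := (integrable_mkcond (EFin \o w) mc).1 intw.
  congr (integrable _ _ _); apply/funext => x.
  by rewrite patchE /wc indicE; case: ifPn => _; rewrite ?mulr1 ?mulr0.
have [mp mpE] := exists_density vol3 (measurable_funepos mwc) (fun x => funepos_ge0 wc x).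
have [mn mnE] := exists_density vol3 (measurable_funeneg mwc) (fun x => funeneg_ge0 wc x).
have iS B : measurable B -> vol3.-integrable B wc.
  by move=> mB; exact: (integrableS measurableT mB (@subsetT _ B) iwc).
have split_int B : measurable B -> (\int[vol3]_(x in B) wc x = mp B - mn B)%E.
  by move=> mB; rewrite mpE mnE [LHS]integralE.
have fp B : measurable B -> mp B \is a fin_num.
  by move=> mB; rewrite mpE; exact: integrable_pos_fin_num (iS B mB).
have fn B : measurable B -> mn B \is a fin_num.
  by move=> mB; rewrite mnE; exact: integrable_neg_fin_num (iS B mB).
have cellE B : measurable B -> (\int[vol3]_(x in B) wc x =
    \int[vol3]_(x in cell l) (w x * \1_B x)%:E)%E.
  move=> mB; rewrite integral_mkcond [RHS]integral_mkcond; apply: eq_integral => x _.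
  rewrite !patchE /wc !indicE; case: ifPn => xB; case: ifPn => xc; rewrite ?mulr1 ?mulr0//.
have eq_oct a : mp (octant a) = mn (octant a).
  have mo := @measurable_octant R a.
  have iw : vol3.-integrable (cell l) (EFin \o (fun x => w x * \1_(octant a) x)).
    apply: (@integrable_wM _ 1); first exact: measurable_indic.
    by move=> x; rewrite indicE; case: (_ \in _); rewrite ?normr1 ?normr0.
  have := w_octant a; rewrite /Rintegral => H.
  have : (\int[vol3]_(x in octant a) wc x = 0)%E.
    by rewrite cellE// -(fineK (integrable_fin_num mc iw)) H.
  rewrite split_int// -(fineK (fp _ mo)) -(fineK (fn _ mo)) -EFinB => -[/eqP].
  by rewrite subr_eq0 => /eqP ->.
have eqB B : measurable B -> mp B = mn B.
  apply: octants_measure_unique => //.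
  by have := fp _ measurableT; rewrite ge0_fin_numE.
apply: integral_ae_eq => // E Ec mE.
rewrite integral0.
transitivity (\int[vol3]_(x in E) wc x)%E.
  apply: eq_integral => x; rewrite inE => /Ec xc.
  by rewrite /wc indicE mem_set// mulr1.
by rewrite split_int// eqB// subee// fn.
Qed.

End Uniqueness.

(** * The energy as a functional of the positive phase *)

Section EnergyFormula.
Context {R : realType}.
Local Notation vol3 := (@vol3 R).
Implicit Types (x y z : R3 R) (i : 'I_3) (f u v chi : R3 R -> R).
Variables (kappa l : R).
Hypotheses (kappa_gt0 : 0 < kappa) (l_gt0 : 0 < l).

Local Notation "\cell f" := (\int[vol3]_(x in cell l) f x) (at level 36, f at level 36).

Lemma L2_torus_integrable v : L2_torus l v -> vol3.-integrable (cell l) (EFin \o v).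
Proof.
move=> [mv pv v2]; have mc := @measurable_cell R l.
have i2 : vol3.-integrable (cell l) (EFin \o (fun x => v x ^+ 2)).
  apply/integrableP; split.
    by apply/measurable_EFinP; apply: measurable_funTS; exact: measurable_funX.
  rewrite (eq_integral (fun x => (v x ^+ 2)%:E))// => x _.
  by rewrite /= ger0_norm// sqr_ge0.
have i1 : vol3.-integrable (cell l) (EFin \o cst 1).
  by apply: (@integrable_cell R l l_gt0 _ 1) => // x; rewrite normr1.
apply: (@le_integrable _ _ _ _ _ _ _ (EFin \o (fun x => 1 + v x ^+ 2))) => //.
- by apply/measurable_EFinP; exact: measurable_funTS.
- move=> x _; rewrite /= lee_fin [leRHS]ger0_norm ?addr_ge0 ?sqr_ge0//.
  by have := sqr_ge0 (`|v x| - 1); rewrite -[v x ^+ 2]real_normK ?num_real//; have := normr_ge0 (v x); nra.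
- exact: integrable_addr.
Qed.

Lemma screened_poisson_ae_unique f v v' :
  screened_poisson kappa l f v -> screened_poisson kappa l f v' ->
  ae_eq vol3 (cell l) (EFin \o v) (EFin \o v').
Proof.
move=> [L2v Hv] [L2v' Hv']; have mc := @measurable_cell R l.
have [mv pv _] := L2v; have [mv' pv' _] := L2v'.
have iv := L2_torus_integrable L2v; have iv' := L2_torus_integrable L2v'.
pose w x := v x - v' x.
have mw : measurable_fun setT w by exact: measurable_funB.
have iw : vol3.-integrable (cell l) (EFin \o w).
  by have := integrableB mc iv iv'; congr (integrable _ _ _); apply/funext => x /=; rewrite EFinB.
have weak phi : smooth phi -> periodic l phi -> \cell (fun x => w x * screened kappa phi x) = 0.
  move=> sphi pphi; have [M tphi] := smooth_tame l_gt0 sphi pphi.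
  have [cphi bphi _] := tphi.
  have M0 : 0 <= M := le_trans (normr_ge0 _) (bphi 0).
  have sc := screened_bound kappa M0 tphi.
  have ms : measurable_fun setT (screened kappa phi).
    apply: measurable_funD; last by apply: measurable_funM => //; exact: continuous_measurable3.
    apply: measurable_funN; exact: continuous_measurable3 (continuous_laplacian tphi).
  have I1 := integrable_wM mv iv ms sc.
  have I2 := integrable_wM mv' iv' ms sc.
  transitivity (\cell (fun x => v x * screened kappa phi x) - \cell (fun x => v' x * screened kappa phi x)).
    by rewrite -(RintegralB mc I1 I2); apply: eq_Rintegral => x _; rewrite /w; ring.
  apply/eqP; rewrite subr_eq0; apply/eqP; congr fine.
  by rewrite [LHS](Hv _ sphi pphi) [RHS](Hv' _ sphi pphi).
have [N [mN N0 H]] := w_ae0 kappa_gt0 l_gt0 mw iw weak.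
exists N; split => // x /= h; apply: H => /= h2; apply: h => cx.
have := h2 cx; rewrite /w => -[/eqP]; rewrite subr_eq0 => /eqP ->.
by [].
Qed.

Definition indicator_of u x : R := (1 + u x) / 2.

Definition phase_volume u : R := \cell (indicator_of u).

Definition self_energy u : R :=
  \cell (fun x => indicator_of u x * rresolve kappa (indicator_of u) x).

Lemma indicator_of01 u : (forall x, u x = -1 \/ u x = 1) ->
  forall x, indicator_of u x = 0 \/ indicator_of u x = 1.
Proof.
by move=> H x; rewrite /indicator_of; have [->|->] := H x; [left|right]; field.
Qed.

Lemma measurable_indicator_of u : measurable_fun setT u -> measurable_fun setT (indicator_of u).
Proof. by move=> mu; apply: measurable_funM => //; exact: measurable_funD. Qed.

(** With ubar = m - 1 the datum is 2 chi - m. The resolvent chosen by [get] is replaced almost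
    everywhere by the explicit convolution and the square is expanded; both cross terms equal the
    phase volume over kappa^2, since symmetry moves the convolution onto the constant 1. *)
Lemma nonlocal_energy u (m : R) : measurable_fun setT u -> periodic l u ->
  (forall x, u x = -1 \/ u x = 1) ->
  (\int[vol3]_(x in cell l) ((u x - (m - 1)) * resolvent kappa l (fun y => u y - (m - 1)) x)%:E =
  (4 * self_energy u - 4 * m * kappa ^- 2 * phase_volume u + m ^+ 2 * kappa ^- 2 * l ^+ 3)%:E)%E.
Proof.
move=> mu pu u1; have mc := @measurable_cell R l.
pose chi := indicator_of u.
have mchi : measurable_fun setT chi by exact: measurable_indicator_of.
have chi01 := indicator_of01 u1.
have chib x : 0 <= chi x <= 1.
  by rewrite /chi; have [->|->] := chi01 x; rewrite ?lexx ?ler01.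
have chi0 x : 0 <= chi x by have /andP[] := chib x.
have chin x : `|chi x| <= 1 by rewrite ger0_norm//; have /andP[] := chib x.
have pchi : periodic l chi by move=> i x; rewrite /chi /indicator_of pu.
have fE : (fun y => u y - (m - 1)) = (fun y => 2 * chi y + - m).
  by apply/funext => y; rewrite /chi /indicator_of; field.
have sol0 := screened_poisson_rresolve kappa_gt0 l_gt0 2 (- m) mchi chib pchi.
pose v0 x := 2 * rresolve kappa chi x + - m * kappa ^- 2.
rewrite fE /resolvent.
set P := [set v | _].
(* The explicit solution witnesses existence; without it [get] would return an arbitrary default. *)
have solv : P (get P) by apply: getPex; exists v0.
have := screened_poisson_ae_unique solv sol0.
set v := get P => vv0.
have [[mv pv _] _] := solv; have [[mv0 _ _] _] := sol0.
have mr := measurable_rresolve kappa mchi chi0.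
have br x : `|rresolve kappa chi x| <= kappa ^- 2.
  by have /andP[r0 r1] := rresolve_bound kappa_gt0 x mchi chib; rewrite ger0_norm// -[leRHS]mul1r.
transitivity (\int[vol3]_(x in cell l) ((2 * chi x + - m) * v0 x)%:E)%E.
  apply: ae_eq_integral => //.
  - apply/measurable_EFinP; apply: measurable_funTS; apply: measurable_funM => //.
    by apply: measurable_funD => //; exact: measurable_funM.
  - apply/measurable_EFinP; apply: measurable_funTS; apply: measurable_funM => //.
    by apply: measurable_funD => //; exact: measurable_funM.
  - have [N [mN N0 H]] := vv0; exists N; split => // x /= h; apply: H => /= h2; apply: h => cx.
    by have := h2 cx => -[->]; have := congr1 (fun f => f x) fE => /= ->.
have I1 : vol3.-integrable (cell l) (EFin \o (fun x => chi x * rresolve kappa chi x)).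
  apply: (@integrable_cell R l l_gt0 _ (1 * kappa ^- 2)); first exact: measurable_funM.
  by move=> x; rewrite normrM ler_pM.
have I2 : vol3.-integrable (cell l) (EFin \o chi) by exact: (integrable_cell l_gt0 mchi chin).
have I3 : vol3.-integrable (cell l) (EFin \o rresolve kappa chi) by exact: (integrable_cell l_gt0 mr br).
have I4 : vol3.-integrable (cell l) (EFin \o cst 1).
  by apply: (@integrable_cell R l l_gt0 _ 1) => // x; rewrite normr1.
have Zi (r : R) f : vol3.-integrable (cell l) (EFin \o f) ->
    vol3.-integrable (cell l) (EFin \o (fun x => r * f x)).
  by move=> If; have := integrableZl mc r If; congr (integrable _ _ _); apply/funext => x /=; rewrite -EFinM.
have E3 : \cell (rresolve kappa chi) = kappa ^- 2 * \cell chi.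
  have c1 x : 0 <= (cst 1 : R3 R -> R) x <= 1 by rewrite /= ler01 lexx.
  have := rresolve_sym kappa_gt0 l_gt0 mchi (@measurable_cst _ _ (R3 R) R setT 1) chib c1 pchi (fun i x => erefl).
  have -> : \cell (fun x => rresolve kappa chi x * cst 1 x) = \cell (rresolve kappa chi).
    by apply: eq_Rintegral => x _; rewrite mulr1.
  move=> ->; rewrite -(RintegralZl _ mc I2); apply: eq_Rintegral => x _.
  by rewrite (rresolve_cst kappa_gt0 x ler01) mul1r mulrC.
have E4 : \cell (cst 1) = l ^+ 3.
  by rewrite Rintegral_cst// mul1r; exact: (congr1 fine (vol3_cell (ltW l_gt0))).
pose G x := 4 * (chi x * rresolve kappa chi x) + (- 2 * m) * rresolve kappa chi x +
   (- 2 * m * kappa ^- 2) * chi x + (m ^+ 2 * kappa ^- 2) * cst 1 x.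
have J12 := integrable_addr mc (Zi 4 _ I1) (Zi (- 2 * m) _ I3).
have J123 := integrable_addr mc J12 (Zi (- 2 * m * kappa ^- 2) _ I2).
have J := integrable_addr mc J123 (Zi (m ^+ 2 * kappa ^- 2) _ I4).
have GE : \cell G = 4 * self_energy u - 4 * m * kappa ^- 2 * phase_volume u + m ^+ 2 * kappa ^- 2 * l ^+ 3.
  rewrite /G (RintegralD mc J123 (Zi _ _ I4)) (RintegralD mc J12 (Zi _ _ I2)).
  rewrite (RintegralD mc (Zi _ _ I1) (Zi _ _ I3)) (RintegralZl _ mc I1) (RintegralZl _ mc I2).
  rewrite (RintegralZl _ mc I3) (RintegralZl _ mc I4) E3 E4 /self_energy /phase_volume -/chi.
  ring.
rewrite -GE /Rintegral fineK; last exact: integrable_fin_num J.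
by apply: eq_integral => x _; congr EFin; rewrite /G /v0 /=; ring.
Qed.

Lemma energyE (sigma eps m : R) u : measurable_fun setT u -> periodic l u ->
  (forall x, u x = -1 \/ u x = 1) ->
  (energy sigma kappa l (m - 1) eps u = (eps * sigma / 2)%:E * TV_torus l u +
  (2 * self_energy u - 2 * m * kappa ^- 2 * phase_volume u + m ^+ 2 * kappa ^- 2 * l ^+ 3 / 2)%:E)%E.
Proof.
move=> mu pu u1; rewrite /energy nonlocal_energy// -EFinM; congr (_ + _%:E)%E.
by field; rewrite gt_eqF.
Qed.

End EnergyFormula.

(** * Comparison of the Yukawa and Newton kernels *)

Section KernelBounds.
Context {R : realType}.
Local Notation vol3 := (@vol3 R).
Local Notation leb := (@lebesgue_measure R).
Implicit Types (x y z : R3 R) (i : 'I_3) (f h om : R3 R -> R).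

Lemma ge0_integral_scale1 (s : R) (f : measurableTypeR R -> \bar R) : 0 < s ->
  measurable_fun setT f -> (forall t, 0 <= f t)%E ->
  (\int[leb]_t f (s * t)%R = s^-1%:E * \int[leb]_t f t)%E.
Proof.
move=> s0 mf f0; have k0 : 0 <= s^-1 by rewrite invr_ge0 ltW.
have m1 : measurable_fun setT (fun t : measurableTypeR R => s * t : measurableTypeR R).
  by apply: measurable_funM.
have := @ge0_integral_pushforward _ _ _ _ R _ m1 leb setT f measurableT mf (fun t _ => f0 t).
rewrite preimage_setT /= => <-.
rewrite -(@ge0_integral_mscale _ _ _ leb setT measurableT (NngNum k0) f mf)//.
apply: eq_measure_integral => B mB _.
have := lebesgue_measure_affine 0 (lt0r_neq0 s0) mB.
rewrite gtr0_norm// => H; transitivity (s^-1%:E * leb B)%E; last by [].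
by rewrite -H; congr (leb _); apply/seteqP; split => t; rewrite /= add0r.
Qed.

Lemma indic_gt0_scale (s v : R) : 0 < s ->
  \1_(`]0, +oo[%classic : set R) (s * v) = \1_(`]0, +oo[%classic : set R) v :> R.
Proof.
move=> s0; rewrite !indicE.
suff -> : (s * v \in (`]0, +oo[%classic : set R)) = (v \in (`]0, +oo[%classic : set R)) by [].
by apply/idP/idP; rewrite !inE/= !in_itv/= !andbT pmulr_rgt0.
Qed.

Definition e1 : R3 R := unit_vec ord0.

(** Substituting v by |z| v. The kernel at z becomes 1/|z| times its value at unit distance with
    screening kappa |z|, so being close to the Newton kernel at short distance is continuity of one
    number at zero screening. *)
Lemma yukawa_scale (kappa : R) z : 0 < sqn z ->
  yukawa kappa z = ((enorm z)^-1%:E * yukawa (kappa * enorm z) e1)%E.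
Proof.
move=> z0; have e0 : 0 < enorm z by rewrite sqrtr_gt0.
have eE : sqn z = enorm z ^+ 2 by rewrite sqr_sqrtr// ltW.
have md : measurable_fun setT (fun v => (yukawa_density (kappa * enorm z) e1 v)%:E).
  by apply/measurable_EFinP; exact: measurable_yukawa_density1.
have d0 v : (0 <= (yukawa_density (kappa * enorm z) e1 v)%:E)%E.
  by rewrite lee_fin yukawa_density_ge0.
rewrite /yukawa -(ge0_integral_scale1 e0 md d0).
apply: eq_integral => v _; congr EFin; rewrite /yukawa_density.
rewrite indic_gt0_scale//.
congr (_ * (_ * _ * expR (- _))).
  rewrite /damping; congr (expR (- _)); rewrite exprMn [in RHS]exprMn.
  have [->|v0] := eqVneq v 0; first by rewrite expr0n/= !mulr0 !invr0 !mulr0.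
  by field; rewrite v0 gt_eqF.
by rewrite sqn_unit_vec mulr1 eE exprMn; ring.
Qed.

Lemma yukawa0_e1 : yukawa 0 e1 = (1 / (4 * pi))%:E.
Proof.
pose f (t : R) := \1_(`]0, +oo[%classic : set R) t * expR (- t ^+ 2).
have s2 : 0 < (Num.sqrt 2)^-1 :> R by rewrite invr_gt0 sqrtr_gt0.
have mf : measurable_fun setT (fun t : measurableTypeR R => (f t)%:E).
  apply/measurable_EFinP; apply: measurable_funM.
    by apply: measurable_indic; exact: measurable_itv.
  exact: measurable_gauss_fun.
have f0 t : (0 <= (f t)%:E)%E by rewrite lee_fin mulr_ge0 ?expR_ge0.
have If : (\int[leb]_t (f t)%:E = (Num.sqrt pi / 2)%:E)%E.
  rewrite -integral0y_gauss -integral_itv_obnd_cbnd; last first.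
    by apply/measurable_EFinP; apply: measurable_funTS; exact: measurable_gauss_fun.
  rewrite [RHS]integral_mkcond; apply: eq_integral => t _.
  by rewrite patchE /f indicE; case: ifPn => _; rewrite ?mul1r ?mul0r.
have := ge0_integral_scale1 s2 mf f0; rewrite If invrK => H.
transitivity (gnorm%:E * \int[leb]_t (f ((Num.sqrt 2)^-1 * t))%:E)%E.
  have mg : measurable_fun setT (fun t : measurableTypeR R => (f ((Num.sqrt 2)^-1 * t))%:E).
    by apply: (measurableT_comp mf); apply: measurable_funM.
  rewrite -(ge0_integralZl leb measurableT mg (fun t _ => f0 _)); last first.
    by rewrite lee_fin ltW// gnorm_gt0.
  apply: eq_integral => t _; rewrite -EFinM; congr EFin; rewrite /yukawa_density /f.
  rewrite indic_gt0_scale//.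
  rewrite /damping expr0n/= mul0r oppr0 expR0 mulr1 sqn_unit_vec mulr1.
  rewrite exprMn exprVn sqr_sqrtr// mulrCA; congr (_ * (_ * expR (- _))).
  by rewrite mulrC.
rewrite H -!EFinM; congr EFin.
rewrite /gnorm sqrtrM//.
have p0 : 0 < Num.sqrt pi :> R by rewrite sqrtr_gt0 pi_gt0.
have q0 : 0 < Num.sqrt 2 :> R by rewrite sqrtr_gt0.
have pE : pi = Num.sqrt pi ^+ 2 :> R by rewrite sqr_sqrtr// pi_ge0.
have qE : 4 = 2 * Num.sqrt 2 ^+ 2 :> R by rewrite sqr_sqrtr//; ring.
move: p0 q0 pE qE; set p := Num.sqrt pi; set q := Num.sqrt 2.
by move=> p0 q0 pE qE; rewrite pE qE; field; rewrite !gt_eqF.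
Qed.

Lemma damping_antitone (k k' v : R) : 0 <= k <= k' -> damping k' v <= damping k v.
Proof.
move=> /andP[k0 kk]; rewrite ler_expR lerN2 ler_wpM2r//.
  by rewrite invr_ge0 mulr_ge0// sqr_ge0.
by apply: lerXn2r; rewrite ?nnegrE// (le_trans k0).
Qed.

Lemma yukawa_antitone (k k' : R) z : 0 <= k <= k' -> (yukawa k' z <= yukawa k z)%E.
Proof.
move=> kk; apply: ge0_le_integral => //.
- by move=> v _; rewrite lee_fin yukawa_density_ge0.
- by apply/measurable_EFinP; exact: measurable_yukawa_density1.
- by apply/measurable_EFinP; exact: measurable_yukawa_density1.
- move=> v _; rewrite lee_fin ler_wpM2l// ler_wpM2r ?expR_ge0//.
  by rewrite ler_wpM2l ?damping_antitone// ltW// gnorm_gt0.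
Qed.

Lemma yukawa_le_newton (kappa : R) z : 0 <= kappa -> 0 < sqn z ->
  (yukawa kappa z <= (1 / (4 * pi) / enorm z)%:E)%E.
Proof.
move=> k0 z0; have e0 : 0 < enorm z by rewrite sqrtr_gt0.
rewrite yukawa_scale// [(_ / enorm z)%:E]EFinM [X in (_ <= X)%E]muleC lee_pmul2l ?lte_fin ?invr_gt0// -yukawa0_e1.
by apply: yukawa_antitone; rewrite lexx mulr_ge0// ltW.
Qed.

Lemma cvg_yukawa0 : yukawa n.+1%:R^-1 e1 @[n --> \oo] --> yukawa (0 : R) e1.
Proof.
pose g n v := (yukawa_density (n.+1%:R^-1 : R) e1 v)%:E.
have nd v m n : (m <= n)%N -> (g m v <= g n v)%E.
  move=> mn; rewrite lee_fin ler_wpM2l// ler_wpM2r ?expR_ge0//.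
  rewrite ler_wpM2l ?(ltW gnorm_gt0)// damping_antitone//.
  by rewrite invr_ge0 ler0n/= lef_pV2 ?posrE// ler_nat.
have := @cvg_monotone_convergence _ _ R leb setT measurableT g.
have E v : limn (g ^~ v) = (yukawa_density 0 e1 v)%:E.
  apply/cvg_lim => //; apply: cvg_EFin; first by apply: nearW.
  apply: cvgMr; apply: cvgMl; apply: cvgMr.
  apply: (@cvg_comp _ _ _ (fun n : nat => - ((n.+1%:R^-1 : R) ^+ 2 / (2 * v ^+ 2))) (@expR R) _
     (nbhs (- (0 ^+ 2 / (2 * v ^+ 2)) : R))); last exact: continuous_expR.
  apply: cvgN; apply: cvgMl.
  have h : (n.+1%:R^-1 : R) @[n --> \oo] --> (0 : R) by exact: cvg_harmonic.
  by rewrite expr2; under eq_fun do rewrite expr2; apply: cvgM.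
move=> H; have {}H : ((\int[leb]_v g n v)%E @[n --> \oo] --> (\int[leb]_v limn (g ^~ v))%E).
  apply: H.
  - by move=> n; apply/measurable_EFinP; exact: measurable_yukawa_density1.
  - by move=> n v _; rewrite /g lee_fin yukawa_density_ge0.
  - by move=> v _ m n mn; exact: nd mn.
have -> : yukawa 0 e1 = (\int[leb]_v limn (g ^~ v))%E.
  by apply: eq_integral => v _; rewrite E.
exact: H.
Qed.

(** At unit distance the value tends to 1 / (4 pi) as the screening decreases to 0, by monotone
    convergence. The radius d makes kappa |z| at most 1 / (N+1), a screening at which the factor
    theta is reached. *)
Lemma yukawa_ge_newton (kappa theta : R) : 0 < kappa -> theta < 1 ->
  exists2 d : R, 0 < d & forall z, 0 < sqn z <= d ^+ 2 ->
    ((theta / (4 * pi) / enorm z)%:E <= yukawa kappa z)%E.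
Proof.
move=> k0 t1.
have ltK : ((theta / (4 * pi))%:E < yukawa (0 : R) e1)%E.
  by rewrite yukawa0_e1 lte_fin ltr_pM2r// invr_gt0 mulr_gt0// pi_gt0.
have : \forall n \near \oo, ((theta / (4 * pi))%:E < yukawa (n.+1%:R^-1 : R) e1)%E.
  by have := cvg_yukawa0 (open_ereal_gt' ltK).
move=> [N _ HN]; exists (N.+1%:R^-1 / kappa); first by rewrite divr_gt0// invr_gt0.
move=> z /andP[z0 zd]; have e0 : 0 < enorm z by rewrite sqrtr_gt0.
rewrite yukawa_scale// [(_ / enorm z)%:E]EFinM [X in (X <= _)%E]muleC lee_pmul2l ?lte_fin ?invr_gt0//.
apply: (le_trans (ltW (HN N (leqnn N)))); apply: yukawa_antitone.
rewrite (_ : 0 <= kappa * enorm z) ?andTb; last by apply: mulr_ge0; exact: ltW.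
have : enorm z <= N.+1%:R^-1 / kappa.
  have D0 : 0 <= N.+1%:R^-1 / kappa by apply: divr_ge0 => //; exact: ltW.
  by rewrite -(ger0_norm D0) -sqrtr_sqr; exact: ler_wsqrtr.
by rewrite ler_pdivlMr// mulrC.
Qed.

End KernelBounds.

(** * A periodic cutoff in one variable *)

Section Bump.
Context {R : realType}.
Local Notation leb := (@lebesgue_measure R).

Lemma is_derive_mul_abs (u : R) : is_derive u 1 (fun t : R => t * `|t|) (2 * `|u|).
Proof.
have [u0|u0|u0] := ltrgtP 0 u.
- apply: (@near_eq_is_derive _ _ _ (fun t : R => t * t)); last first.
    by apply: is_derive_eq; rewrite /GRing.scale/= gtr0_norm//; ring.
  near=> t; rewrite gtr0_norm//; near: t; exact: lt_nbhsr.
- apply: (@near_eq_is_derive _ _ _ (fun t : R => t * - t)); last first.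
    by apply: is_derive_eq; rewrite /GRing.scale/= ltr0_norm//; ring.
  near=> t; rewrite ltr0_norm//; near: t; exact: lt_nbhsl.
- rewrite -u0 normr0 mulr0.
  have H : (fun h : R => h^-1 *: (((fun t : R => t * `|t|) \o shift 0) (h *: (1 : R)) - (0 : R) * `|0 : R|))
      @ 0^' --> (0 : R).
    have A : (fun h : R => `|h|) @ 0^' --> (0 : R).
      have := @norm_continuous _ R (0 : R); rewrite /continuous_at normr0.
      exact: cvg_within_filter.
    apply/(cvg_trans _ A)/near_eq_cvg; near=> h.
    have h0 : h != 0 by near: h; exact: nbhs_dnbhs_neq.
    by rewrite /= mul0r subr0 addr0 /GRing.scale/= mulr1 mulKf.
  apply: DeriveDef; first by apply/cvg_ex; exists 0.
  exact/cvg_lim.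
Unshelve. all: by end_near. Qed.

Lemma is_derive1_continuous (f : R -> R) (u df : R) : is_derive u 1 f df -> {for u, continuous f}.
Proof. by move=> [df' _]; apply: differentiable_continuous; apply/derivable1_diffP. Qed.

(** This is max(u, 0)^2, written with u |u| so that differentiability at the kink comes from
    [is_derive_mul_abs]. *)
Definition pos_sq (u : R) : R := (u ^+ 2 + u * `|u|) / 2.

Lemma pos_sq_ge0 u : 0 <= pos_sq u.
Proof.
rewrite /pos_sq; have [u0|u0] := ger0P u.
  by rewrite divr_ge0// addr_ge0// ?sqr_ge0// mulr_ge0.
by rewrite expr2 mulrN subrr mul0r.
Qed.

Lemma is_derive_pos_sq (u : R) : is_derive u 1 pos_sq (u + `|u|).
Proof.
have -> : pos_sq = (fun t : R => 2^-1 *: (t * t + t * `|t|)).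
  by apply/funext => t; rewrite /pos_sq expr2 mulrC.
have H := is_derive_mul_abs u.
by apply: is_derive_eq; rewrite /GRing.scale/=; field.
Qed.

(** With q = max(s - 1, 0)^2 this is q / (1 + q): a C1 nondecreasing step, zero up to s = 1 and
    tending to 1. Order C1 matches the class of test fields. *)
Definition step (s : R) : R := pos_sq (s - 1) / (1 + pos_sq (s - 1)).
Definition dstep (s : R) : R := (s - 1 + `|s - 1|) / (1 + pos_sq (s - 1)) ^+ 2.

Let den_gt0 s : 0 < 1 + pos_sq (s - 1).
Proof. by rewrite ltr_wpDr// pos_sq_ge0. Qed.

Lemma step01 s : 0 <= step s <= 1.
Proof.
have q0 := pos_sq_ge0 (s - 1); have d0 := den_gt0 s.
apply/andP; split; first by rewrite divr_ge0// ltW.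
by rewrite ler_pdivrMr// mul1r lerDr.
Qed.

Lemma step0 s : s <= 1 -> step s = 0.
Proof.
by move=> s1; rewrite /step /pos_sq ler0_norm ?subr_le0// expr2 mulrN subrr !mul0r.
Qed.

Lemma step_ge s : 0 < s -> 1 - step s <= 2 / s.
Proof.
move=> s0; have [s1|s1] := leP s 1.
  by rewrite step0// subr0 ler_pdivlMr// mul1r; lra.
have -> : 1 - step s = (1 + pos_sq (s - 1))^-1.
  by rewrite /step; field; rewrite gt_eqF.
rewrite -[leRHS]invrK lef_pV2 ?posrE// ?invr_gt0 ?divr_gt0//.
rewrite invf_div ler_pdivrMr// /pos_sq gtr0_norm ?subr_gt0//.
(* The claim s / 2 <= 1 + (s - 1)^2 follows by completing the square, whose centre is 5/4. *)
by have := sqr_ge0 (s - 5 / 4); lra.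
Qed.

Lemma dstep_ge0 s : 0 <= dstep s.
Proof.
rewrite divr_ge0 ?sqr_ge0//.
by have := ler_norm (- (s - 1)); rewrite normrN; lra.
Qed.

Lemma is_derive_step (s : R) : is_derive s 1 step (dstep s).
Proof.
pose f (t : R) : R := 1 - (1 + pos_sq (t - 1))^-1.
have -> : step = f.
  by apply/funext => t; rewrite /step /f; field; rewrite gt_eqF.
have H1 : is_derive s 1 (fun t : R => t - 1) 1.
  by apply: is_derive_eq; rewrite subr0.
have H2 : is_derive s 1 (fun t : R => pos_sq (t - 1)) (s - 1 + `|s - 1|).
  have := @is_derive1_comp _ pos_sq (fun t : R => t - 1) s _ _ (is_derive_pos_sq (s - 1)) H1.
  by rewrite mulr1.
have H3 : is_derive s 1 (fun t : R => 1 + pos_sq (t - 1)) (s - 1 + `|s - 1|).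
  apply: is_derive_eq (is_deriveD (is_derive_cst (1 : R) s 1) H2) _.
  by rewrite add0r.
have H4 := @is_deriveV _ (fun t : R => 1 + pos_sq (t - 1)) s _ 1 (lt0r_neq0 (den_gt0 s)) H3.
have H5 : is_derive s 1 f (0 - (- (1 + pos_sq (s - 1)) ^- 2 *: (s - 1 + `|s - 1|))).
  exact: is_deriveB.
by apply: is_derive_eq; rewrite sub0r scaleNr opprK /GRing.scale/= mulrC.
Qed.

Lemma continuous_pos_sq : continuous pos_sq.
Proof. by move=> u; exact: is_derive1_continuous (is_derive_pos_sq u). Qed.

Lemma continuous_dstep : continuous dstep.
Proof.
move=> s; apply: cvgM.
  apply: cvgD; first by apply: cvgB; [exact: cvg_id|exact: cvg_cst].
  by apply: (@cvg_norm _ _ _ _ _ (fun t : R => t - 1)); apply: cvgB; [exact: cvg_id|exact: cvg_cst].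
apply: cvgV; first by rewrite expf_neq0// gt_eqF.
have c : 1 + pos_sq (t - 1) @[t --> s] --> 1 + pos_sq (s - 1).
  apply: cvgD; first exact: cvg_cst.
  apply: (@continuous_comp _ _ _ (fun t : R => t - 1) pos_sq s); last exact: continuous_pos_sq.
  by apply: cvgB; [exact: cvg_id|exact: cvg_cst].
by rewrite expr2; apply/(cvg_trans _ (cvgM c c))/near_eq_cvg; near=> t; rewrite expr2.
Unshelve. all: by end_near. Qed.

Variables (d : R) (j : nat).
Hypothesis d0 : 0 < d.

Definition phase (t : R) : R := 2 * pi / d * t.
(** Periodic of period d, zero near the multiples of d because the argument of [step] is below 1
    there, and tending to 1 elsewhere as j grows. It rises and falls once per period, so its
    variation over a period is at most 2 whatever j: steeper cutoffs cost no more. *)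
Definition bump (t : R) : R := step (j%:R * (1 - cos (phase t))).
Definition dbump (t : R) : R :=
  dstep (j%:R * (1 - cos (phase t))) * (j%:R * (2 * pi / d * sin (phase t))).

Lemma bump01 t : 0 <= bump t <= 1. Proof. exact: step01. Qed.

Lemma is_derive_bump (t : R) : is_derive t 1 bump (dbump t).
Proof.
have H1 : is_derive t 1 phase (2 * pi / d).
  have -> : phase = (fun s : R => (2 * pi / d) *: s) by [].
  by apply: is_derive_eq; rewrite /GRing.scale/= mulr1.
have H2 : is_derive t 1 (fun s => cos (phase s)) (- sin (phase t) * (2 * pi / d)).
  exact: (@is_derive1_comp _ (@cos R) phase t).
have H3 : is_derive t 1 (fun s => j%:R *: (1 - cos (phase s)) : R)
    (j%:R * (2 * pi / d * sin (phase t))).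
  have := is_deriveZ j%:R (is_deriveB (is_derive_cst (1 : R) t 1) H2).
  by rewrite /GRing.scale/= sub0r mulNr opprK [sin _ * _]mulrC.
exact: (@is_derive1_comp _ step (fun s => j%:R *: (1 - cos (phase s)) : R) t _ _ (is_derive_step _) H3).
Qed.

Lemma continuous_phase : continuous phase.
Proof. by move=> t; apply: cvgMr; exact: cvg_id. Qed.

Lemma continuous_bump : continuous bump.
Proof. by move=> u; exact: is_derive1_continuous (is_derive_bump u). Qed.

Let continuous_arg : continuous (fun t => j%:R * (1 - cos (phase t))).
Proof.
move=> t; apply: cvgMr; apply: cvgB; first exact: cvg_cst.
by apply: (@continuous_comp _ _ _ phase (@cos R)); [exact: continuous_phase|exact: continuous_cos].
Qed.

Lemma continuous_dbump : continuous dbump.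
Proof.
move=> t; apply: cvgM.
  apply: (@continuous_comp _ _ _ (fun t => j%:R * (1 - cos (phase t))) dstep).
    exact: continuous_arg.
  exact: continuous_dstep.
apply: cvgMr; apply: cvgMr.
by apply: (@continuous_comp _ _ _ phase (@sin R)); [exact: continuous_phase|exact: continuous_sin].
Qed.

Lemma cos_phase_periodic t (k : int) : cos (phase (t + d * k%:~R)) = cos (phase t).
Proof.
have -> : phase (t + d * k%:~R) = phase t + k%:~R * (2 * pi).
  by rewrite /phase; field; rewrite gt_eqF.
have P (m : nat) a : cos (a + m%:R * (2 * pi)) = cos a :> R.
  by rewrite mulr_natl -(periodicn (@cosD2pi R) m a) [2 * pi]mulr_natl.
case: k => k; first exact: P.
by rewrite NegzE mulrNz mulNr -[X in _ = cos X](subrK ((k.+1)%:R * (2 * pi))) P.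
Qed.

Lemma bump_periodic t (k : int) : bump (t + d * k%:~R) = bump t.
Proof. by rewrite /bump cos_phase_periodic. Qed.

Lemma bump_vanish (k : int) : \forall t \near (d * k%:~R), bump t = 0.
Proof.
have c1 : j%:R * (1 - cos (phase (d * k%:~R))) < 1.
  have := cos_phase_periodic 0 k; rewrite add0r => ->.
  by rewrite /phase mulr0 cos0 subrr mulr0.
have H : \forall t \near (d * k%:~R), j%:R * (1 - cos (phase t)) < 1.
  by move: (@continuous_arg (d * k%:~R)) => /cvgr_lt; apply.
by near=> t; apply/step0/ltW; near: t.
Unshelve. all: by end_near. Qed.

(** On a monotone piece, made increasing by the sign e, the integral of the absolute derivative is
    an increment of a function with values in [0, 1]. *)
Lemma integral_abs_dbump_mono a b (e : R) : a < b -> `|e| = 1 ->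
  {in `[a, b], forall t, 0 <= e * dbump t} ->
  (\int[leb]_(t in `[a, b]) `|dbump t|%:E <= 1)%E.
Proof.
move=> ab e1 pos.
rewrite (_ : (\int[leb]_(t in `[a, b]) `|dbump t|%:E = \int[leb]_(t in `[a, b]) (e * dbump t)%:E)%E); last first.
  apply: eq_integral => t; rewrite inE => /= tab; congr EFin.
  by rewrite -[RHS](ger0_norm (pos t tab)) (normrM e (dbump t)) e1 mul1r.
have D (t : R) : is_derive t 1 (fun s => e *: bump s : R) (e * dbump t).
  by have := is_derive_bump t => ?; exact: is_deriveZ.
have C : continuous (fun s => e *: bump s : R).
  by move=> u; exact: is_derive1_continuous (D u).
rewrite (@continuous_FTC2 _ _ (fun s => e *: bump s : R))//.
- rewrite -EFinB lee_fin /GRing.scale/= -mulrBr (le_trans (ler_norm _))// (normrM e) e1 mul1r.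
  have := bump01 a; have := bump01 b; rewrite ler_norml; lra.
- by apply: continuous_subspaceT => t; apply: cvgMr; exact: continuous_dbump.
- split; first by move=> t _; have [] := D t.
    exact: cvg_at_right_filter (C a).
  exact: cvg_at_left_filter (C b).
- by move=> t _; rewrite derive1E (@derive_val _ _ _ _ _ _ _ (D t)).
Qed.

Lemma integral_abs_dbump :
  (\int[leb]_(t in `[0%R, d[) `|dbump t|%:E <= 2%:E)%E.
Proof.
have md (A : set R) : measurable A -> measurable_fun A (fun t => `|dbump t|%:E).
  move=> mA; apply/measurable_EFinP; apply: measurable_funTS.
  apply: measurableT_comp => //; exact: continuous_measurable_fun continuous_dbump.
have p0 := pi_gt0 R.
have phaseE t : phase t = 2 * (t / d) * pi by rewrite /phase; ring.
have sin_neg t : `[d / 2, d]%classic t -> sin (phase t) <= 0.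
  rewrite /= in_itv/= => /andP[t1 t2].
  have q1 : 1 / 2 <= t / d by rewrite ler_pdivlMr//; lra.
  have q2 : t / d <= 1 by rewrite ler_pdivrMr// mul1r.
  rewrite -(subrK pi (phase t)) sinDpi oppr_le0 sin_ge0_pi// phaseE.
  by move: (t / d) q1 q2 => q q1 q2; apply/andP; split; nra.
have sin_pos t : `[0, d / 2]%classic t -> 0 <= sin (phase t).
  rewrite /= in_itv/= => /andP[t1 t2].
  have q1 : 0 <= t / d by rewrite ler_pdivlMr// mul0r.
  have q2 : t / d <= 1 / 2 by rewrite ler_pdivrMr//; lra.
  rewrite sin_ge0_pi// phaseE.
  by move: (t / d) q1 q2 => q q1 q2; apply/andP; split; nra.
have pd : 0 <= 2 * pi / d by apply: divr_ge0; [rewrite mulr_ge0// pi_ge0|exact: ltW].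
apply: (@le_trans _ _ (\int[leb]_(t in `[0%R, (d / 2)%R[ `|` `[(d / 2)%R, d]) `|dbump t|%:E)%E).
  apply: ge0_subset_integral => //.
  - by apply: measurableU; exact: measurable_itv.
  - by apply: md; apply: measurableU; exact: measurable_itv.
  - move=> t; rewrite /= !in_itv/= => /andP[t0 td].
    by have [h|h] := ltP t (d / 2); [left|right]; rewrite ?t0 ?h//= (ltW td).
rewrite ge0_integral_setU//; last 2 first.
- by apply: md; apply: measurableU; exact: measurable_itv.
- rewrite disj_set2E; apply/eqP/seteqP; split => // t [] /=; rewrite !in_itv/= => /andP[_ h1] /andP[h2 _].
  by move: (lt_le_trans h1 h2); rewrite ltxx.
rewrite (_ : 2%:E = 1 + 1)%E//; apply: leeD.
  apply: (@le_trans _ _ (\int[leb]_(t in `[0%R, (d / 2)%R]) `|dbump t|%:E)%E).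
    apply: ge0_subset_integral => //; first by apply: md.
    by move=> t; rewrite /= !in_itv/= => /andP[-> /ltW].
  apply: (@integral_abs_dbump_mono _ _ 1); rewrite ?normr1 ?divr_gt0// => t td.
  rewrite mul1r; apply: mulr_ge0; first exact: dstep_ge0.
  by apply: mulr_ge0 => //; apply: mulr_ge0 => //; exact: sin_pos.
apply: (@integral_abs_dbump_mono _ _ (-1)); rewrite ?normrN1//.
  by move: d0; lra.
move=> t td; rewrite mulN1r /dbump -!mulrN; apply: mulr_ge0; first exact: dstep_ge0.
by apply: mulr_ge0 => //; apply: mulr_ge0 => //; rewrite oppr_ge0; exact: sin_neg.
Qed.

Lemma bump_ge t : cos (phase t) < 1 -> (0 < j)%N ->
  1 - bump t <= 2 / (j%:R * (1 - cos (phase t))).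
Proof. by move=> c1 j0; rewrite step_ge// mulr_gt0 ?subr_gt0// ltr0n. Qed.

Lemma cos_phase_lt1 t : 0 < t < d -> cos (phase t) < 1.
Proof.
move=> /andP[t0 td]; have p0 := pi_gt0 R.
have -> : phase t = pi * (t / d) + pi * (t / d) by rewrite /phase; ring.
have q1 : 0 < t / d by rewrite divr_gt0.
have q2 : t / d < 1 by rewrite ltr_pdivrMr// mul1r.
rewrite cosD -!expr2.
have s0 : 0 < sin (pi * (t / d)).
  by apply: sin_gt0_pi; move: (t / d) q1 q2 => q q1 q2; apply/andP; split; nra.
have := cos2Dsin2 (pi * (t / d)); nra.
Qed.
End Bump.

(** * C1 functions and gluing along a grid *)

Section C1Calculus.
Context {R : realType}.
Local Notation vol3 := (@vol3 R).
Local Notation leb := (@lebesgue_measure R).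
Implicit Types (x y z : R3 R) (i : 'I_3) (f g eta : R3 R -> R).

Lemma Ck1I f (df : 'I_3 -> R3 R -> R) : continuous f ->
  (forall i x, is_derive x (unit_vec i) f (df i x)) -> (forall i, continuous (df i)) ->
  Ck 1 f /\ forall i x, partial i f x = df i x.
Proof.
move=> cf Df cdf.
have E i : partial i f = df i.
  by apply/funext => x; have [_ H] := Df i x; rewrite /partial H.
split; last by move=> i x; rewrite E.
split=> // i; split; first by move=> x; have [] := Df i x.
by rewrite /= E; exact: cdf.
Qed.

Lemma Ck1_continuous f : Ck 1 f -> continuous f. Proof. by case. Qed.

Lemma Ck1_derive f i x : Ck 1 f -> is_derive x (unit_vec i) f (partial i f x).
Proof. by move=> [_ /(_ i)[df _]]; exact: DeriveDef. Qed.

Lemma Ck1_partial f i : Ck 1 f -> continuous (partial i f).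
Proof. by move=> [_ /(_ i)[_ +]]. Qed.

Lemma Ck1M f g : Ck 1 f -> Ck 1 g -> Ck 1 (fun x => f x * g x) /\
  forall i x, partial i (fun x => f x * g x) x = partial i f x * g x + f x * partial i g x.
Proof.
move=> Cf Cg; have cf := Ck1_continuous Cf; have cg := Ck1_continuous Cg.
apply: Ck1I.
- by move=> x; apply: cvgM; [exact: cf|exact: cg].
- move=> i x; have Df := Ck1_derive i x Cf; have Dg := Ck1_derive i x Cg.
  have := is_deriveM Df Dg.
  by rewrite /GRing.scale/= addrC [g x * _]mulrC.
- move=> i; have pf := @Ck1_partial _ i Cf; have pg := @Ck1_partial _ i Cg.
  move=> x; apply: cvgD; apply: cvgM; [exact: pf|exact: cg|exact: cf|exact: pg].
Qed.

Lemma Ck1_cst (c : R) : Ck 1 (fun _ : R3 R => c) /\ forall i x, partial i (fun _ : R3 R => c) x = 0.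
Proof.
apply: (@Ck1I _ (fun _ _ => 0)); first by move=> x; exact: cvg_cst.
by move=> i x; exact: cvg_cst.
Qed.

Lemma Ck1_affine f (a : R3 R) (s : R) : Ck 1 f -> Ck 1 (fun x => f (a + s *: x)) /\
  forall i x, partial i (fun x => f (a + s *: x)) x = s * partial i f (a + s *: x).
Proof.
move=> Cf.
have ca : continuous (fun x : R3 R => a + s *: x).
  by move=> x; apply: cvgD; [exact: cvg_cst|exact: scaler_continuous].
apply: Ck1I.
- move=> x; apply: (@continuous_comp _ _ _ (fun x : R3 R => a + s *: x) f); first exact: ca.
  exact: Ck1_continuous.
- move=> i x; apply: is_derive_line0.
  have D := Ck1_derive i (a + s *: x) Cf.
  have H : is_derive (0 * s) 1 (fun t : R => f (a + s *: x + t *: unit_vec i)) (partial i f (a + s *: x)).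
    by rewrite mul0r; apply: is_derive_line; rewrite scale0r addr0 //; case: D.
  have M : is_derive (0 : R) 1 (fun t : R => t * s) s.
    have := is_derive1_continuous.
    have -> : (fun t : R => t * s) = (fun t : R => s *: t) by apply/funext => t; rewrite mulrC.
    have := is_deriveZ s (is_derive_id (0 : R) 1).
    by rewrite /GRing.scale/= mulr1.
  have := @is_derive1_comp _ (fun t : R => f (a + s *: x + t *: unit_vec i)) (fun t : R => t * s) 0 _ _ H M.
  rewrite mulrC; congr (is_derive _ _ _ _); apply/funext => t /=.
  by rewrite scalerDr addrA scalerA mulrC.
- move=> i x; apply: cvgMr.
  apply: (@continuous_comp _ _ _ (fun x : R3 R => a + s *: x) (partial i f)); first exact: ca.
  exact: Ck1_partial.
Qed.

Lemma Ck1_coord (b db : R -> R) (k : 'I_3) : (forall t : R, is_derive t 1 b (db t)) ->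
  continuous db -> Ck 1 (fun x => b (coord x k)) /\
  forall i x, partial i (fun x => b (coord x k)) x = (k == i)%:R * db (coord x k).
Proof.
move=> Db cdb.
have cb : continuous b by move=> t; exact: is_derive1_continuous (Db t).
apply: Ck1I.
- move=> x; apply: (@continuous_comp _ _ _ (fun x => coord x k) b); last exact: cb.
  exact: continuous_coord.
- move=> i x; apply: is_derive_line0.
  have M : is_derive (0 : R) 1 (fun t : R => coord x k + (k == i)%:R *: t : R) (k == i)%:R.
    have := is_deriveD (is_derive_cst (coord x k) (0 : R) 1) (is_deriveZ (k == i)%:R (is_derive_id (0 : R) 1)).
    by rewrite /GRing.scale/= mulr1 add0r.
  have Db' : is_derive (coord x k + (k == i)%:R *: (0 : R)) 1 b (db (coord x k)).
    by rewrite scaler0 addr0.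
  have := @is_derive1_comp _ b (fun t : R => coord x k + (k == i)%:R *: t : R) 0 _ _ Db' M.
  rewrite mulrC; congr (is_derive _ _ _ _); apply/funext => t /=.
  by rewrite coordD coordZ coord_unit_vec mulrC.
- move=> i x; apply: cvgMr.
  apply: (@continuous_comp _ _ _ (fun x => coord x k) db); last exact: cdb.
  exact: continuous_coord.
Qed.

Lemma near_eq_continuous f g x : (\near x, f x = g x) -> continuous_at x g -> continuous_at x f.
Proof.
move=> fg cg; have fgx := nbhs_singleton fg.
rewrite /continuous_at /prop_for/= fgx.
apply/(cvg_trans _ cg)/near_eq_cvg. by near=> y; apply/esym; near: y.
Unshelve. all: by end_near.
Qed.

(** The choice of [F] jumps across the faces of the grid, but near each point either eta vanishes or
    the lattice index is constant. In both cases the glued function agrees near x with eta times the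
    single function attached to x. *)
Lemma Ck1_glue (d : R) (eta : R3 R -> R) (F : int * int * int -> R3 R -> R) :
  Ck 1 eta -> (forall k, Ck 1 (F k)) ->
  (forall x, (\forall y \near x, eta y = 0) \/
             (\forall y \near x, lattice_floor d y = lattice_floor d x)) ->
  let psi x := eta x * F (lattice_floor d x) x in
  Ck 1 psi /\ forall i x, partial i psi x =
    partial i eta x * F (lattice_floor d x) x + eta x * partial i (F (lattice_floor d x)) x.
Proof.
move=> Ce CF alt psi.
pose G i x := partial i eta x * F (lattice_floor d x) x + eta x * partial i (F (lattice_floor d x)) x.
have psi_near x : \forall y \near x, eta y * F (lattice_floor d x) y = psi y.
  have [e0|fl] := alt x; near=> y; rewrite /psi.
    by rewrite (_ : eta y = 0) ?mul0r//; near: y.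
  by rewrite (_ : lattice_floor d y = lattice_floor d x)//; near: y.
have G_near i x : \forall y \near x,
    G i y = partial i eta y * F (lattice_floor d x) y + eta y * partial i (F (lattice_floor d x)) y.
  have [e0|fl] := alt x; last first.
    by near=> y; rewrite /G (_ : lattice_floor d y = lattice_floor d x)//; near: y.
  near=> y; have ey : eta y = 0 by near: y.
  have ny : \forall z \near y, eta z = cst 0 z by near: y; exact: (near_join e0).
  have pe : partial i eta y = 0 by rewrite /partial (near_eq_derive _ ny) derive_cst.
  by rewrite /G pe ey !mul0r.
apply: Ck1I.
- move=> x; apply: near_eq_continuous (_ : continuous_at x (fun y => eta y * F (lattice_floor d x) y)).
    by near=> y; apply/esym; near: y; exact: psi_near.
  by have [[c _] _] := Ck1M Ce (CF (lattice_floor d x)); exact: c.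
- move=> i x; apply: near_eq_is_derive (psi_near x) _.
  have [C E] := Ck1M Ce (CF (lattice_floor d x)).
  by have := Ck1_derive i x C; rewrite E.
- move=> i x; apply: (near_eq_continuous (G_near i x)).
  have [C E] := Ck1M Ce (CF (lattice_floor d x)).
  by have := @Ck1_partial _ i C x; rewrite (funext (E i)).
Unshelve. all: by end_near. Qed.

End C1Calculus.

(** * Integrals of product functions *)

Section ProductIntegral.
Context {R : realType}.
Local Notation vol3 := (@vol3 R).
Local Notation leb := (@lebesgue_measure R).

Lemma ge0_integral_prod3 (f1 f2 f3 : measurableTypeR R -> R) :
  measurable_fun setT f1 -> measurable_fun setT f2 -> measurable_fun setT f3 ->
  (forall t, 0 <= f1 t) -> (forall t, 0 <= f2 t) -> (forall t, 0 <= f3 t) ->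
  (\int[vol3]_x (f1 x.1.1 * f2 x.1.2 * f3 x.2)%:E =
   (\int[leb]_t (f1 t)%:E) * (\int[leb]_t (f2 t)%:E) * \int[leb]_t (f3 t)%:E)%E.
Proof.
move=> m1 m2 m3 p1 p2 p3.
have mE (f : measurableTypeR R -> R) : measurable_fun setT f -> measurable_fun setT (fun t => (f t)%:E).
  by move=> mf; apply/measurable_EFinP.
have q3 : (0 <= \int[leb]_t (f3 t)%:E)%E by apply: integral_ge0 => t _; rewrite lee_fin.
have q2 : (0 <= \int[leb]_t (f2 t)%:E)%E by apply: integral_ge0 => t _; rewrite lee_fin.
have m12 : measurable_fun setT (fun x : measurableTypeR R * measurableTypeR R => f1 x.1 * f2 x.2).
  apply: measurable_funM.
    by apply: (measurableT_comp m1); exact: measurable_fst.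
  by apply: (measurableT_comp m2); exact: measurable_snd.
have mE12 : measurable_fun setT (fun x : measurableTypeR R * measurableTypeR R => (f1 x.1 * f2 x.2)%:E).
  by apply/measurable_EFinP.
have mf : measurable_fun setT (fun z : R3 R => (f1 z.1.1 * f2 z.1.2 * f3 z.2)%:E).
  apply/measurable_EFinP; apply: measurable_funM.
    by apply: (measurableT_comp m12); exact: measurable_fst.
  by apply: (measurableT_comp m3); exact: measurable_snd.
have f0 z : (0 <= (f1 z.1.1 * f2 z.1.2 * f3 z.2)%:E)%E by rewrite lee_fin !mulr_ge0.
transitivity (\int[@vol2 R]_x ((f1 x.1 * f2 x.2)%:E * \int[leb]_t (f3 t)%:E))%E.
  rewrite (_ : (\int[vol3]_z (f1 z.1.1 * f2 z.1.2 * f3 z.2)%:E =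
     \int[@vol2 R]_x \int[leb]_t (f1 x.1 * f2 x.2 * f3 t)%:E)%E); last first.
    exact: (@fubini_tonelli1 _ _ _ _ R (@vol2 R) leb _ mf f0).
  apply: eq_integral => x _; under eq_integral do rewrite EFinM.
  rewrite (ge0_integralZl leb measurableT (mE _ m3))//.
  - by move=> t _; rewrite lee_fin.
  - by rewrite lee_fin mulr_ge0.
rewrite (ge0_integralZr (@vol2 R) measurableT mE12)//; last first.
  by move=> t _; rewrite lee_fin mulr_ge0.
congr (_ * _)%E.
rewrite (_ : (\int[@vol2 R]_x (f1 x.1 * f2 x.2)%:E =
     \int[leb]_s \int[leb]_t (f1 s * f2 t)%:E)%E); last first.
  apply: (@fubini_tonelli1 _ _ _ _ R leb leb (fun x => (f1 x.1 * f2 x.2)%:E) mE12) => x.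
  by rewrite lee_fin mulr_ge0.
transitivity (\int[leb]_s ((f1 s)%:E * \int[leb]_t (f2 t)%:E))%E.
  apply: eq_integral => s _; under eq_integral do rewrite EFinM.
  rewrite (ge0_integralZl leb measurableT (mE _ m2))//.
  - by move=> t _; rewrite lee_fin.
  - by rewrite lee_fin.
rewrite (ge0_integralZr leb measurableT (mE _ m1))//.
by move=> t _; rewrite lee_fin.
Qed.

Lemma ge0_integral_cell_coord (d : R) (g : R -> R) i : 0 <= d ->
  measurable_fun setT (g : measurableTypeR R -> R) -> (forall t, 0 <= g t) ->
  (\int[vol3]_(x in cell d) (g (coord x i))%:E = (d ^+ 2)%:E * \int[leb]_(t in `[0%R, d[) (g t)%:E)%E.
Proof.
move=> d0 mg g0.
pose c (t : measurableTypeR R) : R := \1_(`[0%R, d[%classic : set R) t.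
have mc : measurable_fun setT c by apply: measurable_indic; exact: measurable_itv.
have c0 t : 0 <= c t by [].
pose cg (t : measurableTypeR R) : R := c t * g t.
have mcg : measurable_fun setT cg by apply: measurable_funM.
have cg0 t : 0 <= cg t by rewrite mulr_ge0.
have Ic : (\int[leb]_t (c t)%:E = d%:E)%E.
  have mI : measurable (`[0%R, d[%classic : set (measurableTypeR R)) by exact: measurable_itv.
  rewrite /c (integral_indic leb measurableT mI) setIT.
  by rewrite [LHS]lebesgue_measure_itv/= lte_fin; case: ltgtP d0 => //= [_|<-] _; rewrite ?oppr0 ?addr0.
have Icg : (\int[leb]_t (cg t)%:E = \int[leb]_(t in `[0%R, d[) (g t)%:E)%E.
  rewrite [RHS]integral_mkcond; apply: eq_integral => t _.
  by rewrite patchE /cg /c indicE; case: ifPn => _; rewrite ?mul1r ?mul0r.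
have E (f1 f2 f3 : measurableTypeR R -> R) :
    (forall x : R3 R, f1 x.1.1 * f2 x.1.2 * f3 x.2 = c x.1.1 * c x.1.2 * c x.2 * g (coord x i)) ->
    (\int[vol3]_(x in cell d) (g (coord x i))%:E = \int[vol3]_x (f1 x.1.1 * f2 x.1.2 * f3 x.2)%:E)%E.
  move=> fE; rewrite integral_mkcond; apply: eq_integral => x _; rewrite fE patchE /c !indicE.
  have -> : (x \in cell d) = [&& x.1.1 \in (`[0%R, d[%classic : set R), x.1.2 \in (`[0%R, d[%classic : set R) & x.2 \in (`[0%R, d[%classic : set R)].
    apply/idP/and3P; rewrite !inE; first by move=> [[]].
    by move=> [].
  case: (_ \in _); last by rewrite !mul0r.
  case: (_ \in _); last by rewrite mulr0 !mul0r.
  by case: (_ \in _); rewrite ?mul1r ?mul0r.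
elim/ord3_ind: i E => E.
- apply: etrans (E cg c c _) _; first by move=> x; rewrite /cg coordE; ring.
  by rewrite ge0_integral_prod3// Ic Icg -muleA -EFinM muleC.
- apply: etrans (E c cg c _) _; first by move=> x; rewrite /cg coordE; ring.
  by rewrite ge0_integral_prod3// Ic Icg muleAC -EFinM.
- apply: etrans (E c c cg _) _; first by move=> x; rewrite /cg coordE; ring.
  by rewrite ge0_integral_prod3// Ic Icg -EFinM.
Qed.

End ProductIntegral.

(** * Cutoffs adapted to a cubic grid *)

Section Cutoff.
Context {R : realType}.
Local Notation vol3 := (@vol3 R).
Local Notation leb := (@lebesgue_measure R).
Implicit Types (x y z : R3 R) (i : 'I_3) (f g eta : R3 R -> R).
Variable d : R.
Hypothesis d0 : 0 < d.

Definition cutoff (j : nat) x : R :=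
  bump d j (coord x ord0) * bump d j (coord x (lift ord0 ord0)) * bump d j (coord x ord_max).

(** Dominates the sum of the absolute partial derivatives of [cutoff]. Its integral over a cell is
    at most 6 d^2, twice the cross-section d^2 for each axis, uniformly in j. *)
Definition slope (j : nat) x : R := \sum_(i < 3) `|dbump d j (coord x i)|.

Lemma cutoff01 j x : 0 <= cutoff j x <= 1.
Proof.
rewrite /cutoff; have /andP[a0 a1] := bump01 d j (coord x ord0).
have /andP[b0 b1] := bump01 d j (coord x (lift ord0 ord0)).
have /andP[c0 c1] := bump01 d j (coord x ord_max).
apply/andP; split; first exact: (mulr_ge0 (mulr_ge0 a0 b0) c0).
exact: (mulr_ile1 (mulr_ge0 a0 b0) c0 (mulr_ile1 a0 b0 a1 b1) c1).
Qed.

Lemma cutoffC_le j x : 1 - cutoff j x <= \sum_(i < 3) (1 - bump d j (coord x i)).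
Proof.
rewrite sum_ord3 /cutoff; have := bump01 d j (coord x ord0).
have := bump01 d j (coord x (lift ord0 ord0)); have := bump01 d j (coord x ord_max).
move: (bump _ _ _) => a; move: (bump _ _ _) => b; move: (bump _ _ _) => c.
move=> /andP[a0 a1] /andP[b0 b1] /andP[c0 c1].
have : 0 <= (1 - c) * (1 - b) by rewrite mulr_ge0// subr_ge0.
have : 0 <= (1 - c * b) * (1 - a) by rewrite mulr_ge0// subr_ge0// mulr_ile1.
by lra.
Qed.

Lemma Ck1_cutoff j : Ck 1 (cutoff j) /\
  forall i x, `|partial i (cutoff j) x| <= `|dbump d j (coord x i)|.
Proof.
have [C0 E0] := Ck1_coord ord0 (fun t : R => is_derive_bump d j t) (@continuous_dbump _ d j).
have [C1 E1] := Ck1_coord (lift ord0 ord0) (fun t : R => is_derive_bump d j t) (@continuous_dbump _ d j).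
have [C2 E2] := Ck1_coord ord_max (fun t : R => is_derive_bump d j t) (@continuous_dbump _ d j).
have [C01 E01] := Ck1M C0 C1; have [C E] := Ck1M C01 C2.
split; first exact: C.
move=> i x; rewrite (E i x) (E01 i x) (E0 i x) (E1 i x) (E2 i x).
have := bump01 d j (coord x ord0).
have := bump01 d j (coord x (lift ord0 ord0)); have := bump01 d j (coord x ord_max).
have B (a b u : R) : 0 <= a <= 1 -> 0 <= b <= 1 -> `|a * b * u| <= `|u|.
  move=> /andP[a0 a1] /andP[b0 b1]; rewrite normrM ger0_norm ?mulr_ge0//.
  by rewrite ler_piMl// mulr_ile1.
elim/ord3_ind: i => b2 b1 b0 /=; rewrite !(mul0r, mulr0, mul1r, add0r, addr0).
- rewrite -mulrA mulrC; exact: B.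
- rewrite mulrAC; exact: B.
- exact: B.
Qed.

Lemma cutoff_periodic j : periodic d (cutoff j).
Proof.
move=> i x; rewrite /cutoff !coordD !coordZ !coord_unit_vec.
have P t (k : bool) : bump d j (t + d * k%:R) = bump d j t.
  by have := bump_periodic j d0 t k; rewrite pmulrn.
by rewrite !P.
Qed.

(** The dichotomy required by [Ck1_glue]: if some coordinate is a multiple of d the corresponding
    bump vanishes nearby, otherwise all three floors are locally constant. *)
Lemma cutoff_alt j x : (\forall y \near x, cutoff j y = 0) \/
  (\forall y \near x, lattice_floor d y = lattice_floor d x).
Proof.
have cc i : (coord y i) @[y --> x] --> coord x i by exact: continuous_coord.
have fl t : (exists k : int, t = d * k%:~R) \/ (\forall s \near t, Num.floor (s / d) = Num.floor (t / d)).
  have [->|nt] := eqVneq t (d * (Num.floor (t / d))%:~R); first by left; eexists.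
  right.
  have := floor_itv (t / d); rewrite ler_pdivlMr// ltr_pdivrMr// => /andP[t1 t2].
  have t1' : (Num.floor (t / d))%:~R * d < t by rewrite lt_neqAle t1 andbT mulrC eq_sym.
  near=> s; apply: floor_def; rewrite ler_pdivlMr// ltr_pdivrMr//; apply/andP; split.
    by apply: ltW; near: s; exact: lt_nbhsr.
  by near: s; exact: lt_nbhsl.
have Z i : (exists k : int, coord x i = d * k%:~R) -> \forall y \near x, cutoff j y = 0.
  move=> [k xk]; have : \forall y \near x, bump d j (coord y i) = 0.
    have V : nbhs (coord x i) (fun t => bump d j t = 0) by rewrite xk; exact: (bump_vanish j d0 k).
    exact: (cc i _ V).
  by apply: filterS => y; elim/ord3_ind: i {xk} => h; rewrite /cutoff h !(mul0r, mulr0).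
have [/Z|f0] := fl (coord x ord0); first by left.
have [/Z|f1] := fl (coord x (lift ord0 ord0)); first by left.
have [/Z|f2] := fl (coord x ord_max); first by left.
right.
have g0 : \forall y \near x, Num.floor (coord y ord0 / d) = Num.floor (coord x ord0 / d) := cc _ _ f0.
have g1 : \forall y \near x, Num.floor (coord y (lift ord0 ord0) / d) =
  Num.floor (coord x (lift ord0 ord0) / d) := cc _ _ f1.
have g2 : \forall y \near x, Num.floor (coord y ord_max / d) = Num.floor (coord x ord_max / d) := cc _ _ f2.
have E y : lattice_floor d y = (Num.floor (coord y ord0 / d),
    Num.floor (coord y (lift ord0 ord0) / d), Num.floor (coord y ord_max / d)).
  by rewrite !coordE.
near=> y; rewrite !E; congr (_, _, _).
- by near: y; exact: g0.
- by near: y; exact: g1.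
- by near: y; exact: g2.
Unshelve. all: by end_near. Qed.

Lemma continuous_slope j : continuous (slope j).
Proof.
have C i : continuous (fun x => `|dbump d j (coord x i)|).
  move=> x; apply: cvg_norm.
  apply: (@continuous_comp _ _ _ (fun x => coord x i) (dbump d j)).
    exact: continuous_coord.
  exact: continuous_dbump.
have -> : slope j = (fun x => `|dbump d j (coord x ord0)| + `|dbump d j (coord x (lift ord0 ord0))|
    + `|dbump d j (coord x ord_max)|).
  by apply/funext => x; rewrite /slope sum_ord3.
by move=> x; apply: cvgD; [apply: cvgD|]; exact: C.
Qed.

Lemma slope_ge0 j x : 0 <= slope j x. Proof. by apply: sumr_ge0. Qed.

Lemma ge0_integral_sum_coord (g : R -> R) (I : \bar R) : 
  measurable_fun setT (g : measurableTypeR R -> R) -> (forall t, 0 <= g t) ->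
  (\int[leb]_(t in `[0%R, d[) (g t)%:E <= I)%E ->
  (\int[vol3]_(x in cell d) (\sum_(i < 3) g (coord x i))%:E <= (3 * d ^+ 2)%:E * I)%E.
Proof.
move=> mg g0 gI.
have mi i : measurable_fun setT (fun x => g (coord x i)).
  by apply: (measurableT_comp mg); exact: measurable_coord.
under eq_integral do rewrite -sumEFin.
rewrite ge0_integral_sum//=; last 3 first.
- exact: measurable_cell.
- by move=> i; apply/measurable_EFinP; apply: measurable_funTS.
- by move=> i x _; rewrite lee_fin.
under eq_bigr do rewrite (ge0_integral_cell_coord _ (ltW d0) mg g0).
rewrite !big_ord_recl big_ord0 adde0.
have -> : ((3 * d ^+ 2)%:E * I = (d ^+ 2)%:E * I + ((d ^+ 2)%:E * I + (d ^+ 2)%:E * I))%E.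
  have I0 : (0 <= I)%E by apply: le_trans gI; apply: integral_ge0 => t _; rewrite lee_fin.
  have s0 : (0 <= (d ^+ 2)%:E)%E by rewrite lee_fin sqr_ge0.
  by rewrite -ge0_muleDl// -ge0_muleDl ?adde_ge0// -!EFinD; congr (_%:E * _)%E; ring.
have H : ((d ^+ 2)%:E * \int[leb]_(t in `[0%R, d[) (g t)%:E <= (d ^+ 2)%:E * I)%E.
  by apply: lee_wpmul2l; rewrite ?lee_fin ?sqr_ge0.
by apply: leeD => //; apply: leeD.
Qed.

Lemma integral_slope j : (\int[vol3]_(x in cell d) (slope j x)%:E <= (6 * d ^+ 2)%:E)%E.
Proof.
have -> : (6 * d ^+ 2)%:E = ((3 * d ^+ 2)%:E * 2%:E)%E by rewrite -EFinM; congr EFin; ring.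
apply: (@ge0_integral_sum_coord (fun t => `|dbump d j t|)) => //.
  apply: measurableT_comp => //; exact: continuous_measurable_fun (@continuous_dbump _ d j).
exact: integral_abs_dbump.
Qed.

Lemma cvg_integral_bumpC :
  (\int[leb]_(t in `[0%R, d[) (1 - bump d j t)%:E)%E @[j --> \oo] --> 0%E.
Proof.
have mb j (A : set R) : measurable A -> measurable_fun A (fun t => (1 - bump d j t)%:E).
  move=> mA; apply/measurable_EFinP; apply: measurable_funTS.
  apply: measurable_funB => //; exact: continuous_measurable_fun (@continuous_bump _ d j).
(* At t = 0 the bump vanishes for every j, so the pointwise limit holds on the open interval
   only. *)
have E j : (\int[leb]_(t in `[0%R, d[) (1 - bump d j t)%:E = \int[leb]_(t in `]0%R, d[) (1 - bump d j t)%:E)%E.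
  rewrite integral_itv_obnd_cbnd//; apply: mb; exact: measurable_itv.
under eq_fun do rewrite E.
rewrite (_ : 0%E = \int[leb]_(t in `]0%R, d[) (cst 0%E t : \bar R))%E; last by rewrite integral0.
have mI : measurable (`]0%R, d[%classic : set (measurableTypeR R)) by exact: measurable_itv.
have /(_ (fun j t => (1 - bump d j t)%:E) (cst 0%E) (cst 1%E)) := @dominated_convergence _ _ R leb (`]0%R, d[)%classic mI.
case => //.
- by move=> j; apply: mb; exact: measurable_itv.
- apply: aeW => t /=; rewrite in_itv/= => td.
  apply: cvg_EFin; first exact: nearW.
  have c1 := cos_phase_lt1 d0 td.
  have H : (2 / (1 - cos (phase d t)) * j.+1%:R^-1) @[j --> \oo] --> (0 : R).
    by rewrite -[X in _ --> X](mulr0 (2 / (1 - cos (phase d t)))); apply: cvgMr; exact: cvg_harmonic.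
  have K : (1 - bump d j.+1 t) @[j --> \oo] --> (0 : R).
    apply: (squeeze_cvgr _ (cvg_cst (0 : R)) H).
    apply: nearW => j /=; have /andP[b0 b1] := bump01 d j.+1 t; rewrite subr_ge0 b1/=.
    have := bump_ge c1 (ltn0Sn j); congr (_ <= _).
    by rewrite invfM mulrCA mulrC.
  by move: K; rewrite (cvg_shiftS (fun j => 1 - bump d j t)).
- apply/integrableP; split; first exact: measurable_cst.
  under eq_integral do rewrite gee0_abs//.
  by rewrite integral_cst// mul1e [X in (X < _)%E]lebesgue_measure_itv/= lte_fin d0 -EFinB ltry.
- apply: aeW => t j _; have /andP[b0 b1] := bump01 d j t.
  by rewrite lee_fin ger0_norm ?subr_ge0// gerBl.
Qed.

Lemma cvg_integral_cutoffC :
  (\int[vol3]_(x in cell d) (1 - cutoff j x)%:E)%E @[j --> \oo] --> 0%E.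
Proof.
pose B j := (\int[leb]_(t in `[0%R, d[) (1 - bump d j t)%:E)%E.
have H : ((3 * d ^+ 2)%:E * B j)%E @[j --> \oo] --> 0%E.
  rewrite -[X in _ --> X](mule0 (3 * d ^+ 2)%:E).
  by apply: cvgeZl => //; exact: cvg_integral_bumpC.
apply: (squeeze_cvge _ (cvg_cst 0%E) H); apply: nearW => j; apply/andP; split.
  by apply: integral_ge0 => x _; rewrite lee_fin subr_ge0; have /andP[] := cutoff01 j x.
have mb : measurable_fun setT (fun t : measurableTypeR R => 1 - bump d j t).
  by apply: measurable_funB => //; exact: continuous_measurable_fun (@continuous_bump _ d j).
have b0 t : 0 <= 1 - bump d j t by rewrite subr_ge0; have /andP[] := bump01 d j t.
apply: (le_trans _ (ge0_integral_sum_coord mb b0 (lexx _))).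
apply: ge0_le_integral; first exact: measurable_cell.
- by move=> x _; rewrite lee_fin subr_ge0; have /andP[] := cutoff01 j x.
- apply/measurable_EFinP; apply: measurable_funTS; apply: measurable_funB => //.
  by apply: continuous_measurable3; have [[c _] _] := Ck1_cutoff j; exact: c.
- apply/measurable_EFinP; apply: measurable_funTS; apply: measurable_sum => i.
  by apply: (measurableT_comp mb); exact: measurable_coord.
- by move=> x _; rewrite lee_fin cutoffC_le.
Qed.

End Cutoff.

(** * Glued test fields and the total variation on the torus *)

Section GluedFields.
Context {R : realType}.
Local Notation vol3 := (@vol3 R).
Local Notation leb := (@lebesgue_measure R).
Implicit Types (x y z : R3 R) (i : 'I_3) (f g eta u : R3 R -> R) (phi : R3 R -> R3 R).

Lemma enormE x : enorm x = Num.sqrt (sqn x). Proof. by []. Qed.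

Lemma enormZ (a : R) x : enorm (a *: x) = `|a| * enorm x.
Proof. by rewrite !enormE sqnZ sqrtrM ?sqr_ge0// sqrtr_sqr. Qed.

Lemma coord_le_enorm x i : `|coord x i| <= enorm x.
Proof.
rewrite /enorm -sqrtr_sqr ler_wsqrtr// sum_ord3.
have := sqr_ge0 (coord x ord0); have := sqr_ge0 (coord x (lift ord0 ord0)).
have := sqr_ge0 (coord x ord_max).
by elim/ord3_ind: i; lra.
Qed.

Lemma C1_field0 : C1_field (fun _ : R3 R => 0 : R3 R).
Proof.
move=> i; have [C _] := @Ck1_cst R 0.
have -> : component (fun _ : R3 R => 0 : R3 R) i = (fun=> 0).
  by apply/funext => x; rewrite /component -(scale0r (0 : R3 R)) coordZ mul0r.
exact: C.
Qed.

Lemma divergence0 x : divergence (fun _ : R3 R => 0 : R3 R) x = 0.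
Proof.
have [_ E] := @Ck1_cst R 0.
rewrite /divergence big1// => i _.
have -> : component (fun _ : R3 R => 0 : R3 R) i = (fun=> 0).
  by apply/funext => y; rewrite /component -(scale0r (0 : R3 R)) coordZ mul0r.
exact: E.
Qed.

Lemma C1_field_affine phi (a : R3 R) (s : R) : C1_field phi ->
  C1_field (fun x => phi (a + s *: x)) /\
  forall x, divergence (fun x => phi (a + s *: x)) x = s * divergence phi (a + s *: x).
Proof.
move=> C1; split; first by move=> i; have [C _] := Ck1_affine a s (C1 i); exact: C.
move=> x; rewrite /divergence mulr_sumr; apply: eq_bigr => i _.
by have [_ E] := Ck1_affine a s (C1 i); exact: E.
Qed.

Lemma continuous_divergence phi : C1_field phi -> continuous (divergence phi).
Proof.
move=> C1; have -> : divergence phi = (fun x => partial ord0 (component phi ord0) x +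
   partial (lift ord0 ord0) (component phi (lift ord0 ord0)) x +
   partial ord_max (component phi ord_max) x).
  by apply/funext => x; rewrite /divergence sum_ord3.
have C i := @Ck1_partial _ _ i (C1 i).
by move=> x; apply: cvgD; [apply: cvgD|]; exact: C.
Qed.

Lemma measurable_divergence phi : C1_field phi -> measurable_fun setT (divergence phi).
Proof. by move=> C1; apply: continuous_measurable3; exact: continuous_divergence. Qed.

Definition glue (d : R) (j : nat) (F : int * int * int -> R3 R -> R3 R) x : R3 R :=
  cutoff d j x *: F (lattice_floor d x) x.

Lemma enorm_glue (d : R) j F x : (forall k x, enorm (F k x) <= 1) -> enorm (glue d j F x) <= 1.
Proof.
move=> F1; rewrite enormZ; have /andP[c0 c1] := cutoff01 d j x.
by rewrite ger0_norm// mulr_ile1// sqrtr_ge0.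
Qed.

(** The product rule: the error is the gradient of the cutoff against a field of Euclidean norm at
    most 1, hence at most [slope]. *)
Lemma glue_field (d : R) j F : 0 < d -> (forall k, C1_field (F k)) ->
  (forall k x, enorm (F k x) <= 1) ->
  C1_field (glue d j F) /\
  forall x, `|divergence (glue d j F) x - cutoff d j x * divergence (F (lattice_floor d x)) x| <=
     slope d j x.
Proof.
move=> d0 C1 F1.
have [Ce Be] := Ck1_cutoff d j.
have E i : component (glue d j F) i =
    (fun x => cutoff d j x * component (F (lattice_floor d x)) i x).
  by apply/funext => x; rewrite /component /glue coordZ.
have G i := Ck1_glue Ce (fun k => C1 k i) (cutoff_alt d0 j).
split; first by move=> i; rewrite E; have [C _] := G i; exact: C.
move=> x; rewrite /divergence mulr_sumr -sumrB.
apply: (le_trans (ler_norm_sum _ _ _)); apply: ler_sum => i _.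
rewrite E; have [_ ->] := G i; rewrite addrK normrM.
apply: (le_trans (ler_wpM2r (normr_ge0 _) (Be i x))).
rewrite ler_piMr//; exact: le_trans (coord_le_enorm _ _) (F1 _ _).
Qed.

Variable l : R.
Hypothesis l_gt0 : 0 < l.

Lemma periodic_cell_axis f i (h : R) : measurable_fun setT f -> periodic l f ->
  \int[vol3]_(x in cell l) f (x + h *: unit_vec i) = \int[vol3]_(x in cell l) f x.
Proof.
move=> mf pf; rewrite /Rintegral; congr fine.
have := @integral_cell_shift R l (EFin \o f) (h *: unit_vec i) l_gt0.
move=> <-; last 2 first.
- exact/measurable_EFinP.
- by move=> k x; rewrite /= pf.
by apply: eq_integral => x _ /=; rewrite addrC.
Qed.

Lemma integral_partial_cell f i : Ck 1 f -> periodic l f ->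
  \int[vol3]_(x in cell l) partial i f x = 0.
Proof.
move=> C pf; have cf := Ck1_continuous C; have cp := @Ck1_partial _ _ i C.
have [M fM] := periodic_bounded l_gt0 cf pf.
have [M' pM] := periodic_bounded l_gt0 cp (periodic_partial i pf).
have mf := continuous_measurable3 cf.
have ms (h : R) : measurable_fun setT (fun x : R3 R => f (x + h *: unit_vec i)).
  by have := measurable_shiftl (h *: unit_vec i) mf.
apply: (@Rintegral_partial_eq0 _ _ f (fun _ => M')).
- exact: measurable_cell.
- by move=> x; have [] := Ck1_derive i x C.
- by move=> h; apply: (integrable_cell l_gt0 (ms h) (fun x => fM _)).
- by move=> h; exact: periodic_cell_axis.
- by move=> x; exact: le_trans (pM x).
- apply: (@integrable_cell _ _ l_gt0 (fun=> M') `|M'|) => //.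
- by move=> x h _ _; exact: pM.
Qed.

Lemma periodic_component phi i : periodic l phi -> periodic l (component phi i).
Proof. by move=> pp k x; rewrite /component pp. Qed.

Lemma periodic_divergence phi : periodic l phi -> periodic l (divergence phi).
Proof.
move=> pp k x; rewrite /divergence; apply: eq_bigr => i _.
exact: (periodic_partial i (periodic_component i pp)).
Qed.

Lemma integral_divergence_cell phi : C1_field phi -> periodic l phi ->
  \int[vol3]_(x in cell l) divergence phi x = 0.
Proof.
move=> C1 pp; have mc := @measurable_cell R l.
have I i : vol3.-integrable (cell l) (EFin \o partial i (component phi i)).
  have cp := @Ck1_partial _ _ i (C1 i).
  have [M pM] := periodic_bounded l_gt0 cp (periodic_partial i (periodic_component i pp)).
  exact: (integrable_cell l_gt0 (continuous_measurable3 cp) pM).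
have Z i : \int[vol3]_(x in cell l) partial i (component phi i) x = 0.
  exact: (integral_partial_cell i (C1 i) (periodic_component i pp)).
have -> : divergence phi = (fun x => (partial ord0 (component phi ord0) x +
   partial (lift ord0 ord0) (component phi (lift ord0 ord0)) x) +
   partial ord_max (component phi ord_max) x).
  by apply/funext => x; rewrite /divergence sum_ord3.
rewrite (RintegralD mc (integrable_addr mc (I ord0) (I (lift ord0 ord0))) (I ord_max)).
by rewrite (RintegralD mc (I ord0) (I (lift ord0 ord0))) (Z ord0) (Z (lift ord0 ord0)) (Z ord_max) !addr0.
Qed.

Lemma divergence_bounded phi : C1_field phi -> periodic l phi ->
  exists M, forall x, `|divergence phi x| <= M.
Proof.
move=> C1 pp.
exact: (periodic_bounded l_gt0 (continuous_divergence C1) (periodic_divergence pp)).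
Qed.

(** Divergences of periodic fields have zero mean and u = 2 chi - 1, so testing u is twice testing
    chi: the total variation of u is twice the perimeter of the phase. *)
Lemma torus_test u phi : measurable_fun setT u -> (forall x, u x = -1 \/ u x = 1) ->
  C1_field phi -> periodic l phi ->
  (\int[vol3]_(x in cell l) (u x * divergence phi x)%:E =
   (2 * \int[vol3]_(x in cell l) (indicator_of u x * divergence phi x))%:E)%E.
Proof.
move=> mu u1 C1 pp; have mc := @measurable_cell R l.
have [M dM] := divergence_bounded C1 pp.
have md := measurable_divergence C1.
have Id := integrable_cell l_gt0 md dM.
have mi := measurable_indicator_of mu.
have bi x : `|indicator_of u x| <= 1.
  by have [->|->] := indicator_of01 u1 x; rewrite ?normr0 ?normr1.
have mid : measurable_fun setT (fun x => indicator_of u x * divergence phi x).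
  exact: measurable_funM.
have Iid : vol3.-integrable (cell l) (EFin \o (fun x => indicator_of u x * divergence phi x)).
  apply: (@integrable_cell _ _ l_gt0 _ M mid) => x.
  by rewrite normrM (le_trans _ (dM x))// ler_piMl.
have Iu : vol3.-integrable (cell l) (EFin \o (fun x => u x * divergence phi x)).
  apply: (@integrable_cell _ _ l_gt0 _ M); first exact: measurable_funM.
  move=> x; rewrite normrM (le_trans _ (dM x))// ler_piMl//.
  by have [->|->] := u1 x; rewrite ?normrN normr1.
rewrite -[LHS](fineK (integrable_fin_num mc Iu)); congr EFin.
transitivity (\int[vol3]_(x in cell l) (u x * divergence phi x)); first by [].
have := RintegralD mc Iu Id; rewrite (integral_divergence_cell C1 pp) addr0 => <-.
rewrite -(RintegralZl 2 mc Iid); apply: eq_Rintegral => x _.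
by rewrite /indicator_of; field.
Qed.

Lemma TV_torus_ge u phi : measurable_fun setT u -> (forall x, u x = -1 \/ u x = 1) ->
  C1_field phi -> periodic l phi -> (forall x, enorm (phi x) <= 1) ->
  ((2 * \int[vol3]_(x in cell l) (indicator_of u x * divergence phi x))%:E <= TV_torus l u)%E.
Proof.
move=> mu u1 C1 pp p1; rewrite -torus_test//.
by apply: ereal_sup_ubound; exists phi.
Qed.

Lemma TV_torus_le u (T : R) : measurable_fun setT u -> (forall x, u x = -1 \/ u x = 1) ->
  (forall phi, C1_field phi -> periodic l phi -> (forall x, enorm (phi x) <= 1) ->
    \int[vol3]_(x in cell l) (indicator_of u x * divergence phi x) <= T) ->
  (TV_torus l u <= (2 * T)%:E)%E.
Proof.
move=> mu u1 H; apply: ge_ereal_sup => _ [phi [pp C1 p1] <-].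
by rewrite torus_test// lee_fin ler_pM2l//; exact: H.
Qed.

Lemma TV_torus_ge0 u : measurable_fun setT u -> (forall x, u x = -1 \/ u x = 1) ->
  (0 <= TV_torus l u)%E.
Proof.
move=> mu u1; have := TV_torus_ge mu u1 C1_field0.
have -> : \int[vol3]_(x in cell l) (indicator_of u x * divergence (fun _ : R3 R => 0 : R3 R) x) = 0.
  by rewrite /Rintegral integral0_eq// => x _; rewrite divergence0 mulr0.
rewrite mulr0; apply => //.
by move=> x; rewrite -(scale0r (0 : R3 R)) enormZ normr0 mul0r.
Qed.

Lemma TV_torus_minus1 : TV_torus l (fun _ : R3 R => -1 : R) = 0%E.
Proof.
have m1 : measurable_fun setT (fun _ : R3 R => -1 : R) by exact: (@measurable_cst _ _ (R3 R) R setT (-1)).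
have u1 (x : R3 R) : (-1 : R) = -1 \/ (-1 : R) = 1 by left.
apply/eqP; rewrite eq_le TV_torus_ge0// andbT.
rewrite -[leRHS](_ : (2 * 0)%:E = 0%E); last by rewrite mulr0.
apply: TV_torus_le => // phi C1 pp p1.
rewrite (_ : (\int[vol3]_(x in cell l) _) = 0)//.
by rewrite /Rintegral integral0_eq// => x _; rewrite /indicator_of subrr !mul0r.
Qed.

End GluedFields.

(** * Near-optimal fields for f^* and dilations *)

Section ScaledFields.
Context {R : realType}.
Local Notation vol3 := (@vol3 R).
Implicit Types (x y z : R3 R) (i : 'I_3) (f g om : R3 R -> R) (phi : R3 R -> R3 R).

Lemma measurable_enorm : measurable_fun setT (@enorm R).
Proof.
have ms : measurable_fun setT (@Num.sqrt R : measurableTypeR R -> measurableTypeR R).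
  by apply: continuous_measurable_fun; exact: sqrt_continuous.
by apply: (measurableT_comp ms); exact: measurable_sqn.
Qed.

Lemma measurable_sub3 : measurable_fun setT (fun xy : R3 R * R3 R => xy.1 - xy.2 : R3 R).
Proof.
have mN : measurable_fun setT (fun x : R3 R => - x : R3 R).
  have := measurable_affine3 (0 : R3 R) (-1); apply: eq_measurable_fun => x _.
  by rewrite affine3E add0r scaleN1r.
apply: (measurableT_comp (@measurable_add3 R) (_ : measurable_fun setT
  (fun xy : R3 R * R3 R => (xy.1, - xy.2) : R3 R * R3 R))).
apply: measurable_fun_pair; first exact: measurable_fst.
by apply: (measurableT_comp mN); exact: measurable_snd.
Qed.

Definition coulomb_density om (xy : R3 R * R3 R) : \bar R :=
  (om xy.1 * om xy.2 / enorm (xy.1 - xy.2))%:E.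

Lemma measurable_coulomb_density om : measurable_fun setT om ->
  measurable_fun setT (coulomb_density om).
Proof.
move=> mo; apply/measurable_EFinP; apply: measurable_funM.
  apply: measurable_funM; first by apply: (measurableT_comp mo); exact: measurable_fst.
  by apply: (measurableT_comp mo); exact: measurable_snd.
have mi := @measurable_inv R.
apply: (measurableT_comp mi); apply: (measurableT_comp measurable_enorm).
exact: measurable_sub3.
Qed.

Lemma coulomb_density_ge0 om xy : (forall x, 0 <= om x) -> (0 <= coulomb_density om xy)%E.
Proof. by move=> o0; rewrite lee_fin divr_ge0 ?sqrtr_ge0// mulr_ge0. Qed.

Lemma coulomb_ge0 om : (forall x, 0 <= om x) -> (0 <= coulomb om)%E.
Proof.
move=> o0; apply: integral_ge0 => x _; apply: integral_ge0 => y _.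
exact: (coulomb_density_ge0 (x, y) o0).
Qed.

(** Each of the two variables contributes r^-3 and the kernel contributes r. *)
Lemma coulomb_scale om (r : R) : 0 < r -> measurable_fun setT om -> (forall x, 0 <= om x) ->
  (coulomb (fun x => om (affine3 0%R r x)) = (r^-1 ^+ 5)%:E * coulomb om)%E.
Proof.
move=> r0 mo o0; have rn0 := lt0r_neq0 r0.
have mc := measurable_coulomb_density mo.
have mc1 x : measurable_fun setT (fun y => coulomb_density om (x, y)).
  by apply: (measurableT_comp mc); exact: measurable_fun_pair.
have mI : measurable_fun setT (fun x => \int[vol3]_y coulomb_density om (x, y))%E.
  exact: (@measurable_fun_fubini_tonelli_F _ _ _ _ R vol3 _ mc (fun xy => coulomb_density_ge0 xy o0)).
transitivity (\int[vol3]_x ((r^-1 ^+ 2)%:E * \int[vol3]_y coulomb_density om (affine3 0%R r x, y)))%E.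
  apply: eq_integral => x _.
  transitivity (\int[vol3]_y (r%:E * coulomb_density om (affine3 0%R r x, affine3 0%R r y)))%E.
    apply: eq_integral => y _; rewrite /coulomb_density /= -EFinM; congr EFin.
    have -> : affine3 0%R r x - affine3 0%R r y = r *: (x - y).
      by rewrite !affine3E !add0r scalerBr.
    rewrite enormZ gtr0_norm// invfM.
    by move: (om _) (om _) ((enorm _)^-1) => a b c; field.
  have mr : measurable_fun setT (fun y => coulomb_density om (affine3 0%R r x, affine3 0%R r y)).
    exact: (measurableT_comp (mc1 (affine3 0%R r x)) (measurable_affine3 0%R r)).
  rewrite (ge0_integralZl vol3 measurableT mr); last 2 first.
  - by move=> y _; exact: coulomb_density_ge0.
  - by rewrite lee_fin ltW.
  have := ge0_integral_affine 0 rn0 measurableT (mc1 (affine3 0%R r x)) (fun y _ => coulomb_density_ge0 _ o0).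
  rewrite preimage_setT => ->; rewrite muleA -EFinM gtr0_norm//.
  by congr (_%:E * _)%E; field.
have mIr : measurable_fun setT (fun x => \int[vol3]_y coulomb_density om (affine3 0%R r x, y))%E.
  exact: (measurableT_comp mI (measurable_affine3 0%R r)).
have I0 x : (0 <= \int[vol3]_y coulomb_density om (x, y))%E.
  by apply: integral_ge0 => y _; exact: coulomb_density_ge0.
rewrite (ge0_integralZl vol3 measurableT mIr); last 2 first.
- by move=> x _; exact: I0.
- by rewrite lee_fin sqr_ge0.
have := ge0_integral_affine 0 rn0 measurableT mI (fun y _ => I0 y).
rewrite preimage_setT => ->; rewrite muleA -EFinM gtr0_norm//.
by congr (_%:E * _)%E; rewrite -exprD.
Qed.

Lemma TV_space_ge0 om : (0 <= TV_space om)%E.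
Proof.
apply: ereal_sup_ubound; exists (fun _ => 0).
  split; [|exact: C1_field0|].
    rewrite /compactly_supported (_ : [set x | (0 : R3 R) != 0] = set0).
      by rewrite closure0; exact: compact0.
    by apply/seteqP; split => x //=; rewrite eqxx.
  by move=> x; rewrite -(scale0r (0 : R3 R)) enormZ normr0 mul0r.
by rewrite integral0_eq// => x _; rewrite divergence0 mulr0.
Qed.

Lemma f_star_le (f' : R) om (M C T : R) : (f'%:E <= @f_star R)%E -> BV_space om ->
  (forall x, om x = 0 \/ om x = 1) -> 0 < M -> mass om = M%:E -> coulomb om = C%:E ->
  TV_space om = T%:E -> f' * M <= T + C / (8 * pi).
Proof.
move=> ff bv o1 M0 mE cE tE.
have : (f'%:E <= (TV_space om + (1 / (8 * pi))%:E * coulomb om) / mass om)%E.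
  apply: (le_trans ff); apply: ereal_inf_lbound; exists om => //.
  by split => //; rewrite mE lte_fin.
rewrite mE cE tE -EFinM -EFinD inver gt_eqF// -EFinM lee_fin ler_pdivlMr//.
by rewrite mul1r [_^-1 * _]mulrC.
Qed.

(** If every field fell short, the total variation would be at most f'' M - C / (8 pi), hence
    finite, and the quotient of [om] would be at most f'' < f'. Finite perimeter is thus obtained
    inside the contradiction instead of being assumed. *)
Lemma f_star_field (f' f'' : R) om (M C : R) : (f'%:E <= @f_star R)%E -> f'' < f' ->
  measurable_fun setT om -> (forall x, om x = 0 \/ om x = 1) -> 0 < M ->
  mass om = M%:E -> coulomb om = C%:E ->
  exists phi, [/\ C1_field phi, forall x, enorm (phi x) <= 1 &
    ((f'' * M - C / (8 * pi))%:E <= \int[vol3]_x (om x * divergence phi x)%:E)%E].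
Proof.
move=> ff f2 mo o1 M0 mE cE; apply: contrapT => /forallNP H.
have tle : (TV_space om <= (f'' * M - C / (8 * pi))%:E)%E.
  apply: ge_ereal_sup => _ [phi [cs C1 p1] <-].
  rewrite leNgt; apply/negP => /ltW lt; apply: (H phi); split => //.
have t0 := TV_space_ge0 om.
have tf : TV_space om \is a fin_num by rewrite ge0_fin_numE// (le_lt_trans tle)// ltry.
have bv : BV_space om.
  split; last by rewrite (le_lt_trans tle)// ltry.
  apply/integrableP; split; first exact/measurable_EFinP.
  under eq_integral => x _.
    rewrite gee0_abs; last by rewrite lee_fin; have [->|->] := o1 x.
    over.
  by rewrite [X in (X < _)%E]mE ltry.
have := f_star_le ff bv o1 M0 mE cE (esym (fineK tf)).
move: tle; rewrite -(fineK tf) lee_fin => h1 h2.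
have : f'' * M < f' * M by rewrite ltr_pM2r.
by move: h1 h2; lra.
Qed.

Lemma continuous_cell_bounded (d : R) f : continuous f ->
  exists M, forall x, cell d x -> `|f x| <= M.
Proof.
move=> cf.
pose K : set (R3 R) := `[0, d]%classic `*` `[0, d]%classic `*` `[0, d]%classic.
have cK : compact K.
  by apply: compact_setX; [apply: compact_setX|]; exact: segment_compact.
have : compact (f @` K).
  by apply: continuous_compact cK; exact: continuous_subspaceT.
move=> /compact_bounded[M [_ HM]].
exists (M + 1) => x /cellP H; apply: (HM (M + 1)); first by rewrite ltrDl.
exists x => //.
move: (H ord0) (H (lift ord0 ord0)) (H ord_max); rewrite !coordE => /andP[a1 a2] /andP[b1 b2] /andP[c1 c2].
by split; [split|] => /=; rewrite in_itv/= ?a1 ?b1 ?c1/= ltW.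
Qed.

Lemma integrable_supported (d M : R) f : 0 < d -> measurable_fun setT f ->
  (forall x, `|f x| <= M) -> (forall x, f x != 0 -> cell d x) ->
  vol3.-integrable setT (EFin \o f).
Proof.
move=> d0 mf fM fs; have I := integrable_cell d0 mf fM.
have -> : EFin \o f = (EFin \o f) \_ (cell d).
  apply/funext => x; rewrite patchE; case: ifPn => // /negP; rewrite inE => nx /=.
  by apply/congr1/eqP; apply: contrapT => /negP /fs.
by apply/(integrable_mkcond (EFin \o f) (@measurable_cell R d)).
Qed.

Lemma integrable_supportedM (d : R) om g : 0 < d -> measurable_fun setT om ->
  (forall x, om x = 0 \/ om x = 1) -> (forall x, om x != 0 -> cell d x) -> continuous g ->
  vol3.-integrable setT (EFin \o (fun x => om x * g x)).
Proof.
move=> d0 mo o1 os cg; have [M gM] := continuous_cell_bounded d cg.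
have M0 : 0 <= M.
  apply: le_trans (gM 0 _); first exact: normr_ge0.
  by apply/cellP => i; rewrite -(scale0r (0 : R3 R)) coordZ mul0r lexx.
apply: (@integrable_supported d M) => //.
- by apply: measurable_funM => //; exact: continuous_measurable3.
- move=> x; have [->|e] := o1 x; first by rewrite mul0r normr0.
  by rewrite e mul1r gM//; apply: os; rewrite e oner_neq0.
- by move=> x h; apply: os; apply: contra h => /eqP ->; rewrite mul0r.
Qed.

(** The bound for the set magnified by 1/r, read back at the original size: magnification multiplies
    mass, Coulomb energy and the tested integral by r^-3, r^-5 and r^-2. The scale r is the one at
    which perimeter and self-energy balance. *)
Lemma f_star_field_scaled (d r f' f'' : R) om (M C : R) : 0 < d -> 0 < r ->
  (f'%:E <= @f_star R)%E -> f'' < f' ->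
  measurable_fun setT om -> (forall x, om x = 0 \/ om x = 1) ->
  (forall x, om x != 0 -> cell d x) ->
  mass om = M%:E -> coulomb om = C%:E ->
  exists phi, [/\ C1_field phi, forall x, enorm (phi x) <= 1 &
    f'' * M / r - C / (8 * pi) / r ^+ 3 <= \int[vol3]_x (om x * divergence phi x)].
Proof.
move=> d0 r0 ff f2 mo o1 os mE cE.
have o0 x : 0 <= om x by have [->|->] := o1 x.
have C0 : 0 <= C by rewrite -lee_fin -cE coulomb_ge0.
have : 0 <= M by rewrite -lee_fin -mE; apply: integral_ge0 => x _; rewrite lee_fin.
have pi8 : 0 < 8 * pi :> R by rewrite mulr_gt0// pi_gt0.
rewrite le_eqVlt => /predU1P[M0|M0].
  (* An empty piece is not a competitor for [f_star]; the zero field serves it. *)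
  exists (fun _ => 0); split; [exact: C1_field0| |].
    by move=> x; rewrite -(scale0r (0 : R3 R)) enormZ normr0 mul0r.
  rewrite /Rintegral integral0_eq/=; last by move=> x _; rewrite divergence0 mulr0.
  rewrite -M0 mulr0 mul0r sub0r oppr_le0; apply: divr_ge0; last by apply: exprn_ge0; exact: ltW.
  by apply: divr_ge0 => //; exact: ltW.
have rn0 := lt0r_neq0 r0; have ri0 : 0 < r^-1 by rewrite invr_gt0.
have m_r : measurable_fun setT (fun x => om (affine3 0%R r x)).
  exact: (measurableT_comp mo (measurable_affine3 0%R r)).
have mE_r : mass (fun x => om (affine3 0%R r x)) = (r^-1 ^+ 3 * M)%:E.
  have mo' : measurable_fun setT (fun x => (om x)%:E) by apply/measurable_EFinP.
  have := ge0_integral_affine 0 rn0 measurableT mo' (fun y _ => (o0 y : (0 <= (om y)%:E)%E)).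
  by rewrite preimage_setT /mass => ->; rewrite gtr0_norm// [X in (_ * X)%E]mE -EFinM.
have cE_r : coulomb (fun x => om (affine3 0%R r x)) = (r^-1 ^+ 5 * C)%:E.
  by rewrite coulomb_scale// cE -EFinM.
have [phi [C1 p1 H]] := f_star_field ff f2 m_r (fun x => o1 _) (mulr_gt0 (exprn_gt0 3 ri0) M0) mE_r cE_r.
have [C1' D'] := C1_field_affine 0 r^-1 C1.
exists (fun x => phi (0 + r^-1 *: x)); split => //.
have cd := continuous_divergence C1.
have dr0 : 0 < d / r by rewrite divr_gt0.
have I := integrable_supportedM (om := fun x => om (affine3 0%R r x)) dr0 m_r (fun x => o1 _).
have {}I : vol3.-integrable setT (EFin \o (fun x => om (affine3 0%R r x) * divergence phi x)).
  apply: I cd => x /os /cellP h; apply/cellP => i; have := h i.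
  rewrite affine3E add0r coordZ ltr_pdivlMr// [_ * r]mulrC => /andP[h1 ->].
  by rewrite andbT -(pmulr_rge0 _ r0).
have := Rintegral_affine 0 (lt0r_neq0 ri0) I.
have -> : \int[vol3]_x (om (affine3 0%R r (affine3 0%R r^-1 x)) * divergence phi (affine3 0%R r^-1 x)) =
   r * \int[vol3]_x (om x * divergence (fun x => phi (0 + r^-1 *: x)) x).
  have I2 : vol3.-integrable setT (EFin \o (fun x => om x * divergence (fun x => phi (0 + r^-1 *: x)) x)).
    by apply: (integrable_supportedM d0) => //; exact: continuous_divergence.
  rewrite -(RintegralZl r measurableT I2); apply: eq_Rintegral => x _.
  rewrite D' !affine3E !add0r scalerA mulfV// scale1r.
  by move: (om x) (divergence _ _) => a b; field.
rewrite (gtr0_norm ri0) invrK => E.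
have H' : f'' * (r^-1 ^+ 3 * M) - r^-1 ^+ 5 * C / (8 * pi) <=
    \int[vol3]_x (om (affine3 0%R r x) * divergence phi x).
  rewrite -lee_fin; apply: (le_trans H).
  by rewrite /Rintegral fineK; [exact: lexx|exact: (integrable_fin_num measurableT I)].
rewrite -(ler_pM2l r0) E.
apply: le_trans (ler_wpM2l (exprn_ge0 3 (ltW r0)) H').
rewrite le_eqVlt; apply/orP; left; apply/eqP.
clear -rn0 pi8; move: (8 * pi) pi8 => P P0.
by field; rewrite rn0 (lt0r_neq0 P0).
Qed.

End ScaledFields.

(** * Choice of a good translation of the grid *)

Section Slicing.
Context {R : realType}.
Local Notation vol3 := (@vol3 R).
Implicit Types (x y z a : R3 R) (chi : R3 R -> R).

Lemma limn_einf_ge (w : (\bar R)^nat) c N : (forall j, (N <= j)%N -> (c <= w j)%E) ->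
  (c <= limn_einf w)%E.
Proof.
move=> H; rewrite limn_einf_lim; apply: lime_ge; first exact: is_cvg_einfs.
exists N => // n /= Nn; apply: le_ereal_inf_tmp => _ [k /= nk <-].
by apply: H; exact: leq_trans nk.
Qed.

Lemma limn_einf_le (w : (\bar R)^nat) c : (forall j, (w j <= c)%E) -> (limn_einf w <= c)%E.
Proof.
move=> H; rewrite limn_einf_lim; apply: lime_le; first exact: is_cvg_einfs.
apply: nearW => n; apply: le_trans (H n); apply: ereal_inf_lbound.
by exists n => /=.
Qed.

Lemma slope_periodic (d : R) j : 0 < d -> periodic d (slope d j).
Proof.
move=> d0 i y; apply: eq_bigr => k _; congr (`|_|).
rewrite coordD coordZ coord_unit_vec /dbump.
have := @cos_phase_periodic R d d0 (coord y k) (k == i); rewrite -[X in d * X]pmulrn => ->.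
congr (_ * (_ * (_ * _))).
rewrite /phase mulrDr mulrA.
case: (k == i); rewrite ?mulr0 ?addr0//= mulr1.
have -> : 2 * pi / d * d = pi *+ 2 :> R by rewrite -mulr_natl; field; rewrite gt_eqF.
by rewrite sinD2pi.
Qed.

(** By Tonelli the cost of the cut, integrated over all translations in a cell, is at most 6 d^2 m,
    so some a in [A] costs at most 6 d^2 m / V. One translation has to serve arbitrarily steep
    cutoffs, so the mean value argument is applied to the lower limit in j, through Fatou; the slack
    e gives infinitely many j. A subset [A] of the cell is allowed because truncating a set also
    restricts where the cuts may fall. *)
Lemma slice (d : R) (A D : set (R3 R)) chi (m V e : R) : 0 < d -> 0 < V -> 0 < e ->
  measurable A -> A `<=` cell d -> vol3 A = V%:E ->
  measurable D -> measurable_fun setT chi -> (forall x, 0 <= chi x) ->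
  (\int[vol3]_(x in D) (chi x)%:E = m%:E)%E ->
  exists2 a, A a & forall N, exists2 j, (N <= j)%N &
    (\int[vol3]_(x in D) (chi x * slope d j (x + a))%:E <= (6 * d ^+ 2 * m / V + e)%:E)%E.
Proof.
move=> d0 V0 e0 mA Acell VA mD mchi chi0 Im; apply: contrapT => /forall2NP H.
pose c := 6 * d ^+ 2 * m / V + e.
pose F j (ax : R3 R * R3 R) : \bar R := (chi ax.2 * slope d j (ax.2 + ax.1))%:E.
have ms j : measurable_fun setT (slope d j).
  by apply: continuous_measurable3; exact: continuous_slope.
have mF j : measurable_fun setT (F j).
  apply/measurable_EFinP; apply: measurable_funM.
    by apply: (measurableT_comp mchi); exact: measurable_snd.
  have := measurableT_comp (ms j) (@measurable_add3 R).
  by apply: eq_measurable_fun => ax _ /=; rewrite addrC.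
have F0 j ax : (0 <= F j ax)%E by rewrite lee_fin mulr_ge0// slope_ge0.
pose g j a : \bar R := (\int[vol3]_(x in D) F j (a, x))%E.
have mFD j : measurable_fun setT (fun ax : R3 R * R3 R => F j ax * (\1_D ax.2)%:E)%E.
  apply: emeasurable_funM => //; apply/measurable_EFinP.
  have mI : measurable_fun setT (\1_D : R3 R -> R) by exact: measurable_indic.
  by apply: (measurableT_comp mI); exact: measurable_snd.
have FD0 j ax : (0 <= F j ax * (\1_D ax.2)%:E)%E by rewrite mule_ge0// lee_fin.
have gE j a : g j a = (\int[vol3]_x (F j (a, x) * (\1_D x)%:E))%E.
  rewrite /g integral_mkcond; apply: eq_integral => x _; rewrite patchE indicE.
  by case: ifPn => _; rewrite ?mule1 ?mule0.
have mg j : measurable_fun setT (g j).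
  have := @measurable_fun_fubini_tonelli_F _ _ _ _ R vol3 _ (mFD j) (FD0 j).
  by apply: eq_measurable_fun => a _; rewrite gE.
have g0 j a : (0 <= g j a)%E by apply: integral_ge0.
have Ig j : (\int[vol3]_(a in A) g j a <= (6 * d ^+ 2 * m)%:E)%E.
  have m0 : 0 <= m by rewrite -lee_fin -Im; apply: integral_ge0 => x _; rewrite lee_fin.
  apply: (@le_trans _ _ (\int[vol3]_(a in cell d) g j a)%E).
    by apply: ge0_subset_integral => //; [exact: measurable_cell|exact: measurable_funTS].
  have -> : (\int[vol3]_(a in cell d) g j a =
     \int[vol3]_(x in D) \int[vol3]_(a in cell d) F j (a, x))%E.
    pose G (ax : R3 R * R3 R) := (F j ax * (\1_D ax.2)%:E * (\1_(cell d) ax.1)%:E)%E.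
    have mG : measurable_fun setT G.
      apply: emeasurable_funM => //; apply/measurable_EFinP.
      have mI : measurable_fun setT (\1_(cell d) : R3 R -> R).
        by apply: measurable_indic; exact: measurable_cell.
      by apply: (measurableT_comp mI); exact: measurable_fst.
    have G0 ax : (0 <= G ax)%E by rewrite mule_ge0// lee_fin.
    transitivity (\int[vol3]_a \int[vol3]_x G (a, x))%E.
      rewrite integral_mkcond; apply: eq_integral => a _; rewrite patchE /G /= indicE.
      case: ifPn => _; last by rewrite integral0_eq// => x _; rewrite mule0.
      by rewrite gE; apply: eq_integral => x _; rewrite mule1.
    transitivity (\int[vol3]_x \int[vol3]_a G (a, x))%E.
      exact: (@fubini_tonelli _ _ _ _ R vol3 vol3 G mG G0).
    rewrite [RHS]integral_mkcond; apply: eq_integral => x _; rewrite patchE /G /= indicE.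
    case: ifPn => _; last by rewrite integral0_eq// => a _; rewrite mule0 mul0e.
    rewrite [RHS]integral_mkcond; apply: eq_integral => a _; rewrite patchE mule1 indicE.
    by case: ifPn => _; rewrite ?mule1 ?mule0.
  have -> : (6 * d ^+ 2 * m)%:E = (\int[vol3]_(x in D) ((6 * d ^+ 2)%:E * (chi x)%:E))%E.
    rewrite ge0_integralZl//; last 3 first.
    - by apply/measurable_EFinP; exact: measurable_funTS.
    - by move=> x _; rewrite lee_fin.
    - by rewrite lee_fin mulr_ge0// sqr_ge0.
    by rewrite Im -EFinM.
  apply: ge0_le_integral => //.
  - by move=> x _; apply: integral_ge0.
  - have mG' : measurable_fun setT (fun xa : R3 R * R3 R => (F j (xa.2, xa.1) * (\1_(cell d) xa.2)%:E)%E).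
      apply: emeasurable_funM.
        apply: (measurableT_comp (mF j)).
        by apply: measurable_fun_pair; [exact: measurable_snd|exact: measurable_fst].
      apply/measurable_EFinP.
      have mI : measurable_fun setT (\1_(cell d) : R3 R -> R).
        by apply: measurable_indic; exact: measurable_cell.
      by apply: (measurableT_comp mI); exact: measurable_snd.
    apply: measurable_funTS.
    have G0 xa : (0 <= F j (xa.2, xa.1) * (\1_(cell d) xa.2)%:E)%E by rewrite mule_ge0// lee_fin.
    have := @measurable_fun_fubini_tonelli_F _ _ _ _ R vol3 _ mG' G0.
    apply: eq_measurable_fun => x _; rewrite [RHS]integral_mkcond.
    apply: eq_integral => a _; rewrite patchE /= indicE.
    by case: ifPn => _; rewrite ?mule1 ?mule0.
  - apply: emeasurable_funM; first exact: measurable_cst.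
    by apply/measurable_EFinP; exact: measurable_funTS.
  - move=> x _; rewrite muleC.
    have mse : measurable_fun setT (fun a => (slope d j a)%:E) by apply/measurable_EFinP; exact: ms.
    have mss : measurable_fun (cell d) (fun a => (slope d j (x + a))%:E).
      by apply: measurable_funTS; apply/measurable_EFinP; exact: measurable_shiftr.
    have s0 a : (0 <= (slope d j a)%:E)%E by rewrite lee_fin slope_ge0.
    have pse : periodic d (fun a => (slope d j a)%:E) by move=> i y; rewrite (slope_periodic j d0).
    rewrite [leLHS](_ : _ = (\int[vol3]_(a in cell d) ((chi x)%:E * (slope d j (x + a))%:E))%E); last first.
      by apply: eq_integral => a _; rewrite -EFinM.
    rewrite ge0_integralZl//; [|exact: measurable_cell|by rewrite lee_fin].
    rewrite (@ge0_integral_cell_shift R d (fun a => (slope d j a)%:E) x d0 mse s0 pse).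
    by apply: lee_wpmul2l; [rewrite lee_fin|exact: integral_slope].
have fat := @fatou _ _ R vol3 A mA g (fun j => measurable_funTS (mg j)) (fun j a _ => g0 j a).
have cV : (c%:E * V%:E <= (6 * d ^+ 2 * m)%:E)%E.
  apply: le_trans (limn_einf_le Ig); apply: le_trans fat.
  rewrite -VA -integral_cst//; apply: ge0_le_integral => //.
  - move=> a _; rewrite lee_fin; apply: addr_ge0; last exact: ltW.
    apply: divr_ge0; last exact: ltW.
    apply: mulr_ge0; first by rewrite mulr_ge0// sqr_ge0.
    by rewrite -lee_fin -Im; apply: integral_ge0 => x _; rewrite lee_fin.
  - apply: measurable_funTS.
    have mN : measurable_fun setT (fun a => limn_esup (fun j => (- g j a)%E)).
      by apply: measurable_fun_limn_esup => j; apply: (measurableT_comp (@oppe_measurable R _)); exact: mg.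
    exact: (measurableT_comp (@oppe_measurable R _) mN).
  - move=> a Aa; have [//|] := H a => /existsNP[N] /forall2NP HN.
    apply: (@limn_einf_ge _ _ N) => j Nj; have [//|/negP] := HN j.
    by rewrite -ltNge => /ltW.
move: cV; rewrite -EFinM lee_fin /c mulrDl divfK ?gt_eqF// gerDl.
by rewrite leNgt mulr_gt0.
Qed.

End Slicing.

(** * Lower bound for the self-energy *)

Section SelfEnergyLower.
Context {R : realType}.
Local Notation vol3 := (@vol3 R).
Implicit Types (x y z : R3 R) (i : 'I_3) (f g h om chi : R3 R -> R).
Variables (kappa l : R).
Hypotheses (kappa_gt0 : 0 < kappa) (l_gt0 : 0 < l).

Lemma sqn_eq0 z : sqn z = 0 -> z = 0.
Proof.
move=> z0; apply/coordP => i; rewrite -[in RHS](scale0r (0 : R3 R)) coordZ mul0r.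
apply/eqP; rewrite -sqrf_eq0; move: z0; rewrite /sqn sum_ord3.
have := sqr_ge0 (coord z ord0); have := sqr_ge0 (coord z (lift ord0 ord0)).
have := sqr_ge0 (coord z ord_max).
by elim/ord3_ind: i => a b c h; apply/eqP; lra.
Qed.

Lemma sqn_cellB (d : R) x y : cell d x -> cell d y -> sqn (x - y) <= 3 * d ^+ 2.
Proof.
move=> /cellP hx /cellP hy.
have H i : coord (x - y) i ^+ 2 <= d ^+ 2.
  have /andP[a1 a2] := hx i; have /andP[b1 b2] := hy i.
  rewrite coordD coordN; move: (coord x i) (coord y i) a1 a2 b1 b2 => a b; nra.
rewrite /sqn sum_ord3; have := H ord0; have := H (lift ord0 ord0); have := H ord_max.
by lra.
Qed.

Lemma measurable_coulomb_inner om x : measurable_fun setT om ->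
  measurable_fun setT (fun z => (om x * om (x + z) / enorm z)%:E).
Proof.
move=> mo; apply/measurable_EFinP; apply: measurable_funM.
  by apply: measurable_funM => //; exact: measurable_shiftr.
by apply: (measurableT_comp (@measurable_inv R)); exact: measurable_enorm.
Qed.

Lemma coulomb_shift om : measurable_fun setT om -> (forall x, 0 <= om x) ->
  coulomb om = (\int[vol3]_x \int[vol3]_z (om x * om (x + z) / enorm z)%:E)%E.
Proof.
move=> mo o0; apply: eq_integral => x _.
have mi : measurable_fun setT (fun y => coulomb_density om (x, y)).
  by apply: (measurableT_comp (measurable_coulomb_density mo)); exact: measurable_fun_pair.
have := ge0_integral_shift3 x measurableT mi.
rewrite preimage_setT => <-; last first.
  by move=> y _; exact: coulomb_density_ge0.
apply: eq_integral => z _; rewrite /coulomb_density /=; congr (_ / _)%:E.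
by rewrite opprD addrA subrr add0r -scaleN1r enormZ normrN1 mul1r.
Qed.

(** The kernel is nonnegative, so interactions leaving the cell may be dropped; two points of the
    cell are at squared distance at most 3 d^2, where the kernel is at least theta times the Newton
    kernel. *)
Lemma coulomb_le_resolve (theta d : R) h om : 0 <= theta -> 0 < d ->
  measurable_fun setT h -> (forall x, 0 <= h x) ->
  (forall x, om x = h x * \1_(cell d) x) ->
  (forall z, 0 < sqn z <= 3 * d ^+ 2 ->
    ((theta / (4 * pi) / enorm z)%:E <= yukawa kappa z)%E) ->
  ((theta / (4 * pi))%:E * coulomb om <=
    \int[vol3]_(x in cell d) ((h x)%:E * resolve kappa h x))%E.
Proof.
move=> t0 d0 mh h0 omE near_bound.
have tp0 : 0 <= theta / (4 * pi) by apply: divr_ge0 => //; rewrite mulr_ge0// pi_ge0.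
have mc := @measurable_cell R d.
have mo : measurable_fun setT om.
  have -> : om = (fun x => h x * \1_(cell d) x) by apply/funext.
  by apply: measurable_funM => //; exact: measurable_indic.
have o0 x : 0 <= om x by rewrite omE mulr_ge0.
have mJ : measurable_fun setT (fun xz : R3 R * R3 R => (om xz.1 * om (xz.1 + xz.2) / enorm xz.2)%:E).
  apply/measurable_EFinP; apply: measurable_funM.
    apply: measurable_funM; first by apply: (measurableT_comp mo); exact: measurable_fst.
    exact: (measurableT_comp mo (@measurable_add3 R)).
  apply: (measurableT_comp (@measurable_inv R)); apply: (measurableT_comp (@measurable_enorm R)).
  exact: measurable_snd.
have J0 xz : (0 <= (om xz.1 * om (xz.1 + xz.2) / enorm xz.2)%:E)%E.
  by rewrite lee_fin divr_ge0 ?sqrtr_ge0// mulr_ge0.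
have mI : measurable_fun setT (fun x => \int[vol3]_z (om x * om (x + z) / enorm z)%:E)%E :=
  @measurable_fun_fubini_tonelli_F _ _ _ _ R vol3 _ mJ J0.
have I0 x : (0 <= \int[vol3]_z (om x * om (x + z) / enorm z)%:E)%E.
  by apply: integral_ge0 => z _; exact: (J0 (x, z)).
rewrite coulomb_shift// -(ge0_integralZl vol3 measurableT mI (fun x _ => I0 x)); last first.
  by rewrite lee_fin.
rewrite [leRHS]integral_mkcond; apply: ge0_le_integral => //.
- by move=> x _; apply: mule_ge0; [rewrite lee_fin|exact: I0].
- by apply: emeasurable_funM => //; exact: measurable_cst.
- apply/(measurable_restrictT _ mc); apply: measurable_funTS; apply: emeasurable_funM.
    exact/measurable_EFinP.
  exact: measurable_resolve.
move=> x _; rewrite patchE.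
have mx := measurable_coulomb_inner x mo.
rewrite -(ge0_integralZl vol3 measurableT mx); last 2 first.
- by move=> z _; exact: (J0 (x, z)).
- by rewrite lee_fin.
case: ifPn => xc; last first.
  rewrite integral0_eq// => z _.
  by rewrite omE indicE (negbTE xc) mulr0 !mul0r mule0.
have mr : measurable_fun setT (fun z => (yukawa kappa z * (h (x + z))%:E)%E).
  by apply: emeasurable_funM; [exact: measurable_yukawa|apply/measurable_EFinP; exact: measurable_shiftr].
have r0 z : (0 <= yukawa kappa z * (h (x + z))%:E)%E.
  by apply: mule_ge0; [exact: yukawa_ge0|rewrite lee_fin].
rewrite /resolve -(ge0_integralZl vol3 measurableT mr (fun z _ => r0 z)); last by rewrite lee_fin.
apply: ge0_le_integral => //.
- by move=> z _; apply: mule_ge0; [rewrite lee_fin|exact: (J0 (x, z))].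
- by apply: emeasurable_funM => //; exact: measurable_cst.
- by apply: emeasurable_funM => //; exact: measurable_cst.
move=> z _; rewrite -EFinM.
have -> : om x = h x by rewrite omE indicE xc mulr1.
have [zc|zc] := boolP (x + z \in cell d); last first.
  rewrite (omE (x + z)) indicE (negbTE zc) !mulr0 mul0r mulr0.
  by apply: mule_ge0; rewrite ?lee_fin.
have -> : om (x + z) = h (x + z) by rewrite omE indicE zc mulr1.
(* At z = 0 the Coulomb integrand is 0, by the convention for the inverse of 0. *)
have [z0|z0] := leP (sqn z) 0.
  have -> : enorm z = 0 by rewrite /enorm (_ : \sum_(i < 3) _ = sqn z)// ler0_sqrtr.
  by rewrite invr0 !mulr0; apply: mule_ge0; rewrite ?lee_fin.
have zs : sqn z <= 3 * d ^+ 2.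
  have -> : z = (x + z) - x by rewrite addrC addKr.
  by apply: sqn_cellB; apply/set_mem.
have := near_bound z; rewrite z0 zs => /(_ isT) nb.
apply: (@le_trans _ _ ((h x)%:E * ((theta / (4 * pi) / enorm z)%:E * (h (x + z))%:E))%E).
  by rewrite -!EFinM lee_fin le_eqVlt; apply/orP; left; apply/eqP; ring.
by apply: lee_wpmul2l; rewrite ?lee_fin//; apply: lee_wpmul2r; rewrite ?lee_fin.
Qed.

Lemma resolve_shift h a x : resolve kappa (fun y => h (a + y)) x = resolve kappa h (a + x).
Proof. by apply: eq_integral => z _; rewrite addrA. Qed.

Lemma cell_resolve_rresolve chi : measurable_fun setT chi -> (forall x, 0 <= chi x <= 1) ->
  (\int[vol3]_(x in cell l) ((chi x)%:E * resolve kappa chi x) =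
   (\int[vol3]_(x in cell l) (chi x * rresolve kappa chi x))%:E)%E.
Proof.
move=> mc c01; have mcl := @measurable_cell R l.
have c0 x : 0 <= chi x by have /andP[] := c01 x.
have mr := measurable_rresolve kappa mc c0.
have B x := rresolve_bound kappa_gt0 x mc c01.
have I : vol3.-integrable (cell l) (EFin \o (fun x => chi x * rresolve kappa chi x)).
  apply: (@integrable_cell _ _ l_gt0 _ (1 * kappa ^- 2)); first exact: measurable_funM.
  move=> x; have /andP[b0 b1] := B x; have /andP[a0 a1] := c01 x.
  rewrite ger0_norm ?mulr_ge0//; apply: le_trans b1.
  by rewrite ler_piMl.
rewrite -[RHS](fineK (_ : (\int[vol3]_(x in cell l) (chi x * rresolve kappa chi x))%:E \is a fin_num))//=.
rewrite [in RHS]/Rintegral fineK; last exact: (integrable_fin_num mcl I).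
apply: eq_integral => x _; rewrite [RHS]EFinM; congr (_ * _)%E.
by rewrite -[LHS](fineK (resolve_fin kappa_gt0 x mc c01)).
Qed.

Lemma self_energy_lower (theta d : R) (N : nat) chi : 0 <= theta -> 0 < d -> l = N%:R * d ->
  measurable_fun setT chi -> (forall x, 0 <= chi x <= 1) ->
  (forall z, 0 < sqn z <= 3 * d ^+ 2 ->
    ((theta / (4 * pi) / enorm z)%:E <= yukawa kappa z)%E) ->
  (\sum_(k : 'I_N * 'I_N * 'I_N) (theta / (4 * pi))%:E *
      coulomb (fun x => chi (node d (nat_node k) + x) * \1_(cell d) x)%R <=
   (\int[vol3]_(x in cell l) (chi x * rresolve kappa chi x))%:E)%E.
Proof.
move=> t0 d0 lE mc c01 nb; rewrite -cell_resolve_rresolve// lE.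
have c0 x : 0 <= chi x by have /andP[] := c01 x.
have mr := measurable_resolve kappa mc c0.
rewrite (@ge0_integral_subcells _ N d _ d0); last 2 first.
- by apply: emeasurable_funM => //; exact/measurable_EFinP.
- by move=> x; apply: mule_ge0; [rewrite lee_fin|exact: resolve_ge0].
apply: lee_sum => k _.
have := @coulomb_le_resolve theta d (fun x => chi (node d (nat_node k) + x)) _ t0 d0
  (measurable_shiftr _ mc) (fun x => c0 _) (fun x => erefl) nb.
move=> /le_trans; apply; rewrite le_eqVlt; apply/orP; left; apply/eqP.
by apply: eq_integral => x _; rewrite resolve_shift.
Qed.

End SelfEnergyLower.

(** * Interaction with distant copies *)

Section SelfEnergyUpper.
Context {R : realType}.
Local Notation vol3 := (@vol3 R).
Implicit Types (x y z s : R3 R) (i : 'I_3) (f g h om chi : R3 R -> R).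
Variables (kappa l : R).
Hypotheses (kappa_gt0 : 0 < kappa) (l_gt0 : 0 < l).

(** If a set lies in a cell of side l/2, a displacement from one of its points to a point of another
    of its l-periodic copies has a component larger than l/2, hence is far. *)
Definition far z : R := \1_(~` [set z : R3 R | forall i, `|coord z i| < l / 2]) z.

Lemma farP z : far z = 0 \/ (far z = 1 /\ exists i, l / 2 <= `|coord z i|).
Proof.
rewrite /far indicE; case: (boolP (z \in _)) => h; last by left.
right; split=> //; move: h; rewrite inE/= => /existsNP[i /negP]; rewrite -leNgt => h.
by exists i.
Qed.

Lemma measurable_far : measurable_fun setT far.
Proof.
apply: measurable_indic; apply: measurableC.
have -> : [set z : R3 R | forall i, `|coord z i| < l / 2] =
    \bigcap_(i in [set: 'I_3]) ((fun z => `|coord z i|) @^-1` `]-oo, l / 2[).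
  by apply/seteqP; split => [z H i _|z H i] /=; have := H i; rewrite /= in_itv//=; apply.
apply: fin_bigcap_measurable => // i _; rewrite -[X in measurable X]setTI.
have mn : measurable_fun setT (fun z : R3 R => `|coord z i|).
  by apply: measurableT_comp => //; exact: measurable_coord.
by apply: mn => //; exact: measurable_itv.
Qed.

(** Here |z - s|^2 <= 2 |z|^2 + 6 l^2 <= 26 |z|^2, because |z| >= l/2, and 26 <= 10^2; the kernel
    decreases with the distance. The cube of 10 is the 1000 in the bounds below. *)
Lemma far_kernel z s : far z != 0 -> cell l s ->
  (yukawa kappa z <= yukawa kappa (affine3 0%R 10^-1 (z - s)%R))%E.
Proof.
have [->|[_ [i zi]]] := farP z; first by rewrite eqxx.
move=> _ /cellP sc; apply: le_yukawa.
rewrite affine3E add0r sqnZ.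
have h : (l / 2) ^+ 2 <= sqn z.
  have : (l / 2) ^+ 2 <= coord z i ^+ 2.
    by rewrite -(real_normK (num_real (coord z i))); apply: lerXn2r; rewrite ?nnegrE// divr_ge0// ltW.
  rewrite /sqn sum_ord3; have := sqr_ge0 (coord z ord0); have := sqr_ge0 (coord z (lift ord0 ord0)).
  by have := sqr_ge0 (coord z ord_max); elim/ord3_ind: i {zi}; lra.
have hs : sqn s <= 3 * l ^+ 2.
  have H k : coord s k ^+ 2 <= l ^+ 2.
    have /andP[a b] := sc k; move: (coord s k) a b => a; nra.
  by rewrite /sqn sum_ord3; have := H ord0; have := H (lift ord0 ord0); have := H ord_max; lra.
have := sqnD_le z (- s); rewrite sqnN.
move: (sqn z) (sqn s) (sqn _) h hs => a b c h hs h2.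
rewrite exprVn ler_pdivrMl ?exprn_gt0//.
by move: h; rewrite expr_div_n; have := sqr_ge0 l; lra.
Qed.

Lemma integral_yukawa10 : (\int[vol3]_z yukawa kappa (affine3 0%R 10^-1 z) = (1000 * kappa ^- 2)%:E)%E.
Proof.
have t0 : (10^-1 : R) != 0 by [].
have := ge0_integral_affine 0 t0 measurableT (measurable_yukawa kappa) (fun z _ => yukawa_ge0 kappa z).
rewrite preimage_setT => ->; rewrite integral_yukawa1// -EFinM; congr EFin.
by rewrite ger0_norm// invrK; congr (_ * _); ring.
Qed.

(* On the far set [K z] is below [K ((z - s) / 10)] for every [s] in the cell;
   averaging over [s] lets the periodicity of [chi] absorb the convolution. *)
Lemma far_potential_le chi Om x : measurable_fun setT chi -> (forall x, 0 <= chi x) ->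
  periodic l chi -> (\int[vol3]_(x in cell l) (chi x)%:E = Om%:E)%E ->
  (\int[vol3]_z (yukawa kappa z * (far z * chi (x + z))%:E) <=
    (1000 * kappa ^- 2 * Om / l ^+ 3)%:E)%E.
Proof.
move=> mchi c0 pchi IOm; have mc := @measurable_cell R l.
have l30 : 0 < l ^+ 3 by rewrite exprn_gt0.
have far0 z : 0 <= far z by rewrite /far indicE.
have mcx := measurable_shiftr x mchi.
have mF : measurable_fun setT (fun z => (yukawa kappa z * (far z * chi (x + z))%:E)%E).
  apply: emeasurable_funM; first exact: measurable_yukawa.
  by apply/measurable_EFinP; apply: measurable_funM => //; exact: measurable_far.
have F0 z : (0 <= yukawa kappa z * (far z * chi (x + z))%:E)%E.
  by apply: mule_ge0; [exact: yukawa_ge0|rewrite lee_fin mulr_ge0].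
pose G (zs : R3 R * R3 R) : \bar R :=
  (yukawa kappa (affine3 0%R 10^-1 (zs.1 - zs.2)%R) * (chi (x + zs.1) * \1_(cell l) zs.2)%:E)%E.
have mI : measurable_fun setT (\1_(cell l) : R3 R -> R) by exact: measurable_indic.
have mG : measurable_fun setT G.
  apply: emeasurable_funM.
    apply: (measurableT_comp (measurable_yukawa kappa)).
    apply: (measurableT_comp (measurable_affine3 0 10^-1)); exact: measurable_sub3.
  apply/measurable_EFinP; apply: measurable_funM.
    by apply: (measurableT_comp mcx); exact: measurable_fst.
  by apply: (measurableT_comp mI); exact: measurable_snd.
have G0 zs : (0 <= G zs)%E.
  by apply: mule_ge0; [exact: yukawa_ge0|rewrite lee_fin mulr_ge0].
suff H : ((l ^+ 3)%:E * \int[vol3]_z (yukawa kappa z * (far z * chi (x + z))%:E) <=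
    (1000 * kappa ^- 2 * Om)%:E)%E.
  have -> : (1000 * kappa ^- 2 * Om / l ^+ 3)%:E = ((l ^+ 3)^-1%:E * (1000 * kappa ^- 2 * Om)%:E)%E.
    by rewrite -EFinM mulrC.
  have -> : (\int[vol3]_z (yukawa kappa z * (far z * chi (x + z))%:E) =
    (l ^+ 3)^-1%:E * ((l ^+ 3)%:E * \int[vol3]_z (yukawa kappa z * (far z * chi (x + z))%:E)))%E.
    by rewrite muleA -EFinM mulVf ?gt_eqF// mul1e.
  by apply: (lee_wpmul2l _ H); rewrite lee_fin invr_ge0 ltW.
rewrite -(ge0_integralZl vol3 measurableT mF (fun z _ => F0 z)); last by rewrite lee_fin ltW.
apply: (@le_trans _ _ (\int[vol3]_z \int[vol3]_s G (z, s))%E).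
  apply: ge0_le_integral => //.
  - by move=> z _; apply: mule_ge0; [rewrite lee_fin ltW|exact: F0].
  - by apply: emeasurable_funM => //; exact: measurable_cst.
  - exact: (@measurable_fun_fubini_tonelli_F _ _ _ _ R vol3 _ mG G0).
  move=> z _.
  have -> : ((l ^+ 3)%:E * (yukawa kappa z * (far z * chi (x + z))%:E) =
    \int[vol3]_(s in cell l) (yukawa kappa z * (far z * chi (x + z))%:E))%E.
    by rewrite integral_cst// [X in (_ = _ * X)%E](vol3_cell (ltW l_gt0)) muleC.
  rewrite integral_mkcond; apply: ge0_le_integral => //.
  - by move=> s _; rewrite patchE; case: ifP.
  - by apply/(measurable_restrictT _ mc); exact: measurable_cst.
  - apply: (measurableT_comp mG); exact: measurable_fun_pair.
  move=> s _; rewrite patchE /G /= indicE; case: ifPn => sc; last by rewrite mulr0 mule0.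
  rewrite mulr1.
  have [f0|[f1 _]] := farP z; first by rewrite f0 mul0r mule0; apply: mule_ge0; [exact: yukawa_ge0|rewrite lee_fin].
  rewrite f1 mul1r; apply: lee_wpmul2r; first by rewrite lee_fin.
  by apply: far_kernel; [rewrite f1 oner_neq0|exact: set_mem].
have -> : (\int[vol3]_z \int[vol3]_s G (z, s) = \int[vol3]_s \int[vol3]_z G (z, s))%E.
  exact: (@fubini_tonelli _ _ _ _ R vol3 vol3 G mG G0).
pose H (sw : R3 R * R3 R) : \bar R :=
  (yukawa kappa (affine3 0%R 10^-1 sw.2) * (chi (x + (sw.1 + sw.2))%R * \1_(cell l) sw.1)%:E)%E.
have mH : measurable_fun setT H.
  apply: emeasurable_funM.
    apply: (measurableT_comp (measurable_yukawa kappa)).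
    apply: (measurableT_comp (measurable_affine3 0 10^-1)); exact: measurable_snd.
  apply/measurable_EFinP; apply: measurable_funM.
    by apply: (measurableT_comp mcx); exact: measurable_add3.
  by apply: (measurableT_comp mI); exact: measurable_fst.
have H0 sw : (0 <= H sw)%E.
  by apply: mule_ge0; [exact: yukawa_ge0|rewrite lee_fin mulr_ge0].
have -> : (\int[vol3]_s \int[vol3]_z G (z, s) = \int[vol3]_s \int[vol3]_w H (s, w))%E.
  apply: eq_integral => s _.
  have mGs : measurable_fun setT (fun z => G (z, s)).
    by apply: (measurableT_comp mG); exact: measurable_fun_pair.
  have := ge0_integral_shift3 s measurableT mGs (fun z _ => G0 _).
  rewrite preimage_setT => <-; apply: eq_integral => w _.
  by rewrite /G /H /= addrC addKr addrC.
have -> : (\int[vol3]_s \int[vol3]_w H (s, w) = \int[vol3]_w \int[vol3]_s H (s, w))%E.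
  exact: (@fubini_tonelli _ _ _ _ R vol3 vol3 H mH H0).
have mY : measurable_fun setT (fun w => yukawa kappa (affine3 0%R 10^-1 w)).
  exact: (measurableT_comp (measurable_yukawa kappa) (measurable_affine3 0 10^-1)).
have Y0 w : (0 <= yukawa kappa (affine3 0%R 10^-1 w))%E by exact: yukawa_ge0.
have Om0 : (0 <= Om%:E)%E by rewrite -IOm; apply: integral_ge0 => y _; rewrite lee_fin.
rewrite le_eqVlt; apply/orP; left; apply/eqP.
rewrite EFinM -integral_yukawa10 -(ge0_integralZr vol3 measurableT mY (fun w _ => Y0 w) Om0).
apply: eq_integral => w _; rewrite /H /=.
have mE : measurable_fun setT (fun y => (chi y)%:E) by exact/measurable_EFinP.
have pE : periodic l (fun y => (chi y)%:E) by move=> i y; rewrite pchi.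
have := @ge0_integral_cell_shift R l (fun y => (chi y)%:E) (x + w) l_gt0 mE (fun y => c0 y) pE.
rewrite IOm => <-.
have mw : measurable_fun (cell l) (fun s => (chi (x + w + s))%:E).
  by apply: measurable_funTS; apply: (measurableT_comp mE); exact: measurable_shift3.
rewrite -(ge0_integralZl vol3 mc mw (fun s _ => c0 (x + w + s)) (Y0 w)).
rewrite [RHS]integral_mkcond; apply: eq_integral => s _; rewrite patchE indicE.
case: ifPn => _; last by rewrite mulr0 mule0.
by rewrite mulr1 addrAC addrA.
Qed.

Lemma vol3_set1 x : vol3 [set x] = 0%E.
Proof.
have -> : [set x] = [set x.1.1] `*` [set x.1.2] `*` [set x.2].
  apply/seteqP; split => [y ->//|[[y1 y2] y3] /= [[-> ->] ->]].
  by case: x => -[].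
have m1 (t : R) : measurable ([set t] : set (measurableTypeR R)) by exact: measurable_set1.
by rewrite vol3_setX//; [rewrite [X in (_ * X)%E]lebesgue_measure_set1 mule0|exact: measurableX].
Qed.

End SelfEnergyUpper.

(** * Lower bound for the total variation on the torus *)

Section TorusLower.
Context {R : realType}.
Local Notation vol3 := (@vol3 R).
Implicit Types (x y z a b : R3 R) (i : 'I_3) (f g h om chi u : R3 R -> R) (phi : R3 R -> R3 R).

Lemma EFin_Rintegral D f : measurable D -> vol3.-integrable D (EFin \o f) ->
  (\int[vol3]_(x in D) f x)%:E = (\int[vol3]_(x in D) (f x)%:E)%E.
Proof. by move=> mD If; rewrite /Rintegral fineK//; exact: (integrable_fin_num mD If). Qed.

(** The axiom of choice is applied to the function [om] alone. This is possible because M and C are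
    determined by [om], and the zero field is the default when [om] is not a bona fide piece. *)
Lemma field_choice (d r f' f'' : R) : 0 < d -> 0 < r -> (f'%:E <= @f_star R)%E -> f'' < f' ->
  exists Fld : (R3 R -> R) -> (R3 R -> R3 R),
    (forall om, C1_field (Fld om)) /\ (forall om x, enorm (Fld om x) <= 1) /\
    forall om (M C : R), measurable_fun setT om -> (forall x, om x = 0 \/ om x = 1) ->
      (forall x, om x != 0 -> cell d x) -> mass om = M%:E -> coulomb om = C%:E ->
      f'' * M / r - C / (8 * pi) / r ^+ 3 <= \int[vol3]_x (om x * divergence (Fld om) x).
Proof.
move=> d0 r0 ff f2.
pose ok om (M C : R) := [/\ measurable_fun setT om, (forall x, om x = 0 \/ om x = 1),
      (forall x, om x != 0 -> cell d x), mass om = M%:E & coulomb om = C%:E].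
have H om : exists phi, [/\ C1_field phi, forall x, enorm (phi x) <= 1 & forall M C, ok om M C ->
      f'' * M / r - C / (8 * pi) / r ^+ 3 <= \int[vol3]_x (om x * divergence phi x)].
  have [[M [C omok]]|nok] := pselect (exists M C, ok om M C); last first.
    exists (fun _ => 0); split; [exact: C1_field0| |].
      by move=> x; rewrite -(scale0r (0 : R3 R)) enormZ normr0 mul0r.
    by move=> M C h; exfalso; apply: nok; exists M, C.
  have [mo o1 os mE cE] := omok.
  have [phi [C1 p1 B]] := f_star_field_scaled d0 r0 ff f2 mo o1 os mE cE.
  exists phi; split => // M' C' [_ _ _ mE' cE'].
  have [<-] : M%:E = M'%:E by rewrite -mE -mE'.
  have [<-] : C%:E = C'%:E by rewrite -cE -cE'.
  exact: B.
have [Fld HF] := choice H; exists Fld; split; first by move=> om; have [] := HF om.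
split; first by move=> om; have [_ + _] := HF om.
by move=> om M C mo o1 os mE cE; have [_ _] := HF om; apply.
Qed.

(** Moving each piece back to the cell at the origin makes pieces that differ by a period equal as
    functions, hence their chosen fields equal. *)
Definition piece (d : R) chi b x : R := chi (b + x) * \1_(cell d) x.

Lemma piece01 (d : R) chi b : (forall x, chi x = 0 \/ chi x = 1) ->
  forall x, piece d chi b x = 0 \/ piece d chi b x = 1.
Proof.
move=> c1 x; rewrite /piece indicE; case: (_ \in _); last by left; rewrite mulr0.
by rewrite mulr1; exact: c1.
Qed.

Lemma piece_cell (d : R) chi b x : piece d chi b x != 0 -> cell d x.
Proof.
rewrite /piece indicE; case: (boolP (x \in cell d)) => [/set_mem//|_].
by rewrite mulr0 eqxx.
Qed.

Lemma measurable_piece (d : R) chi b : measurable_fun setT chi -> measurable_fun setT (piece d chi b).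
Proof.
move=> mc; apply: measurable_funM; first exact: measurable_shiftr.
by apply: measurable_indic; exact: measurable_cell.
Qed.

Lemma floor_node (d : R) k x : 0 < d -> cell d x -> lattice_floor d (node d k + x) = k.
Proof.
move=> d0 /cellP H.
have fl (m : int) (t : R) : 0 <= t < d -> Num.floor ((d * m%:~R + t) / d) = m.
  move=> /andP[t1 t2]; apply: floor_def.
  rewrite ler_pdivlMr// ltr_pdivrMr// intrD; apply/andP; split; nra.
move: (H ord0) (H (lift ord0 ord0)) (H ord_max); rewrite !coordE => h0 h1 h2.
by case: k => -[k0 k1] k2; rewrite /lattice_floor /node /=; congr (_, _, _); exact: fl.
Qed.

Lemma node_floor_shift (d : R) N x i : 0 < d ->
  node d (lattice_floor d (x + (N%:R * d) *: unit_vec i)) =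
  node d (lattice_floor d x) + (N%:R * d) *: unit_vec i.
Proof.
move=> d0.
have fl (t : R) (b : bool) : d * (Num.floor ((t + N%:R * d * b%:R) / d))%:~R =
    d * (Num.floor (t / d))%:~R + N%:R * d * b%:R.
  have -> : (t + N%:R * d * b%:R) / d = t / d + ((N * b)%N : int)%:~R.
    by rewrite -pmulrn natrM; field; rewrite gt_eqF.
  rewrite floorDrz ?intr_int// intrKfloor intrD mulrDr -pmulrn natrM.
  by congr (_ + _); ring.
have cn y k : coord (node d (lattice_floor d y)) k = d * (Num.floor (coord y k / d))%:~R.
  by elim/ord3_ind: k; rewrite !coordE.
by apply/coordP => k; rewrite coordD !cn coordD !coordZ !coord_unit_vec; exact: fl _ (k == i).
Qed.

(* The test field glues near-optimal fields of the pieces of [chi]; choosing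
   them as functions of the piece alone makes the glued field periodic. *)
Lemma torus_lower u (l d r f' f'' B e : R) (N : nat) (C : 'I_N * 'I_N * 'I_N -> R) :
  0 < l -> 0 < d -> l = N%:R * d -> 0 < r -> (f'%:E <= @f_star R)%E -> f'' < f' -> 0 < e ->
  measurable_fun setT u -> periodic l u -> (forall x, u x = -1 \/ u x = 1) ->
  (forall k, coulomb (piece d (indicator_of u) (node d (nat_node k))) = (C k)%:E) ->
  (forall N0, exists2 j, (N0 <= j)%N &
    (\int[vol3]_(x in cell l) (indicator_of u x * slope d j x)%:E <= B%:E)%E) ->
  ((2 * (f'' * phase_volume l u / r - (\sum_k C k) / (8 * pi) / r ^+ 3 - B - e))%:E <=
    TV_torus l u)%E.
Proof.
move=> l0 d0 lE r0 ff f2 e0 mu pu u1 cE slopeB.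
pose chi := indicator_of u.
have mchi : measurable_fun setT chi by exact: measurable_indicator_of.
have chi1 x : chi x = 0 \/ chi x = 1 := indicator_of01 u1 x.
have chi01 x : 0 <= chi x <= 1 by have [->|->] := chi1 x; rewrite lexx ler01.
have chi0 x : 0 <= chi x by have /andP[] := chi01 x.
have chin x : `|chi x| <= 1 by rewrite ger0_norm//; have /andP[] := chi01 x.
have pchi : periodic l chi by move=> i x; rewrite /chi /indicator_of pu.
have mcd := @measurable_cell R d; have mcl := @measurable_cell R l.
have [Fld [FC1 [F1 Fbound]]] := field_choice d0 r0 ff f2.
pose F (k : int * int * int) x := Fld (piece d chi (node d k)) (- node d k + 1 *: x).
have FC1' k : C1_field (F k) by have [] := C1_field_affine (- node d k) 1 (FC1 (piece d chi (node d k))).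
have Fdiv k x : divergence (F k) x = divergence (Fld (piece d chi (node d k))) (- node d k + 1 *: x).
  by have [_ ->] := C1_field_affine (- node d k) 1 (FC1 (piece d chi (node d k))); rewrite mul1r.
have F1' k x : enorm (F k x) <= 1 by exact: F1.
pose Psi j := glue d j F.
have PC j : C1_field (Psi j) by have [] := @glue_field R d j F d0 FC1' F1'.
have Pdiv j x : `|divergence (Psi j) x - cutoff d j x * divergence (F (lattice_floor d x)) x| <= slope d j x.
  by have [_] := @glue_field R d j F d0 FC1' F1'; apply.
have P1 j x : enorm (Psi j x) <= 1 by exact: enorm_glue.
have cut_l j x i : cutoff d j (x + (N%:R * d) *: unit_vec i) = cutoff d j x.
  by rewrite mulrC -[N%:R]pmulrn (periodic_int i (N : int) x (@cutoff_periodic R d d0 j)).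
have pP j : periodic l (Psi j).
  move=> i x; rewrite /Psi /glue lE cut_l /F node_floor_shift//.
  have -> : piece d chi (node d (lattice_floor d x) + (N%:R * d) *: unit_vec i) =
      piece d chi (node d (lattice_floor d x)).
    by apply/funext => y; rewrite /piece addrAC -lE pchi.
  by rewrite !scale1r opprD addrACA addNr addr0.
pose K := ('I_N * 'I_N * 'I_N)%type.
pose nd (k : K) := node d (nat_node k).
pose om (k : K) := piece d chi (nd k).
pose D (k : K) := divergence (Fld (om k)).
have cD k : continuous (D k) by exact: continuous_divergence.
have mD k : measurable_fun setT (D k) by exact: measurable_divergence.
(* The chosen fields are not known to have bounded divergence on R^3; only values on one cell enter,
   where continuity gives a bound. *)
have /choice[T HT] : forall k, exists T, forall x, cell d x -> `|D k x| <= T.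
  by move=> k; exact: continuous_cell_bounded.
have T0 k : 0 <= T k.
  apply: le_trans (HT k 0 _); first exact: normr_ge0.
  by apply/cellP => i; rewrite -(scale0r (0 : R3 R)) coordZ mul0r lexx.
have mcut j : measurable_fun setT (cutoff d j).
  by apply: continuous_measurable3; have [[c _] _] := Ck1_cutoff d j; exact: c.
have msl j : measurable_fun setT (slope d j).
  by apply: continuous_measurable3; exact: continuous_slope.
pose eps j := \int[vol3]_(x in cell d) (1 - cutoff d j x).
have Icut j : vol3.-integrable (cell d) (EFin \o (fun x => 1 - cutoff d j x)).
  apply: (@integrable_cell _ _ d0 _ 1); first by apply: measurable_funB => //; exact: (@measurable_cst _ _ (R3 R) R setT 1).
  move=> x; have /andP[a0 a1] := cutoff01 d j x.
  by rewrite ger0_norm ?subr_ge0// gerBl.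
have ceps : eps j @[j --> \oo] --> (0 : R).
  by apply: (@fine_cvg _ _ _ _ _ 0); exact: cvg_integral_cutoffC.
pose TT := \sum_k T k.
have TT0 : 0 <= TT by apply: sumr_ge0.
(* A single j must be large enough for the cutoff defect and also satisfy the slope bound, which is
   why that bound is available for arbitrarily large j. *)
have [j /ltW jeps jB] : exists2 j, TT * eps j < e &
    (\int[vol3]_(x in cell l) (indicator_of u x * slope d j x)%:E <= B%:E)%E.
  have : \forall j \near \oo, TT * eps j < e.
    have c : TT * eps j @[j --> \oo] --> TT * 0 by apply: cvgMr.
    by apply: (cvgr_lt _ c); rewrite mulr0.
  move=> [N0 _ HN0]; have [j jN jB] := slopeB N0.
  by exists j => //; exact: HN0.
apply: (le_trans _ (TV_torus_ge l0 mu u1 (PC j) (pP j) (P1 j))).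
rewrite lee_fin ler_pM2l//.
have [Mdiv HMdiv] := divergence_bounded l0 (PC j) (pP j).
have mdiv := measurable_divergence (PC j).
have mG : measurable_fun setT (fun x => chi x * divergence (Psi j) x) by exact: measurable_funM.
have mS : measurable_fun setT (fun x => chi x * slope d j x) by exact: measurable_funM.
have [Ms HMs] : exists M, forall x, `|slope d j x| <= M.
  apply: (periodic_bounded d0); first exact: continuous_slope.
  exact: slope_periodic.
have sl_node k x : slope d j (nd k + x) = slope d j x.
  by rewrite addrC; exact: (periodic_node _ _ (@slope_periodic R d j d0)).
have cut_node k x : cutoff d j (nd k + x) = cutoff d j x.
  by rewrite addrC; exact: (periodic_node _ _ (@cutoff_periodic R d d0 j)).
have Isub (f : R3 R -> R) : measurable_fun setT f ->
    (forall k, vol3.-integrable (cell d) (EFin \o (fun x => f (nd k + x)))) ->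
    \int[vol3]_(x in cell l) f x = \sum_k \int[vol3]_(x in cell d) f (nd k + x).
  move=> mf If; rewrite [LHS]/Rintegral lE (@integral_subcells R N d f d0 mf).
  rewrite -[RHS]/(fine (\sum_k \int[vol3]_(x in cell d) f (nd k + x))%:E); congr fine.
  rewrite -sumEFin; apply: eq_bigr => k _.
  exact/esym/(EFin_Rintegral mcd (If k)).
have IG k : vol3.-integrable (cell d) (EFin \o (fun x => chi (nd k + x) * divergence (Psi j) (nd k + x))).
  apply: (@integrable_cell _ _ d0 _ Mdiv); first exact: (measurable_shiftr (nd k) mG).
  move=> x; rewrite normrM; apply: le_trans (HMdiv (nd k + x)).
  by rewrite ler_piMl.
have integrable_on (f : R3 R -> R) (M : R) : measurable_fun setT f -> (forall x, cell d x -> `|f x| <= M) ->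
    vol3.-integrable (cell d) (EFin \o f).
  move=> mf fM; apply: measurable_bounded_integrable => //.
  - exact: vol3_cell_lty.
  - exact: measurable_funTS.
  - by exists M; split; [exact: num_real|move=> t Mt x cx; apply: (le_trans (fM x cx)); exact: ltW].
have IS k : vol3.-integrable (cell d) (EFin \o (fun x => chi (nd k + x) * slope d j (nd k + x))).
  apply: (@integrable_cell _ _ d0 _ Ms); first exact: (measurable_shiftr (nd k) mS).
  move=> x; rewrite normrM sl_node; apply: le_trans (HMs x).
  by rewrite ler_piMl.
have mom k : measurable_fun setT (om k) by exact: measurable_piece.
have omn k x : `|om k x| <= 1.
  have : om k x = 0 \/ om k x = 1 := piece01 d (nd k) chi1 x.
  by case=> ->; rewrite ?normr0 ?normr1.
have IoD k : vol3.-integrable (cell d) (EFin \o (fun x => om k x * D k x)).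
  apply: (@integrable_on _ (T k)); first exact: measurable_funM.
  by move=> x cx; rewrite normrM; apply: le_trans (HT k x cx); rewrite ler_piMl.
(* In one cell the glued divergence is the cutoff times the chosen divergence up to [slope], and
   replacing the cutoff by 1 costs at most [T k] times its defect. *)
have key k : \int[vol3]_x (om k x * D k x) - T k * eps j -
    \int[vol3]_(x in cell d) (chi (nd k + x) * slope d j (nd k + x)) <=
    \int[vol3]_(x in cell d) (chi (nd k + x) * divergence (Psi j) (nd k + x)).
  have -> : \int[vol3]_x (om k x * D k x) = \int[vol3]_(x in cell d) (om k x * D k x).
    rewrite [RHS]Rintegral_mkcond; apply: eq_Rintegral => x _; rewrite patchE.
    case: ifPn => // /negP; rewrite inE => nx.
    by rewrite (_ : om k x = 0) ?mul0r//; apply/eqP; apply: contrapT => /negP /piece_cell.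
  rewrite /eps -(RintegralZl (T k) mcd (Icut j)).
  have IT : vol3.-integrable (cell d) (EFin \o (fun x => T k * (1 - cutoff d j x))).
    have := integrableZl mcd (T k) (Icut j).
    by congr (integrable _ _ _).
  rewrite -(RintegralB mcd (IoD k) IT).
  have IB : vol3.-integrable (cell d) (EFin \o (fun x => om k x * D k x - T k * (1 - cutoff d j x))).
    have := integrableB mcd (IoD k) IT.
    by congr (integrable _ _ _).
  rewrite -(RintegralB mcd IB (IS k)).
  have IB2 : vol3.-integrable (cell d) (EFin \o (fun x => om k x * D k x - T k * (1 - cutoff d j x) -
      chi (nd k + x) * slope d j (nd k + x))).
    have := integrableB mcd IB (IS k).
    by congr (integrable _ _ _).
  apply: (le_Rintegral mcd IB2 (IG k)) => x cx.
  have := Pdiv j (nd k + x); rewrite floor_node// Fdiv -/(nd k) scale1r addKr -/(om k) -/(D k) cut_node.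
  have -> : om k x = chi (nd k + x) by rewrite /om /piece indicE mem_set// mulr1.
  have /andP[c0 c1] := cutoff01 d j x.
  have := HT k x cx; have /andP[a0 a1] := chi01 (nd k + x).
  move: (chi _) (slope _ _ _) (divergence _ _) (D k x) (cutoff _ _ _) (T k) a0 a1 c0 c1.
  move=> c s v w q t a0 a1 q0 q1 /[!ler_norml] /andP[w1 w2] /andP[v1 v2].
  have h1 : c * (q * w - s) <= c * v by rewrite ler_wpM2l//; lra.
  have h2 : c * ((1 - q) * w) <= t * (1 - q).
    apply: (@le_trans _ _ (c * ((1 - q) * t))).
      by rewrite ler_wpM2l// ler_wpM2l// subr_ge0.
    rewrite mulrC [t * _]mulrC ler_piMr// mulr_ge0 ?subr_ge0//; lra.
  by move: h1 h2; rewrite !mulrBr !mulrBl !mul1r; lra.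
have Hsum : \sum_k (\int[vol3]_x (om k x * D k x)) - TT * eps j - B <=
    \int[vol3]_(x in cell l) (chi x * divergence (Psi j) x).
  rewrite (Isub _ mG IG).
  apply: (le_trans _ (ler_sum _ (fun k _ => key k))).
  rewrite !sumrB -mulr_suml lerD2l lerN2 -(Isub _ mS IS) -lee_fin.
  apply: le_trans jB; rewrite (EFin_Rintegral mcl); first exact: lexx.
  apply: (@integrable_cell _ _ l0 _ Ms mS) => x.
  by rewrite normrM; apply: le_trans (HMs x); rewrite ler_piMl.
have mk k : mass (om k) = (\int[vol3]_x om k x)%:E.
  have I := integrable_supported d0 (mom k) (omn k) (fun x hx => piece_cell hx).
  exact/esym/(EFin_Rintegral measurableT I).
have pvE : phase_volume l u = \sum_k \int[vol3]_x om k x.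
  rewrite /phase_volume (Isub _ mchi); last first.
    move=> k; apply: (@integrable_cell _ _ d0 _ 1); first exact: (measurable_shiftr (nd k) mchi).
    by move=> x; exact: chin.
  apply: eq_bigr => k _; rewrite [RHS]Rintegral_mkcond Rintegral_mkcond.
  apply: eq_Rintegral => x _; rewrite !patchE /om /piece indicE in_setT.
  by case: ifPn => _; rewrite ?mulr1 ?mulr0.
apply: (le_trans _ Hsum).
have bk k : f'' * (\int[vol3]_x om k x) / r - C k / (8 * pi) / r ^+ 3 <= \int[vol3]_x (om k x * D k x).
  apply: Fbound => //; [exact: piece01|by move=> x; exact: piece_cell|exact: cE].
have : \sum_k (f'' * (\int[vol3]_x om k x) / r - C k / (8 * pi) / r ^+ 3) <=
    \sum_k (\int[vol3]_x (om k x * D k x)) by apply: ler_sum => k _; exact: bk.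
rewrite sumrB -!mulr_suml -mulr_sumr -pvE.
move: jeps; move: (f'' * _ / r - _ / (8 * pi) / r ^+ 3) (\sum_k \int[vol3]_x (om k x * D k x)) (TT * eps j).
by move=> p q s; clear; lra.
Qed.

End TorusLower.

(** * Upper bound for the self-energy *)

Section SelfEnergyUpper2.
Context {R : realType}.
Local Notation vol3 := (@vol3 R).
Implicit Types (x y z s : R3 R) (i : 'I_3) (f g h om chi : R3 R -> R).
Variables (kappa l : R).
Hypotheses (kappa_gt0 : 0 < kappa) (l_gt0 : 0 < l).

Lemma measurable_origin : measurable [set (0 : R3 R)].
Proof.
have -> : [set (0 : R3 R)] = [set z | sqn z <= 0].
  apply/seteqP; split => z /=; first by move=> ->; rewrite sqnE/= expr0n/= !addr0.
  by move=> h; apply: sqn_eq0; apply/eqP; rewrite eq_le h sqn_ge0.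
rewrite -[X in measurable X]setTI.
have := (@measurable_sqn R) measurableT `]-oo, 0]%classic (measurable_itv _).
by congr (measurable (_ `&` _)); apply/seteqP; split => z /=; rewrite in_itv.
Qed.

(** At the origin the Yukawa kernel is infinite while 1/|z| is read as 0, so the pointwise
    comparison fails there, on a null set. *)
Lemma ge0_le_integral_off0 (F G : R3 R -> \bar R) : measurable_fun setT F -> measurable_fun setT G ->
  (forall z, 0 <= F z)%E -> (forall z, 0 <= G z)%E -> (forall z, z != 0%R -> F z <= G z)%E ->
  (\int[vol3]_z F z <= \int[vol3]_z G z)%E.
Proof.
move=> mF mG F0 G0 FG; have m0 := measurable_origin.
have n0 := vol3_set1 (0 : R3 R).
rewrite (ge0_negligible_integral m0 measurableT mF (fun z _ => F0 z) n0).
rewrite (ge0_negligible_integral m0 measurableT mG (fun z _ => G0 z) n0).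
apply: ge0_le_integral.
- exact: measurableD.
- by move=> z _; exact: F0.
- exact: measurable_funTS.
- exact: measurable_funTS.
- by move=> z [_ /eqP zn0]; exact: FG.
Qed.

(** A displacement between two points of the periodic set either stays in one copy, where the Newton
    kernel dominates, or is far; support in a half cell leaves no third case. The far potential is
    O(Om) by [far_potential_le], and integrating it over the set gives Om^2. *)
Lemma self_energy_upper chi om Om : measurable_fun setT chi -> (forall x, 0 <= chi x <= 1) ->
  periodic l chi -> (forall x, om x = chi x * \1_(cell l) x) ->
  (forall x, om x != 0 -> cell (l / 2) x) ->
  (\int[vol3]_(x in cell l) (chi x)%:E = Om%:E)%E ->
  ((\int[vol3]_(x in cell l) (chi x * rresolve kappa chi x))%:E <=
   (1 / (4 * pi))%:E * coulomb om + (1000 * kappa ^- 2 * Om ^+ 2 / l ^+ 3)%:E)%E.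
Proof.
move=> mchi c01 pchi omE oms IOm; have mc := @measurable_cell R l.
have c0 x : 0 <= chi x by have /andP[] := c01 x.
rewrite -(cell_resolve_rresolve kappa_gt0 l_gt0)//.
have mo : measurable_fun setT om.
  have -> : om = (fun x => chi x * \1_(cell l) x) by apply/funext.
  by apply: measurable_funM => //; exact: measurable_indic.
have o0 x : 0 <= om x by rewrite omE mulr_ge0.
have Om0 : 0 <= Om by rewrite -lee_fin -IOm; apply: integral_ge0 => y _; rewrite lee_fin.
pose D := 1000 * kappa ^- 2 * Om / l ^+ 3.
have D0 : 0 <= D.
  apply: divr_ge0; last by apply: exprn_ge0; exact: ltW.
  apply: (mulr_ge0 _ Om0); apply: mulr_ge0; first exact: ler0n.
  by rewrite invr_ge0; exact: sqr_ge0.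
have p0 : 0 <= 1 / (4 * pi) :> R by apply: divr_ge0 => //; rewrite mulr_ge0// pi_ge0.
have far0 z : 0 <= far l z by rewrite /far indicE.
pose J x := (\int[vol3]_z (om x * om (x + z) / enorm z)%:E)%E.
have mJ : measurable_fun setT (fun xz : R3 R * R3 R => (om xz.1 * om (xz.1 + xz.2) / enorm xz.2)%:E).
  apply/measurable_EFinP; apply: measurable_funM.
    apply: measurable_funM; first by apply: (measurableT_comp mo); exact: measurable_fst.
    exact: (measurableT_comp mo (@measurable_add3 R)).
  apply: (measurableT_comp (@measurable_inv R)); apply: (measurableT_comp (@measurable_enorm R)).
  exact: measurable_snd.
have J0 xz : (0 <= (om xz.1 * om (xz.1 + xz.2) / enorm xz.2)%:E)%E.
  by rewrite lee_fin divr_ge0 ?sqrtr_ge0// mulr_ge0.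
have mI : measurable_fun setT J := @measurable_fun_fubini_tonelli_F _ _ _ _ R vol3 _ mJ J0.
have I0 x : (0 <= J x)%E by apply: integral_ge0 => z _; exact: (J0 (x, z)).
have meo : measurable_fun setT (fun x => (om x)%:E) by exact/measurable_EFinP.
have IOm' : (\int[vol3]_x (om x)%:E = Om%:E)%E.
  rewrite -IOm [RHS]integral_mkcond; apply: eq_integral => x _.
  by rewrite patchE omE indicE; case: ifPn => _; rewrite ?mulr1 ?mulr0.
have -> : (1000 * kappa ^- 2 * Om ^+ 2 / l ^+ 3)%:E = (\int[vol3]_x (D%:E * (om x)%:E))%E.
  rewrite (ge0_integralZl vol3 measurableT meo); [|by move=> x _; rewrite lee_fin|by rewrite lee_fin].
  by rewrite IOm' -EFinM; congr EFin; rewrite /D; move: (1000 * kappa ^- 2) => K; ring.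
rewrite coulomb_shift// -(ge0_integralZl vol3 measurableT mI (fun x _ => I0 x)); last by rewrite lee_fin.
have mA : measurable_fun setT (fun x => ((1 / (4 * pi))%:E * J x)%E).
  by apply: emeasurable_funM => //; exact: measurable_cst.
have mB : measurable_fun setT (fun x => (D%:E * (om x)%:E)%E).
  by apply: emeasurable_funM => //; exact: measurable_cst.
have A0 x : (0 <= (1 / (4 * pi))%:E * J x)%E by apply: mule_ge0 => //; rewrite lee_fin.
have B0 x : (0 <= D%:E * (om x)%:E)%E by apply: mule_ge0 => //; rewrite lee_fin.
rewrite -(ge0_integralD vol3 measurableT (fun x _ => A0 x) mA (fun x _ => B0 x) mB).
rewrite [leLHS]integral_mkcond; apply: ge0_le_integral => //.
- move=> x _; rewrite patchE; case: ifP => // _; apply: mule_ge0; first by rewrite lee_fin.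
  exact: resolve_ge0.
- apply/(measurable_restrictT _ mc); apply: measurable_funTS; apply: emeasurable_funM.
    exact/measurable_EFinP.
  exact: measurable_resolve.
- exact: emeasurable_funD.
move=> x _; rewrite patchE; case: ifPn => xc; last by apply: adde_ge0.
have oxE : om x = chi x by rewrite omE indicE xc mulr1.
have [ox0|ox0] := eqVneq (om x) 0.
  by rewrite -oxE ox0 mul0e; apply: adde_ge0 => //; rewrite -ox0.
have mx := measurable_coulomb_inner x mo.
have mfx : measurable_fun setT (fun z => (yukawa kappa z * (far l z * chi (x + z))%:E)%E).
  apply: emeasurable_funM; first exact: measurable_yukawa.
  by apply/measurable_EFinP; apply: measurable_funM; [exact: measurable_far|exact: measurable_shiftr].
have mrx : measurable_fun setT (fun z => (yukawa kappa z * (chi (x + z))%:E)%E).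
  apply: emeasurable_funM; first exact: measurable_yukawa.
  by apply/measurable_EFinP; exact: measurable_shiftr.
have F0 z : (0 <= yukawa kappa z * (far l z * chi (x + z))%:E)%E.
  by apply: mule_ge0; [exact: yukawa_ge0|rewrite lee_fin mulr_ge0].
have R0 z : (0 <= yukawa kappa z * (chi (x + z))%:E)%E.
  by apply: mule_ge0; [exact: yukawa_ge0|rewrite lee_fin].
apply: (@le_trans _ _ ((1 / (4 * pi))%:E * J x +
   (om x)%:E * \int[vol3]_z (yukawa kappa z * (far l z * chi (x + z))%:E))%E); last first.
  apply: leeD => //; rewrite muleC; apply: lee_wpmul2r; first by rewrite lee_fin.
  exact: far_potential_le.
rewrite -oxE /resolve /J.
rewrite -(ge0_integralZl vol3 measurableT mrx (fun z _ => R0 z)); last by rewrite lee_fin.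
rewrite -(ge0_integralZl vol3 measurableT mfx (fun z _ => F0 z)); last by rewrite lee_fin.
rewrite -(ge0_integralZl vol3 measurableT mx (fun z _ => J0 (x, z))); last by rewrite lee_fin.
have mx' : measurable_fun setT (fun z => ((1 / (4 * pi))%:E * (om x * om (x + z) / enorm z)%:E)%E).
  by apply: emeasurable_funM => //; exact: measurable_cst.
have mfx' : measurable_fun setT (fun z => ((om x)%:E * (yukawa kappa z * (far l z * chi (x + z))%:E))%E).
  by apply: emeasurable_funM => //; exact: measurable_cst.
have mrx' : measurable_fun setT (fun z => ((om x)%:E * (yukawa kappa z * (chi (x + z))%:E))%E).
  by apply: emeasurable_funM => //; exact: measurable_cst.
have x'0 z : (0 <= (1 / (4 * pi))%:E * (om x * om (x + z) / enorm z)%:E)%E.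
  by apply: mule_ge0; [rewrite lee_fin|exact: (J0 (x, z))].
have f'0 z : (0 <= (om x)%:E * (yukawa kappa z * (far l z * chi (x + z))%:E))%E.
  by apply: mule_ge0; [rewrite lee_fin|].
have r'0 z : (0 <= (om x)%:E * (yukawa kappa z * (chi (x + z))%:E))%E.
  by apply: mule_ge0; [rewrite lee_fin|].
rewrite -(ge0_integralD vol3 measurableT (fun z _ => x'0 z) mx' (fun z _ => f'0 z) mfx').
apply: ge0_le_integral_off0.
- exact: mrx'.
- exact: emeasurable_funD.
- exact: r'0.
- by move=> z; apply: adde_ge0; [exact: x'0|exact: f'0].
move=> z zn0.
have zp : 0 < sqn z.
  rewrite lt_neqAle sqn_ge0 andbT eq_sym; apply: contra zn0 => /eqP h.
  by apply/eqP; exact: sqn_eq0.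
have [zc|zc] := boolP (x + z \in cell l).
  have -> : om (x + z) = chi (x + z) by rewrite omE indicE zc mulr1.
  apply: (@le_trans _ _ ((1 / (4 * pi))%:E * (om x * chi (x + z) / enorm z)%:E)%E); last first.
    by rewrite leeDl.
  rewrite -EFinM.
  apply: (@le_trans _ _ ((om x)%:E * ((1 / (4 * pi) / enorm z)%:E * (chi (x + z))%:E))%E); last first.
    by rewrite -!EFinM lee_fin le_eqVlt; apply/orP; left; apply/eqP; ring.
  apply: lee_wpmul2l; first by rewrite lee_fin.
  by apply: lee_wpmul2r; [rewrite lee_fin|exact: yukawa_le_newton (ltW kappa_gt0) zp].
apply: (@le_trans _ _ ((om x)%:E * (yukawa kappa z * (far l z * chi (x + z))%:E))%E); last first.
  by rewrite leeDr.
have [c00|cn0] := eqVneq (chi (x + z)) 0; first by rewrite c00 mulr0 mule0.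
suff -> : far l z = 1 by rewrite mul1r.
have wc : cell (l / 2) (wrap l (x + z)).
  have wcl : cell l (wrap l (x + z)) by exact: cell_wrap.
  by apply: oms; rewrite omE indicE (mem_set wcl) mulr1 (periodic_wrap _ pchi).
rewrite /far indicE mem_set//= => nearz.
have /cellP xh := oms x ox0; have /cellP wh := wc.
move/negP: zc; apply; apply/mem_set/cellP => i.
have /andP[x1 x2] := xh i; have := nearz i; rewrite ltr_norml => /andP[z1 z2].
have /andP[w1 w2] := wh i.
move: w1 w2; rewrite /wrap coordD coordN.
have [k ->] : exists k : int, coord (node l (lattice_floor l (x + z))) i = l * k%:~R.
  by elim/ord3_ind: i {x1 x2 z1 z2}; rewrite coordE; eexists.
rewrite !coordD => w1 w2.
(* Both x and the wrapped point have coordinates in [0, l/2) and |z_i| < l/2, so the lattice shift l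
   k lies strictly between - l and l. Hence k = 0, and x + z was in the cell already. *)
have k1 : (k < 1)%R.
  rewrite -(ltr_int R) -(ltr_pM2l l_gt0) mulr1; move: w1 x2 z2; lra.
have k2 : (-1 < k)%R.
  by rewrite -(ltr_int R) -(ltr_pM2l l_gt0) intrN mulrN mulr1; move: w2 x1 z1; lra.
have k0 : k = 0 by apply/eqP; rewrite eq_le -ltzD1 add0r k1 -ltzD1/= -(ltrD2r (-1)) addrK add0r k2.
by move: w1 w2; rewrite k0 mulr0 subr0 => -> /= /lt_le_trans; apply; move: l_gt0; lra.
Qed.

End SelfEnergyUpper2.

(** * Subcritical case: any positive phase costs energy *)

Section BelowThreshold.
Context {R : realType}.
Local Notation vol3 := (@vol3 R).
Implicit Types (x y z a b : R3 R) (i : 'I_3) (f g h om chi u : R3 R -> R) (phi : R3 R -> R3 R).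
Variables (sigma kappa l : R).
Hypotheses (sigma_gt0 : 0 < sigma) (kappa_gt0 : 0 < kappa) (l_gt0 : 0 < l).

Lemma TV_torus_shift_le u a : measurable_fun setT u -> periodic l u ->
  (TV_torus l (fun x => u (a + x)%R) <= TV_torus l u)%E.
Proof.
move=> mu pu; apply: ge_ereal_sup => _ [phi [pp C1 p1] <-].
have [C1' D'] := C1_field_affine (- a) 1 C1.
apply: ereal_sup_ubound; exists (fun x => phi (- a + 1 *: x)).
  by split=> // i x; rewrite !scale1r addrA pp.
pose g x := (u x * divergence (fun x => phi (- a + 1 *: x)) x)%:E.
have mg : measurable_fun setT g.
  by apply/measurable_EFinP; apply: measurable_funM => //; exact: measurable_divergence.
have pg : periodic l g.
  by move=> i x; rewrite /g pu !D' !scale1r addrA (periodic_divergence pp).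
have := integral_cell_shift a l_gt0 mg pg.
rewrite -/g => <-; apply: eq_integral => x _.
by rewrite /g D' mul1r scale1r addKr.
Qed.

Lemma rresolve_shift h a x : rresolve kappa (fun y => h (a + y)) x = rresolve kappa h (a + x).
Proof. exact: (congr1 fine (resolve_shift kappa h a x)). Qed.

Lemma phase_volume_shift u a : measurable_fun setT u -> periodic l u ->
  phase_volume l (fun x => u (a + x)) = phase_volume l u.
Proof.
move=> mu pu; rewrite /phase_volume /Rintegral; congr fine.
have me : measurable_fun setT (fun x => (indicator_of u x)%:E).
  by apply/measurable_EFinP; exact: measurable_indicator_of.
have pe : periodic l (fun x => (indicator_of u x)%:E).
  by move=> i x; rewrite /indicator_of pu.
exact: (integral_cell_shift a l_gt0 me pe).
Qed.

Lemma indicator_of_bounds u : (forall x, u x = -1 \/ u x = 1) -> forall x, 0 <= indicator_of u x <= 1.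
Proof. by move=> u1 x; have [->|->] := indicator_of01 u1 x; rewrite lexx ler01. Qed.

Lemma periodic_indicator_of u : periodic l u -> periodic l (indicator_of u).
Proof. by move=> pu i x; rewrite /indicator_of pu. Qed.

Lemma self_energy_shift u a : measurable_fun setT u -> periodic l u ->
  (forall x, u x = -1 \/ u x = 1) ->
  self_energy kappa l (fun x => u (a + x)) = self_energy kappa l u.
Proof.
move=> mu pu u1; have mi := measurable_indicator_of mu.
have i0 x : 0 <= indicator_of u x by have /andP[] := indicator_of_bounds u1 x.
pose g x := (indicator_of u x * rresolve kappa (indicator_of u) x)%:E.
have me : measurable_fun setT g.
  apply/measurable_EFinP; apply: measurable_funM => //; exact: measurable_rresolve.
have pe : periodic l g.
  move=> i x; rewrite /g (periodic_indicator_of pu).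
  by rewrite (periodic_rresolve kappa (periodic_indicator_of pu)).
have E := congr1 fine (integral_cell_shift a l_gt0 me pe).
transitivity (\int[vol3]_(x in cell l) (indicator_of u (a + x) * rresolve kappa (indicator_of u) (a + x))).
  apply: eq_Rintegral => x _; rewrite -(rresolve_shift (indicator_of u) a x).
  reflexivity.
exact: E.
Qed.

Lemma phase_volumeE u : measurable_fun setT u -> (forall x, u x = -1 \/ u x = 1) ->
  (\int[vol3]_(x in cell l) (indicator_of u x)%:E = (phase_volume l u)%:E)%E.
Proof.
move=> mu u1; apply/esym/(EFin_Rintegral (@measurable_cell R l)).
apply: (@integrable_cell _ _ l_gt0 _ 1 (measurable_indicator_of mu)) => x.
by have /andP[a0 a1] := indicator_of_bounds u1 x; rewrite ger0_norm.
Qed.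

Lemma phase_volume_ge0 u : (forall x, u x = -1 \/ u x = 1) -> 0 <= phase_volume l u.
Proof.
move=> u1; apply: fine_ge0; apply: integral_ge0 => x _; rewrite lee_fin.
by have /andP[] := indicator_of_bounds u1 x.
Qed.

Lemma self_energy_ge0 u : measurable_fun setT u -> (forall x, u x = -1 \/ u x = 1) ->
  0 <= self_energy kappa l u.
Proof.
move=> mu u1; apply: fine_ge0; apply: integral_ge0 => x _; rewrite lee_fin.
have /andP[a0 _] := indicator_of_bounds u1 x.
have /andP[b0 _] := rresolve_bound kappa_gt0 x (measurable_indicator_of mu) (indicator_of_bounds u1).
by rewrite mulr_ge0.
Qed.

(** The factor theta lost in the kernel is given up in the perimeter as well, so that the Coulomb
    energies of the pieces cancel exactly between the two lower bounds. What remains is theta f''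
    per unit of rescaled volume, less 6 theta r / d for the cuts; g is room for strictness. *)
Lemma energy_gap u (eps m r d theta f' f'' g : R) (N : nat) :
  0 < d -> l = N%:R * d -> 0 < r -> (f'%:E <= @f_star R)%E -> f'' < f' ->
  0 < theta <= 1 -> 0 < g -> eps * sigma = 4 * r ^+ 3 ->
  m * kappa ^- 2 <= 2 * r ^+ 2 * (theta * f'' - 6 * theta * r / d - g) ->
  (forall z, 0 < sqn z <= 3 * d ^+ 2 ->
    ((theta / (4 * pi) / enorm z)%:E <= yukawa kappa z)%E) ->
  measurable_fun setT u -> periodic l u -> (forall x, u x = -1 \/ u x = 1) ->
  0 < phase_volume l u ->
  ((m ^+ 2 * kappa ^- 2 * l ^+ 3 / 2)%:E < energy sigma kappa l (m - 1) eps u)%E.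
Proof.
move=> d0 lE r0 ff f2 /andP[t0 t1] g0 er gap nb mu pu u1 Om0.
set Om := phase_volume l u in Om0 *.
pose chi := indicator_of u.
have mchi : measurable_fun setT chi by exact: measurable_indicator_of.
have c01 := indicator_of_bounds u1.
have c0 x : 0 <= chi x by have /andP[] := c01 x.
have pchi : periodic l chi by exact: periodic_indicator_of.
(* Of this size, the two slacks together cost theta r^2 Om g, against the 4 r^2 Om g that the
   hypothesis on m sets aside. *)
pose e1 := Om * g / (8 * r).
have e10 : 0 < e1 by rewrite divr_gt0 ?mulr_gt0.
have V0 : 0 < d ^+ 3 by rewrite exprn_gt0.
have msl j : measurable_fun setT (slope d j).
  by apply: continuous_measurable3; exact: continuous_slope.
have [a _ Ha] := slice d0 V0 e10 (@measurable_cell R d) (fun x hx => hx) (vol3_cell (ltW d0))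
  (@measurable_cell R l) mchi c0 (phase_volumeE mu u1).
(* Translating u instead of the cutoffs keeps the grid on the lattice of step d. *)
pose ua x := u (- a + x).
have mua : measurable_fun setT ua by exact: measurable_shiftr.
have pua : periodic l ua by exact: periodic_shift.
have ua1 x : ua x = -1 \/ ua x = 1 by exact: u1.
have ca01 := indicator_of_bounds ua1.
have psl j : periodic l (slope d j).
  move=> i x; rewrite lE mulrC -[N%:R]pmulrn.
  exact: (periodic_int i (N : int) x (@slope_periodic R d j d0)).
have slopeB N0 : exists2 j, (N0 <= j)%N &
    (\int[vol3]_(x in cell l) (indicator_of ua x * slope d j x)%:E <= (6 * d ^+ 2 * Om / d ^+ 3 + e1)%:E)%E.
  have [j jN jB] := Ha N0; exists j => //; apply: le_trans jB.
  pose q x := (chi x * slope d j (x + a))%:E.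
  have mq : measurable_fun setT q.
    apply/measurable_EFinP; apply: measurable_funM => //.
    exact: measurable_shiftl.
  have q0 x : (0 <= q x)%E by rewrite lee_fin mulr_ge0// slope_ge0.
  have pq : periodic l q by move=> i x; rewrite /q pchi addrAC psl.
  have := ge0_integral_cell_shift (- a) l_gt0 mq q0 pq.
  rewrite -/q => <-; rewrite le_eqVlt; apply/orP; left; apply/eqP; apply: eq_integral => x _.
  by rewrite /q addrAC addNr add0r.
have SL := self_energy_lower kappa_gt0 l_gt0 (ltW t0) d0 lE (measurable_indicator_of mua) ca01 nb.
have pi0 := pi_gt0 R.
have tp : 0 < theta / (4 * pi) by rewrite divr_gt0// mulr_gt0.
pose X (k : 'I_N * 'I_N * 'I_N) := coulomb (piece d (indicator_of ua) (node d (nat_node k))).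
have piece_ge0 k x : 0 <= piece d (indicator_of ua) (node d (nat_node k)) x.
  by rewrite mulr_ge0//; have /andP[] := ca01 (node d (nat_node k) + x).
have X0 k : (0 <= X k)%E by apply: coulomb_ge0; exact: piece_ge0.
(* Finiteness of the Coulomb energy of a piece comes from the self-energy bound itself, whose
   right-hand side is a real number. *)
have XE k : X k = (fine (X k))%:E.
  rewrite fineK// ge0_fin_numE// ltNge leye_eq; apply/negP => /eqP Xk.
  have : ((theta / (4 * pi))%:E * X k <= (self_energy kappa l ua)%:E)%E.
    apply: le_trans SL; rewrite (bigD1 k)//= leeDl//; apply: sume_ge0 => k' _.
    by apply: mule_ge0; [rewrite lee_fin ltW|exact: X0].
  by rewrite Xk gt0_muley ?lte_fin// leye_eq.
pose C k := fine (X k).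
have SLr : theta / (4 * pi) * \sum_k C k <= self_energy kappa l ua.
  rewrite -lee_fin mulr_sumr -sumEFin; apply: le_trans SL.
  by apply: lee_sum => k _; rewrite EFinM /C -XE.
have TL := torus_lower l_gt0 d0 lE r0 ff f2 e10 mua pua ua1 XE slopeB.
have {}TL := le_trans TL (TV_torus_shift_le (- a) mu pu).
have T0 := TV_torus_ge0 l_gt0 mu u1.
rewrite (energyE kappa_gt0 l_gt0 sigma eps m mu pu u1) -/Om.
move: SLr TL; rewrite phase_volume_shift// -/Om self_energy_shift//.
move: (self_energy kappa l u) (\sum_k C k) => Q S SLr TL.
have er0 : 0 < eps * sigma / 2 by rewrite er divr_gt0// mulr_gt0// exprn_gt0.
case: (TV_torus l u) T0 TL => [T| |] //; last first.
  by rewrite gt0_muley ?lte_fin// addye// ltry.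
rewrite !lee_fin => T0 TL; rewrite -EFinM -EFinD lte_fin er.
have gapO := ler_wpM2r (ltW Om0) gap.
pose P := S / (8 * pi).
have SP : theta / (4 * pi) * S = 2 * (theta * P).
  by rewrite /P; move: (pi : R) (lt0r_neq0 pi0) => p pn0; field.
have tT : theta * (2 * (f'' * Om / r - P / r ^+ 3 - (6 * d ^+ 2 * Om / d ^+ 3 + e1) - e1)) <= T.
  apply: (@le_trans _ _ (theta * T)); first by rewrite ler_pM2l.
  by rewrite ler_piMl.
have r30 : 0 <= 2 * r ^+ 3 by rewrite mulr_ge0// exprn_ge0// ltW.
have hT := ler_wpM2l r30 tT.
have E1 : 2 * r ^+ 3 * (theta * (2 * (f'' * Om / r - P / r ^+ 3 - (6 * d ^+ 2 * Om / d ^+ 3 + e1) - e1))) =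
    4 * (r ^+ 2 * (theta * f'') * Om) - 4 * (theta * P) - 4 * (r ^+ 2 * (6 * theta * r / d) * Om)
    - theta * (r ^+ 2 * Om * g).
  by rewrite /e1; field; rewrite !gt_eqF.
have E2 : 2 * r ^+ 2 * (theta * f'' - 6 * theta * r / d - g) * Om =
    2 * (r ^+ 2 * (theta * f'') * Om) - 2 * (r ^+ 2 * (6 * theta * r / d) * Om) - 2 * (r ^+ 2 * Om * g).
  by ring.
have G0 : 0 < r ^+ 2 * Om * g by rewrite !mulr_gt0// exprn_gt0.
have tG : theta * (r ^+ 2 * Om * g) <= r ^+ 2 * Om * g by rewrite ler_piMl// ltW.
have E3 : 4 * r ^+ 3 / 2 * T = 2 * r ^+ 3 * T by field.
have E4 : 2 * m * kappa ^- 2 * Om = 2 * (m * kappa ^- 2 * Om) by ring.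
move: SLr hT gapO; rewrite SP E1 E2 E3 E4.
move: (2 * r ^+ 3 * T) (theta * P) (r ^+ 2 * (theta * f'') * Om) (r ^+ 2 * (6 * theta * r / d) * Om)
  (theta * (r ^+ 2 * Om * g)) (r ^+ 2 * Om * g) (m * kappa ^- 2 * Om) (m ^+ 2 * kappa ^- 2 * l ^+ 3 / 2) G0 tG.
move=> *; lra.
Qed.

(** The phase is null in one cell, and R^3 is covered by countably many lattice translates of that
    cell. *)
Lemma phase_volume0_ae u : measurable_fun setT u -> periodic l u ->
  (forall x, u x = -1 \/ u x = 1) -> phase_volume l u = 0 -> {ae vol3, forall x, u x = -1}.
Proof.
move=> mu pu u1 Om0; have mc := @measurable_cell R l.
have mi := measurable_indicator_of mu.
pose S := [set x | indicator_of u x != 0].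
have mS : measurable S.
  have -> : S = indicator_of u @^-1` (~` [set 0]).
    by apply/seteqP; split => x /=; [move=> /eqP|move=> h; apply/eqP].
  by rewrite -[X in measurable X]setTI; apply: mi => //; apply: measurableC; exact: measurable_set1.
have Scell : vol3 (S `&` cell l) = 0%E.
  have := phase_volumeE mu u1; rewrite Om0 => H.
  rewrite -integral_indic//; rewrite -[RHS]H.
  apply: eq_integral => x _; congr EFin; rewrite indicE.
  have [h|h] := indicator_of01 u1 x; rewrite h.
    have -> : (x \in S) = false by apply/negP => /set_mem; rewrite /S/= h eqxx.
    by [].
  by have -> : (x \in S) = true by apply/mem_set; rewrite /S/= h oner_neq0.
pose W (n : nat) : set (R3 R) := if unpickle n is Some k then
  affine3 (- node l (k : int * int * int)) 1 @^-1` (S `&` cell l) else set0.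
have WN n : vol3.-negligible (W n).
  rewrite /W; case: unpickle => [k|]; last exact: negligible_set0.
  have mSc : measurable (S `&` cell l) by exact: measurableI.
  exists (affine3 (- node l k) 1 @^-1` (S `&` cell l)); split => //.
    by have := measurable_affine3 (- node l k) (1 : R) measurableT mSc; rewrite setTI.
  by rewrite [LHS](vol3_affine (- node l k) (oner_neq0 R) mSc) Scell mule0.
apply: (negligibleS _ (negligible_bigcup WN)) => x /= ux.
exists (pickle (lattice_floor l x)); first by [].
rewrite /W pickleK.
have E : affine3 (- node l (lattice_floor l x)) 1 x = wrap l x.
  by rewrite affine3E scale1r addrC.
rewrite /preimage/= E; split; last exact: cell_wrap.
rewrite /S/= (periodic_wrap _ (periodic_indicator_of pu)).
have [h|h] := u1 x; first by case: ux.
by rewrite /indicator_of h; apply/eqP => h'; move: h'; lra.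
Qed.

Lemma admissible_minus1 : admissible l (fun _ : R3 R => -1).
Proof.
have m1 : measurable_fun setT (fun _ : R3 R => -1 : R) by exact: (@measurable_cst _ _ (R3 R) R setT (-1)).
split; last by left.
split => //; last by rewrite TV_torus_minus1// ltry.
by apply: (@integrable_cell _ _ l_gt0 _ 1 m1) => x; rewrite normrN normr1.
Qed.

Lemma energy_minus1 (eps m : R) :
  energy sigma kappa l (m - 1) eps (fun _ : R3 R => -1) = (m ^+ 2 * kappa ^- 2 * l ^+ 3 / 2)%:E.
Proof.
have m1 : measurable_fun setT (fun _ : R3 R => -1 : R) by exact: (@measurable_cst _ _ (R3 R) R setT (-1)).
rewrite (energyE kappa_gt0 l_gt0)//; last by left.
rewrite TV_torus_minus1// mule0 add0e; congr EFin.
have -> : phase_volume l (fun _ : R3 R => -1) = 0.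
  by rewrite /phase_volume /Rintegral integral0_eq// => x _; rewrite /indicator_of subrr mul0r.
have -> : self_energy kappa l (fun _ : R3 R => -1) = 0.
  by rewrite /self_energy /Rintegral integral0_eq// => x _; rewrite {1}/indicator_of subrr !mul0r.
by rewrite !mulr0 subrr add0r.
Qed.

(** Every function with positive phase volume has strictly larger energy than -1, uniformly for r <
    r0; a minimizer therefore has phase volume zero. The side d comes from the kernel comparison,
    and only afterwards is r bounded in terms of d. *)
Lemma unique_minimizer_below (c f' : R) : 0 < c -> c < f' -> (f'%:E <= @f_star R)%E ->
  exists2 r0 : R, 0 < r0 & forall eps m r, 0 < r < r0 -> eps * sigma = 4 * r ^+ 3 ->
    m * kappa ^- 2 = 2 * r ^+ 2 * c ->
    unique_minimizer (admissible l) (energy sigma kappa l (m - 1) eps) (fun _ => -1).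
Proof.
move=> c0 cf ff.
pose f'' := (c + f') / 2.
have f20 : 0 < f'' by rewrite /f''; lra.
have f2 : f'' < f' by rewrite /f''; lra.
(* With this choice theta f'' is the midpoint of c and f'', still above c; half of the excess is
   g. *)
pose theta := (c / f'' + 1) / 2.
have q1 : c / f'' < 1 by rewrite ltr_pdivrMr// mul1r /f''; lra.
have q0 : 0 < c / f'' by rewrite divr_gt0.
have t1 : theta < 1 by rewrite /theta; lra.
have t0 : 0 < theta by rewrite /theta; lra.
have tf : theta * f'' = (c + f'') / 2 by rewrite /theta; field; rewrite gt_eqF.
pose g := (theta * f'' - c) / 2.
have g0 : 0 < g by rewrite /g tf /f''; lra.
have [d1 d10 nb] := yukawa_ge_newton kappa_gt0 t1.
(* The side d must divide l, and 2 d <= d1 covers the diameter of a cell, which is d times the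
   square root of 3. *)
pose N := (Num.truncn (2 * l / d1)).+1.
pose d := l / N%:R.
have N0 : 0 < N%:R :> R by rewrite ltr0n.
have d0 : 0 < d by rewrite divr_gt0.
have lE : l = N%:R * d by rewrite /d mulrC divfK// gt_eqF.
have dd : 2 * d <= d1.
  have := truncnS_gt (2 * l / d1); rewrite -/N ltr_pdivrMr// => /ltW t.
  by rewrite /d mulrA ler_pdivrMr// [d1 * _]mulrC.
have nb' z : 0 < sqn z <= 3 * d ^+ 2 -> ((theta / (4 * pi) / enorm z)%:E <= yukawa kappa z)%E.
  move=> /andP[z0 zd]; apply: nb; rewrite z0/= (le_trans zd)//.
  by move: dd d0; nra.
(* For r below this the cuts cost at most g, and theta f'' - 2 g = c. *)
exists (g * d / 6); first by rewrite divr_gt0// mulr_gt0.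
move=> eps m r /andP[r0 rr] er mc.
have gap : m * kappa ^- 2 <= 2 * r ^+ 2 * (theta * f'' - 6 * theta * r / d - g).
  rewrite mc ler_pM2l ?mulr_gt0 ?exprn_gt0//.
  have : 6 * theta * r / d <= g.
    rewrite ler_pdivrMr//; apply: (@le_trans _ _ (6 * r)); last by lra.
    by rewrite -mulrA ler_pM2l// ler_piMl// ltW.
  by move: (6 * theta * r / d) => q; rewrite /g; lra.
have strict v : admissible l v -> 0 < phase_volume l v ->
    (energy sigma kappa l (m - 1) eps (fun _ : R3 R => (-1)%R) < energy sigma kappa l (m - 1) eps v)%E.
  move=> [[mv pv _ _] v1] Om0; rewrite energy_minus1.
  by apply: (energy_gap d0 lE r0 ff f2 _ g0 er gap nb') => //; rewrite t0 ltW.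
have er0 : 0 <= eps * sigma / 2 by rewrite er divr_ge0// mulr_ge0// exprn_ge0// ltW.
have min1 : minimizer (admissible l) (energy sigma kappa l (m - 1) eps) (fun _ => -1).
  split; first exact: admissible_minus1.
  move=> v av; have [[mv pv _ _] v1] := av.
  have := phase_volume_ge0 v1; rewrite le_eqVlt => /predU1P[Om0|Om0]; last by apply/ltW/strict.
  rewrite energy_minus1 (energyE kappa_gt0 l_gt0)// -Om0 mulr0 subr0.
  rewrite -[leLHS]add0e; apply: leeD.
    by apply: mule_ge0; [rewrite lee_fin|exact: TV_torus_ge0].
  by rewrite lee_fin lerDr mulr_ge0// self_energy_ge0.
split=> // v [av vmin]; have [[mv pv _ _] v1] := av.
apply: phase_volume0_ae => //; apply/eqP; rewrite eq_le phase_volume_ge0// andbT leNgt.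
by apply/negP => /(strict v av); rewrite ltNge vmin//; exact: admissible_minus1.
Qed.

End BelowThreshold.

(** * Perimeter of a truncated set *)

Section CutField.
Context {R : realType}.
Local Notation vol3 := (@vol3 R).
Implicit Types (x y z a b : R3 R) (i : 'I_3) (f g h om chi u : R3 R -> R) (phi F : R3 R -> R3 R).

Lemma compactly_supported_cell (d : R) a phi : (forall x, phi x != 0 -> cell d (a + x)) ->
  compactly_supported phi.
Proof.
move=> H; pose K : set (R3 R) :=
  `[- a.1.1, d - a.1.1]%classic `*` `[- a.1.2, d - a.1.2]%classic `*` `[- a.2, d - a.2]%classic.
have cK : compact K.
  by apply: compact_setX; [apply: compact_setX|]; exact: segment_compact.
have KK : closed K by apply: compact_closed => //; exact: norm_hausdorff.
have sK : [set x | phi x != 0] `<=` K.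
  move=> x /H /cellP h.
  have := (h ord0, h (lift ord0 ord0), h ord_max); rewrite !coordE /=.
  move=> [[/andP[a1 a2] /andP[b1 b2]] /andP[c1 c2]].
  by split; [split|] => /=; rewrite in_itv/=; apply/andP; split; lra.
apply: (subclosed_compact (@closed_closure _ _) cK).
by rewrite closureE => x; apply; split.
Qed.

(* The field [F] is cut off inside one cell and extended by zero; the slicing
   lemma bounds what the cutoff costs. *)
Lemma cut_TV (d B T M : R) a chi F : 0 < d -> measurable_fun setT chi ->
  (forall x, chi x = 0 \/ chi x = 1) -> mass chi = M%:E ->
  (TV_space chi <= T%:E)%E ->
  (forall N, exists2 j, (N <= j)%N &
    (\int[vol3]_x (chi x * slope d j (x + a))%:E <= B%:E)%E) ->
  C1_field F -> (forall x, enorm (F x) <= 1) ->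
  \int[vol3]_x (piece d chi (- a) x * divergence F x) <= T + B.
Proof.
move=> d0 mchi chi1 mE tT slopeB C1 F1.
have chi0 x : 0 <= chi x by have [->|->] := chi1 x.
pose om := piece d chi (- a).
have mom : measurable_fun setT om by exact: measurable_piece.
have om1 x : om x = 0 \/ om x = 1 := piece01 d (- a) chi1 x.
have omc x : om x != 0 -> cell d x by exact: piece_cell.
have Ichi : vol3.-integrable setT (EFin \o chi).
  apply/integrableP; split; first exact/measurable_EFinP.
  under eq_integral do rewrite gee0_abs ?lee_fin//.
  by rewrite [X in (X < _)%E]mE ltry.
have cdF := continuous_divergence C1.
have mdF := measurable_divergence C1.
have [Tf HTf] := continuous_cell_bounded d cdF.
have Tf0 : 0 <= Tf.
  apply: le_trans (HTf 0 _); first exact: normr_ge0.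
  by apply/cellP => i; rewrite -(scale0r (0 : R3 R)) coordZ mul0r lexx.
(* Gluing F on the cell of index 0 with zero fields on all other cells produces the extension by
   zero, and its C1 regularity is inherited from [glue_field]. *)
pose Fk (k : int * int * int) : R3 R -> R3 R := if k == 0 then F else fun _ => 0.
have FkC k : C1_field (Fk k) by rewrite /Fk; case: ifP => _ //; exact: C1_field0.
have Fk1 k x : enorm (Fk k x) <= 1.
  rewrite /Fk; case: ifP => _ //.
  by rewrite -(scale0r (0 : R3 R)) enormZ normr0 mul0r.
have floor0 x : cell d x <-> lattice_floor d x = 0.
  split=> [xc|x0].
    have := @floor_node R d 0 x d0 xc.
    by rewrite /node /= !mulr0 (_ : (0, 0, 0) = 0 :> R3 R)// add0r.
  have := cell_wrap x d0; rewrite /wrap x0 /node /= !mulr0.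
  by rewrite (_ : (0, 0, 0) = 0 :> R3 R)// subr0.
pose Psi j := glue d j Fk.
have PC j : C1_field (Psi j) by have [] := @glue_field R d j Fk d0 FkC Fk1.
have Pdiv j x : `|divergence (Psi j) x - cutoff d j x * divergence (Fk (lattice_floor d x)) x| <= slope d j x.
  by have [_] := @glue_field R d j Fk d0 FkC Fk1; apply.
have P1 j x : enorm (Psi j x) <= 1 by exact: enorm_glue.
have HMs j : exists Ms, forall x, `|slope d j x| <= Ms.
  apply: (periodic_bounded d0); first exact: continuous_slope.
  exact: slope_periodic.
have dom (G : R3 R -> R) (K : R) : measurable_fun setT G -> (forall x, `|G x| <= K) ->
    vol3.-integrable setT (EFin \o (fun x => chi x * G x)).
  move=> mG GK.
  have K0 : 0 <= K := le_trans (normr_ge0 _) (GK 0).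
  apply: (le_integrable measurableT _ _ (integrableZl measurableT K Ichi)).
    by apply/measurable_EFinP; exact: measurable_funM.
  move=> x _; rewrite /= lee_fin normrM (ger0_norm (chi0 x)) (ger0_norm (mulr_ge0 K0 (chi0 x))).
  by rewrite mulrC; apply: ler_wpM2r.
have mPd j : measurable_fun setT (divergence (Psi j)) by exact: measurable_divergence.
have mcut j : measurable_fun setT (cutoff d j).
  by apply: continuous_measurable3; have [[c _] _] := Ck1_cutoff d j; exact: c.
have msl j : measurable_fun setT (slope d j).
  by apply: continuous_measurable3; exact: continuous_slope.
have PB j : exists K, forall x, `|divergence (Psi j) x| <= K.
  have [Ms HM] := HMs j; exists (Tf + Ms) => x.
  have := Pdiv j x; have := HM x; rewrite (ger0_norm (slope_ge0 d j x)).
  have /andP[q0 q1] := cutoff01 d j x.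
  have : `|cutoff d j x * divergence (Fk (lattice_floor d x)) x| <= Tf.
    rewrite normrM (ger0_norm q0) /Fk; case: ifPn => [/eqP/floor0 xc|_].
      by apply: le_trans (HTf x xc); rewrite ler_piMl.
    by rewrite divergence0 normr0 mulr0.
  rewrite !ler_norml.
  move: (cutoff d j x * divergence (Fk (lattice_floor d x)) x) (divergence (Psi j) x) (slope d j x) => p q s.
  by move=> /andP[a1 a2] b1 /andP[c1 c2]; apply/andP; split; lra.
have Tj j : \int[vol3]_x (chi x * divergence (Psi j) (a + x)) <= T.
  have [C1' D'] := C1_field_affine a 1 (PC j).
  rewrite -lee_fin; apply: le_trans tT.
  rewrite EFin_Rintegral//; last first.
    have [K HK] := PB j.
    exact: (dom (fun x => divergence (Psi j) (a + x)) K (measurable_shiftr a (mPd j)) (fun x => HK _)).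
  apply: ereal_sup_ubound; exists (fun x => Psi j (a + 1 *: x)); first split.
  - apply: (@compactly_supported_cell d a) => x; rewrite scale1r /Psi /glue => h.
    apply/floor0/eqP; apply: contrapT => /negP/negbTE nk; move: h.
    by rewrite /Fk nk scaler0 eqxx.
  - exact: C1'.
  - by move=> x; exact: P1.
  by apply: eq_integral => x _; rewrite D' mul1r scale1r.
have Iom (G : R3 R -> R) : continuous G -> vol3.-integrable setT (EFin \o (fun x => om x * G x)).
  by move=> cG; exact: (integrable_supportedM d0 mom om1 omc cG).
have ccut j : continuous (cutoff d j) by have [[c _] _] := Ck1_cutoff d j; exact: c.
pose eps j := \int[vol3]_(x in cell d) (1 - cutoff d j x).
have Icut j : vol3.-integrable (cell d) (EFin \o (fun x => 1 - cutoff d j x)).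
  apply: (@integrable_cell _ _ d0 _ 1); first by apply: measurable_funB => //; exact: (@measurable_cst _ _ (R3 R) R setT 1).
  move=> x; have /andP[a0 a1] := cutoff01 d j x.
  by rewrite ger0_norm ?subr_ge0// gerBl.
have ceps : eps j @[j --> \oo] --> (0 : R).
  by apply: (@fine_cvg _ _ _ _ _ 0); exact: cvg_integral_cutoffC.
have bound j : (\int[vol3]_x (chi x * slope d j (x + a))%:E <= B%:E)%E ->
    \int[vol3]_x (om x * divergence F x) <= T + B + Tf * eps j.
  move=> jB; have [Ms HM] := HMs j; have [K HK] := PB j.
  have I1 := Iom _ cdF.
  have cc : continuous (fun x => cutoff d j x * divergence F x).
    by move=> x; apply: cvgM; [exact: ccut|exact: cdF].
  have I2 := Iom _ cc.
  have I3 := dom (fun x => divergence (Psi j) (a + x)) K (measurable_shiftr a (mPd j)) (fun x => HK _).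
  have I4 := dom (fun x => slope d j (x + a)) Ms (measurable_shiftl a (msl j)) (fun x => HM _).
  have S1 : \int[vol3]_x (om x * divergence F x) <=
      \int[vol3]_x (om x * (cutoff d j x * divergence F x)) + Tf * eps j.
    rewrite /eps -(RintegralZl Tf (@measurable_cell R d) (Icut j)) [X in _ <= _ + X]Rintegral_mkcond.
    have I5 : vol3.-integrable setT (EFin \o ((fun x => Tf * (1 - cutoff d j x)) \_ (cell d))).
      rewrite -restrict_EFin; apply/(integrable_mkcond _ (@measurable_cell R d)).
      have := integrableZl (@measurable_cell R d) Tf (Icut j).
      by congr (integrable _ _ _).
    rewrite -(RintegralD measurableT I2 I5).
    apply: (le_Rintegral measurableT I1 (integrable_addr measurableT I2 I5)) => x _.
    rewrite patchE; have /andP[q0 q1] := cutoff01 d j x.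
    case: ifPn => [/set_mem xc|/negP xc].
      have := HTf x xc; rewrite ler_norml; have [->|->] := om1 x.
        by rewrite !mul0r add0r mulr_ge0// subr_ge0.
      move: (divergence F x) (cutoff d j x) q0 q1 => w q q0 q1 /andP[w1 w2].
      have : 0 <= (1 - q) * (Tf - w) by rewrite mulr_ge0 ?subr_ge0.
      by rewrite !mul1r mulrBr mulrBl; lra.
    by have [->|h] := om1 x; [rewrite !mul0r addr0|exfalso; apply: xc; apply/mem_set/omc; rewrite h oner_neq0].
  have S2 : \int[vol3]_x (om x * (cutoff d j x * divergence F x)) <=
      \int[vol3]_x (chi x * divergence (Psi j) (a + x)) + \int[vol3]_x (chi x * slope d j (x + a)).
    rewrite -(RintegralD measurableT I3 I4).
    pose G x := om x * (cutoff d j x * divergence F x).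
    have mG : measurable_fun setT (EFin \o G) by have := measurable_int vol3 I2.
    have E : (\int[vol3]_x (G (a + x)%R)%:E = \int[vol3]_x (G x)%:E)%E.
      by have := integral_shift3 a measurableT mG; rewrite preimage_setT.
    have -> : \int[vol3]_x G x = \int[vol3]_x G (a + x) by exact: (esym (congr1 fine E)).
    pose H x := (\1_(cell d) (a + x) : R) * (cutoff d j (a + x) * divergence F (a + x)).
    have GE x : G (a + x) = chi x * H x.
      by rewrite /G /om /piece addKr /H -[LHS]mulrA.
    have IGs : vol3.-integrable setT (EFin \o (fun x => G (a + x))).
      have [K' HK'] := continuous_cell_bounded d cc.
      have -> : (fun x => G (a + x)) = (fun x => chi x * H x) by apply/funext => x; exact: GE.
      apply: (dom _ (Num.max K' 0)).
        apply: (measurable_shiftr a (h := fun x => \1_(cell d) x * (cutoff d j x * divergence F x))).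
        apply: measurable_funM; first by apply: measurable_indic; exact: measurable_cell.
        exact: continuous_measurable3.
      move=> x; rewrite /H indicE; case: (boolP (_ \in _)) => [/set_mem xc|_].
        by rewrite mul1r; apply: (le_trans (HK' _ xc)); rewrite le_max lexx.
      by rewrite mul0r normr0 le_max lexx orbT.
    apply: (le_Rintegral measurableT IGs (integrable_addr measurableT I3 I4)) => x _.
    rewrite GE -(mulrDr (chi x)); apply: ler_wpM2l; first exact: chi0.
    rewrite /H.
    have := Pdiv j (a + x); rewrite [x + a]addrC indicE /Fk.
    case: (boolP (a + x \in cell d)) => [/set_mem/floor0 ->|xc].
      rewrite eqxx mul1r ler_norml => /andP[h _].
      by move: h; move: (cutoff d j (a + x) * divergence F (a + x)) (divergence (Psi j) (a + x)) (slope d j (a + x)) => p q s; lra.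
    rewrite mul0r ifF; last by apply/negbTE; apply: contra xc => /eqP/floor0/mem_set.
    rewrite divergence0 mulr0 subr0 ler_norml => /andP[h _].
    by rewrite -subr_ge0 subr0 in h *; move: h; move: (divergence _ _) (slope _ _ _) => p s; lra.
  apply: (le_trans S1); rewrite lerD2r; apply: (le_trans S2); apply: lerD; first exact: Tj.
  by rewrite -lee_fin (EFin_Rintegral measurableT I4).
(* The cutoff defect vanishes as j grows, and the slope bound holds along arbitrarily large j, so
   the inequality survives without the defect. *)
have c : (T + B + Tf * eps j) @[j --> \oo] --> T + B + Tf * 0.
  by apply: cvgD; [exact: cvg_cst|apply: cvgMr].
rewrite -/om leNgt; apply/negP => lt.
have : \forall j \near \oo, T + B + Tf * eps j < \int[vol3]_x (om x * divergence F x).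
  by apply: (cvgr_lt _ c); rewrite mulr0 addr0.
move=> [N _ HN]; have [j jN jB] := slopeB N.
by have := HN j jN; rewrite /= ltNge (bound j jB).
Qed.

End CutField.

(** * Near-optimal sets and periodization *)

Section AboveThreshold.
Context {R : realType}.
Local Notation vol3 := (@vol3 R).
Implicit Types (x y z a b : R3 R) (i : 'I_3) (om chi u : R3 R -> R) (phi F : R3 R -> R3 R).

Lemma near_optimal (c : R) : (@f_star R < c%:E)%E ->
  exists chi (T C M : R), [/\ measurable_fun setT chi, forall x, chi x = 0 \/ chi x = 1,
    TV_space chi = T%:E, coulomb chi = C%:E & mass chi = M%:E /\ 0 < M /\ T + C / (8 * pi) < c * M].
Proof.
move=> fc.
have [chi [[[Ichi TVy] chi1 M0] lt]] : exists chi, [/\ BV_space chi, forall x, chi x = 0 \/ chi x = 1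
    & (0 < mass chi)%E] /\ ((TV_space chi + (1 / (8 * pi))%:E * coulomb chi) / mass chi < c%:E)%E.
  apply: contrapT => /forallNP H; move: fc; rewrite ltNge => /negP; apply.
  apply: le_ereal_inf_tmp => _ [chi adm <-]; rewrite leNgt; apply/negP => h.
  by apply: (H chi); split.
have mchi : measurable_fun setT chi by apply/measurable_EFinP; exact: measurable_int Ichi.
have chi0 x : 0 <= chi x by have [->|->] := chi1 x.
have TE : TV_space chi = (fine (TV_space chi))%:E.
  by rewrite fineK// ge0_fin_numE// TV_space_ge0.
have ME : mass chi = (fine (mass chi))%:E.
  by rewrite fineK//; exact: (integrable_fin_num measurableT Ichi).
have Mp : 0 < fine (mass chi) by rewrite -lte_fin -ME.
have pi8 : 0 < 1 / (8 * pi) :> R by rewrite divr_gt0// mulr_gt0// pi_gt0.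
(* The mass is finite and the quotient lies below the real number c, which excludes an infinite
   Coulomb energy. *)
have CE : coulomb chi = (fine (coulomb chi))%:E.
  rewrite fineK// ge0_fin_numE ?coulomb_ge0// ltNge leye_eq; apply/negP => /eqP Cy.
  move: lt; rewrite Cy gt0_muley ?lte_fin// TE ME addey// inver gt_eqF// gt0_mulye ?lte_fin ?invr_gt0//.
exists chi, (fine (TV_space chi)), (fine (coulomb chi)), (fine (mass chi)); split => //; split => //; split => //.
move: lt; rewrite TE CE ME -EFinM -EFinD inver gt_eqF// -EFinM lte_fin ltr_pdivrMr//.
by rewrite mul1r [_^-1 * _]mulrC.
Qed.

Lemma mass_in_box chi (M eta : R) : measurable_fun setT chi -> (forall x, 0 <= chi x) ->
  mass chi = M%:E -> 0 < eta ->
  exists2 n : R, 0 < n & ((M - eta)%:E <=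
    \int[vol3]_(x in (affine3 (n, n, n) 1 @^-1` cell (2 * n))%classic) (chi x)%:E)%E.
Proof.
move=> mchi chi0 mE e0.
pose box (n : R) := affine3 (n, n, n) 1 @^-1` cell (2 * n).
have boxP n x : box n x <-> forall i, - n <= coord x i < n.
  have E i : coord (affine3 (n, n, n) 1 x) i = n + coord x i.
    by rewrite affine3E coordD scale1r; congr (_ + _); elim/ord3_ind: i; rewrite coordE.
  split=> [/cellP h i|h]; last apply/cellP => i.
    by have := h i; rewrite E; lra.
  by have := h i; rewrite E; lra.
pose S (k : nat) := box k.+1%:R.
have mS k : measurable (S k).
  have := measurable_affine3 (k.+1%:R, k.+1%:R, k.+1%:R) (1 : R) measurableT (@measurable_cell R (2 * k.+1%:R)).
  by rewrite setTI.
have ndS : nondecreasing_seq S.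
  move=> k k' kk; rewrite subsetEset => x /boxP h; apply/boxP => i; have := h i.
  have : k.+1%:R <= k'.+1%:R :> R by rewrite ler_nat.
  by lra.
have SU : \bigcup_k S k = setT.
  apply/seteqP; split=> // x _.
  exists (Num.truncn (`|coord x ord0| + `|coord x (lift ord0 ord0)| + `|coord x ord_max|)) => //.
  apply/boxP => i; set s := (`|coord x ord0| + _ + _).
  have : `|coord x i| <= s.
    rewrite /s; have := normr_ge0 (coord x ord0); have := normr_ge0 (coord x (lift ord0 ord0)).
    by have := normr_ge0 (coord x ord_max); elim/ord3_ind: i; lra.
  have := truncnS_gt s; move: (_%:R) => t st; rewrite ler_norml => /andP[h1 h2].
  by apply/andP; split; lra.
have me : measurable_fun setT (fun x => (chi x)%:E) by exact/measurable_EFinP.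
have := @ge0_nondecreasing_set_cvg_integral _ _ R S (fun x => (chi x)%:E) vol3 ndS mS
  (fun k => measurable_funTS me) (fun k x _ => chi0 x).
rewrite SU => cv.
have lt : ((M - eta)%:E < \int[vol3]_x (chi x)%:E)%E.
  by rewrite [X in (_ < X)%E]mE lte_fin ltrBlDr ltrDl.
have [N _ HN] := cv _ (open_ereal_gt' lt).
exists N.+1%:R; first by rewrite ltr0n.
by apply: ltW; exact: (HN N (leqnn N)).
Qed.

Lemma coulomb_piece_le (d C : R) chi b : measurable_fun setT chi -> (forall x, 0 <= chi x) ->
  coulomb chi = C%:E -> (coulomb (piece d chi b) <= C%:E)%E.
Proof.
move=> mc c0 <-.
have mp := measurable_piece d b mc.
have p0 x : 0 <= piece d chi b x by rewrite mulr_ge0.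
have pc x : piece d chi b x <= chi (b + x).
  by rewrite /piece indicE; case: (_ \in _); rewrite ?mulr1 ?mulr0.
rewrite !coulomb_shift//.
have mJ (om : R3 R -> R) : measurable_fun setT om -> (forall x, 0 <= om x) ->
    measurable_fun setT (fun x => \int[vol3]_z (om x * om (x + z) / enorm z)%:E)%E.
  move=> mo o0.
  have m2 : measurable_fun setT (fun xz : R3 R * R3 R => (om xz.1 * om (xz.1 + xz.2) / enorm xz.2)%:E).
    apply/measurable_EFinP; apply: measurable_funM.
      apply: measurable_funM; first by apply: (measurableT_comp mo); exact: measurable_fst.
      exact: (measurableT_comp mo (@measurable_add3 R)).
    apply: (measurableT_comp (@measurable_inv R)); apply: (measurableT_comp (@measurable_enorm R)).
    exact: measurable_snd.
  have J0 xz : (0 <= (om xz.1 * om (xz.1 + xz.2) / enorm xz.2)%:E)%E.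
    by rewrite lee_fin divr_ge0 ?sqrtr_ge0// mulr_ge0.
  exact: (@measurable_fun_fubini_tonelli_F _ _ _ _ R vol3 _ m2 J0).
have I0 x : (0 <= \int[vol3]_z (chi x * chi (x + z) / enorm z)%:E)%E.
  by apply: integral_ge0 => z _; rewrite lee_fin divr_ge0 ?sqrtr_ge0// mulr_ge0.
have := ge0_integral_shift3 b measurableT (mJ chi mc c0) (fun x _ => I0 x).
rewrite preimage_setT => <-; apply: ge0_le_integral => //.
- by move=> x _; apply: integral_ge0 => z _; rewrite lee_fin divr_ge0 ?sqrtr_ge0// mulr_ge0.
- exact: mJ.
- exact: (measurableT_comp (mJ chi mc c0) (measurable_shift3 b)).
move=> x _; apply: ge0_le_integral => //.
- by move=> z _; rewrite lee_fin divr_ge0 ?sqrtr_ge0// mulr_ge0.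
- exact: measurable_coulomb_inner.
- exact: measurable_coulomb_inner.
move=> z _; rewrite lee_fin ler_wpM2r ?invr_ge0 ?sqrtr_ge0// -addrA.
by rewrite ler_pM.
Qed.

(** A point is in the periodized set exactly when one of its lattice translates is in the original
    set, so the set is a countable union of translates. *)
Lemma periodize_measurable (l : R) om : 0 < l -> measurable_fun setT om ->
  (forall x, om x = 0 \/ om x = 1) -> (forall x, om x != 0 -> cell l x) ->
  measurable_fun setT (fun x => om (wrap l x)).
Proof.
move=> l0 mo o1 oc.
pose W (n : nat) : set (R3 R) := if unpickle n is Some k then
  affine3 (- node l (k : int * int * int)) 1 @^-1` [set x | om x != 0] else set0.
have m1 : measurable [set x | om x != 0].
  have -> : [set x | om x != 0] = om @^-1` (~` [set 0]).
    by apply/seteqP; split => x /=; [move=> /eqP|move=> h; apply/eqP].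
  by rewrite -[X in measurable X]setTI; apply: mo => //; apply: measurableC; exact: measurable_set1.
have mW n : measurable (W n).
  rewrite /W; case: unpickle => [k|]; last exact: measurable0.
  by have := measurable_affine3 (- node l k) (1 : R) measurableT m1; rewrite setTI.
have wE x : affine3 (- node l (lattice_floor l x)) 1 x = wrap l x.
  by rewrite affine3E scale1r addrC.
have E : (fun x => om (wrap l x)) = \1_(\bigcup_n W n).
  apply/funext => x; rewrite indicE.
  have [h|h] := o1 (wrap l x); rewrite h.
    have -> : (x \in \bigcup_n W n) = false; last by [].
    apply/negP => /set_mem [n _]; rewrite /W; case: unpickle => [k|//] /=.
    rewrite affine3E scale1r => kx; have xc := oc _ kx.
    have := @floor_node R l k _ l0 xc; rewrite addNKr => fk.
    by move: kx; rewrite addrC -fk -/(wrap l x) h eqxx.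
  have -> : (x \in \bigcup_n W n) = true; last by [].
  apply/mem_set; exists (pickle (lattice_floor l x)); first by [].
  by rewrite /W pickleK /preimage/= wE h oner_neq0.
by rewrite E; apply: measurable_indic; exact: bigcup_measurable.
Qed.

End AboveThreshold.

(** * Supercritical case: a competitor beats the constant *)

Section NotMinimizer.
Context {R : realType}.
Local Notation vol3 := (@vol3 R).
Implicit Types (x y z a b : R3 R) (i : 'I_3) (om chi u : R3 R -> R) (phi F : R3 R -> R3 R).

Lemma box_coord (n : R) x i : coord (affine3 (n, n, n) 1 x) i = n + coord x i.
Proof. by rewrite affine3E coordD scale1r; congr (_ + _); elim/ord3_ind: i; rewrite coordE. Qed.

(** A near-optimal set is truncated to one cell of a large grid, at the price of part of the gap g.
    The perimeter bound is stated for all C1 fields of norm at most 1, not only compactly supported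
    ones, because periodic fields on the torus are to be tested against it. *)
Lemma bounded_competitor (c : R) : (@f_star R < c%:E)%E ->
  exists om (D T C M g : R), [/\ 0 < D /\ 0 < g /\ 0 < M, measurable_fun setT om /\ (forall x, om x = 0 \/ om x = 1)
      /\ (forall x, om x != 0 -> cell D x),
    forall F, C1_field F -> (forall x, enorm (F x) <= 1) -> \int[vol3]_x (om x * divergence F x) <= T,
    (coulomb om <= C%:E)%E & mass om = M%:E /\ T + C / (8 * pi) + g <= c * M].
Proof.
move=> fc; have [chi [T [C [M [mchi chi1 tE cE [mE [M0 lt]]]]]]] := near_optimal fc.
have chi0 x : 0 <= chi x by have [->|->] := chi1 x.
have pi8 : 0 < 8 * pi :> R by rewrite mulr_gt0// pi_gt0.
have C0 : 0 <= C by rewrite -lee_fin -cE coulomb_ge0.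
have T0 : 0 <= T by rewrite -lee_fin -tE TV_space_ge0.
have c0 : 0 < c.
  have : 0 < c * M by apply: le_lt_trans lt; rewrite addr_ge0// divr_ge0// ltW.
  by rewrite pmulr_lgt0.
pose g := c * M - (T + C / (8 * pi)).
have g0 : 0 < g by rewrite subr_gt0.
(* Losing this much mass lowers c times the mass by g / 4. *)
have e0 : 0 < g / (4 * c) by rewrite divr_gt0// mulr_gt0.
have [n n0 box] := mass_in_box mchi chi0 mE e0.
(* From 4 n <= D one gets V >= (D / 2)^3, so the cut costs at most 48 M / D, and D >= 384 M / g
   makes this at most g / 8. *)
pose D := 4 * n + 384 * M / g.
have q0 : 0 < M / g by rewrite divr_gt0.
have D0 : 0 < D by rewrite /D -mulrA; lra.
have Dn : 4 * n <= D by rewrite /D -mulrA; lra.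
have DM : 384 * M <= D * g.
  by rewrite -ler_pdivrMr// /D -mulrA; lra.
(* The translations that carry the box of half-side n, which holds nearly all the mass, into the
   cell of side D. *)
pose A := affine3 (- n, - n, - n) 1 @^-1` cell (D - 2 * n).
have mc2 := @measurable_cell R (D - 2 * n).
have mA : measurable A.
  by have := measurable_affine3 (- n, - n, - n) (1 : R) measurableT mc2; rewrite setTI.
have Dn2 : 0 < D - 2 * n by move: n0 Dn; lra.
pose V := (D - 2 * n) ^+ 3.
have V0 : 0 < V by rewrite exprn_gt0.
have VA : vol3 A = V%:E.
  rewrite [LHS](vol3_affine (- n, - n, - n) (oner_neq0 R) mc2) vol3_cell; last exact: ltW.
  by rewrite normr1 invr1 expr1n mul1e.
have AP x : A x -> forall i, n <= coord x i < D - n.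
  by move=> /cellP h i; have := h i; rewrite box_coord; lra.
have Ac : A `<=` cell D.
  by move=> x /AP h; apply/cellP => i; have := h i; move: n0; lra.
have g80 : 0 < g / 8 by rewrite divr_gt0.
have [a aA slopeB] := slice D0 V0 g80 mA Ac VA measurableT mchi chi0 mE.
pose B := 6 * D ^+ 2 * M / V + g / 8.
have Bg : B <= g / 4.
  have : 6 * D ^+ 2 * M / V <= g / 8.
    rewrite ler_pdivrMr//; apply: (@le_trans _ _ (g / 8 * (D / 2) ^+ 3)).
      have -> : g / 8 * (D / 2) ^+ 3 = D ^+ 2 * (D * g) / 64 by field.
      rewrite ler_pdivlMr//.
      apply: (@le_trans _ _ (D ^+ 2 * (384 * M))); last by rewrite ler_pM2l ?exprn_gt0.
      by rewrite le_eqVlt; apply/orP; left; apply/eqP; ring.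
    rewrite ler_pM2l//; apply: lerXn2r.
    - by rewrite nnegrE divr_ge0// ltW.
    - by rewrite nnegrE ltW.
    - by move: n0 Dn; lra.
  by rewrite /B; lra.
pose om := piece D chi (- a).
have om1 x : om x = 0 \/ om x = 1 := piece01 D (- a) chi1 x.
have om0 x : 0 <= om x by have [->|->] := om1 x.
have mom : measurable_fun setT om by exact: measurable_piece.
have omc x : om x != 0 -> cell D x by exact: piece_cell.
have Iom : vol3.-integrable setT (EFin \o om).
  apply: (@integrable_supported R D 1 om D0 mom _ omc) => x.
  by have [->|->] := om1 x; rewrite ?normr0 ?normr1.
pose Mo := \int[vol3]_x om x.
have moE : mass om = Mo%:E by exact/esym/(EFin_Rintegral measurableT Iom).
have meo : measurable_fun setT (fun x => (om x)%:E) by exact/measurable_EFinP.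
have MoM : M - g / (4 * c) <= Mo.
  rewrite -lee_fin -moE; apply: (le_trans box).
  have := ge0_integral_shift3 a measurableT meo (fun x _ => om0 x).
  rewrite preimage_setT => E.
  apply: (@le_trans _ _ (\int[vol3]_x (om (a + x)%R)%:E)%E); last by rewrite [X in (X <= _)%E]E.
  rewrite [leLHS]integral_mkcond; apply: ge0_le_integral => //.
  - by move=> x _; rewrite patchE; case: ifP => _ //; rewrite lee_fin.
  - have mbox : measurable (affine3 (n, n, n) 1 @^-1` cell (2 * n)).
      by have := measurable_affine3 (n, n, n) (1 : R) measurableT (@measurable_cell R (2 * n)); rewrite setTI.
    apply/(measurable_restrictT _ mbox).
    by apply: measurable_funTS; exact/measurable_EFinP.
  - exact: (measurableT_comp meo (measurable_shift3 a)).
  move=> x _; rewrite patchE; case: ifPn => [/set_mem /cellP h|_]; last by rewrite lee_fin.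
  rewrite lee_fin /om /piece addKr indicE mem_set ?mulr1//.
  apply/cellP => i; have := h i; rewrite box_coord coordD; have := AP a aA i.
  by move: n0; lra.
exists om, D, (T + B), C, Mo, (g / 4); split.
- split=> //; split; first by rewrite divr_gt0.
  rewrite -(pmulr_rgt0 _ c0); apply: lt_le_trans (_ : c * (M - g / (4 * c)) <= _); last by rewrite ler_pM2l.
  have -> : c * (M - g / (4 * c)) = c * M - g / 4 by field; rewrite gt_eqF.
  have : 0 <= C / (8 * pi) by rewrite divr_ge0// ltW.
  by move: g0; rewrite /g; move: (C / (8 * pi)) T0 => q; lra.
- by split.
- move=> F C1 F1; apply: (@cut_TV R D B T M a chi F) => //.
  by rewrite tE.
- exact: coulomb_piece_le.
split=> //.
have : c * (M - g / (4 * c)) <= c * Mo by rewrite ler_pM2l.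
have -> : c * (M - g / (4 * c)) = c * M - g / 4 by field; rewrite gt_eqF.
have gE : c * M = g + (T + C / (8 * pi)) by rewrite /g; ring.
by move: Bg; rewrite gE; move: (C / (8 * pi)) g0 => q; lra.
Qed.

(** For the competitor dilated by r and periodized, the energy exceeds that of -1 by at most 4 r^5
    (T + C / (8 pi) - c M) + 2 K M^2 r^6, hence by at most - 4 g r^5 plus a term of order r^6. *)
Lemma not_minimizer_above (sigma kappa l c : R) : 0 < sigma -> 0 < kappa -> 0 < l -> (@f_star R < c%:E)%E ->
  exists2 r0 : R, 0 < r0 & forall eps m r, 0 < r < r0 -> eps * sigma = 4 * r ^+ 3 ->
    m * kappa ^- 2 = 2 * r ^+ 2 * c ->
    ~ minimizer (admissible l) (energy sigma kappa l (m - 1) eps) (fun _ => -1).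
Proof.
move=> s0 k0 l0 fc.
have [om [D [T [C [M [g [[D0 [g0 M0]] [mom [om1 omc]] TB CB [mE gap]]]]]]]] := bounded_competitor fc.
have om0 x : 0 <= om x by have [->|->] := om1 x.
pose K := 1000 * kappa ^- 2 / l ^+ 3.
have K0 : 0 < K.
  apply: divr_gt0; last by rewrite exprn_gt0.
  by apply: mulr_gt0; [rewrite ltr0n|rewrite invr_gt0 exprn_gt0].
have KM0 : 0 < K * M ^+ 2 by rewrite mulr_gt0// exprn_gt0.
(* The first bound fits the dilated set into a half cell, as [self_energy_upper] requires; the
   second makes K M^2 r smaller than g. *)
exists (Num.min (l / (2 * D)) (g / (K * M ^+ 2))).
  by rewrite lt_min !divr_gt0// mulr_gt0.
move=> eps m r /andP[r0]; rewrite lt_min => /andP[rl rg] er mc [_ min1].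
have rn0 := lt0r_neq0 r0; have ri0 : 0 < r^-1 by rewrite invr_gt0.
have rin0 := lt0r_neq0 ri0.
pose omr x := om (affine3 0 r^-1 x).
have mor : measurable_fun setT omr by exact: (measurableT_comp mom (measurable_affine3 0 r^-1)).
have or1 x : omr x = 0 \/ omr x = 1 by exact: om1.
have rD : r * D <= l / 2.
  have : r < l / (2 * D) by [].
  by rewrite ltr_pdivlMr ?mulr_gt0// => h; move: h; lra.
have orc2 x : omr x != 0 -> cell (l / 2) x.
  move=> /omc /cellP h; apply/cellP => i; have := h i.
  rewrite affine3E add0r coordZ => /andP[h1 h2].
  have h1' : 0 <= coord x i by rewrite -(pmulr_rge0 _ ri0).
  have h2' : coord x i < r * D by rewrite -(ltr_pM2l ri0) mulKf.
  by rewrite h1'/= (lt_le_trans h2').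
have orc x : omr x != 0 -> cell l x.
  move=> /orc2/cellP h; apply/cellP => i; have /andP[-> h2] := h i.
  by rewrite (lt_trans h2)//; move: l0; lra.
pose u x : R := -1 + 2 * omr (wrap l x).
have iE x : indicator_of u x = omr (wrap l x) by rewrite /indicator_of /u; field.
have mw := periodize_measurable l0 mor or1 orc.
have mu : measurable_fun setT u.
  apply: measurable_funD; first exact: (@measurable_cst _ _ (R3 R) R setT (-1)).
  by apply: measurable_funM => //; exact: (@measurable_cst _ _ (R3 R) R setT 2).
have u1 x : u x = -1 \/ u x = 1.
  by rewrite /u; have [->|->] := or1 (wrap l x); [left|right]; ring.
have pu : periodic l u.
  move=> i x; rewrite /u /wrap.
  have := @node_floor_shift R l 1 x i l0; rewrite mul1r => ->.
  by rewrite opprD addrACA subrr addr0.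
have wrapc x : cell l x -> wrap l x = x.
  move=> xc; have := @floor_node R l 0 x l0 xc.
  have n00 : node l 0 = 0 by rewrite /node /= mulr0.
  by rewrite n00 add0r /wrap => ->; rewrite n00 subr0.
have iomE x : omr x = indicator_of u x * \1_(cell l) x.
  rewrite iE indicE; case: (boolP (x \in cell l)) => [/set_mem xc|/negP xc].
    by rewrite wrapc// mulr1.
  by rewrite mulr0; have [//|h] := or1 x; exfalso; apply: xc; apply/mem_set/orc; rewrite h oner_neq0.
have ib := indicator_of_bounds u1.
have Ior : vol3.-integrable setT (EFin \o omr).
  apply: (@integrable_supported R l 1 omr l0 mor _ orc) => x.
  by have [->|->] := or1 x; rewrite ?normr0 ?normr1.
have Iom : vol3.-integrable setT (EFin \o om).
  apply: (@integrable_supported R D 1 om D0 mom _ omc) => x.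
  by have [->|->] := om1 x; rewrite ?normr0 ?normr1.
have cellE (G : R3 R -> R) : \int[vol3]_(x in cell l) (indicator_of u x * G x) = \int[vol3]_x (omr x * G x).
  rewrite Rintegral_mkcond; apply: eq_Rintegral => x _; rewrite patchE iomE indicE.
  by case: ifPn => _; rewrite ?mulr1 ?mulr0 ?mul0r.
have PV : phase_volume l u = r ^+ 3 * M.
  have -> : phase_volume l u = \int[vol3]_x omr x.
    transitivity (\int[vol3]_(x in cell l) (indicator_of u x * 1)).
      by apply: eq_Rintegral => x _; rewrite mulr1.
    by rewrite (cellE (fun=> 1)); apply: eq_Rintegral => x _; rewrite mulr1.
  rewrite [LHS](Rintegral_affine 0 rin0 Iom) (gtr0_norm ri0) invrK; congr (_ * _).
  have := EFin_Rintegral measurableT Iom; rewrite [X in _ = X -> _]mE.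
  by case.
have cr0 : (coulomb omr <= (r ^+ 5 * C)%:E)%E.
  rewrite [coulomb omr](coulomb_scale ri0 mom om0) invrK (EFinM (r ^+ 5) C).
  by apply: lee_wpmul2l => //; rewrite lee_fin exprn_ge0// ltW.
have TV : (TV_torus l u <= (2 * (r ^+ 2 * T))%:E)%E.
  apply: TV_torus_le => // phi C1 pp p1; rewrite cellE.
  have [C1' D'] := C1_field_affine 0 r C1.
  have cd := continuous_divergence C1.
  have cdr : continuous (fun y : R3 R => divergence phi (0 + r *: y)).
    move=> y; apply: (@continuous_comp _ _ _ (fun x : R3 R => 0 + r *: x) (divergence phi)); last exact: cd.
    by apply: cvgD; [exact: cvg_cst|exact: scaler_continuous].
  have I := integrable_supportedM D0 mom om1 omc cdr.
  have := Rintegral_affine 0 rin0 I; rewrite (gtr0_norm ri0) invrK => E.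
  have -> : \int[vol3]_x (omr x * divergence phi x) =
      \int[vol3]_x (om (affine3 0 r^-1 x) * divergence phi (0 + r *: affine3 0 r^-1 x)).
    apply: eq_Rintegral => x _; rewrite /omr; congr (_ * divergence phi _).
    by rewrite affine3E !add0r scalerA mulfV// scale1r.
  rewrite E.
  have h0 := TB _ C1' (fun x => p1 _).
  have E2 : \int[vol3]_x (om x * divergence (fun x => phi (0 + r *: x)) x) =
      r * \int[vol3]_x (om x * divergence phi (0 + r *: x)).
    rewrite -(RintegralZl r measurableT I); apply: eq_Rintegral => x _.
    by rewrite D' mulrCA.
  have h := eq_ind _ (fun t => t <= T) h0 _ E2; have r20 : 0 <= r ^+ 2 by exact: sqr_ge0.
  have := ler_wpM2l r20 h; rewrite mulrA -exprSr; exact.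
have adm : admissible l u.
  split=> //; split=> //.
    apply: (@integrable_cell _ _ l0 _ 1 mu) => x.
    by have [->|->] := u1 x; rewrite ?normrN normr1.
  by rewrite (le_lt_trans TV)// ltry.
have mi := measurable_indicator_of mu.
have SE : self_energy kappa l u <= r ^+ 5 * (C / (4 * pi)) + K * (r ^+ 3 * M) ^+ 2.
  have := self_energy_upper k0 l0 mi ib (periodic_indicator_of pu) iomE orc2 (phase_volumeE l0 mu u1).
  rewrite PV => h; rewrite -lee_fin; apply: (le_trans h).
  apply: (@le_trans _ _ ((1 / (4 * pi))%:E * (r ^+ 5 * C)%:E + (1000 * kappa ^- 2 * (r ^+ 3 * M) ^+ 2 / l ^+ 3)%:E)%E).
    apply: leeD => //; apply: lee_wpmul2l => //.
    by rewrite lee_fin divr_ge0// mulr_ge0// pi_ge0.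
  rewrite -EFinM -EFinD lee_fin /K le_eqVlt; apply/orP; left; apply/eqP.
  by move: (1000 * kappa ^- 2) => k; ring.
have T0 := TV_torus_ge0 l0 mu u1.
have := min1 u adm; rewrite (energy_minus1 sigma k0 l0) (energyE k0 l0 sigma eps m mu pu u1) PV.
have tf : TV_torus l u \is a fin_num by rewrite ge0_fin_numE// (le_lt_trans TV)// ltry.
move: TV; rewrite -(fineK tf); move: (fine (TV_torus l u)) => t; rewrite lee_fin => TVt.
rewrite -EFinM -EFinD lee_fin er.
have r30 : 0 <= 2 * r ^+ 3 by rewrite mulr_ge0// exprn_ge0// ltW.
have hT := ler_wpM2l r30 TVt.
have r50 : 0 < r ^+ 5 by rewrite exprn_gt0.
have Kr : K * M ^+ 2 * r < g by rewrite mulrC -ltr_pdivlMr.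
have hK := ltr_pM2l r50 (K * M ^+ 2 * r) g; rewrite Kr in hK.
have hg := ler_wpM2l (ltW r50) gap.
have E1 : 4 * r ^+ 3 / 2 * t = 2 * r ^+ 3 * t by field.
have E2 : 2 * m * kappa ^- 2 * (r ^+ 3 * M) = 4 * (r ^+ 5 * (c * M)).
  have -> : 2 * m * kappa ^- 2 * (r ^+ 3 * M) = 2 * (m * kappa ^- 2) * (r ^+ 3 * M) by ring.
  by rewrite mc; ring.
have E3 : 2 * r ^+ 3 * (2 * (r ^+ 2 * T)) = 4 * (r ^+ 5 * T) by ring.
have E4 : K * (r ^+ 3 * M) ^+ 2 = r ^+ 5 * (K * M ^+ 2 * r) by ring.
have E5 : r ^+ 5 * (T + C / (8 * pi) + g) = r ^+ 5 * T + r ^+ 5 * (C / (8 * pi)) + r ^+ 5 * g by ring.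
have E6 : r ^+ 5 * (C / (4 * pi)) = 2 * (r ^+ 5 * (C / (8 * pi))).
  by move: (pi : R) (lt0r_neq0 (pi_gt0 R)) => p pn0; field.
have G0 : 0 < r ^+ 5 * g by rewrite mulr_gt0.
move: SE hT hK hg; rewrite E1 E2 E3 E4 E5 E6.
move: (r ^+ 5 * T) (r ^+ 5 * (C / (8 * pi))) (r ^+ 5 * (K * M ^+ 2 * r)) (r ^+ 5 * (c * M))
  (2 * r ^+ 3 * t) (self_energy kappa l u) (m ^+ 2 * kappa ^- 2 * l ^+ 3 / 2) (r ^+ 5 * g) G0.
by clear; move=> *; lra.
Qed.

End NotMinimizer.

(** * From the threshold on lambda to the comparison of c with f^* *)

Theorem corollary3p5 (R : realType) (sigma kappa lambda l : R)
    (sigma_gt0 : 0 < sigma) (kappa_gt0 : 0 < kappa)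
    (lambda_gt0 : 0 < lambda) (l_gt0 : 0 < l) :
  let ubar (eps : R) : R := -1 + lambda * eps `^ (2 / 3) in
  let E (eps : R) : (R3 R -> R) -> \bar R :=
    energy sigma kappa l (ubar eps) eps in
  exists eps0 : R, 0 < eps0 /\
    ((lambda%:E < lambda_c sigma kappa)%E ->
      forall eps : R, 0 < eps -> eps < eps0 ->
        unique_minimizer (admissible l) (E eps) (fun _ => -1)) /\
    ((lambda_c sigma kappa < lambda%:E)%E ->
      forall eps : R, 0 < eps -> eps < eps0 ->
        ~ minimizer (admissible l) (E eps) (fun _ => -1)).
Proof.
move=> ubar E.
pose A : R := 2 `^ (- (1 / 3)) * sigma `^ (2 / 3) * kappa ^+ 2.
have A0 : 0 < A by rewrite !mulr_gt0 ?powR_gt0 ?exprn_gt0.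
pose c := lambda / A.
have c0 : 0 < c by rewrite divr_gt0.
(* At this length the perimeter and Coulomb terms both scale as 4 r^5, with relative weights 1 and 1
   / (8 pi) as in f^*. *)
pose rad (eps : R) := (eps * sigma / 4) `^ (1 / 3).
have es0 eps : 0 < eps -> 0 < eps * sigma / 4 by move=> e0; rewrite divr_gt0// mulr_gt0.
have rad0 eps : 0 < eps -> 0 < rad eps by move=> e0; rewrite powR_gt0// es0.
have rad3 eps : 0 < eps -> eps * sigma = 4 * rad eps ^+ 3.
  move=> e0; rewrite /rad -powR_mulrn ?powR_ge0// -powRrM.
  rewrite (_ : 1 / 3 * 3%:R = 1); last by field.
  by rewrite powRr1 ?ltW ?es0//; field.
have radm eps : 0 < eps -> lambda * eps `^ (2 / 3) * kappa ^- 2 = 2 * rad eps ^+ 2 * c.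
  move=> e0; have -> : rad eps ^+ 2 = (eps * sigma / 4) `^ (2 / 3).
    rewrite /rad -powR_mulrn ?powR_ge0// -powRrM.
    by rewrite (_ : 1 / 3 * 2%:R = 2 / 3); last by field.
  rewrite powRM ?ltW ?mulr_gt0 ?invr_gt0// powRM ?ltW//.
  (* The origin of 2^(-1/3) in lambda_c: it is 2 times 4^(-2/3), where the 4 comes from eps sigma =
     4 r^3 and the 2 from m kappa^-2 = 2 r^2 c. *)
  have -> : 4^-1 `^ (2 / 3) = 2 `^ (- (1 / 3)) / 2 :> R.
    have -> : 4^-1 = 2 `^ (- 2) :> R.
      by rewrite powRN (_ : 2 `^ 2 = 4 :> R)//; rewrite (powR_mulrn 2)//; ring.
    rewrite -powRrM; have -> : - 2 * (2 / 3) = - (1 / 3) + (- 1) :> R by field.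
    rewrite powRD; last by apply/implyP => _; rewrite pnatr_eq0.
    by rewrite [2 `^ (- 1)]powRN powRr1.
  rewrite /c /A.
  have s1 : 0 < sigma `^ (2 / 3) by rewrite powR_gt0.
  have t1 : 0 < 2 `^ (- (1 / 3)) :> R by rewrite powR_gt0.
  move: (sigma `^ _) (2 `^ _) (eps `^ _) s1 t1 => s t e s1 t1.
  by field; rewrite !gt_eqF.
have radlt r0 eps : 0 < r0 -> 0 < eps -> eps < 4 * r0 ^+ 3 / sigma -> rad eps < r0.
  move=> r00 e0; rewrite ltr_pdivlMr// (rad3 eps e0) ltr_pM2l// => h.
  rewrite ltNge; apply/negP => h2; move: h; apply/negP; rewrite -leNgt; apply: lerXn2r h2.
  - by rewrite nnegrE ltW.
  - by rewrite nnegrE ltW// rad0.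
have ubarE eps : ubar eps = lambda * eps `^ (2 / 3) - 1 by rewrite /ubar addrC.
have e00 r0 : 0 < r0 -> 0 < 4 * r0 ^+ 3 / sigma.
  by move=> r00; rewrite divr_gt0// mulr_gt0// exprn_gt0.
have lamE : lambda_c sigma kappa = (A%:E * @f_star R)%E by [].
have lamA : lambda%:E = (A%:E * c%:E)%E.
  by rewrite -EFinM /c mulrC divfK// gt_eqF.
have A0E : (0 < A%:E)%E by rewrite lte_fin.
have ltE : (lambda%:E < lambda_c sigma kappa)%E = (c%:E < @f_star R)%E.
  by rewrite lamE lamA; move: (@f_star R) => F; exact: (@lte_pmul2l R A%:E).
have gtE : (lambda_c sigma kappa < lambda%:E)%E = (@f_star R < c%:E)%E.
  by rewrite lamE lamA; move: (@f_star R) => F; exact: (@lte_pmul2l R A%:E).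
have [lt|ge] := boolP (c%:E < @f_star R)%E.
  have [f' cf' ff] : exists2 f' : R, c < f' & (f'%:E <= @f_star R)%E.
    (* Only a real number strictly above c and at most [f_star] is required, so an infinite value is
       treated on the same footing. *)
    move: lt; case: (@f_star R) => [f| |] //.
      by rewrite lte_fin => h; exists f.
    by move=> _; exists (c + 1); [rewrite ltrDl|rewrite leey].
  have [r0 r00 H] := @unique_minimizer_below R sigma kappa l kappa_gt0 l_gt0 c f' c0 cf' ff.
  exists (4 * r0 ^+ 3 / sigma); split; first exact: e00.
  split=> [_ eps e0 e1|gt]; last first.
    by exfalso; move: gt; apply/negP; rewrite gtE -leNgt ltW.
  rewrite /E ubarE; apply: (H _ _ (rad eps)); [|exact: rad3|exact: radm].
  by rewrite rad0//= radlt.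
have [gt|le] := boolP (@f_star R < c%:E)%E.
  have [r0 r00 H] := not_minimizer_above sigma_gt0 kappa_gt0 l_gt0 gt.
  exists (4 * r0 ^+ 3 / sigma); split; first exact: e00.
  split=> [lt|_ eps e0 e1].
    by exfalso; move: lt; apply/negP; rewrite ltE.
  rewrite /E ubarE; apply: (H _ _ (rad eps)); [|exact: rad3|exact: radm].
  by rewrite rad0//= radlt.
(* At lambda = lambda_c both claims are vacuous, and any positive eps0 serves. *)
exists 1; split; first exact: ltr01.
by split=> h; exfalso; move: h; apply/negP; [rewrite ltE|rewrite gtE].
Qed.
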